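(* For each $\varphi\in\mathcal{S}$, put $h_\varphi=\log\varphi'$ and $\mathrm{N}(\varphi)=h_\varphi'=\varphi''/\varphi'$. Then $$\sigma(h_\varphi)^2=\sigma_1(\mathrm{N}(\varphi))^2\le\frac{2}{5}\big(\sqrt{96}-6\big).$$
   Context: $\mathbb{D}$ is the open unit disk, $\mathbb{T}$ the unit circle, $\mathrm{ds}=|\mathrm{d}z|/(2\pi)$ and $\mathrm{dA}=\mathrm{d}x\,\mathrm{d}y/\pi$. $\mathcal{S}$ is the class of univalent holomorphic functions $\varphi:\mathbb{D}\to\mathbb{C}$ with $\varphi(0)=0$, $\varphi'(0)=1$. The logarithm $\log\varphi'$ is fixed by $\log\varphi'(0)=0$. For holomorphic $f:\mathbb{D}\to\mathbb{C}$, $$\sigma(f)^2=\limsup_{r\to1^-}\frac{1}{\log\frac1{1-r^2}}\int_{\mathbb{T}}|f(r\zeta)|^2\,\mathrm{ds}(\zeta),$$ $$\sigma_1(f)^2=\limsup_{r\to1^-}\frac{1}{\log\frac1{1-r^2}}\int_{\mathbb{D}}|f(rz)|^2(1-|z|^2)\,\mathrm{dA}(z).$$ *)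

(* Defs.v *)
From HB Require Import structures.
From mathcomp Require Import all_boot all_order all_algebra.
From mathcomp Require Import complex.
From mathcomp Require Import all_classical all_reals all_analysis.
Set Implicit Arguments.
Unset Strict Implicit.
Unset Printing Implicit Defensive.
Import Order.TTheory GRing.Theory Num.Theory.
Import numFieldNormedType.Exports.

Local Open Scope classical_set_scope.
Local Open Scope ring_scope.
Local Open Scope complex_scope.

(* [R[i]] as a normed module over itself (with the topology of its norm). *)
HB.instance Definition _ (R : rcfType) := NormedModule.copy R[i] R[i]^o.

Section Defs.
Variable R : realType.
Local Notation C := R[i].
Implicit Types (f h phi : C -> C).

Definition cmod (z : C) : R := ComplexField.Normc.normc z.

Definition unit_disk : set C := [set z | cmod z < 1].

(* [derivable f z 1] over the field [C] is complex differentiability: the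
   increment in the difference quotient ranges over [C]. *)
Definition holomorphic_disk f := forall z : C, unit_disk z -> derivable f z 1.

Definition cexp (z : C) : C :=
  (expR (complex.Re z))%:C * (cos (complex.Im z) +i* sin (complex.Im z)).

Definition classS phi :=
  [/\ holomorphic_disk phi, set_inj unit_disk phi,
      phi 0 = 0 & derive1 phi 0 = 1].

(* The integrals of nonnegative functions below are Lebesgue integrals with
   values in [\bar R]; [ds] is pushed forward from [dt / (2 pi)] under
   [t |-> e^{it}]. *)
Definition circle_mean (g : C -> R) : \bar R :=
  (((2 * pi)^-1)%:E *
    \int[lebesgue_measure]_(t in `[0%R, (2 * pi)%R]) (g (cos t +i* sin t))%:E)%E.

Definition disk_integral (g : C -> R) : \bar R :=
  ((pi^-1)%:E *
    \int[(lebesgue_measure \x lebesgue_measure)%E]_(p in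
        [set p : R * R | unit_disk (p.1 +i* p.2)]) (g (p.1 +i* p.2))%:E)%E.

(* [sigma_sq f] and [sigma1_sq f] are the squares sigma(f)^2, sigma_1(f)^2. *)
Definition sigma_sq f : \bar R :=
  limf_esup (fun r : R => ((ln ((1 - r ^+ 2)^-1))^-1)%:E *
    circle_mean (fun zeta => cmod (f (r%:C * zeta)) ^+ 2)%R)%E 1^'-.

Definition sigma1_sq f : \bar R :=
  limf_esup (fun r : R => ((ln ((1 - r ^+ 2)^-1))^-1)%:E *
    disk_integral (fun z =>
      cmod (f (r%:C * z)) ^+ 2 * (1 - cmod z ^+ 2))%R)%E 1^'-.

(* Only the values on the unit disk are determined (uniquely there). *)
Definition is_log_deriv phi h :=
  [/\ holomorphic_disk h, h 0 = 0
    & forall z, unit_disk z -> cexp (h z) = derive1 phi z].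

Definition log_deriv phi : C -> C := xget (fun=> 0) (is_log_deriv phi).

Definition pre_schwarzian phi : C -> C :=
  fun z => derive1 (derive1 phi) z / derive1 phi z.

End Defs.

(* Main.v *)
(** Univalence enters through areas. If [g] is univalent and bounded, then
    [v = g' / (g - g lam)], with [|lam| = (1 + s) / 2], is the derivative of
    [log (g - g lam)], and the image of [|z| <= s] under [g] covers no point twice, so
    [int_(|z| <= s) |v| ^ 2 dA <= 2 log (B / d)], where [d] is the distance from [g lam] to that
    image. A Koebe estimate gives [d >= c (1 - s) |g' lam|], and averaging over [lam] replaces
    [log |g' lam|] by its value at [0]. In terms of the coefficients of
    [log ((g z - g lam) / (z - lam)) = sum k_(m,j) z ^ j lam ^ (m - j)] this reads
      [sum_m s ^ (2 m) sum_j j |k_(m,j)| ^ 2 <= log (1 / (1 - s)) + O(1)].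
    The [k_(m,j)] are symmetric in [j <-> m - j]; their sum over [j] is the [m]-th coefficient of
    [log g'], and their sum against [j (m - j)] involves only [log g'] and [(z N) ^ 2], where
    [N = g'' / g']. Projecting on these two directions bounds [sum_j j |k_(m,j)| ^ 2] from below,
    so that, with [D] the normalized disk integral of [|N| ^ 2] and [E u] the circle mean of
    [|z N| ^ 4] on [|z| ^ 2 = u],
      [D / 2 + 5 / 8 * int_0^t (t - u) ^ 3 / 6 * E u du <= log (1 / (1 - t)) + O(1)].
    Inserting [|w| ^ 4 >= 2 y |w| ^ 2 - y ^ 2] with [y = X / (t - u) ^ 2] yields
    [(1 / 2 + 5 X / 24) D <= (1 + 5 X ^ 2 / 48) log (1 / (1 - t)) + O(1)], that is [D <= X log]
    when [5 X ^ 2 + 24 X = 48].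

    A function of the class S omits some [w0]. With [q ^ 2 = phi - w0] and [g = 1 / (q + q 0)],
    the pre-Schwarzian of [phi] is that of the bounded function [g] plus terms [f' / f] with [f]
    univalent, bounded and without zeros, and the area estimate for [log f] shows that these
    contribute [o(log)].

    Finally [log phi'] and its derivative have weights [x ^ (i + 1) / (i + 1) ^ 2] and
    [x ^ i / ((i + 1) (i + 2))] on the same coefficients, which are equivalent as [x -> 1],
    [i -> oo]; this is the equality of the two limits. *)

From HB Require Import structures.
From mathcomp Require Import all_boot all_order all_algebra.
From mathcomp Require Import complex.
From mathcomp Require Import all_classical all_reals all_analysis measurable_realfun.
From mathcomp Require Import ring lra zify.
Require Import Defs.
Set Implicit Arguments.
Unset Strict Implicit.
Unset Printing Implicit Defensive.
Import Order.TTheory GRing.Theory Num.Theory.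
Import numFieldNormedType.Exports.

Local Open Scope classical_set_scope.
Local Open Scope ring_scope.
Local Open Scope complex_scope.

(** * Complex numbers *)

(** The area inequality yields 2 log (1 / (1 - s)), twice what is wanted. The surplus is paid by the
    pole: splitting 1 / (z - lam) off g' / (g - g lam) puts a constant term of modulus 1 into every
    coefficient function, and Parseval over |lam| = (1 + s) / 2 collects sum x ^ j / j from them,
    one full logarithm on the favourable side. Only the factor of the logarithm matters, so any
    absolute constant serves in the Koebe estimate; 64 comes from an elementary covering argument.
    The constant 5 / 8 is 180 / (2 * 12 ^ 2): 12 from the second moment of the k_(m,j), 180 from the
    squared length of the centred weight j (m - j). The choice y = X / (t - u) ^ 2 turns the cost y
    ^ 2 (t - u) ^ 3 / 6 into a multiple of 1 / (t - u), hence into a logarithm. With c in place of X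
    the resulting bound (1 + 5 c ^ 2 / 48) / (1 / 2 + 5 c / 24) is smallest exactly where it equals
    c, which is why X is both the parameter and the bound. Multiplicity of an image is measured by
    Tonelli's theorem on the set |w - f z| < del, with no change of variables in the plane. *)

Section ComplexBasics.
Variable R : realType.
Local Notation C := R[i].
Implicit Types (z w : C) (x y : R).

Lemma cmodE z : cmod z ^+ 2 = complex.Re z ^+ 2 + complex.Im z ^+ 2.
Proof. by case: z => a b; rewrite /cmod /= sqr_sqrtr // addr_ge0 ?sqr_ge0. Qed.

Lemma cmod_ge0 z : 0 <= cmod z.
Proof. by case: z => a b; rewrite /cmod /= sqrtr_ge0. Qed.

Lemma cmod0 : cmod (0 : C) = 0. Proof. exact: ComplexField.Normc.normc0. Qed.
Lemma cmod1 : cmod (1 : C) = 1. Proof. exact: ComplexField.Normc.normc1. Qed.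

Lemma cmod_eq0 z : (cmod z == 0) = (z == 0).
Proof.
apply/eqP/eqP => [/ComplexField.Normc.eq0_normc//|->]; exact: cmod0.
Qed.

Lemma cmod_gt0 z : (0 < cmod z) = (z != 0).
Proof. by rewrite lt_neqAle cmod_ge0 andbT eq_sym cmod_eq0. Qed.

Lemma cmodM z w : cmod (z * w) = cmod z * cmod w.
Proof. exact: ComplexField.Normc.normcM. Qed.

Lemma cmodV z : cmod z^-1 = (cmod z)^-1.
Proof. exact: ComplexField.Normc.normcV. Qed.

Lemma cmodX z n : cmod (z ^+ n) = cmod z ^+ n.
Proof. by elim: n => [|n IH]; rewrite ?expr0 ?cmod1 // !exprS cmodM IH. Qed.

Lemma cmodN z : cmod (- z) = cmod z. Proof. by case: z => a b; rewrite /cmod /= !sqrrN. Qed.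

Lemma cmodD z w : cmod (z + w) <= cmod z + cmod w.
Proof. exact: le_normcD. Qed.

Lemma cmodB z w : cmod (z - w) <= cmod z + cmod w.
Proof. by rewrite -(cmodN w) cmodD. Qed.

Lemma cmodC z w : cmod (z - w) = cmod (w - z).
Proof. by rewrite -cmodN opprB. Qed.

Lemma cmod_tri z w v : cmod (z - w) <= cmod (z - v) + cmod (v - w).
Proof. by apply: le_trans (cmodD _ _); rewrite addrA subrK. Qed.

Lemma cmod_subr z w : cmod z - cmod w <= cmod (z - w).
Proof. by rewrite lerBlDr; apply: le_trans (cmodD _ _); rewrite subrK. Qed.

Lemma cmodR x : cmod (x%:C : C) = `|x|.
Proof. by rewrite /cmod /= expr0n addr0 sqrtr_sqr. Qed.

Lemma cmod_nat n : cmod (n%:R : C) = n%:R.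
Proof.
have -> : (n%:R : C) = (n%:R : R)%:C by rewrite rmorph_nat.
by rewrite cmodR ger0_norm.
Qed.

Lemma cmod_i : cmod ('i : C) = 1.
Proof. by rewrite /cmod /= expr0n expr1n add0r sqrtr1. Qed.

Lemma normC_cmod z : `|z| = (cmod z)%:C.
Proof. by rewrite normc_def; case: z. Qed.

Lemma Re_le_cmod z : `|complex.Re z| <= cmod z.
Proof.
rewrite -(@ler_pXn2r _ 2) ?nnegrE ?cmod_ge0 // cmodE real_normK ?num_real //.
by rewrite lerDl sqr_ge0.
Qed.

Lemma Im_le_cmod z : `|complex.Im z| <= cmod z.
Proof.
rewrite -(@ler_pXn2r _ 2) ?nnegrE ?cmod_ge0 // cmodE real_normK ?num_real //.
by rewrite lerDr sqr_ge0.
Qed.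

Lemma cmod_le_ReIm z : cmod z <= `|complex.Re z| + `|complex.Im z|.
Proof.
case: z => a b; have -> : a +i* b = a%:C + 'i * b%:C :> C.
  by rewrite [LHS]complexE.
apply: le_trans (cmodD _ _) _; rewrite cmodM cmod_i mul1r !cmodR /=.
by rewrite !mul0r !mul1r subr0 !add0r addr0.
Qed.

Lemma Re_sum (I : Type) (r : seq I) (P : pred I) (F : I -> C) :
  complex.Re (\sum_(i <- r | P i) F i) = \sum_(i <- r | P i) complex.Re (F i).
Proof. by apply: (big_morph (@complex.Re R)) => [[? ?] [? ?]|]. Qed.

Lemma Im_sum (I : Type) (r : seq I) (P : pred I) (F : I -> C) :
  complex.Im (\sum_(i <- r | P i) F i) = \sum_(i <- r | P i) complex.Im (F i).
Proof. by apply: (big_morph (@complex.Im R)) => [[? ?] [? ?]|]. Qed.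

Lemma cmod_sum (I : Type) (r : seq I) (P : pred I) (F : I -> C) :
  cmod (\sum_(i <- r | P i) F i) <= \sum_(i <- r | P i) cmod (F i).
Proof.
elim/big_rec2 : _ => [|i y1 y2 _ h]; first by rewrite cmod0.
by apply: le_trans (cmodD _ _) _; rewrite lerD2l.
Qed.

Lemma ReD z w : complex.Re (z + w) = complex.Re z + complex.Re w.
Proof. by case: z; case: w. Qed.
Lemma ImD z w : complex.Im (z + w) = complex.Im z + complex.Im w.
Proof. by case: z; case: w. Qed.
Lemma ReN z : complex.Re (- z) = - complex.Re z. Proof. by case: z. Qed.
Lemma ImN z : complex.Im (- z) = - complex.Im z. Proof. by case: z. Qed.
Lemma ReM z w : complex.Re (z * w) =
  complex.Re z * complex.Re w - complex.Im z * complex.Im w.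
Proof. by case: z; case: w. Qed.
Lemma ImM z w : complex.Im (z * w) =
  complex.Re z * complex.Im w + complex.Im z * complex.Re w.
Proof. by case: z; case: w => a b c d /=; rewrite addrC. Qed.
Lemma ReZ x z : complex.Re (x%:C * z) = x * complex.Re z.
Proof. by rewrite ReM /= mul0r subr0. Qed.
Lemma ImZ x z : complex.Im (x%:C * z) = x * complex.Im z.
Proof. by rewrite ImM /= mul0r addr0. Qed.

Lemma complex_eq z w : complex.Re z = complex.Re w ->
  complex.Im z = complex.Im w -> z = w.
Proof. by case: z; case: w => a b c d /= -> ->. Qed.

Lemma mulcJ z : z * conjc z = (cmod z ^+ 2)%:C.
Proof.
rewrite cmodE; apply: complex_eq; rewrite ?ReM ?ImM; case: z => a b /=; ring.
Qed.

Lemma cmod_conj z : cmod (conjc z) = cmod z.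
Proof. by case: z => a b; rewrite /cmod /= sqrrN. Qed.

Definition cis (t : R) : C := cos t +i* sin t.

Lemma cmod_cis t : cmod (cis t) = 1.
Proof. by rewrite /cis /cmod /= cos2Dsin2 sqrtr1. Qed.

Lemma cis0 : cis 0 = 1. Proof. by rewrite /cis cos0 sin0. Qed.

Lemma cisD s t : cis (s + t) = cis s * cis t.
Proof. by apply: complex_eq; rewrite ?ReM ?ImM /= ?cosD ?sinD //; ring. Qed.

Lemma cis_neq0 t : cis t != 0.
Proof. by rewrite -cmod_gt0 cmod_cis. Qed.

Lemma cis2pi : cis (2 * pi) = 1.
Proof. by rewrite /cis mulr_natl cos2pi sin2pi. Qed.

Lemma cexpE z : cexp z = (expR (complex.Re z))%:C * cis (complex.Im z).
Proof. by []. Qed.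

Lemma cexpD z w : cexp (z + w) = cexp z * cexp w.
Proof.
rewrite !cexpE ReD ImD cisD expRD rmorphM /=; ring.
Qed.

Lemma cexp0 : cexp (0 : C) = 1.
Proof. by rewrite cexpE /= expR0 cis0 mulr1. Qed.

Lemma cexp_neq0 z : cexp z != 0.
Proof.
rewrite cexpE mulf_neq0 ?cis_neq0 // -cmod_gt0 cmodR normr_gt0 gt_eqF //; exact: expR_gt0.
Qed.

Lemma cexpN z : cexp (- z) = (cexp z)^-1.
Proof. by apply: (mulIf (cexp_neq0 z)); rewrite -cexpD addNr cexp0 mulVf // cexp_neq0. Qed.

Lemma cmod_cexp z : cmod (cexp z) = expR (complex.Re z).
Proof. by rewrite cexpE cmodM cmod_cis mulr1 cmodR ger0_norm // expR_ge0. Qed.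

(** Polar form: [acos] of the normalized real part gives an angle in [0, pi]; its reflection in the
    real axis serves the lower half plane. *)
Lemma cis_surj z : z != 0 -> exists t : R, 0 <= t <= 2 * pi /\ z = (cmod z)%:C * cis t.
Proof.
move=> z0; have mz : 0 < cmod z by rewrite cmod_gt0.
pose a := complex.Re z / cmod z; pose b := complex.Im z / cmod z.
have ab : a ^+ 2 + b ^+ 2 = 1.
  by rewrite !exprMn -mulrDl -cmodE exprVn mulfV // expf_neq0 // gt_eqF.
have a1 : -1 <= a <= 1.
  by rewrite -ler_norml normrM normfV (gtr0_norm mz) ler_pdivrMr // mul1r Re_le_cmod.
have zE : z = (cmod z)%:C * (a +i* b).
  by apply: complex_eq; rewrite ?ReZ ?ImZ /= mulrC divfK // gt_eqF.
have [/andP[acge0 acle] cosac] := acos_def a1.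
have sb : sin (acos a) ^+ 2 = b ^+ 2.
  by rewrite sin2cos2 cosac -ab addrC addKr.
have s0 : 0 <= sin (acos a) by apply: sin_ge0_pi; rewrite acge0.
have [b0|b0] := leP 0 b.
  exists (acos a); split; first by rewrite acge0 /= (le_trans acle) // ler_peMl ?pi_ge0 // ler1n.
  rewrite {1}zE; congr (_ * _); rewrite /cis cosac; congr (_ +i* _).
  by apply/eqP; rewrite -(@eqrXn2 _ 2) // sb.
exists (2 * pi - acos a); split.
  rewrite subr_ge0 gerBl acge0 andbT (le_trans acle) // ler_peMl ?pi_ge0 // ler1n //.
rewrite {1}zE; congr (_ * _); rewrite cisD cis2pi mul1r /cis cosN sinN cosac; congr (_ +i* _).
apply: oppr_inj; rewrite opprK; apply/eqP; rewrite -(@eqrXn2 _ 2) //; first by rewrite sqrrN sb.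
by rewrite oppr_ge0 ltW.
Qed.

End ComplexBasics.

#[global] Opaque cmod cis cexp.

(** * Complex derivatives *)

Section Cousin.
Variable R : realType.
Implicit Types (a b c d x y : R).

Lemma half_pow_lt (w e : R) : 0 < e -> exists n, w / 2 ^+ n < e.
Proof.
move=> e0; exists (Num.bound `|w / e|); rewrite ltr_pdivrMr ?exprn_gt0 //.
have h : w / e < (Num.bound `|w / e|)%:R.
  by apply: le_lt_trans (ler_norm _) _; apply: archi_boundP.
rewrite mulrC -ltr_pdivrMr //; apply: lt_trans h _.
by rewrite -natrX ltr_nat ltn_expl.
Qed.

Lemma cousin_rect (P : R -> R -> R -> R -> Prop) a b c d : a <= b -> c <= d ->
  (forall a' b' c' d', a <= a' -> a' <= b' -> b' <= b -> c <= c' -> c' <= d' -> d' <= d ->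
     let m := (a' + b') / 2 in let n := (c' + d') / 2 in
     P a' m c' n -> P m b' c' n -> P a' m n d' -> P m b' n d' -> P a' b' c' d') ->
  (forall x y, a <= x <= b -> c <= y <= d -> exists2 e, 0 < e &
     forall a' b' c' d', a <= a' <= x -> x <= b' <= b -> c <= c' <= y -> y <= d' <= d ->
       b' - a' < e -> d' - c' < e -> P a' b' c' d') ->
  P a b c d.
Proof.
move=> ab cd glue loc; apply: contrapT => nP.
pose T := ((R * R) * (R * R))%type.
pose Q (r : T) := [/\ a <= r.1.1, r.1.1 <= r.1.2 & r.1.2 <= b] /\
  [/\ c <= r.2.1, r.2.1 <= r.2.2, r.2.2 <= d & ~ P r.1.1 r.1.2 r.2.1 r.2.2].
pose S (r r' : T) := [/\ r.1.1 <= r'.1.1, r'.1.2 <= r.1.2 &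
   r'.1.2 - r'.1.1 = (r.1.2 - r.1.1) / 2] /\ [/\ r.2.1 <= r'.2.1, r'.2.2 <= r.2.2
   & r'.2.2 - r'.2.1 = (r.2.2 - r.2.1) / 2].
have step r : exists r', Q r -> Q r' /\ S r r'.
  case: r => [[a' b'] [c' d']].
  have [[[/= h1 h2 h3] [h4 h5 h6 h7]]|nQ] := pselect (Q ((a', b'), (c', d'))); last first.
    by exists ((a', b'), (c', d')) => /nQ.
  pose m := (a' + b') / 2; pose n := (c' + d') / 2.
  have [am mb] : a' <= m /\ m <= b' by rewrite /m; split; lra.
  have [cn nd] : c' <= n /\ n <= d' by rewrite /n; split; lra.
  have am' : a <= m := le_trans h1 am. have mb' : m <= b := le_trans mb h3.
  have cn' : c <= n := le_trans h4 cn. have nd' : n <= d := le_trans nd h6.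
  have [em1 em2] : m - a' = (b' - a') / 2 /\ b' - m = (b' - a') / 2 by rewrite /m; split; field.
  have [en1 en2] : n - c' = (d' - c') / 2 /\ d' - n = (d' - c') / 2 by rewrite /n; split; field.
  have [n1|p1] := pselect (~ P a' m c' n).
    by exists ((a', m), (c', n)); split; split; split => //=; exact: lexx.
  have [n2|p2] := pselect (~ P m b' c' n).
    by exists ((m, b'), (c', n)); split; split; split => //=; exact: lexx.
  have [n3|p3] := pselect (~ P a' m n d').
    by exists ((a', m), (n, d')); split; split; split => //=; exact: lexx.
  have [n4|p4] := pselect (~ P m b' n d').
    by exists ((m, b'), (n, d')); split; split; split => //=; exact: lexx.
  case: h7; apply: glue => //; exact: contrapT.
have [f fP] := choice step.
pose r k := iter k f ((a, b), (c, d)).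
have Qr k : Q (r k).
  elim: k => [|k IH]; last by have [] := fP _ IH.
  by split; split.
have Sr k : S (r k) (r k.+1) by have [] := fP _ (Qr k).
have w1 k : (r k).1.2 - (r k).1.1 = (b - a) / 2 ^+ k.
  elim: k => [|k IH]; first by rewrite expr0 divr1.
  have [[_ _ ->] _] := Sr k; rewrite IH exprSr invfM mulrA //.
have w2 k : (r k).2.2 - (r k).2.1 = (d - c) / 2 ^+ k.
  elim: k => [|k IH]; first by rewrite expr0 divr1.
  have [_ [_ _ ->]] := Sr k; rewrite IH exprSr invfM mulrA //.
have mono1 i j : (i <= j)%N -> (r i).1.1 <= (r j).1.1 /\ (r j).1.2 <= (r i).1.2.
  elim: j => [|j IH]; first by rewrite leqn0 => /eqP->.
  rewrite leq_eqVlt => /orP[/eqP->//|/IH[h1 h2]].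
  by have [[h3 h4 _] _] := Sr j; split; lra.
have mono2 i j : (i <= j)%N -> (r i).2.1 <= (r j).2.1 /\ (r j).2.2 <= (r i).2.2.
  elim: j => [|j IH]; first by rewrite leqn0 => /eqP->.
  rewrite leq_eqVlt => /orP[/eqP->//|/IH[h1 h2]].
  by have [_ [h3 h4 _]] := Sr j; split; lra.
have ub1 i j : (r i).1.1 <= (r j).1.2.
  have [/mono1[h1 h2]|/ltnW/mono1[h1 h2]] := leqP i j.
    by have [[? ? ?] _] := Qr j; lra.
  by have [[? ? ?] _] := Qr i; lra.
have ub2 i j : (r i).2.1 <= (r j).2.2.
  have [/mono2[h1 h2]|/ltnW/mono2[h1 h2]] := leqP i j.
    by have [_ [? ? ? _]] := Qr j; lra.
  by have [_ [? ? ? _]] := Qr i; lra.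
pose x := sup [set (r i).1.1 | i in setT]; pose y := sup [set (r i).2.1 | i in setT].
have hx k : (r k).1.1 <= x <= (r k).1.2.
  apply/andP; split.
    apply: ub_le_sup; last by exists k.
    by exists (r k).1.2 => _ [i _ <-]; exact: ub1.
  by apply: ge_sup => [|_ [i _ <-]]; [exists (r 0%N).1.1; exists 0%N|exact: ub1].
have hy k : (r k).2.1 <= y <= (r k).2.2.
  apply/andP; split.
    apply: ub_le_sup; last by exists k.
    by exists (r k).2.2 => _ [i _ <-]; exact: ub2.
  by apply: ge_sup => [|_ [i _ <-]]; [exists (r 0%N).2.1; exists 0%N|exact: ub2].
have [e e0 he] := loc x y (hx 0%N) (hy 0%N).
have [k1 hk1] := half_pow_lt (b - a) e0; have [k2 hk2] := half_pow_lt (d - c) e0.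
pose k := maxn k1 k2.
have hp j (w : R) : 0 <= w -> (j <= k)%N -> w / 2 ^+ k <= w / 2 ^+ j.
  move=> w0 jk; rewrite ler_wpM2l // lef_pV2 ?posrE ?exprn_gt0 //.
  by rewrite ler_weXn2l // ler1n.
have [[q1 q2 q3] [q4 q5 q6 nPk]] := Qr k.
apply: nPk; apply: he.
- by rewrite q1; have /andP[] := hx k.
- by rewrite q3 andbT; have /andP[] := hx k.
- by rewrite q4; have /andP[] := hy k.
- by rewrite q6 andbT; have /andP[] := hy k.
- by rewrite w1; apply: le_lt_trans hk1; apply: hp; [lra|exact: leq_maxl].
- by rewrite w2; apply: le_lt_trans hk2; apply: hp; [lra|exact: leq_maxr].
Qed.

End Cousin.

(** * Rules of complex differentiation *)

Section ComplexDerivative.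
Variable R : realType.
Local Notation C := R[i].
Implicit Types (f g : C -> C) (z w h d : C).

(** An increment estimate without division: h = 0 is allowed and all bounds are real, which suits
    composition and bisection. By [cdiff_derivable] and [derivable_cdiff] it means that
    [derivable f z 1] holds with derivative [d]. *)
Definition cdiff f z d := forall e : R, 0 < e -> exists2 del : R, 0 < del &
  forall h, cmod h < del -> cmod (f (z + h) - f z - d * h) <= e * cmod h.

Definition ccont f z := forall e : R, 0 < e -> exists2 del : R, 0 < del &
  forall w, cmod (w - z) < del -> cmod (f w - f z) < e.

Lemma cdiff_cont f z d : cdiff f z d -> ccont f z.
Proof.
move=> fd e e0; have [del del0 H] := fd 1 ltr01.
exists (Num.min del (e / (cmod d + 2))) => [|w].
  by rewrite lt_min del0 divr_gt0 // (ltr_wpDl (cmod_ge0 _)).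
rewrite lt_min => /andP[/H]; rewrite mul1r addrCA subrr addr0 => h1 h2.
have d2 : 0 < cmod d + 2 by rewrite (ltr_wpDl (cmod_ge0 _)).
rewrite ltr_pdivlMr // in h2.
have -> : f w - f z = (f w - f z - d * (w - z)) + d * (w - z) by rewrite subrK.
apply: le_lt_trans (cmodD _ _) _; rewrite cmodM.
by apply: le_lt_trans h2; have := cmod_ge0 (w - z); lra.
Qed.

Lemma cdiff_derivable f z d : cdiff f z d -> derivable f z 1 /\ derive1 f z = d.
Proof.
move=> fd.
suff H : (fun h : C => h^-1 *: (f (h + z) - f z)) @ 0^' --> d.
  split.
    apply/cvg_ex; exists d; apply: cvg_trans H.
    by apply: near_eq_cvg; near=> h; rewrite /= /GRing.scale /= mulr1.
  by rewrite /derive1; apply/cvg_lim => //; exact: norm_hausdorff.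
apply/cvgrPdist_le => /= e e0.
have e0' : 0 < complex.Re e by move: e0; rewrite ltcE /= => /andP[].
have eE : e = (complex.Re e)%:C.
  by move: e0; rewrite ltcE /= => /andP[/eqP i0 _]; apply: complex_eq.
have [del del0 H] := fd _ e0'.
near=> h.
have h0 : h != 0 by near: h; exact: nbhs_dnbhs_neq.
have hd : cmod h < del.
  rewrite -ltcR -normC_cmod -(normrN h) -[- h]add0r.
  near: h; apply: nbhs_dnbhs; exists del%:C => //=; first by rewrite ltcR.
have := H h hd; rewrite [z + h]addrC => H1.
rewrite eE normC_cmod lecR.
have -> : d - h^-1 *: (f (h + z) - f z) = - (h^-1 * (f (h + z) - f z - d * h)).
  by rewrite mulrBr mulrCA mulVf // mulr1 opprB.
rewrite cmodN cmodM cmodV mulrC ler_pdivrMr ?cmod_gt0 //.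
Unshelve. all: by end_near. Qed.

Lemma derivable_cdiff f z : derivable f z 1 -> cdiff f z (derive1 f z).
Proof.
move=> fd e e0.
have H : (fun h : C => h^-1 *: (f (h + z) - f z)) @ 0^' --> derive1 f z.
  have : (fun h : C => h^-1 *: (f (h + z) - f z)) @ 0^' --> lim
     ((fun h : C => h^-1 *: (f (h + z) - f z)) @ 0^').
    move: fd => /cvg_ex[l Hl]; apply/cvg_ex; exists l; apply: cvg_trans Hl.
    by apply: near_eq_cvg; near=> h; rewrite /= /GRing.scale /= mulr1.
  by [].
move/cvgrPdist_le/(_ e%:C): H; rewrite ltcR => /(_ e0) [del /= del0 H].
have del0' : 0 < complex.Re del by move: del0; rewrite ltcE /= => /andP[].
have delE : del = (complex.Re del)%:C.
  by move: del0; rewrite ltcE /= => /andP[/eqP i0 _]; apply: complex_eq.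
exists (complex.Re del) => // h hd.
have [->|h0] := eqVneq h 0; first by rewrite mulr0 subr0 addr0 subrr cmod0 mulr0.
have := H h; rewrite /= sub0r normrN normC_cmod delE ltcR hd => /(_ erefl h0).
rewrite normC_cmod lecR.
have -> : derive1 f z - h^-1 *: (f (h + z) - f z) = - (h^-1 * (f (h + z) - f z - derive1 f z * h)).
  by rewrite mulrBr mulrCA mulVf // mulr1 opprB.
by rewrite cmodN cmodM cmodV mulrC ler_pdivrMr ?cmod_gt0 // [z + h]addrC.
Unshelve. all: by end_near. Qed.

Lemma cdiff_derive1 f z d : cdiff f z d -> derive1 f z = d.
Proof. by move=> /cdiff_derivable[]. Qed.

Lemma cdiff_unique f z d d' : cdiff f z d -> cdiff f z d' -> d = d'.
Proof. by move=> /cdiff_derive1 <- /cdiff_derive1 <-. Qed.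

Lemma cdiff_near f g z d (r : R) : 0 < r -> (forall w, cmod (w - z) < r -> f w = g w) ->
  cdiff f z d -> cdiff g z d.
Proof.
move=> r0 fg fd e e0; have [del del0 H] := fd e e0.
exists (Num.min del r); first by rewrite lt_min del0.
move=> h; rewrite lt_min => /andP[/H h1 h2].
by rewrite -!fg // ?subrr ?cmod0 // addrC addKr.
Qed.

Lemma cdiff_cst k z : cdiff (fun=> k) z 0.
Proof.
move=> e e0; exists 1 => // h _; rewrite subrr mul0r subr0 cmod0.
by rewrite mulr_ge0 ?cmod_ge0 // ltW.
Qed.

Lemma cdiff_id z : cdiff id z 1.
Proof.
move=> e e0; exists 1 => // h _; rewrite mul1r [z + h]addrC addrK subrr cmod0.
by rewrite mulr_ge0 ?cmod_ge0 ?ltW.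
Qed.

Lemma cdiffD f g z d d' : cdiff f z d -> cdiff g z d' -> cdiff (fun w => f w + g w) z (d + d').
Proof.
move=> fd gd e e0; have e2 : 0 < e / 2 by lra.
have [d1 d10 H1] := fd _ e2; have [d2 d20 H2] := gd _ e2.
exists (Num.min d1 d2); first by rewrite lt_min d10.
move=> h; rewrite lt_min => /andP[/H1 h1 /H2 h2].
have -> : f (z + h) + g (z + h) - (f z + g z) - (d + d') * h =
  (f (z + h) - f z - d * h) + (g (z + h) - g z - d' * h) by ring.
by apply: le_trans (cmodD _ _) _; rewrite [e in leRHS]splitr mulrDl lerD.
Qed.

Lemma cdiffM f g z d d' : cdiff f z d -> cdiff g z d' ->
  cdiff (fun w => f w * g w) z (d * g z + f z * d').
Proof.
move=> fd gd e e0.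
(* One constant dominating every factor in the three error terms; 1 + |d| bounds the increment of
   [f] relative to h. *)
pose M := 1 + cmod d + cmod (f z) + cmod (g z).
have M1 : 1 <= M by rewrite /M -!addrA lerDl !addr_ge0 ?cmod_ge0.
have M0 : 0 < M by lra.
have e3 : 0 < e / (3 * M) by rewrite divr_gt0 // mulr_gt0.
have [d1 d10 H1] := fd _ e3; have [d2 d20 H2] := gd _ e3.
have [d3 d30 H3] := cdiff_cont gd e3; have [d4 d40 H4] := fd 1 ltr01.
exists (Num.min (Num.min d1 d4) (Num.min d2 d3)); first by rewrite !lt_min d10 d20 d30 d40.
move=> h; rewrite !lt_min => /andP[/andP[/H1 h1 /H4 h4] /andP[/H2 h2 hd3]].
have h3 : cmod (g (z + h) - g z) < e / (3 * M) by apply: H3; rewrite addrC addKr.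
have -> : f (z + h) * g (z + h) - f z * g z - (d * g z + f z * d') * h =
  (f (z + h) - f z - d * h) * g z + (f (z+h) - f z) * (g (z + h) - g z)
  + f z * (g (z + h) - g z - d' * h) by ring.
have -> : e * cmod h = e / (3 * M) * cmod h * M + e / (3 * M) * cmod h * M
  + e / (3 * M) * cmod h * M by field; rewrite gt_eqF.
have [gM fM dM] : [/\ cmod (g z) <= M, cmod (f z) <= M & 1 + cmod d <= M].
  by have := cmod_ge0 (f z); have := cmod_ge0 (g z); have := cmod_ge0 d; rewrite /M; split; lra.
apply: le_trans (cmodD _ _) _; apply: lerD; last first.
  by rewrite cmodM mulrC; apply: ler_pM; rewrite ?cmod_ge0.
apply: le_trans (cmodD _ _) _; apply: lerD.
  by rewrite cmodM; apply: ler_pM; rewrite ?cmod_ge0.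
rewrite cmodM mulrC -mulrA; apply: ler_pM; rewrite ?cmod_ge0 //; first exact: ltW.
have -> : f (z + h) - f z = (f (z + h) - f z - d * h) + d * h by rewrite subrK.
apply: le_trans (cmodD _ _) _; rewrite cmodM.
apply: le_trans (lerD h4 (lexx _)) _.
by rewrite -mulrDl mulrC ler_wpM2l ?cmod_ge0.
Qed.

Lemma cdiffN f z d : cdiff f z d -> cdiff (fun w => - f w) z (- d).
Proof.
move=> fd; have := cdiffM (cdiff_cst (-1) z) fd; rewrite mul0r add0r mulN1r.
by apply: (cdiff_near ltr01) => w _; rewrite mulN1r.
Qed.

Lemma cdiffB f g z d d' : cdiff f z d -> cdiff g z d' -> cdiff (fun w => f w - g w) z (d - d').
Proof. by move=> fd /cdiffN; exact: cdiffD. Qed.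

Lemma cdiffZ k f z d : cdiff f z d -> cdiff (fun w => k * f w) z (k * d).
Proof. by move=> fd; have := cdiffM (cdiff_cst k z) fd; rewrite mul0r add0r. Qed.

Lemma cdiff_comp f g z d d' : cdiff f z d -> cdiff g (f z) d' ->
  cdiff (fun w => g (f w)) z (d' * d).
Proof.
move=> fd gd e e0.
pose M := 1 + cmod d + cmod d'.
have M1 : 1 <= M by rewrite /M -!addrA lerDl !addr_ge0 ?cmod_ge0.
have M0 : 0 < M by lra.
have e2 : 0 < e / (2 * M) by rewrite divr_gt0 // mulr_gt0.
have [d1 d10 H1] := fd _ e2; have [d2 d20 H2] := gd _ e2.
have [d3 d30 H3] := cdiff_cont fd d20; have [d4 d40 H4] := fd 1 ltr01.
exists (Num.min (Num.min d1 d4) d3); first by rewrite !lt_min d10 d30 d40.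
move=> h; rewrite !lt_min => /andP[/andP[/H1 h1 /H4 h4] hd3].
have h3 : cmod (f (z + h) - f z) < d2 by apply: H3; rewrite addrC addKr.
have := H2 _ h3; rewrite addrCA subrr addr0 => h2.
have -> : g (f (z + h)) - g (f z) - d' * d * h =
  (g (f (z + h)) - g (f z) - d' * (f (z + h) - f z)) + d' * (f (z + h) - f z - d * h) by ring.
have -> : e * cmod h = e / (2 * M) * (M * cmod h) + M * (e / (2 * M) * cmod h).
  by field; rewrite gt_eqF.
apply: le_trans (cmodD _ _) _; apply: lerD.
  apply: le_trans h2 _; rewrite ler_wpM2l ?(ltW e2) //.
  have -> : f (z + h) - f z = (f (z + h) - f z - d * h) + d * h by rewrite subrK.
  apply: le_trans (cmodD _ _) _; rewrite cmodM.
  apply: le_trans (lerD h4 (lexx _)) _.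
  by rewrite -mulrDl ler_wpM2r ?cmod_ge0 // /M lerDl cmod_ge0.
rewrite cmodM; apply: ler_pM; rewrite ?cmod_ge0 // /M.
by rewrite lerDr addr_ge0 ?cmod_ge0.
Qed.

Lemma cdiff_inv z : z != 0 -> cdiff (fun w => w^-1) z (- z^-2).
Proof.
move=> z0 e e0; have mz : 0 < cmod z by rewrite cmod_gt0.
exists (Num.min (cmod z / 2) (e * cmod z ^+ 3 / 2)).
  by rewrite lt_min; apply/andP; split; rewrite ?divr_gt0 // mulr_gt0 ?exprn_gt0.
move=> h; rewrite lt_min => /andP[h1 h2].
have zh : cmod z / 2 <= cmod (z + h).
  have := cmod_subr z (- h); rewrite opprK cmodN; lra.
have zh0 : z + h != 0 by rewrite -cmod_gt0; lra.
have -> : (z + h)^-1 - z^-1 - - z^-2 * h = h ^+ 2 / (z ^+ 2 * (z + h)) by field; rewrite z0 zh0.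
rewrite cmodM cmodX cmodV cmodM cmodX ler_pdivrMr ?mulr_gt0 ?exprn_gt0 ?cmod_gt0 //.
rewrite expr2 mulrAC ler_wpM2r ?cmod_ge0 //.
apply: le_trans (ltW h2) _; rewrite -!mulrA ler_wpM2l ?(ltW e0) //.
by rewrite !ler_wpM2l ?cmod_ge0.
Qed.

Lemma cdiffV f z d : f z != 0 -> cdiff f z d -> cdiff (fun w => (f w)^-1) z (- d / f z ^+ 2).
Proof.
move=> fz fd; have := cdiff_comp fd (cdiff_inv fz).
by rewrite mulrC mulrN mulNr.
Qed.

Lemma cdiff_div f g z d d' : g z != 0 -> cdiff f z d -> cdiff g z d' ->
  cdiff (fun w => f w / g w) z ((d * g z - f z * d') / g z ^+ 2).
Proof.
move=> gz fd gd; have := cdiffM fd (cdiffV gz gd); congr (cdiff _ _ _).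
by field.
Qed.

Lemma cdiffX n z : cdiff (fun w => w ^+ n) z (n%:R * z ^+ n.-1).
Proof.
elim: n => [|n IH]; first by rewrite mul0r; apply: cdiff_cst.
have := cdiffM (cdiff_id z) IH.
have -> : 1 * z ^+ n + z * (n%:R * z ^+ n.-1) = n.+1%:R * z ^+ n.
  case: n {IH} => [|n] /=; first by rewrite mul0r mulr0 addr0.
  rewrite [n.+2%:R]mulrS exprS; ring.
by apply: (cdiff_near ltr01) => w _; rewrite exprS.
Qed.

End ComplexDerivative.

(** * Integrals and Cauchy's theorem *)

Section ComplexIntegral.
Variable R : realType.
Local Notation C := R[i].
Local Notation mu := (@lebesgue_measure R).
Implicit Types (u v : R -> C) (a b c d x y : R).

Definition rcont a b u := forall x, a <= x <= b -> forall e : R, 0 < e ->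
  exists2 del : R, 0 < del & forall y, a <= y <= b -> `|y - x| < del -> cmod (u y - u x) < e.

Definition cint a b u : C :=
  (\int[mu]_(x in `[a, b]) complex.Re (u x)) +i* (\int[mu]_(x in `[a, b]) complex.Im (u x)).

Lemma within_cont a b (f : R -> R) : (forall x, a <= x <= b -> forall e : R, 0 < e ->
    exists2 del : R, 0 < del & forall y, a <= y <= b -> `|y - x| < del -> `|f y - f x| < e) ->
  {within `[a, b], continuous f}.
Proof.
move=> H; apply/subspace_continuousP => x; rewrite /= in_itv /= => xab.
apply/cvgrPdist_lt => e e0; have [del del0 Hd] := H x xab e e0.
near=> y; rewrite distrC; apply: Hd.
  have : `[a, b]%classic y by near: y; exact: withinT.
  by rewrite /= in_itv.
rewrite distrC; near: y; apply: cvg_within; exact: nbhsx_ballx.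
Unshelve. all: by end_near. Qed.

Lemma rcont_ReIm a b u : rcont a b u ->
  {within `[a, b], continuous (fun x => complex.Re (u x))} /\
  {within `[a, b], continuous (fun x => complex.Im (u x))}.
Proof.
move=> H; split; apply: within_cont => x xab e e0; have [del del0 Hd] := H x xab e e0;
  exists del => // y yab /(Hd y yab); apply: le_lt_trans.
  by rewrite -ReN -ReD Re_le_cmod.
by rewrite -ImN -ImD Im_le_cmod.
Qed.

Lemma rcont_integrable a b u : rcont a b u ->
  mu.-integrable `[a, b] (EFin \o (fun x => complex.Re (u x))) /\
  mu.-integrable `[a, b] (EFin \o (fun x => complex.Im (u x))).
Proof.
by move=> /rcont_ReIm[h1 h2]; split; apply: continuous_compact_integrable => //;
  exact: segment_compact.
Qed.

Lemma rcontD a b u v : rcont a b u -> rcont a b v -> rcont a b (fun x => u x + v x).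
Proof.
move=> hu hv x xab e e0; have e2 : 0 < e / 2 by lra.
have [d1 d10 H1] := hu x xab _ e2; have [d2 d20 H2] := hv x xab _ e2.
exists (Num.min d1 d2); first by rewrite lt_min d10.
move=> y yab; rewrite lt_min => /andP[/(H1 _ yab) h1 /(H2 _ yab) h2].
rewrite opprD addrACA [e]splitr; exact: le_lt_trans (cmodD _ _) (ltrD h1 h2).
Qed.

Lemma rcontZ a b k u : rcont a b u -> rcont a b (fun x => k * u x).
Proof.
move=> hu x xab e e0; have k1 : 0 < 1 + cmod k by rewrite (ltr_wpDr (cmod_ge0 _)).
have [d1 d10 H1] := hu x xab (e / (1 + cmod k)) (divr_gt0 e0 k1).
exists d1 => // y yab /(H1 _ yab); rewrite -mulrBr cmodM ltr_pdivlMr //.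
have := cmod_ge0 (u y - u x); lra.
Qed.

Lemma rcont_ext a b u v : (forall x, a <= x <= b -> u x = v x) -> rcont a b u -> rcont a b v.
Proof.
move=> uv hu x xab e e0; have [d1 d10 H1] := hu x xab e e0.
by exists d1 => // y yab; rewrite -!uv //; exact: H1.
Qed.

Lemma rcont_cst a b k : rcont a b (fun=> k).
Proof. by move=> x _ e e0; exists 1 => // y _ _; rewrite subrr cmod0. Qed.

Lemma eq_cint a b u v : (forall x, a <= x <= b -> u x = v x) -> cint a b u = cint a b v.
Proof.
move=> uv; rewrite /cint; congr (_ +i* _); apply: eq_Rintegral => x;
  by rewrite inE /= in_itv /= => /uv ->.
Qed.

Lemma cintD a b u v : rcont a b u -> rcont a b v ->
  cint a b (fun x => u x + v x) = cint a b u + cint a b v.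
Proof.
move=> /rcont_integrable[u1 u2] /rcont_integrable[v1 v2].
apply: complex_eq; rewrite ?ReD ?ImD /cint /=.
  by under eq_Rintegral do rewrite ReD; rewrite RintegralD.
by under eq_Rintegral do rewrite ImD; rewrite RintegralD.
Qed.

Lemma cintZ a b k u : rcont a b u -> cint a b (fun x => k * u x) = k * cint a b u.
Proof.
move=> /rcont_integrable[u1 u2].
have iZ (r : R) f : mu.-integrable `[a, b] (EFin \o f) ->
    mu.-integrable `[a, b] (EFin \o (fun x => r * f x)).
  move=> fi; have := @integrableZl _ _ _ mu `[a, b] (measurable_itv _) r _ fi.
  by under [X in _ -> _.-integrable _ X]eq_fun do rewrite /= EFinM.
apply: complex_eq; rewrite ?ReM ?ImM /cint /=.
  under eq_Rintegral do rewrite ReM.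
  by rewrite RintegralB ?RintegralZl //; exact: iZ.
under eq_Rintegral do rewrite ImM.
by rewrite RintegralD ?RintegralZl //; exact: iZ.
Qed.

Lemma cintB a b u v : rcont a b u -> rcont a b v ->
  cint a b (fun x => u x - v x) = cint a b u - cint a b v.
Proof.
move=> hu hv; rewrite -[- cint a b v]mulN1r -cintZ // -cintD //; last exact: rcontZ.
by apply: eq_cint => x _; rewrite mulN1r.
Qed.

Lemma cint_cst a b k : a <= b -> cint a b (fun=> k) = (b - a)%:C * k.
Proof.
move=> ab; apply: complex_eq; rewrite ?ReZ ?ImZ /cint /= Rintegral_cst //=;
  rewrite lebesgue_measure_itv /= lte_fin; case: ltgtP ab => //= [_|->] _; rewrite ?subrr ?mulr0 ?mul0r // mulrC //.
Qed.

(** Multiplication by a unimodular [k] makes the integral real and nonnegative, so only the real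
    part of [k * u] is integrated and no factor 2 is lost between the two components. *)
Lemma cint_bound a b u (M : R) : a <= b -> rcont a b u ->
  (forall x, a <= x <= b -> cmod (u x) <= M) -> cmod (cint a b u) <= (b - a) * M.
Proof.
move=> ab hu uM.
have [->|z0] := eqVneq (cint a b u) 0.
  by rewrite cmod0 mulr_ge0 ?subr_ge0 //; apply: le_trans (uM a _); rewrite ?cmod_ge0 ?lexx.
set z := cint a b u in z0 *.
have mz : 0 < cmod z by rewrite cmod_gt0.
pose k := conjc z / (cmod z)%:C.
have kz : k * z = (cmod z)%:C.
  rewrite /k mulrAC [conjc z * z]mulrC mulcJ rmorphXn /= expr2 mulfK //.
  by rewrite -cmod_gt0 cmodR ger0_norm // ltW.
have ck : cmod k = 1 by rewrite cmodM cmodV cmod_conj cmodR (gtr0_norm mz) divff // gt_eqF.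
have : complex.Re (cint a b (fun x => k * u x)) = cmod z by rewrite cintZ // kz.
move=> <-; rewrite /cint /=.
have -> : (b - a) * M = complex.Re (cint a b (fun=> M%:C)) by rewrite cint_cst // ReZ.
have [h1 _] := rcont_integrable (rcontZ k hu).
have [h2 _] := rcont_integrable (@rcont_cst a b M%:C).
rewrite /cint /=; apply: le_Rintegral => // x; rewrite /= in_itv /= => xab.
apply: le_trans (ler_norm _) _; apply: le_trans (Re_le_cmod _) _.
by rewrite cmodM ck mul1r uM.
Qed.

Lemma cint_split a m b u : a <= m -> m <= b -> rcont a b u ->
  cint a b u = cint a m u + cint m b u.
Proof.
move=> am mb /rcont_integrable[h1 h2].
have iS f : mu.-integrable `[a, b] (EFin \o f) -> \int[mu]_(x in `[a, b]) f x =
    \int[mu]_(x in `[a, m]) f x + \int[mu]_(x in `[m, b]) f x.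
  move=> fi; have := @Rintegral_itvB _ f (BLeft a) (BRight b) m fi.
  rewrite !bnd_simp => /(_ am mb) /eqP; rewrite subr_eq addrC => /eqP ->; congr (_ + _).
  rewrite Rintegral_itv_obnd_cbnd //; apply: integrableS fi => //.
  by move=> x /=; rewrite !in_itv /= => /andP[/ltW/(le_trans am) -> ->].
by apply: complex_eq; rewrite ?ReD ?ImD /cint /= iS.
Qed.

Lemma cint_FTC a b (U u : R -> C) : a <= b -> rcont a b u ->
  (forall x : R, is_derive x 1 (fun t => complex.Re (U t)) (complex.Re (u x))) ->
  (forall x : R, is_derive x 1 (fun t => complex.Im (U t)) (complex.Im (u x))) ->
  cint a b u = U b - U a.
Proof.
rewrite le_eqVlt => /predU1P[<-|ab] hu d1 d2.
  by rewrite subrr; apply: complex_eq; rewrite /cint /= set_itv1 Rintegral_set1.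
have H (F f : R -> R) : (forall x, is_derive x (1:R) F (f x)) -> {within `[a, b], continuous f} ->
   \int[mu]_(x in `[a, b]) f x = F b - F a.
  move=> dF cf; rewrite /Rintegral (continuous_FTC2 (F := F)) //.
    split => [x _||]; first by have [] := dF x.
      by apply: cvg_at_right_filter; apply: differentiable_continuous; apply/derivable1_diffP; have [] := dF a.
    by apply: cvg_at_left_filter; apply: differentiable_continuous; apply/derivable1_diffP; have [] := dF b.
  by move=> x _; rewrite derive1E; have [_] := dF x.
have [c1 c2] := rcont_ReIm hu.
by apply: complex_eq; rewrite ?ReD ?ImD ?ReN ?ImN /cint /=; apply: H.
Qed.

End ComplexIntegral.

#[global] Opaque cint.

(** * Goursat's theorem for rectangles *)

Section Goursat.
Variable R : realType.
Local Notation C := R[i].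
Implicit Types (H F : C -> C) (a b c d x y r : R) (z w : C).

(** The contour integral along the boundary, counterclockwise; dz = i dy on the vertical sides. *)
Definition rect_int H a b c d : C :=
  cint a b (fun x => H (x +i* c)) - cint a b (fun x => H (x +i* d)) +
  'i * (cint c d (fun y => H (b +i* y)) - cint c d (fun y => H (a +i* y))).

Definition in_rect a b c d z := a <= complex.Re z <= b /\ c <= complex.Im z <= d.

Lemma hline_rcont H a b y : (forall x, a <= x <= b -> ccont H (x +i* y)) ->
  rcont a b (fun x => H (x +i* y)).
Proof.
move=> Hc x xab e e0; have [del del0 Hd] := Hc x xab e e0.
exists del => // x' _ h; apply: Hd; rewrite (_ : _ - _ = (x' - x)%:C) ?cmodR //.
by apply: complex_eq; rewrite ?ReD ?ImD ?ReN ?ImN /= ?subrr.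
Qed.

Lemma vline_rcont H c d x : (forall y, c <= y <= d -> ccont H (x +i* y)) ->
  rcont c d (fun y => H (x +i* y)).
Proof.
move=> Hc y ycd e e0; have [del del0 Hd] := Hc y ycd e e0.
exists del => // y' _ h; apply: Hd; rewrite (_ : _ - _ = 'i * (y' - y)%:C).
  by rewrite cmodM cmod_i mul1r cmodR.
by apply: complex_eq; rewrite ?ReM ?ImM ?ReD ?ImD ?ReN ?ImN /=; ring.
Qed.

(** The inner sides are traversed twice in opposite directions and cancel. *)
Lemma rect_int_split H a b c d m n : a <= m <= b -> c <= n <= d ->
  (forall z, in_rect a b c d z -> ccont H z) ->
  rect_int H a b c d = rect_int H a m c n + rect_int H m b c n +
    rect_int H a m n d + rect_int H m b n d.
Proof.
move=> /andP[am mb] /andP[cn nd] Hc.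
have ab := le_trans am mb; have cd := le_trans cn nd.
have h y : c <= y <= d -> cint a b (fun x => H (x +i* y)) =
    cint a m (fun x => H (x +i* y)) + cint m b (fun x => H (x +i* y)).
  by move=> ycd; apply: cint_split => //; apply: hline_rcont => x xab; apply: Hc.
have v x : a <= x <= b -> cint c d (fun y => H (x +i* y)) =
    cint c n (fun y => H (x +i* y)) + cint n d (fun y => H (x +i* y)).
  by move=> xab; apply: cint_split => //; apply: vline_rcont => y ycd; apply: Hc.
by rewrite /rect_int !h ?v ?lexx ?ab ?cd ?cn ?am //; ring.
Qed.

Lemma rect_intB H F a b c d : a <= b -> c <= d ->
  (forall z, in_rect a b c d z -> ccont H z) -> (forall z, in_rect a b c d z -> ccont F z) ->
  rect_int (fun z => H z - F z) a b c d = rect_int H a b c d - rect_int F a b c d.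
Proof.
move=> ab cd Hc Fc; rewrite /rect_int !cintB; first by ring.
all: try apply: hline_rcont => x xab; try apply: vline_rcont => y ycd; (apply: Hc || apply: Fc).
all: by split; rewrite //= ?lexx ?ab ?cd.
Qed.

(** Values on opposite sides differ by a constant, so the four sides balance; this makes the affine
    part of a function invisible to its boundary integral. *)
Lemma rect_int_affine k l a b c d : a <= b -> c <= d ->
  rect_int (fun z => k + l * z) a b c d = 0.
Proof.
move=> ab cd.
have cc z : ccont (fun z => k + l * z) z.
  by apply: cdiff_cont; apply: cdiffD (cdiff_cst _ _) (cdiffZ _ (cdiff_id _)).
rewrite /rect_int -!cintB; last first.
- by apply: (hline_rcont (H := fun z => k + l * z)) => ? _; exact: cc.
- by apply: (hline_rcont (H := fun z => k + l * z)) => ? _; exact: cc.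
- by apply: (vline_rcont (H := fun z => k + l * z)) => ? _; exact: cc.
- by apply: (vline_rcont (H := fun z => k + l * z)) => ? _; exact: cc.
rewrite (eq_cint (v := fun=> l * ('i * (c - d)%:C))); last first.
  by move=> x _; apply: complex_eq; rewrite !(ReD, ImD, ReN, ImN, ReM, ImM) /=; ring.
rewrite [X in _ + _ * X](eq_cint (v := fun=> l * (b - a)%:C)); last first.
  by move=> x _; apply: complex_eq; rewrite !(ReD, ImD, ReN, ImN, ReM, ImM) /=; ring.
by rewrite !cint_cst // !rmorphB /=; ring.
Qed.

Lemma rect_int_bound H a b c d (M : R) : a <= b -> c <= d ->
  (forall z, in_rect a b c d z -> ccont H z) ->
  (forall z, in_rect a b c d z -> cmod (H z) <= M) ->
  cmod (rect_int H a b c d) <= 2 * ((b - a) + (d - c)) * M.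
Proof.
move=> ab cd Hc HM.
have h y : c <= y <= d -> cmod (cint a b (fun x => H (x +i* y))) <= (b - a) * M.
  move=> ycd; apply: cint_bound => // [|x xab]; last by apply: HM.
  by apply: hline_rcont => x xab; apply: Hc.
have v x : a <= x <= b -> cmod (cint c d (fun y => H (x +i* y))) <= (d - c) * M.
  move=> xab; apply: cint_bound => // [|y ycd]; last by apply: HM.
  by apply: vline_rcont => y ycd; apply: Hc.
apply: le_trans (cmodD _ _) _; rewrite cmodM cmod_i mul1r.
apply: le_trans (lerD (cmodB _ _) (cmodB _ _)) _.
have := h c; have := h d; have := v a; have := v b; rewrite !lexx ab cd /=.
by move=> /(_ erefl) h1 /(_ erefl) h2 /(_ erefl) h3 /(_ erefl) h4; lra.
Qed.

Lemma mid_between a b : a <= b -> a <= (a + b) / 2 <= b.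
Proof. by move=> ab; apply/andP; split; lra. Qed.

(** A bound by e times the squared half-perimeter is stable under quartering, as four quarters of
    half the size restore it. Near a point it holds because the affine approximation can be
    subtracted at no cost, leaving an error e |z - z0|. Bisection gives it for the whole rectangle
    and every e. *)
Lemma goursat H a b c d : a <= b -> c <= d ->
  (forall z, in_rect a b c d z -> exists D, cdiff H z D) -> rect_int H a b c d = 0.
Proof.
move=> ab cd HD.
have Hc z : in_rect a b c d z -> ccont H z by move=> /HD[D]; exact: cdiff_cont.
suff K (e : R) : 0 < e -> cmod (rect_int H a b c d) <= e * ((b - a) + (d - c)) ^+ 2.
  apply/eqP; rewrite -cmod_eq0 eq_le cmod_ge0 andbT.
  apply/ler_addgt0Pl => e e0; rewrite addr0.
  pose p := 1 + ((b - a) + (d - c)) ^+ 2.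
  have p0 : 0 < p by rewrite /p ltr_wpDr // sqr_ge0.
  apply: le_trans (K (e / p) _) _; first by rewrite divr_gt0.
  rewrite mulrAC ler_pdivrMr // ler_wpM2l ?(ltW e0) //; rewrite /p lerDr //.
move=> e0.
apply: (@cousin_rect _ (fun a b c d => cmod (rect_int H a b c d) <= e * ((b - a) + (d - c)) ^+ 2)
  a b c d ab cd) => [a' b' c' d' aa ab' bb cc cd' dd m n h1 h2 h3 h4|x y xab ycd].
- have /andP[am mb] : a' <= m <= b' by exact: mid_between.
  have /andP[cn nd] : c' <= n <= d' by exact: mid_between.
  rewrite (@rect_int_split _ _ _ _ _ m n) ?am ?cn //; last first.
    move=> z [/andP[z1 z2] /andP[z3 z4]]; apply: Hc; split.
      by rewrite (le_trans aa) ?(le_trans z2).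
    by rewrite (le_trans cc) ?(le_trans z4).
  apply: le_trans (cmodD _ _) _; apply: le_trans (lerD (cmodD _ _) (lexx _)) _.
  apply: le_trans (lerD (lerD (cmodD _ _) (lexx _)) (lexx _)) _.
  apply: le_trans (lerD (lerD (lerD h1 h2) h3) h4) _.
  by rewrite le_eqVlt; apply/orP; left; apply/eqP; rewrite /m /n; field.
- have [D hD] := HD (x +i* y) (conj xab ycd).
  (* The perimeter is twice (b - a) + (d - c), hence the half. *)
  have e2 : 0 < e / 2 by lra.
  have [del del0 Hd] := hD _ e2.
  exists (del / 2) => [|a' b' c' d' /andP[aa ax] /andP[xb bb] /andP[cc cy] /andP[yd dd] ba dc].
    by lra.
  have ab' := le_trans ax xb; have cd' := le_trans cy yd.
  pose k := H (x +i* y) - D * (x +i* y).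
  have Hc' z : in_rect a' b' c' d' z -> ccont H z.
    move=> [/andP[z1 z2] /andP[z3 z4]]; apply: Hc; split.
      by rewrite (le_trans aa) ?(le_trans z2).
    by rewrite (le_trans cc) ?(le_trans z4).
  have Ac z : ccont (fun z => k + D * z) z.
    by apply: cdiff_cont; apply: cdiffD (cdiff_cst _ _) (cdiffZ _ (cdiff_id _)).
  rewrite -[rect_int _ _ _ _ _]subr0 -[X in _ - X](rect_int_affine k D ab' cd') -rect_intB //.
  apply: le_trans (_ : _ <= 2 * ((b' - a') + (d' - c')) * (e / 2 * ((b' - a') + (d' - c')))) _; last first.
    by rewrite le_eqVlt; apply/orP; left; apply/eqP; field.
  apply: rect_int_bound => // z zr.
    move=> e' e'0; have e'2 : 0 < e' / 2 by lra.
    have [d1 d10 H1] := Hc' _ zr _ e'2; have [d2 d20 H2] := Ac z _ e'2.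
    exists (Num.min d1 d2); first by rewrite lt_min d10.
    move=> w; rewrite lt_min => /andP[/H1 h1 /H2 h2].
    rewrite (_ : _ - _ = (H w - H z) - (k + D * w - (k + D * z))); last by ring.
    by rewrite [e']splitr; apply: le_lt_trans (cmodB _ _) (ltrD h1 h2).
  case: z zr => zx zy [/= /andP[z1 z2] /andP[z3 z4]].
  have dz : cmod ((zx - x) +i* (zy - y)) <= (b' - a') + (d' - c').
    apply: le_trans (cmod_le_ReIm _) _ => /=; apply: lerD; rewrite ler_norml; lra.
  have := Hd ((zx - x) +i* (zy - y)).
  have -> : x +i* y + ((zx - x) +i* (zy - y)) = zx +i* zy.
    by apply: complex_eq; rewrite ?ReD ?ImD /= addrC subrK.
  have -> : H (zx +i* zy) - (k + D * (zx +i* zy)) =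
     H (zx +i* zy) - H (x +i* y) - D * ((zx - x) +i* (zy - y)).
    have -> : (zx - x) +i* (zy - y) = (zx +i* zy) - (x +i* y) by [].
    rewrite /k; ring.
  move=> HH; apply: le_trans (HH _) _; first by apply: le_lt_trans dz _; lra.
  by rewrite ler_wpM2l // ltW.
Qed.

End Goursat.

(** * The exponential and means over circles *)

Section CircleMean.
Variable R : realType.
Local Notation C := R[i].
Implicit Types (H F : C -> C) (r : R) (z w : C).

Lemma real_diff (f : R -> R) (d : R) : is_derive (0 : R) (1 : R) f d ->
  forall e : R, 0 < e -> exists2 del : R, 0 < del &
    forall h, `|h| < del -> `|f h - f 0 - d * h| <= e * `|h|.
Proof.
move=> [fd fE] e e0.
move/cvg_ex: fd => [l Hl]; have ld : l = d.
  by rewrite -fE /derive; apply/esym/cvg_lim.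
move: Hl; rewrite ld => /cvgrPdist_le/(_ e e0) [del /= del0 Hd].
exists del => // h hd; have [->|h0] := eqVneq h 0; first by rewrite mulr0 subr0 subrr normr0 mulr0.
have := Hd h; rewrite /= sub0r normrN hd => /(_ erefl h0); rewrite addr0 /GRing.scale /= mulr1.
have -> : d - h^-1 * (f h - f 0) = - (h^-1 * (f h - f 0 - d * h)).
  by field.
by rewrite normrN normrM normfV mulrC ler_pdivrMr ?normr_gt0.
Qed.

(** The expansions of [expR], [cos] and [sin] at 0 are multiplied out; the addition formula will
    carry the derivative to every point. *)
Lemma cdiff_cexp0 : cdiff (@cexp R) 0 1.
Proof.
(* The error terms add up to 6 e' |h|. *)
move=> e e0; pose e' := Num.min (e / 8) 1.
have e'0 : 0 < e' by rewrite lt_min ltr01 andbT; lra.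
have [e'1 e'2] : e' <= e / 8 /\ e' <= 1 by rewrite !ge_min !lexx orbT.
have [d1 d10 H1] := real_diff (is_derive_expR (0 : R)) e'0.
have [d2 d20 H2] := real_diff (is_derive_cos (0 : R)) e'0.
have [d3 d30 H3] := real_diff (is_derive_sin (0 : R)) e'0.
exists (Num.min (Num.min d1 (e' / 2)) (Num.min d2 d3)) => [|h].
  by rewrite !lt_min d10 d20 d30 !andbT; lra.
rewrite !lt_min => /andP[/andP[h1 h4] /andP[h2 h3]].
rewrite add0r cexp0 mul1r.
case: h h1 h2 h3 h4 => x y h1 h2 h3 h4.
have [xh yh] : `|x| <= cmod (x +i* y) /\ `|y| <= cmod (x +i* y).
  by split; [exact: (Re_le_cmod (x +i* y))|exact: (Im_le_cmod (x +i* y))].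
set m := cmod (x +i* y) in h1 h2 h3 h4 xh yh *.
have := H1 x (le_lt_trans xh h1); have := H2 y (le_lt_trans yh h2).
have := H3 y (le_lt_trans yh h3).
rewrite expR0 cos0 sin0 oppr0 mul0r !subr0 !mul1r => k3 k2 k1; rewrite addr0 in k3.
have m0 : 0 <= m by exact: cmod_ge0.
have e'm : e' * m <= e / 8 * m by rewrite ler_wpM2r.
have k1' : `|expR x - 1 - x| <= e' * m by apply: le_trans k1 _; rewrite ler_wpM2l // ltW.
have k2' : `|cos y - 1| <= e' * m by apply: le_trans k2 _; rewrite ler_wpM2l // ltW.
have k3' : `|sin y - y| <= e' * m by apply: le_trans k3 _; rewrite ler_wpM2l // ltW.
have mh : m < e' / 2 by [].
have e1m : e' * m <= m by rewrite ler_piMl.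
have E1 : `|expR x - 1| <= 2 * m.
  have -> : expR x - 1 = (expR x - 1 - x) + x by rewrite subrK.
  apply: le_trans (ler_normD _ _) _; apply: le_trans (lerD k1' xh) _.
  by rewrite mulr_natl mulr2n lerD2r.
have E2 : `|expR x| <= 2.
  have -> : expR x = (expR x - 1) + 1 by rewrite subrK.
  apply: le_trans (ler_normD _ _) _; apply: le_trans (lerD E1 (lexx _)) _.
  by rewrite normr1; lra.
have P1 : `|expR x * (cos y - 1)| <= 2 * (e' * m) by rewrite normrM; apply: ler_pM.
have P2 : `|expR x * (sin y - y)| <= 2 * (e' * m) by rewrite normrM; apply: ler_pM.
have P3 : `|(expR x - 1) * y| <= e' * m.
  rewrite normrM; apply: le_trans (_ : 2 * m * m <= _); first by apply: ler_pM.
  by rewrite ler_wpM2r //; lra.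
apply: le_trans (cmod_le_ReIm _) _.
rewrite !(ReD, ImD, ReN, ImN, cexpE, ReZ, ImZ) /= oppr0 addr0.
have -> : expR x * cos y - 1 - x = expR x * (cos y - 1) + (expR x - 1 - x) by ring.
have -> : expR x * sin y - y = expR x * (sin y - y) + (expR x - 1) * y by ring.
apply: le_trans (lerD (ler_normD _ _) (ler_normD _ _)) _.
have em : 0 <= e * m by rewrite mulr_ge0 // ltW.
apply: le_trans (lerD (lerD P1 k1') (lerD P2 P3)) _; lra.
Qed.

Lemma cdiff_cexp z : cdiff (@cexp R) z (cexp z).
Proof.
have h := cdiffZ (cexp z) cdiff_cexp0; rewrite mulr1 in h.
move=> e e0; have [del del0 Hd] := h e e0; exists del => // w /Hd.
by rewrite add0r cexp0 mulr1 cexpD.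
Qed.

(** The integral of F z / z dz over |z| = r, divided by 2 pi i; hence the factors z in the Cauchy
    kernels below. *)
Definition cmean F r : C := ((2 * pi)^-1)%:C * cint 0 (2 * pi) (fun t => F (r%:C * cis t)).

Lemma pi2_gt0 : 0 < 2 * pi :> R.
Proof. by rewrite mulr_gt0 // pi_gt0. Qed.

Lemma circle_diff F r z t : 0 <= r -> z = r%:C * cis t -> cmod z = r.
Proof. by move=> r0 ->; rewrite cmodM cmod_cis mulr1 cmodR ger0_norm. Qed.

Lemma cmod_rcis r t : 0 <= r -> cmod (r%:C * cis t) = r.
Proof. by move=> r0; apply: circle_diff. Qed.

Lemma cexp_polar r t : 0 < r -> cexp (ln r +i* t) = r%:C * cis t.
Proof. by move=> r0; rewrite cexpE /= lnK. Qed.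

(** The exponential maps the rectangle [ln r1, ln r2] x [0, 2 pi] onto the annulus. In Goursat's
    theorem for F (exp w) the horizontal sides cancel by periodicity, and the vertical ones are the
    two means. *)
Lemma cmean_const F r1 r2 : 0 < r1 -> r1 <= r2 ->
  (forall z, r1 <= cmod z <= r2 -> exists D, cdiff F z D) -> cmean F r1 = cmean F r2.
Proof.
move=> r10 r12 HF; have r20 : 0 < r2 by exact: lt_le_trans r12.
rewrite /cmean; congr (_ * _).
have l12 : ln r1 <= ln r2 by rewrite ler_ln.
pose H w := F (cexp w).
have p0 : 0 <= 2 * pi :> R by rewrite ltW // pi2_gt0.
have := @goursat _ H (ln r1) (ln r2) 0 (2 * pi) l12 p0.
have HD z : in_rect (ln r1) (ln r2) 0 (2 * pi) z -> exists D, cdiff H z D.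
  move=> [/andP[z1 z2] _]; have [|D hD] := HF (cexp z).
    by rewrite cmod_cexp -[r1]lnK // -[r2]lnK // !ler_expR z1.
  by exists (D * cexp z); apply: cdiff_comp hD; exact: cdiff_cexp.
move=> /(_ HD); rewrite /rect_int.
rewrite (eq_cint (v := fun x => H (x +i* (2 * pi)))); last first.
  by move=> x _; rewrite /H !cexpE /= cis0 cis2pi.
rewrite subrr add0r => /eqP; rewrite mulf_eq0 => /orP[|].
  by rewrite eq_complex /= oner_eq0 andbF.
rewrite subr_eq0 => /eqP/esym; rewrite /H.
rewrite (eq_cint (v := fun t => F (r1%:C * cis t))); last by move=> t _; rewrite cexp_polar.
by move=> ->; apply: eq_cint => t _; rewrite cexp_polar.
Qed.

Definition circ_rcont F r := rcont 0 (2 * pi) (fun t => F (r%:C * cis t)).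

Lemma cis_rcont r a b : rcont a b (fun t => r%:C * cis t).
Proof.
apply: rcontZ; apply: (rcont_ext (u := fun t => cexp (0 +i* t))) => [t _|].
  by rewrite cexpE /= expR0 mul1r.
by apply: vline_rcont => y _; apply: cdiff_cont; exact: cdiff_cexp.
Qed.

Lemma circ_rcontP F r : 0 <= r -> (forall z, cmod z = r -> ccont F z) -> circ_rcont F r.
Proof.
move=> r0 Fc t tp e e0.
have [d1 d10 H1] := Fc _ (cmod_rcis t r0) e e0.
have [d2 d20 H2] := cis_rcont r tp d10.
by exists d2 => // y yp /(H2 _ yp); exact: H1.
Qed.

End CircleMean.

(** * Cauchy's formula and Taylor expansion *)

Section Taylor.
Variable R : realType.
Local Notation C := R[i].
Implicit Types (f g F G : C -> C) (r s t : R) (z w : C) (a b : nat -> C).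

Lemma rcont_bounded (u : R -> C) (x y : R) : x <= y -> rcont x y u ->
  exists M : R, forall t, x <= t <= y -> cmod (u t) <= M.
Proof.
move=> xy uc.
pose P (a b _ _ : R) := exists M : R, forall t, a <= t <= b -> cmod (u t) <= M.
suff : P x y 0 0 by [].
apply: (@cousin_rect _ P) => // [a b c d _ ab _ _ _ _ m n [M1 H1] [M2 H2] _ _|t y0 txy _].
  exists (Num.max M1 M2) => t /andP[t1 t2]; rewrite le_max.
  have [tm|/ltW tm] := leP t m; first by rewrite H1 // t1.
  by rewrite H2 ?orbT // tm.
have [del del0 H] := uc t txy _ ltr01.
exists del => // a b c d /andP[xa at_] /andP[tb bx] _ _ ba _.
exists (cmod (u t) + 1) => v /andP[v1 v2].
have -> : u v = u t + (u v - u t) by rewrite addrC subrK.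
apply: le_trans (cmodD _ _) _; rewrite lerD2l ltW // H //.
  by rewrite (le_trans xa) ?(le_trans v2).
by rewrite ltr_norml; lra.
Qed.

Lemma eq_cmean F G r : 0 <= r -> (forall z, cmod z = r -> F z = G z) -> cmean F r = cmean G r.
Proof.
by move=> r0 FG; rewrite /cmean (eq_cint (v := fun t => G (r%:C * cis t))) // => t _; rewrite FG ?cmod_rcis.
Qed.

Lemma cmeanD F G r : circ_rcont F r -> circ_rcont G r ->
  cmean (fun z => F z + G z) r = cmean F r + cmean G r.
Proof. by move=> hF hG; rewrite /cmean cintD // mulrDr. Qed.

Lemma cmeanZ k F r : circ_rcont F r -> cmean (fun z => k * F z) r = k * cmean F r.
Proof. by move=> hF; rewrite /cmean cintZ // mulrCA. Qed.

Lemma cmeanB F G r : circ_rcont F r -> circ_rcont G r ->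
  cmean (fun z => F z - G z) r = cmean F r - cmean G r.
Proof. by move=> hF hG; rewrite /cmean cintB // mulrBr. Qed.

Lemma cmean_cst k r : cmean (fun=> k) r = k.
Proof.
have p0 := pi2_gt0 R; rewrite /cmean cint_cst ?(ltW p0) // subr0 mulrA -rmorphM /=.
by rewrite mulVf ?gt_eqF // mul1r.
Qed.

Lemma cmean0 F : cmean F 0 = F 0.
Proof. by rewrite -[RHS](cmean_cst _ 0) /cmean (eq_cint (v := fun=> F 0)) // => t _; rewrite mul0r. Qed.

Lemma cmean_le F r (M : R) : 0 <= r -> circ_rcont F r -> (forall z, cmod z = r -> cmod (F z) <= M) ->
  cmod (cmean F r) <= M.
Proof.
move=> r0 hF FM; have p0 := pi2_gt0 R; rewrite /cmean cmodM cmodR gtr0_norm ?invr_gt0 //.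
rewrite mulrC ler_pdivrMr //; have := cint_bound (ltW p0) hF (M := M).
by rewrite subr0 [_ * M]mulrC; apply => t _; apply: FM; rewrite cmod_rcis.
Qed.

Lemma le0_eps (x K : R) : (forall e : R, 0 < e -> x <= K * e) -> x <= 0.
Proof.
move=> H; rewrite leNgt; apply/negP => x0.
have k1 : 0 < `|K| + 1 by rewrite ltr_wpDl.
have e0 : 0 < x / 2 / (`|K| + 1) by rewrite divr_gt0 // divr_gt0.
have := H _ e0.
have : K * (x / 2 / (`|K| + 1)) <= (`|K| + 1) * (x / 2 / (`|K| + 1)).
  by rewrite ler_wpM2r ?(ltW e0) // (le_trans (ler_norm _)) // lerDl.
have -> : (`|K| + 1) * (x / 2 / (`|K| + 1)) = x / 2 by field; rewrite gt_eqF.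
lra.
Qed.

Lemma close_eq z w : (forall e : R, 0 < e -> cmod (z - w) <= e) -> z = w.
Proof.
move=> H; apply/eqP; rewrite -subr_eq0 -cmod_eq0 eq_le cmod_ge0 andbT.
by apply: (@le0_eps _ 1) => e /H; rewrite mul1r.
Qed.

Lemma cmeanX n r : 0 < r -> cmean (fun z => z ^+ n.+1) r = 0.
Proof.
move=> r0; apply/eqP; rewrite -cmod_eq0 eq_le cmod_ge0 andbT.
apply: (@le0_eps _ 1) => e e0; rewrite mul1r.
pose r' := Num.min r (Num.min e 1).
have [h1 h2 h3 h4] : [/\ 0 < r', r' <= r, r' <= e & r' <= 1].
  by rewrite /r' !lt_min r0 e0 ltr01 !ge_min !lexx !orbT.
rewrite -(@cmean_const _ _ r' r) //; last by move=> z _; eexists; exact: cdiffX.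
apply: cmean_le => [||z zr]; first exact: ltW.
  by apply: circ_rcontP => [|z _]; [exact: ltW|apply: cdiff_cont; exact: cdiffX].
by rewrite cmodX zr exprS (le_trans _ h3) // ler_piMr ?(ltW h1) // exprn_ile1 // ltW.
Qed.

(** The mean does not change when the circle grows, and at radius r + 1 / e the decay hypothesis
    bounds it by M e. *)
Lemma cmean_to0 F r (M : R) : 0 < r ->
  (forall z, r <= cmod z -> exists D, cdiff F z D) ->
  (forall z, r <= cmod z -> cmod (F z) * (cmod z - r) <= M) -> cmean F r = 0.
Proof.
move=> r0 FD FM; apply/eqP; rewrite -cmod_eq0 eq_le cmod_ge0 andbT.
apply: (@le0_eps _ M) => e e0.
pose r' := r + e^-1.
have ei : 0 < e^-1 by rewrite invr_gt0.
have rr : r <= r' by rewrite /r' lerDl ltW.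
rewrite (@cmean_const _ _ r r') //; last by move=> z /andP[z1 _]; exact: FD.
have r'0 : 0 < r' by rewrite (lt_le_trans r0).
apply: cmean_le => [||z zr]; first exact: ltW.
  by apply: circ_rcontP => [|z zr]; [exact: ltW|have [|D /cdiff_cont] := FD z; rewrite ?zr].
have := FM z; rewrite zr => /(_ rr); rewrite /r' addrC addKr.
by rewrite -ler_pdivlMr // invrK.
Qed.

Lemma cmeanVX n r : 0 < r -> cmean (fun z => (z ^+ n.+1)^-1) r = 0.
Proof.
move=> r0; have nz z : r <= cmod z -> z ^+ n.+1 != 0.
  by move=> rz; rewrite expf_neq0 // -cmod_gt0 (lt_le_trans r0).
apply: (@cmean_to0 _ _ (r ^+ n)^-1) => // z rz.
  by eexists; apply: cdiffV; [exact: nz|exact: cdiffX].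
have z0 : 0 < cmod z by exact: lt_le_trans rz.
rewrite cmodV cmodX; apply: le_trans (_ : (cmod z ^+ n.+1)^-1 * cmod z <= _).
  by rewrite ler_wpM2l ?invr_ge0 ?exprn_ge0 ?(ltW z0) // gerBl ltW.
have -> : (cmod z ^+ n.+1)^-1 * cmod z = (cmod z ^+ n)^-1 by rewrite exprSr; field; rewrite expf_neq0 gt_eqF.
rewrite lef_pV2 ?posrE ?exprn_gt0 //.
by rewrite lerXn2r // ?nnegrE ltW.
Qed.

(** Bisection of the parameter interval turns continuity at each point of the circle into an
    estimate uniform in the angle. *)
Lemma cmean_ucont G r0 : 0 <= r0 -> (forall z, cmod z = r0 -> ccont G z) ->
  forall e : R, 0 < e -> exists2 del : R, 0 < del & forall r t, 0 <= r -> `|r - r0| < del ->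
    0 <= t <= 2 * pi -> cmod (G (r%:C * cis t) - G (r0%:C * cis t)) <= e.
Proof.
move=> r00 Gc e e0.
pose P (a b _ _ : R) := exists2 del : R, 0 < del & forall r t, 0 <= r -> `|r - r0| < del ->
    a <= t <= b -> cmod (G (r%:C * cis t) - G (r0%:C * cis t)) <= e.
suff : P 0 (2 * pi) 0 0 by [].
apply: (@cousin_rect _ P _ _ _ _ (ltW (pi2_gt0 R)) (lexx _)) => [a b c d _ ab _ _ _ _ m n [d1 d10 H1] [d2 d20 H2] _ _|t0 y0 tp _].
  exists (Num.min d1 d2); first by rewrite lt_min d10.
  move=> r t r0' ; rewrite lt_min => /andP[h1 h2] /andP[t1 t2].
  have [tm|/ltW tm] := leP t m; first by rewrite H1 // t1.
  by rewrite H2 // tm.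
have e2 : 0 < e / 2 by lra.
have [del del0 Hd] := Gc _ (cmod_rcis t0 r00) _ e2.
have del2 : 0 < del / 2 by lra.
have [d1 d10 H1] := @cis_rcont _ r0 0 (2 * pi) t0 tp _ del2.
exists d1 => // a b c d /andP[a0 a1] /andP[b0 b1] _ _ ba _.
have near t : a <= t <= b -> cmod (r0%:C * cis t - r0%:C * cis t0) < del / 2.
  move=> /andP[t1 t2]; apply: H1; first by rewrite (le_trans a0) ?(le_trans t2).
  by rewrite ltr_norml; lra.
exists (del / 2) => // r t r0' rr tab.
have -> : G (r%:C * cis t) - G (r0%:C * cis t) =
  (G (r%:C * cis t) - G (r0%:C * cis t0)) - (G (r0%:C * cis t) - G (r0%:C * cis t0)) by ring.
apply: le_trans (cmodB _ _) _; rewrite [e]splitr lerD // ltW // Hd //.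
  apply: (le_lt_trans (cmod_tri (r%:C * cis t) _ (r0%:C * cis t))).
  rewrite [del]splitr ltrD ?near // -mulrBl cmodM cmod_cis mulr1 -rmorphB cmodR //.
by apply: lt_trans (near _ tab) _; lra.
Qed.

Lemma cmean_continuous G r0 : 0 <= r0 -> (forall z, cmod z = r0 -> ccont G z) ->
  forall e : R, 0 < e -> exists2 del : R, 0 < del & forall r, 0 <= r -> `|r - r0| < del ->
    circ_rcont G r -> cmod (cmean G r - cmean G r0) <= e.
Proof.
move=> r00 Gc e e0; have [del del0 H] := cmean_ucont r00 Gc e0.
exists del => // r r0' rr hr.
have h0 := circ_rcontP r00 Gc.
rewrite /cmean -mulrBr -cintB // cmodM cmodR.
have p0 := pi2_gt0 R; rewrite gtr0_norm ?invr_gt0 // mulrC ler_pdivrMr //.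
have hh : rcont 0 (2 * pi) (fun t => G (r%:C * cis t) - G (r0%:C * cis t)).
  by have := rcontD hr (rcontZ (-1) h0); apply: rcont_ext => t _; rewrite mulN1r.
have := cint_bound (ltW p0) hh (M := e); rewrite subr0 [_ * e]mulrC; apply.
by move=> t tp; apply: H.
Qed.

#[global] Opaque cmean.

Lemma cdiff_subV z z0 : z - z0 != 0 -> cdiff (fun w => (w - z0)^-1) z (- 1 / (z - z0) ^+ 2).
Proof.
move=> h; apply: (@cdiffV _ (fun w => w - z0)) => //.
by have := cdiffB (cdiff_id z) (cdiff_cst z0 z); rewrite subr0.
Qed.

Definition hol f := forall z, cmod z < 1 -> exists d, cdiff f z d.

Lemma hol_cont f z : hol f -> cmod z < 1 -> ccont f z.
Proof. by move=> hf /hf[d]; exact: cdiff_cont. Qed.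

Lemma hol_circ f r : hol f -> 0 <= r < 1 -> circ_rcont f r.
Proof. by move=> hf /andP[r0 r1]; apply: circ_rcontP => // z zr; apply: hol_cont; rewrite ?zr. Qed.

Lemma cmean_inv_sub z0 r : cmod z0 < r -> cmean (fun z => (z - z0)^-1) r = 0.
Proof.
move=> zr; have r0 : 0 < r := le_lt_trans (cmod_ge0 _) zr.
have nz z : r <= cmod z -> z - z0 != 0.
  by move=> rz; rewrite subr_eq0; apply/eqP => E; move: zr; rewrite -E ltNge rz.
apply: (@cmean_to0 _ _ 1) => // z rz.
  by eexists; apply: cdiff_subV; exact: nz.
have h : 0 < cmod (z - z0) by rewrite cmod_gt0 nz.
rewrite cmodV mulrC ler_pdivrMr // mul1r.
by have := cmod_subr z z0; lra.
Qed.

Lemma ccontM F G z : ccont F z -> ccont G z -> ccont (fun w => F w * G w) z.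
Proof.
move=> Fc Gc e e0; pose K := 1 + cmod (F z) + cmod (G z).
have [F0 G0] := (cmod_ge0 (F z), cmod_ge0 (G z)).
have K0 : 0 < K by rewrite /K; lra.
pose e' := Num.min 1 (e / (2 * K)).
have e'0 : 0 < e' by rewrite lt_min ltr01 divr_gt0 // mulr_gt0.
have [d1 d10 H1] := Fc _ e'0; have [d2 d20 H2] := Gc _ e'0.
exists (Num.min d1 d2) => [|w]; first by rewrite lt_min d10.
rewrite lt_min => /andP[/H1 h1 /H2 h2].
have -> : F w * G w - F z * G z = (F w - F z) * (G w - G z) + (F w - F z) * G z + F z * (G w - G z).
  by ring.
apply: le_lt_trans (cmodD _ _) _; apply: le_lt_trans (lerD (cmodD _ _) (lexx _)) _.
rewrite !cmodM.
have ee : e' * K <= e / 2.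
  apply: le_trans (_ : e / (2 * K) * K <= _); first by rewrite ler_wpM2r ?(ltW K0) // ge_min lexx orbT.
  by rewrite le_eqVlt; apply/orP; left; apply/eqP; field; rewrite gt_eqF.
have e'1 : e' <= 1 by rewrite ge_min lexx.
apply: le_lt_trans (_ : e' * K < e); last by lra.
have -> : e' * K = e' * 1 + e' * cmod (G z) + cmod (F z) * e' by rewrite /K; ring.
rewrite !lerD //.
- by apply: ler_pM; rewrite ?cmod_ge0 // ltW // (lt_le_trans h2).
- by rewrite ler_wpM2r // ltW.
- by rewrite ler_wpM2l // ltW.
Qed.

(** The mean is constant in the radius on each side of |z0|, where annuli avoid z0, and continuous
    in the radius at |z0| and at 0. The value H 0 = 0 therefore propagates outwards, through the
    circle containing z0. *)
Lemma cmean_removable (H : C -> C) (z0 : C) r : cmod z0 < r -> r < 1 -> H 0 = 0 ->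
  (forall z, cmod z < 1 -> ccont H z) ->
  (forall z, cmod z < 1 -> z != z0 -> exists d, cdiff H z d) -> cmean H r = 0.
Proof.
move=> zr r1 H0 Hc Hd.
have Hr s : 0 <= s -> s < 1 -> circ_rcont H s.
  by move=> s0 s1; apply: circ_rcontP => // z zs; apply: Hc; rewrite zs.
have Hconst s s' : 0 < s -> s <= s' -> s' < 1 ->
    (forall z, s <= cmod z <= s' -> z != z0) -> cmean H s = cmean H s'.
  move=> s0 ss s1 nz; apply: cmean_const => // z zs; apply: Hd; last exact: nz.
  by move: zs => /andP[_ /le_lt_trans]; apply.
have right : cmean H r = cmean H (cmod z0).
  apply: close_eq => e.
    move=> e0; have c0 z : cmod z = cmod z0 -> ccont H z by move=> E; apply: Hc; rewrite E (lt_trans zr).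
    have [del del0 Hdel] := cmean_continuous (cmod_ge0 z0) c0 e0.
    have d2 : 0 < del / 2 by rewrite divr_gt0.
    pose s := Num.min r (cmod z0 + del / 2).
    have [s1 s2 s3] : [/\ cmod z0 < s, s <= r & s <= cmod z0 + del / 2].
      by rewrite /s lt_min zr !ge_min !lexx orbT /= ltrDl d2.
    have s0 := le_lt_trans (cmod_ge0 z0) s1.
    rewrite -(Hconst s r) //; last first.
      by move=> z /andP[z1 _]; apply/eqP => E; move: z1; rewrite E leNgt s1.
    apply: Hdel; [exact: ltW| |apply: Hr; [exact: ltW|exact: le_lt_trans r1]].
    rewrite ger0_norm ?subr_ge0 ?(ltW s1) // ltrBlDl; apply: le_lt_trans s3 _.
    by rewrite ltrD2l ltr_pdivrMr // ltr_pMr // ltr1n.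
have left : cmean H (cmod z0) = 0.
  have [z00|z00] := eqVneq z0 0.
    by rewrite z00 cmod0 cmean0.
  have mz0 : 0 < cmod z0 by rewrite cmod_gt0.
  have small s : 0 < s -> s < cmod z0 -> cmean H s = 0.
    move=> s0 sz; apply/eqP; rewrite -cmod_eq0 eq_le cmod_ge0 andbT.
    apply: (@le0_eps _ 1) => e e0; rewrite mul1r.
    have c0 z : cmod z = 0 -> ccont H z by move=> E; apply: Hc; rewrite E.
    have [del del0 Hdel] := cmean_continuous (lexx 0) c0 e0.
    pose s' := Num.min s (del / 2).
    have [s1 s2 s3] : [/\ 0 < s', s' <= s & s' <= del / 2].
      by rewrite /s' lt_min s0 !ge_min !lexx orbT /= divr_gt0.
    rewrite -(Hconst s' s) //; last 2 first.
    - by apply: lt_trans sz _; exact: lt_trans r1.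
    - by move=> z /andP[_ z1]; apply/eqP => E; move: z1; rewrite E leNgt sz.
    have := Hdel s' (ltW s1); rewrite cmean0 H0 !subr0; apply.
      rewrite gtr0_norm //; apply: le_lt_trans s3 _; lra.
    by apply: Hr; [exact: ltW|exact: le_lt_trans s2 (lt_trans sz (lt_trans zr r1))].
  apply/eqP; rewrite -cmod_eq0 eq_le cmod_ge0 andbT.
  apply: (@le0_eps _ 1) => e e0; rewrite mul1r.
  have c0 z : cmod z = cmod z0 -> ccont H z by move=> E; apply: Hc; rewrite E (lt_trans zr).
  have [del del0 Hdel] := cmean_continuous (cmod_ge0 z0) c0 e0.
  pose s := Num.max (cmod z0 / 2) (cmod z0 - del / 2).
  have [s1 s2 s3] : [/\ 0 < s, s < cmod z0 & cmod z0 - del / 2 <= s].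
    by rewrite /s lt_max gt_max !le_max !lexx orbT /= divr_gt0 // ltr_pdivrMr // ltr_pMr // ltr1n
      ltrBlDr ltrDl divr_gt0.
  have := Hdel s (ltW s1); rewrite (small s) // sub0r cmodN; apply.
    rewrite distrC ger0_norm ?subr_ge0 ?(ltW s2) // ltrBlDr -ltrBlDl; apply: lt_le_trans s3.
    by rewrite ltrD2l ltrN2 ltr_pdivrMr // ltr_pMr // ltr1n.
  by apply: Hr; [exact: ltW|exact: lt_trans s2 (lt_trans zr r1)].
by rewrite right left.
Qed.

Lemma cmean_quotient (z0 : C) (f : C -> C) r : hol f -> cmod z0 < r -> r < 1 ->
  cmean (fun z => z * (f z - f z0) / (z - z0)) r = 0.
Proof.
move=> hf zr r1; have [D hD] := hf _ (lt_trans zr r1).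
(* Extended by the derivative, the quotient is continuous at z0; the factor z in [H] makes the value
   at 0 vanish. *)
pose Q z := if z == z0 then D else (f z - f z0) / (z - z0).
pose H z := z * Q z.
have Hd z : cmod z < 1 -> z != z0 -> exists d, cdiff H z d.
  move=> z1 zz; have [d hd] := hf z z1.
  have zz0 : 0 < cmod (z - z0) by rewrite cmod_gt0 subr_eq0.
  eexists; apply: cdiffM (cdiff_id _) _.
  apply: (@cdiff_near _ (fun w => (f w - f z0) / (w - z0)) _ _ _ _ zz0).
    move=> w hw; rewrite /Q; case: eqP => // E.
    by move: hw; rewrite E cmodC ltxx.
  apply: cdiff_div; first by rewrite subr_eq0.
    exact: cdiffB hd (cdiff_cst _ _).
  exact: cdiffB (cdiff_id _) (cdiff_cst _ _).
have Qc : ccont Q z0.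
  move=> e e0; have e2 : 0 < e / 2 by lra.
  have [del del0 Hdel] := hD _ e2; exists del => // w hw; rewrite /Q eqxx.
  case: eqP => [_|/eqP wz]; first by rewrite subrr cmod0.
  have wz0 : 0 < cmod (w - z0) by rewrite cmod_gt0 subr_eq0.
  have -> : (f w - f z0) / (w - z0) - D = (f w - f z0 - D * (w - z0)) / (w - z0).
    by rewrite [RHS]mulrBl mulfK // subr_eq0.
  rewrite cmodM cmodV ltr_pdivrMr //; apply: le_lt_trans (_ : _ <= e / 2 * cmod (w - z0)) _.
    by have := Hdel _ hw; rewrite [z0 + _]addrC subrK.
  by rewrite ltr_pM2r //; lra.
have Hc z : cmod z < 1 -> ccont H z.
  move=> z1; have [->|zz] := eqVneq z z0; last by have [d] := Hd z z1 zz; exact: cdiff_cont.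
  by apply: ccontM Qc; apply: cdiff_cont; exact: cdiff_id.
have r0 : 0 <= r by exact: ltW (le_lt_trans (cmod_ge0 z0) zr).
rewrite (@eq_cmean _ H) //; first by apply: (cmean_removable zr r1) => //; rewrite /H mul0r.
move=> z zr'; rewrite /H /Q; case: eqP => [E|_]; last by rewrite mulrA.
by move: zr; rewrite -zr' E ltxx.
Qed.

(** Since z / (z - z0) = 1 + z0 / (z - z0) and 1 / (z - z0) has mean 0, replacing f z by f z0 gives
    f z0; the difference is the mean in [cmean_quotient]. *)
Lemma cauchy_formula f z0 r : hol f -> cmod z0 < r -> r < 1 ->
  cmean (fun z => f z * (z / (z - z0))) r = f z0.
Proof.
move=> hf zr r1; have r0 : 0 < r := le_lt_trans (cmod_ge0 _) zr.
have nz z : cmod z = r -> z - z0 != 0.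
  by move=> rz; rewrite subr_eq0; apply/eqP => E; move: zr; rewrite -E rz ltxx.
have := cmean_quotient hf zr r1.
have ci : circ_rcont (fun z => (z - z0)^-1) r.
  apply: circ_rcontP => [|z /nz zz]; first exact: ltW.
  by apply: cdiff_cont; exact: cdiff_subV.
have cf : circ_rcont (fun z => f z * (z / (z - z0))) r.
  apply: circ_rcontP => [|z zE]; first exact: ltW.
  apply: ccontM; first by apply: hol_cont; rewrite ?zE.
  apply: ccontM; first exact: cdiff_cont (cdiff_id _).
  by apply: cdiff_cont; apply: cdiff_subV; exact: nz.
rewrite (@eq_cmean _ (fun z => f z * (z / (z - z0)) - (f z0 + (f z0 * z0) * (z - z0)^-1))); last 2 first.
- exact: ltW.
- by move=> z /nz zz; field.
have cZ : circ_rcont (fun z => f z0 * z0 * (z - z0)^-1) r by exact: rcontZ.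
rewrite cmeanB // ?cmeanD // ?cmean_cst ?cmeanZ ?cmean_inv_sub //.
- by rewrite mulr0 addr0 => /eqP; rewrite subr_eq0 => /eqP.
- exact: rcont_cst.
- by apply: rcontD => //; exact: rcont_cst.
Qed.

(** Geometric convergence on every smaller disc, with [K] and [q] uniform in [z]: one notion
    covering pointwise, uniform and absolute convergence. *)
Definition taylor f a := forall s, 0 <= s -> s < 1 -> exists K q : R, [/\ 0 <= K, 0 <= q, q < 1 &
  forall n z, cmod z <= s -> cmod (f z - \sum_(k < n) a k * z ^+ k) <= K * q ^+ n].

Definition tcoef f n r : C := cmean (fun z => f z * (z ^+ n)^-1) r.

Lemma tcoefE f n r : tcoef f n r = cmean (fun z => f z * (z ^+ n)^-1) r.
Proof. by []. Qed.

Lemma circ_tcoef f n r : hol f -> 0 < r -> r < 1 -> circ_rcont (fun z => f z * (z ^+ n)^-1) r.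
Proof.
move=> hf r0 r1; apply: circ_rcontP => [|z zr]; first exact: ltW.
apply: ccontM; first by apply: hol_cont; rewrite ?zr.
apply: cdiff_cont; apply: cdiffV (cdiffX _ _); rewrite expf_neq0 // -cmod_gt0 zr //.
Qed.

Lemma tcoef_const f n r r' : hol f -> 0 < r -> r < 1 -> 0 < r' -> r' < 1 -> tcoef f n r = tcoef f n r'.
Proof.
move=> hf; wlog rr : r r' / r <= r'.
  by move=> H r0 r1 r'0 r'1; have [rr|/ltW rr] := leP r r'; [|apply/esym]; exact: H.
move=> r0 r1 r'0 r'1; apply: cmean_const => // z /andP[z1 z2].
have [d hd] := hf z (le_lt_trans z2 r'1).
eexists; apply: cdiffM hd _; apply: cdiffV (cdiffX _ _).
by rewrite expf_neq0 // -cmod_gt0 (lt_le_trans r0).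
Qed.

Lemma hol_bounded f r : hol f -> 0 <= r -> r < 1 -> exists2 M : R, 0 <= M & forall z, cmod z = r -> cmod (f z) <= M.
Proof.
move=> hf r0 r1; have hc : circ_rcont f r by apply: hol_circ; rewrite ?r0.
have [M HM] := rcont_bounded (ltW (pi2_gt0 R)) hc.
have HM' z : cmod z = r -> cmod (f z) <= M.
  move=> zr; have [z0|z0] := eqVneq z 0.
    have := HM 0; rewrite lexx (ltW (pi2_gt0 R)) => /(_ erefl).
    by rewrite cis0 mulr1 -zr z0 cmod0.
  have [t [tp zE]] := cis_surj z0.
  by rewrite zE zr; apply: HM.
exists M => //; apply: le_trans (HM' r%:C _); rewrite ?cmod_ge0 //.
by rewrite cmodR ger0_norm.
Qed.

Lemma geom_step (x y u z w : C) : z != 0 -> u != 0 -> z - w != 0 ->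
  x * (y / u * (z / (z - w))) = y * (x / u) + x * (w * y / (z * u) * (z / (z - w))).
Proof. by move=> z0 u0 zw0; field; apply/and3P; split. Qed.

(** The geometric series of z / (z - z0) in powers of z0 / z, stopped after n terms with its exact
    remainder. *)
Lemma taylor_remainder f n z0 r : hol f -> cmod z0 < r -> r < 1 ->
  f z0 = \sum_(k < n) tcoef f k r * z0 ^+ k +
    cmean (fun z => f z * ((z0 ^+ n * (z ^+ n)^-1) * (z / (z - z0)))) r.
Proof.
move=> hf zr r1; have r0 : 0 < r := le_lt_trans (cmod_ge0 _) zr.
have nz z : cmod z = r -> z - z0 != 0.
  by move=> rz; rewrite subr_eq0; apply/eqP => E; move: zr; rewrite -E rz ltxx.
have nz' z : cmod z = r -> z != 0 by move=> rz; rewrite -cmod_gt0 rz.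
have cc m : circ_rcont (fun z => f z * ((z0 ^+ m * (z ^+ m)^-1) * (z / (z - z0)))) r.
  apply: circ_rcontP => [|z zE]; first exact: ltW.
  apply: ccontM; first by apply: hol_cont; rewrite ?zE.
  apply: ccontM.
    apply: ccontM; first exact: cdiff_cont (cdiff_cst _ _).
    by apply: cdiff_cont; apply: cdiffV (cdiffX _ _); rewrite expf_neq0 // nz'.
  apply: ccontM; first exact: cdiff_cont (cdiff_id _).
  by apply: cdiff_cont; apply: cdiff_subV; exact: nz.
elim: n => [|n IH].
  rewrite big_ord0 add0r -[LHS](cauchy_formula hf zr r1).
  by apply: eq_cmean => [|z _]; [exact: ltW|rewrite !expr0 invr1 !mul1r].
rewrite {1}IH big_ord_recr /= -addrA; congr (_ + _).
rewrite (@eq_cmean _ (fun z => z0 ^+ n * (f z * (z ^+ n)^-1) +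
  f z * ((z0 ^+ n.+1 * (z ^+ n.+1)^-1) * (z / (z - z0))))); last 2 first.
- exact: ltW.
- move=> z zE; have [h1 h2 h3] := And3 (nz z zE) (nz' z zE) (expf_neq0 n (nz' z zE)).
  by rewrite !exprS; exact: geom_step.
rewrite cmeanD //; last by apply: rcontZ; exact: circ_tcoef.
by rewrite cmeanZ ?[_ * z0 ^+ n]mulrC //; exact: circ_tcoef.
Qed.

(** The coefficients do not depend on the circle that defines them; for |z| <= s the circle of
    radius r = (1 + s) / 2 gives the ratio q = s / r. *)
Lemma hol_taylor f : hol f -> exists a, taylor f a.
Proof.
move=> hf.
have [a Ha] : exists a, forall n r, 0 < r -> r < 1 -> tcoef f n r = a n.
  have h0 : 0 < 1 / 2 :> R by lra.
  have h1 : 1 / 2 < 1 :> R by lra.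
  by exists (fun n => tcoef f n (1 / 2)) => n r r0 r1; exact: tcoef_const.
exists a => s s0 s1.
have [r sr r1] : exists2 r, s < r & r < 1 by exists ((1 + s) / 2); lra.
have r0 : 0 < r by exact: le_lt_trans sr.
have [M M0 HM] := hol_bounded hf (ltW r0) r1.
exists (M * (r / (r - s))), (s / r).
have rs : 0 < r - s by lra.
split.
- by rewrite mulr_ge0 // divr_ge0 // ltW.
- by rewrite divr_ge0 // ltW.
- by rewrite ltr_pdivrMr // mul1r.
move=> n z zs; have zr : cmod z < r by exact: le_lt_trans sr.
rewrite {1}(taylor_remainder n hf zr r1).
rewrite (eq_bigr (fun k : 'I_n => a k * z ^+ k)); last by move=> k _; rewrite Ha.
rewrite addrC addKr.
have nz w : cmod w = r -> w - z != 0.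
  by move=> rz; rewrite subr_eq0; apply/eqP => E; move: zr; rewrite -E rz ltxx.
have nz' w : cmod w = r -> w != 0 by move=> rz; rewrite -cmod_gt0 rz.
apply: cmean_le => [||w wr]; first exact: ltW.
  apply: circ_rcontP => [|w zE]; first exact: ltW.
  apply: ccontM; first by apply: hol_cont; rewrite ?zE.
  apply: ccontM.
    apply: ccontM; first exact: cdiff_cont (cdiff_cst _ _).
    by apply: cdiff_cont; apply: cdiffV (cdiffX _ _); rewrite expf_neq0 // nz'.
  apply: ccontM; first exact: cdiff_cont (cdiff_id _).
  by apply: cdiff_cont; apply: cdiff_subV; exact: nz.
rewrite !cmodM !cmodV !cmodX wr.
have nw : 0 < cmod (w - z) by rewrite cmod_gt0 nz.
have h1 : cmod z ^+ n * (r ^+ n)^-1 <= (s / r) ^+ n.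
  by rewrite expr_div_n ler_wpM2r ?invr_ge0 ?exprn_ge0 ?(ltW r0) // lerXn2r ?nnegrE ?cmod_ge0.
have h2 : r / cmod (w - z) <= r / (r - s).
  rewrite ler_wpM2l ?(ltW r0) // lef_pV2 ?posrE //.
  by have := cmod_subr w z; rewrite wr; apply: le_trans; rewrite lerD2l lerN2.
apply: le_trans (_ : _ <= M * ((s / r) ^+ n * (r / (r - s)))) _; last first.
  by rewrite le_eqVlt; apply/orP; left; apply/eqP; ring.
apply: ler_pM; rewrite ?cmod_ge0 ?HM //.
  by rewrite !mulr_ge0 ?exprn_ge0 ?invr_ge0 ?exprn_ge0 ?cmod_ge0 // ltW.
apply: ler_pM => //.
- by rewrite mulr_ge0 ?invr_ge0 ?exprn_ge0 ?cmod_ge0 // ltW.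
- by rewrite divr_ge0 ?cmod_ge0 // ltW.
Qed.

End Taylor.

(** * Taylor series *)

Section TaylorCalculus.
Variable R : realType.
Local Notation C := R[i].
Implicit Types (f g F G : C -> C) (r s t q K : R) (z w : C) (a b : nat -> C) (p : {poly C}).

Definition psum a n z : C := \sum_(k < n) a k * z ^+ k.

Lemma psumS a n z : psum a n.+1 z = psum a n z + a n * z ^+ n.
Proof. by rewrite /psum big_ord_recr. Qed.

(** A condition on coefficients alone, from which functions are built. Asking it for every s < 1
    lets a factor polynomial in n be absorbed by enlarging s. *)
Definition coef_geo a := forall s, 0 <= s -> s < 1 -> exists K q : R, [/\ 0 <= K, 0 <= q, q < 1 &
  forall n, cmod (a n) * s ^+ n <= K * q ^+ n].

Definition dcoef a n : C := n.+1%:R * a n.+1.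

Lemma taylor_coef_geo f a : taylor f a -> coef_geo a.
Proof.
move=> fa s s0 s1; have [K [q [K0 q0 q1 H]]] := fa s s0 s1.
exists (2 * K), q; split => // [|n]; first by rewrite mulr_ge0.
have zs : cmod (s%:C : C) <= s by rewrite cmodR ger0_norm.
have := H n.+1 _ zs; have := H n _ zs; rewrite -!/(psum _ _ _) => h1 h2.
have -> : cmod (a n) * s ^+ n = cmod (psum a n.+1 s%:C - psum a n s%:C).
  by rewrite psumS addrC addKr cmodM cmodX cmodR ger0_norm.
rewrite cmodC; apply: le_trans (cmod_tri _ _ (f s%:C)) _; rewrite cmodC.
have h3 : K * q ^+ n.+1 <= K * q ^+ n by rewrite ler_wpM2l // exprS ler_piMl ?exprn_ge0 // ltW.
by apply: le_trans (lerD h1 (le_trans h2 h3)) _; rewrite -mulrA [leRHS]mulr_natl mulr2n.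
Qed.

(** For q < q' < 1, Bernoulli's inequality shows that (q' / q) ^ n outgrows n + 1. *)
Lemma geo_poly q : 0 <= q -> q < 1 -> exists K q' : R, [/\ 0 <= K, 0 <= q', q' < 1 &
  forall n, n.+1%:R * q ^+ n <= K * q' ^+ n].
Proof.
move=> q0 q1; have [q' q01 q'1] : exists2 q', q < q' & q' < 1 by exists ((1 + q) / 2); lra.
have q'0 : 0 < q' := le_lt_trans q0 q01.
have [q00|qn0] := eqVneq q 0.
  exists 1, q'; split => //; first exact: ltW.
  case=> [|n]; first by rewrite !expr0 mul1r.
  by rewrite q00 expr0n mulr0 mul1r exprn_ge0 // ltW.
have qp : 0 < q by rewrite lt_def qn0.
pose t := q' / q - 1.
have t0 : 0 < t by rewrite subr_gt0 ltr_pdivlMr // mul1r.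
exists (1 + t^-1), q'; split => //; [by rewrite addr_ge0 ?invr_ge0 // ltW|exact: ltW|].
move=> n; have bern : 1 + n%:R * t <= (1 + t) ^+ n.
  elim: n => [|n IH]; first by rewrite mul0r addr0 expr0.
  rewrite exprS; apply: le_trans (ler_wpM2l _ IH); last by rewrite addr_ge0 // ltW.
  have h : 0 <= t * (n%:R * t) by rewrite !mulr_ge0 // ltW.
  have -> : (1 + t) * (1 + n%:R * t) = 1 + n.+1%:R * t + t * (n%:R * t) by rewrite -natr1; ring.
  by rewrite lerDl.
have qq : q' = q * (1 + t) by rewrite /t addrC subrK mulrC divfK.
rewrite [q' in leRHS]qq exprMn mulrCA mulrC ler_wpM2l ?exprn_ge0 //.
apply: le_trans (ler_wpM2l _ bern); last by rewrite addr_ge0 ?invr_ge0 // ltW.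
have -> : (1 + t^-1) * (1 + n%:R * t) = n.+1%:R + (n%:R * t + t^-1).
  by rewrite -natr1; field; rewrite gt_eqF.
by rewrite lerDl addr_ge0 ?mulr_ge0 ?invr_ge0 // ltW.
Qed.

Lemma dcoef_geo a : coef_geo a -> coef_geo (dcoef a).
Proof.
move=> ag s s0 s1; have [r sr r1] : exists2 r, s < r & r < 1 by exists ((1 + s) / 2); lra.
have r0 : 0 < r := le_lt_trans s0 sr.
have [K [q [K0 q0 q1 H]]] := ag r (ltW r0) r1.
have [K' [q' [K'0 q'0 q'1 H']]] := geo_poly q0 q1.
exists (K / r * K'), q'; split => // [|n]; first by rewrite !mulr_ge0 ?invr_ge0 // ltW.
rewrite /dcoef cmodM cmod_nat -mulrA.
have h : cmod (a n.+1) * s ^+ n <= K / r * q ^+ n.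
  have := H n.+1; rewrite exprSr mulrA -ler_pdivlMr // => h.
  apply: le_trans (_ : cmod (a n.+1) * r ^+ n <= _).
    by rewrite ler_wpM2l ?cmod_ge0 // lerXn2r ?nnegrE // ltW.
  apply: le_trans h _; rewrite [leRHS]mulrAC ler_wpM2r ?invr_ge0 ?(ltW r0) //.
  rewrite ler_wpM2l //.
  by rewrite exprS ler_piMl ?exprn_ge0 // ltW.
apply: le_trans (ler_wpM2l _ h) _ => //.
by rewrite mulrCA -[leRHS]mulrA ler_wpM2l // divr_ge0 // ltW.
Qed.

(** With K' = K / (1 - q), the sequence u n - K' q ^ n increases and u n + K' q ^ n decreases; the
    limit is the supremum of the lower ends of these nested intervals. *)
Lemma geo_limit_real (u : nat -> R) K q : 0 <= q -> q < 1 ->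
  (forall n, `|u n.+1 - u n| <= K * q ^+ n) ->
  exists l, forall n, `|l - u n| <= K / (1 - q) * q ^+ n.
Proof.
move=> q0 q1 H; pose K' := K / (1 - q).
have q1' : 0 < 1 - q by rewrite subr_gt0.
have KK n : K' * q ^+ n - K' * q ^+ n.+1 = K * q ^+ n.
  by rewrite /K' exprS; field; rewrite gt_eqF.
have K'n n : 0 <= K' * q ^+ n.
  rewrite mulr_ge0 ?exprn_ge0 // divr_ge0 ?(ltW q1') //.
  by have := H 0; rewrite expr0 mulr1; exact: le_trans.
pose v n := u n - K' * q ^+ n; pose w n := u n + K' * q ^+ n.
have vS n : v n <= v n.+1.
  by have := H n; have := KK n; rewrite /v ler_norml => E /andP[h1 h2]; lra.
have wS n : w n.+1 <= w n.
  by have := H n; have := KK n; rewrite /w ler_norml => E /andP[h1 h2]; lra.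
have vm i j : (i <= j)%N -> v i <= v j.
  by move/subnK <-; elim: (j - i)%N => // k IH; rewrite addSn (le_trans IH).
have wm i j : (i <= j)%N -> w j <= w i.
  by move/subnK <-; elim: (j - i)%N => // k IH; rewrite addSn (le_trans _ IH).
have vw i j : v i <= w j.
  have vwn n : v n <= w n by have := K'n n; rewrite /v /w; lra.
  have [ij|/ltnW ij] := leqP i j; first by rewrite (le_trans (vm _ _ ij)).
  by rewrite (le_trans (vwn _)) // wm.
exists (sup [set v n | n in setT]) => n.
have h1 : v n <= sup [set v n | n in setT].
  by apply: ub_le_sup; [exists (w 0%N) => _ [i _ <-]|exists n].
have h2 : sup [set v n | n in setT] <= w n.
  by apply: ge_sup => [|_ [i _ <-]]; [exists (v 0%N); exists 0%N|exact: vw].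
rewrite ler_norml; move: h1 h2; rewrite /v /w -/K' => h1 h2; apply/andP; split.
  by rewrite lerBrDl addrC in h1 *; lra.
by lra.
Qed.

Lemma geo_limit (u : nat -> C) K q : 0 <= q -> q < 1 ->
  (forall n, cmod (u n.+1 - u n) <= K * q ^+ n) ->
  exists l, forall n, cmod (l - u n) <= 2 * (K / (1 - q)) * q ^+ n.
Proof.
move=> q0 q1 H.
have hR n : `|complex.Re (u n.+1) - complex.Re (u n)| <= K * q ^+ n.
  by apply: le_trans (H n); rewrite -ReN -ReD Re_le_cmod.
have hI n : `|complex.Im (u n.+1) - complex.Im (u n)| <= K * q ^+ n.
  by apply: le_trans (H n); rewrite -ImN -ImD Im_le_cmod.
have [l1 H1] := geo_limit_real q0 q1 hR; have [l2 H2] := geo_limit_real q0 q1 hI.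
exists (l1 +i* l2) => n; apply: le_trans (cmod_le_ReIm _) _.
rewrite ReD ImD ReN ImN /= -mulrA mulr_natl mulr2n; exact: lerD.
Qed.

Lemma geo_eps K q (e : R) : 0 <= q -> q < 1 -> 0 < e -> exists m, forall k, (m <= k)%N -> K * q ^+ k <= e.
Proof.
move=> x0 x1 e0; have e2 : 0 < e / (1 + `|K|) by rewrite divr_gt0 // ltr_pwDl.
have := @cvg_expr _ q; rewrite ger0_norm // => /(_ x1).
move/cvgrPdist_lt => /(_ _ e2)[m _ Hm]; exists m => k mk.
have := Hm k mk; rewrite /= sub0r normrN ger0_norm ?exprn_ge0 // ltr_pdivlMr ?ltr_pwDl // => h.
apply: le_trans (ler_norm _) _; rewrite normrM [`|q ^+ k|]ger0_norm ?exprn_ge0 //.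
by apply: le_trans (ltW h); rewrite mulrC ler_wpM2l ?exprn_ge0 // lerDr.
Qed.

Lemma coef_geo_taylor a : coef_geo a -> exists f, taylor f a.
Proof.
move=> ag.
have lim z : exists l, forall s, cmod z <= s -> s < 1 -> exists K q, [/\ 0 <= q, q < 1 &
    forall n, cmod (l - psum a n z) <= K * q ^+ n].
  (* Outside the disc the value 0 is taken and the claim is vacuous. *)
  have [z1|z1] := ltP (cmod z) 1; last by exists 0 => s zs s1; have := lt_le_trans s1 (le_trans z1 zs); rewrite ltxx.
  have [K [q [K0 q0 q1 H]]] := ag _ (cmod_ge0 z) z1.
  have [|l Hl] := @geo_limit (fun n => psum a n z) K q q0 q1.
    by move=> n; rewrite psumS addrC addKr cmodM cmodX.
  by exists l => s _ _; exists (2 * (K / (1 - q))), q.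
have [f Hf] := choice lim; exists f => s s0 s1.
have [K [q [K0 q0 q1 H]]] := ag s s0 s1.
exists (2 * (K / (1 - q))), q; split => //.
  by rewrite mulr_ge0 // divr_ge0 // subr_ge0 ltW.
move=> n z zs; rewrite -/(psum a n z).
have Hn m : cmod (psum a m.+1 z - psum a m z) <= K * q ^+ m.
  rewrite psumS addrC addKr cmodM cmodX; apply: le_trans (H m).
  by rewrite ler_wpM2l ?cmod_ge0 // lerXn2r ?nnegrE ?cmod_ge0.
have [l Hl] := geo_limit q0 q1 Hn.
suff -> : f z = l by exact: Hl.
have [K' [q' [q'0 q'1 H']]] := Hf z s zs s1.
apply: close_eq => e e0.
have [m hm] : exists m, K' * q' ^+ m + 2 * (K / (1 - q)) * q ^+ m <= e.
  have e2 : 0 < e / 2 by rewrite divr_gt0.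
  have [m1 h1] := geo_eps K' q'0 q'1 e2; have [m2 h2] := geo_eps (2 * (K / (1 - q))) q0 q1 e2.
  exists (maxn m1 m2); rewrite [e]splitr lerD ?h1 ?h2 ?leq_maxl ?leq_maxr //.
apply: le_trans hm; apply: le_trans (cmod_tri _ _ (psum a m z)) (lerD (H' m) _).
by rewrite cmodC.
Qed.

Lemma taylor_psum f a z : taylor f a -> cmod z < 1 -> forall e : R, 0 < e ->
  exists m, forall k, (m <= k)%N -> cmod (f z - psum a k z) <= e.
Proof.
move=> fa z1 e e0; have [K [q [K0 q0 q1 H]]] := fa _ (cmod_ge0 z) z1.
have [m Hm] := geo_eps K q0 q1 e0; exists m => k /Hm; apply: le_trans; exact: H.
Qed.

Lemma taylor_ext f g a : (forall z, cmod z < 1 -> f z = g z) -> taylor f a -> taylor g a.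
Proof.
move=> fg fa s s0 s1; have [K [q [K0 q0 q1 H]]] := fa s s0 s1.
by exists K, q; split => // n z zs; rewrite -fg ?H // (le_lt_trans zs).
Qed.

Lemma taylor_fun_unique f g a z : taylor f a -> taylor g a -> cmod z < 1 -> f z = g z.
Proof.
move=> fa ga z1; apply: close_eq => e e0; have e2 : 0 < e / 2 by rewrite divr_gt0.
have [m hm] := taylor_psum fa z1 e2; have [n hn] := taylor_psum ga z1 e2.
apply: le_trans (cmod_tri _ _ (psum a (maxn m n) z)) _; rewrite [e]splitr lerD //.
  by rewrite hm // leq_maxl.
by rewrite cmodC hn // leq_maxr.
Qed.

Lemma coef_geo_sum a s : coef_geo a -> 0 <= s -> s < 1 -> exists2 K : R, 0 <= K &
  forall n, \sum_(k < n) cmod (a k) * s ^+ k <= K.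
Proof.
move=> ag s0 s1; have [K [q [K0 q0 q1 H]]] := ag s s0 s1.
have q1' : 0 < 1 - q by rewrite subr_gt0.
exists (K / (1 - q)) => [|n]; first by rewrite divr_ge0 // ltW.
apply: le_trans (_ : \sum_(k < n) K * q ^+ k <= _); first by apply: ler_sum.
rewrite ler_pdivlMr //; have -> : (\sum_(k < n) K * q ^+ k) * (1 - q) = K - K * q ^+ n.
  elim: n => [|n IH]; first by rewrite big_ord0 mul0r expr0 mulr1 subrr.
  by rewrite big_ord_recr /= mulrDl IH exprS; ring.
by rewrite gerBl mulr_ge0 // exprn_ge0.
Qed.

Lemma exp_quad z w s n : cmod z <= s -> cmod w <= s ->
  cmod (w ^+ n.+2 - z ^+ n.+2 - n.+2%:R * z ^+ n.+1 * (w - z)) <=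
  n.+2%:R * n.+1%:R * s ^+ n * cmod (w - z) ^+ 2.
Proof.
move=> zs ws; have s0 : 0 <= s by exact: le_trans (cmod_ge0 z) zs.
elim: n => [|n IH].
  have -> : w ^+ 2 - z ^+ 2 - 2 * z ^+ 1 * (w - z) = (w - z) ^+ 2 by ring.
  by rewrite cmodX expr0 !mulr1 ler_peMl ?exprn_ge0 ?cmod_ge0 // ler1n.
have -> : w ^+ n.+3 - z ^+ n.+3 - n.+3%:R * z ^+ n.+2 * (w - z) =
   w * (w ^+ n.+2 - z ^+ n.+2 - n.+2%:R * z ^+ n.+1 * (w - z)) + n.+2%:R * z ^+ n.+1 * (w - z) ^+ 2.
  by rewrite -[n.+3%:R]natr1 !exprS; ring.
apply: le_trans (cmodD _ _) _; rewrite !cmodM cmod_nat !cmodX.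
apply: le_trans (_ : s * (n.+2%:R * n.+1%:R * s ^+ n * cmod (w - z) ^+ 2) +
   n.+2%:R * s ^+ n.+1 * cmod (w - z) ^+ 2 <= _).
  apply: lerD; first by apply: ler_pM; rewrite ?cmod_ge0.
  by rewrite -expr2 ler_wpM2r ?exprn_ge0 ?cmod_ge0 // ler_wpM2l // lerXn2r ?nnegrE ?cmod_ge0.
have -> : s * (n.+2%:R * n.+1%:R * s ^+ n * cmod (w - z) ^+ 2) +
   n.+2%:R * s ^+ n.+1 * cmod (w - z) ^+ 2 = n.+2%:R * n.+2%:R * s ^+ n.+1 * cmod (w - z) ^+ 2.
  by rewrite -[n.+2%:R]natr1 (exprS s n); ring.
by rewrite !ler_wpM2r ?exprn_ge0 ?cmod_ge0 // ler_nat.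
Qed.

Lemma psum_quad a z w s n : cmod z <= s -> cmod w <= s ->
  cmod (psum a n.+2 w - psum a n.+2 z - psum (dcoef a) n.+1 z * (w - z)) <=
  (\sum_(k < n) cmod (dcoef (dcoef a) k) * s ^+ k) * cmod (w - z) ^+ 2.
Proof.
move=> zs ws; elim: n => [|n IH].
  rewrite big_ord0 mul0r /psum !big_ord_recr !big_ord0 /= /dcoef.
  by rewrite (_ : _ - _ = 0) ?cmod0 //; ring.
rewrite (psumS a n.+2 w) (psumS a n.+2 z) (psumS (dcoef a) n.+1 z) big_ord_recr /= [leRHS]mulrDl.
have -> : psum a n.+2 w + a n.+2 * w ^+ n.+2 - (psum a n.+2 z + a n.+2 * z ^+ n.+2) -
  (psum (dcoef a) n.+1 z + dcoef a n.+1 * z ^+ n.+1) * (w - z) =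
  (psum a n.+2 w - psum a n.+2 z - psum (dcoef a) n.+1 z * (w - z)) +
  a n.+2 * (w ^+ n.+2 - z ^+ n.+2 - n.+2%:R * z ^+ n.+1 * (w - z)).
  by rewrite {2}/dcoef; ring.
apply: le_trans (cmodD _ _) (lerD IH _).
rewrite cmodM /dcoef !cmodM !cmod_nat.
apply: le_trans (ler_wpM2l (cmod_ge0 _) (exp_quad n zs ws)) _.
by rewrite le_eqVlt; apply/orP; left; apply/eqP; ring.
Qed.

(** A first-order expansion with quadratic remainder, uniform on |z| <= s: partial sums satisfy it
    with the sum of |a''_k| s ^ k as constant, a'' being the twice differentiated coefficients, and
    it passes to the limit. *)
Lemma taylor_quad f f' a s : taylor f a -> taylor f' (dcoef a) -> 0 <= s -> s < 1 ->
  exists2 K : R, 0 <= K & forall z w, cmod z <= s -> cmod w <= s ->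
    cmod (f w - f z - f' z * (w - z)) <= K * cmod (w - z) ^+ 2.
Proof.
move=> fa fa' s0 s1.
have [K K0 HK] := coef_geo_sum (dcoef_geo (dcoef_geo (taylor_coef_geo fa))) s0 s1.
exists K => // z w zs ws.
apply/ler_addgt0Pl => e e0; pose e' := e / (2 + cmod (w - z)).
have p0 : 0 < 2 + cmod (w - z) by rewrite (ltr_wpDr (cmod_ge0 _)).
have e'0 : 0 < e' by rewrite divr_gt0.
have [m1 h1] := taylor_psum fa (le_lt_trans zs s1) e'0.
have [m2 h2] := taylor_psum fa (le_lt_trans ws s1) e'0.
have [m3 h3] := taylor_psum fa' (le_lt_trans zs s1) e'0.
pose n := maxn m1 (maxn m2 m3).
have [n1 n2 n3] : [/\ (m1 <= n.+2)%N, (m2 <= n.+2)%N & (m3 <= n.+1)%N].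
  have hn : (n <= n.+1)%N by []; have hn2 : (n <= n.+2)%N by exact: leqW.
  by split; [apply: leq_trans hn2|apply: leq_trans hn2|apply: leq_trans hn]; rewrite /n !leq_max leqnn ?orbT.
have -> : f w - f z - f' z * (w - z) =
  (psum a n.+2 w - psum a n.+2 z - psum (dcoef a) n.+1 z * (w - z)) +
  ((f w - psum a n.+2 w) - (f z - psum a n.+2 z) - (f' z - psum (dcoef a) n.+1 z) * (w - z)) by ring.
apply: le_trans (cmodD _ _) _; rewrite [leRHS]addrC; apply: lerD.
  apply: le_trans (psum_quad _ _ zs ws) _.
  by rewrite ler_wpM2r ?exprn_ge0 ?cmod_ge0.
apply: le_trans (cmodB _ _) _; apply: le_trans (lerD (cmodB _ _) (lexx _)) _.
rewrite cmodM; apply: le_trans (lerD (lerD (h2 _ n2) (h1 _ n1)) (ler_wpM2r (cmod_ge0 _) (h3 _ n3))) _.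
by rewrite /e' le_eqVlt; apply/orP; left; apply/eqP; field; rewrite gt_eqF.
Qed.

(** The differentiated series has a sum by [coef_geo_taylor], and [taylor_quad] identifies this sum
    as the derivative. *)
Lemma taylor_deriv f a : taylor f a -> taylor (derive1 f) (dcoef a) /\
  forall z, cmod z < 1 -> cdiff f z (derive1 f z).
Proof.
move=> fa; have [f' fa'] := coef_geo_taylor (dcoef_geo (taylor_coef_geo fa)).
have fd z : cmod z < 1 -> cdiff f z (f' z).
  move=> z1; have [s zs s1] : exists2 s, cmod z < s & s < 1 by exists ((cmod z + 1) / 2); lra.
  have [K K0 HK] := taylor_quad fa fa' (le_trans (cmod_ge0 z) (ltW zs)) s1.
  move=> e e0; exists (Num.min (s - cmod z) (e / (1 + K))) => [|h].
    by rewrite lt_min subr_gt0 zs divr_gt0 // (ltr_wpDr K0).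
  rewrite lt_min => /andP[h1 h2].
  have zh : cmod (z + h) <= s by apply: le_trans (cmodD _ _) _; rewrite addrC -lerBrDr ltW.
  have := HK z (z + h) (ltW zs) zh; rewrite [z + h]addrC addrK => /le_trans; apply.
  rewrite expr2 mulrA ler_wpM2r ?cmod_ge0 //.
  rewrite ltr_pdivlMr ?(ltr_wpDr K0) // in h2.
  apply: le_trans (ltW h2); rewrite mulrC ler_wpM2l ?cmod_ge0 // lerDr //.
have E z : cmod z < 1 -> f' z = derive1 f z by move=> /fd /cdiff_derive1.
by split=> [|z z1]; [exact: taylor_ext E fa'|rewrite -E //; exact: fd].
Qed.

Lemma taylor_hol f a : taylor f a -> hol f.
Proof. by move=> /taylor_deriv[_ H] z /H; exists (derive1 f z). Qed.

Lemma hol_deriv f : hol f -> hol (derive1 f).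
Proof. by move=> /hol_taylor[a] /taylor_deriv[/taylor_hol]. Qed.

Lemma hol_cdiff f z : hol f -> cmod z < 1 -> cdiff f z (derive1 f z).
Proof. by move=> /hol_taylor[a] /taylor_deriv[_]; exact. Qed.

Lemma holM f g : hol f -> hol g -> hol (fun z => f z * g z).
Proof. by move=> hf hg z z1; have [d fd] := hf z z1; have [d' gd] := hg z z1; eexists; exact: (cdiffM fd gd). Qed.
Lemma holD f g : hol f -> hol g -> hol (fun z => f z + g z).
Proof. by move=> hf hg z z1; have [d fd] := hf z z1; have [d' gd] := hg z z1; eexists; exact: (cdiffD fd gd). Qed.
Lemma holB f g : hol f -> hol g -> hol (fun z => f z - g z).
Proof. by move=> hf hg z z1; have [d fd] := hf z z1; have [d' gd] := hg z z1; eexists; exact: (cdiffB fd gd). Qed.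
Lemma hol_cst (k : C) : hol (fun _ : C => k).
Proof. by move=> z _; eexists; exact: cdiff_cst. Qed.
Lemma hol_id : hol (id : C -> C).
Proof. by move=> z _; eexists; exact: cdiff_id. Qed.
Lemma holV f : hol f -> (forall z, cmod z < 1 -> f z != 0) -> hol (fun z => (f z)^-1).
Proof. by move=> hf nz z z1; have [d fd] := hf z z1; eexists; apply: cdiffV fd; exact: nz. Qed.
Lemma circ_rcont_conj F r : circ_rcont F r -> circ_rcont (fun z => conjc (F z)) r.
Proof.
move=> Fc t tp e e0; have [del del0 H] := Fc t tp e e0.
by exists del => // y yp /(H y yp); rewrite -rmorphB cmod_conj.
Qed.

Lemma rcontM (F G : R -> C) (x0 y0 : R) : rcont x0 y0 F -> rcont x0 y0 G -> rcont x0 y0 (fun x => F x * G x).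
Proof.
move=> Fc Gc z tp e e0.
pose K := 1 + cmod (F z) + cmod (G z).
have [F0 G0] := (cmod_ge0 (F z), cmod_ge0 (G z)).
have K0 : 0 < K by rewrite /K -addrA ltr_pwDl // addr_ge0.
pose e' := Num.min 1 (e / (2 * K)).
have e'0 : 0 < e' by rewrite lt_min ltr01 divr_gt0 // mulr_gt0.
have [d1 d10 H1] := Fc z tp _ e'0; have [d2 d20 H2] := Gc z tp _ e'0.
exists (Num.min d1 d2) => [|y yp]; first by rewrite lt_min d10.
rewrite lt_min => /andP[/(H1 _ yp) h1 /(H2 _ yp) h2].
have -> : F y * G y - F z * G z = (F y - F z) * (G y - G z) + (F y - F z) * G z + F z * (G y - G z).
  by ring.
apply: le_lt_trans (cmodD _ _) _; apply: le_lt_trans (lerD (cmodD _ _) (lexx _)) _.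
rewrite !cmodM.
have ee : e' * K <= e / 2.
  apply: le_trans (_ : e / (2 * K) * K <= _); first by rewrite ler_wpM2r ?(ltW K0) // ge_min lexx orbT.
  by rewrite le_eqVlt; apply/orP; left; apply/eqP; field; rewrite gt_eqF.
have e'1 : e' <= 1 by rewrite ge_min lexx.
apply: le_lt_trans (_ : e' * K < e); last by apply: le_lt_trans ee _; rewrite ltr_pdivrMr // ltr_pMr // ltr1n.
have -> : e' * K = e' * 1 + e' * cmod (G z) + cmod (F z) * e' by rewrite /K; ring.
rewrite !lerD //.
- by apply: ler_pM; rewrite ?cmod_ge0 // ltW // (lt_le_trans h2).
- by rewrite ler_wpM2r // ltW.
- by rewrite ler_wpM2l // ltW.
Qed.

Lemma circ_rcontM F G r : circ_rcont F r -> circ_rcont G r -> circ_rcont (fun z => F z * G z) r.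
Proof. exact: rcontM. Qed.

Lemma cmean_approx F G r (e : R) : 0 <= r -> circ_rcont F r -> circ_rcont G r ->
  (forall z, cmod z = r -> cmod (F z - G z) <= e) -> cmod (cmean F r - cmean G r) <= e.
Proof.
move=> r0 Fc Gc H; rewrite -cmeanB //; apply: cmean_le => //.
by have := rcontD Fc (rcontZ (-1) Gc); apply: rcont_ext => t _; rewrite mulN1r.
Qed.

Lemma cmean_sum (I : Type) (s : seq I) (F : I -> C -> C) r :
  (forall i, circ_rcont (F i) r) -> circ_rcont (fun z => \sum_(i <- s) F i z) r /\
  cmean (fun z => \sum_(i <- s) F i z) r = \sum_(i <- s) cmean (F i) r.
Proof.
move=> H; elim: s => [|i s [IH1 IH2]].
  have -> : (fun z : C => \sum_(i <- [::]) F i z) = (fun=> 0).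
    by apply/funext => z; rewrite big_nil.
  by rewrite cmean_cst big_nil; split => //; exact: rcont_cst.
have -> : (fun z => \sum_(j <- i :: s) F j z) = (fun z => F i z + \sum_(j <- s) F j z).
  by apply/funext => z; rewrite big_cons.
by rewrite cmeanD // IH2 big_cons; split => //; apply: rcontD; [exact: H|exact: IH1].
Qed.

(** * Orthogonality of monomials, coefficient formulas and Parseval's identity *)

Lemma circ_expV n r : 0 < r -> circ_rcont (fun z => (z ^+ n)^-1) r.
Proof.
move=> r0; apply: circ_rcontP => [|z zr]; first exact: ltW.
by apply: cdiff_cont; apply: cdiffV (cdiffX _ _); rewrite expf_neq0 // -cmod_gt0 zr.
Qed.

Lemma circ_exp n r : 0 <= r -> circ_rcont (fun z => z ^+ n) r.
Proof. by move=> r0; apply: circ_rcontP => [|z zr] //; apply: cdiff_cont; exact: cdiffX. Qed.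

Lemma cmean_monom j k r : 0 < r ->
  cmean (fun z => z ^+ j * (z ^+ k)^-1) r = (j == k)%:R.
Proof.
move=> r0; have nz z : cmod z = r -> z != 0 by move=> zr; rewrite -cmod_gt0 zr.
have [jk|kj|->] := ltngtP j k.
- rewrite (@eq_cmean _ _ (fun z => (z ^+ (k - j).-1.+1)^-1)) ?cmeanVX //; first exact: ltW.
  move=> z /nz z0; rewrite prednK ?subn_gt0 // -{1}(subnK (ltnW jk)) exprD invfM mulrCA divff ?mulr1 //.
  exact: expf_neq0.
- rewrite (@eq_cmean _ _ (fun z => z ^+ (j - k).-1.+1)) ?cmeanX //; first exact: ltW.
  move=> z /nz z0; rewrite prednK ?subn_gt0 // -{1}(subnK (ltnW kj)) exprD mulfK //.
  exact: expf_neq0.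
- rewrite (@eq_cmean _ _ (fun=> 1)) ?cmean_cst //; first exact: ltW.
  by move=> z /nz z0; rewrite divff // expf_neq0.
Qed.

Lemma circ_poly p r : 0 <= r -> circ_rcont (fun z => p.[z]) r.
Proof.
move=> r0; have [h _] := @cmean_sum _ (index_enum 'I_(size p)) (fun i z => p`_i * z ^+ i) r
  (fun i => rcontZ _ (circ_exp i r0)).
by apply: rcont_ext h => t _; rewrite horner_coef.
Qed.

Lemma tcoef_poly p n r : 0 < r -> tcoef (fun z => p.[z]) n r = p`_n.
Proof.
move=> r0; rewrite /tcoef.
rewrite (@eq_cmean _ _ (fun z => \sum_(i < size p) p`_i * (z ^+ i * (z ^+ n)^-1))); last 2 first.
- exact: ltW.
- by move=> z _; rewrite horner_coef mulr_suml; apply: eq_bigr => i _; rewrite mulrA.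
have hc i : circ_rcont (fun z => z ^+ i * (z ^+ n)^-1) r.
  by apply: circ_rcontM; [exact/circ_exp/ltW|exact: circ_expV].
have [_ ->] := @cmean_sum _ (index_enum 'I_(size p)) (fun (i : 'I__) z => p`_i * (z ^+ i * (z ^+ n)^-1)) r
  (fun i => rcontZ _ (hc i)).
rewrite (eq_bigr (fun i : 'I_(size p) => p`_i * (i == n :> nat)%:R)); last first.
  by move=> i _; rewrite cmeanZ ?cmean_monom.
have [np|np] := ltnP n (size p); last first.
  rewrite nth_default // big1 // => i _; rewrite (ltn_eqF (leq_trans (ltn_ord i) np)) mulr0 //.
rewrite (bigD1 (Ordinal np)) //= eqxx mulr1 big1 ?addr0 // => i.
by rewrite -val_eqE /= => /negPf ->; rewrite mulr0.
Qed.

Definition ppoly a n : {poly C} := \poly_(k < n) a k.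

Lemma horner_ppoly a n z : (ppoly a n).[z] = psum a n z.
Proof. exact: horner_poly. Qed.

(** Transfers coefficients from polynomials to their limits; uniform approximation on one circle
    suffices. *)
Lemma tcoef_lim f (P : nat -> {poly C}) n r c : hol f -> 0 < r -> r < 1 ->
  (forall e : R, 0 < e -> exists2 N, (P N)`_n = c &
     forall z, cmod z = r -> cmod (f z - (P N).[z]) <= e) -> tcoef f n r = c.
Proof.
move=> hf r0 r1 H; apply: close_eq => e e0.
have e'0 : 0 < e * r ^+ n by rewrite mulr_gt0 // exprn_gt0.
have [N <- HN] := H _ e'0; rewrite -(tcoef_poly (P N) n r0) /tcoef.
apply: cmean_approx; first exact: ltW.
- exact: circ_tcoef.
- by apply: circ_rcontM; [exact/circ_poly/ltW|exact: circ_expV].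
move=> z zr; rewrite -mulrBl cmodM cmodV cmodX zr ler_pdivrMr ?exprn_gt0 //.
exact: HN.
Qed.

Lemma taylor_unif f a r : taylor f a -> 0 <= r -> r < 1 -> forall e : R, 0 < e ->
  exists m, forall k z, (m <= k)%N -> cmod z <= r -> cmod (f z - (ppoly a k).[z]) <= e.
Proof.
move=> fa r0 r1 e e0; have [K [q [K0 q0 q1 H]]] := fa _ r0 r1.
have [m Hm] := geo_eps K q0 q1 e0; exists m => k z mk zr.
by rewrite horner_ppoly; apply: le_trans (Hm _ mk); exact: H.
Qed.

Lemma taylor_tcoef f a n r : taylor f a -> 0 < r -> r < 1 -> tcoef f n r = a n.
Proof.
move=> fa r0 r1; apply: (@tcoef_lim _ (fun N => ppoly a N)) => //; first exact: taylor_hol fa.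
move=> e e0; have [m Hm] := taylor_unif fa (ltW r0) r1 e0.
exists (maxn m n.+1); first by rewrite coef_poly leq_maxr.
by move=> z zr; apply: Hm; rewrite ?leq_maxl ?zr.
Qed.

Lemma taylor_unique f a b : taylor f a -> taylor f b -> a = b.
Proof.
move=> fa fb; apply/funext => n.
have h0 : 0 < 1 / 2 :> R by rewrite divr_gt0.
have h1 : 1 / 2 < 1 :> R by rewrite ltr_pdivrMr // mul1r ltr1n.
by rewrite -(taylor_tcoef n fa h0 h1) (taylor_tcoef n fb h0 h1).
Qed.

Lemma taylorD f g a b : taylor f a -> taylor g b -> taylor (fun z => f z + g z) (fun n => a n + b n).
Proof.
move=> fa gb s s0 s1; have [K1 [q1 [K10 q10 q11 H1]]] := fa s s0 s1.
have [K2 [q2 [K20 q20 q21 H2]]] := gb s s0 s1.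
exists (K1 + K2), (Num.max q1 q2); split; rewrite ?addr_ge0 ?le_max ?q10 ?gt_max ?q11 //.
move=> n z zs.
have -> : f z + g z - \sum_(k < n) (a k + b k) * z ^+ k = (f z - psum a n z) + (g z - psum b n z).
  by rewrite /psum (eq_bigr _ (fun (i : 'I_n) _ => mulrDl _ _ _)) big_split /=; ring.
apply: le_trans (cmodD _ _) _; rewrite mulrDl lerD //.
  apply: le_trans (H1 n z zs) _; rewrite ler_wpM2l // lerXn2r ?nnegrE ?le_max ?q10 ?lexx //.
by apply: le_trans (H2 n z zs) _; rewrite ler_wpM2l // lerXn2r ?nnegrE ?le_max ?q20 ?lexx ?orbT.
Qed.

Lemma taylorZ f a k : taylor f a -> taylor (fun z => k * f z) (fun n => k * a n).
Proof.
move=> fa s s0 s1; have [K1 [q1 [K10 q10 q11 H1]]] := fa s s0 s1.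
exists (cmod k * K1), q1; split; rewrite ?mulr_ge0 ?cmod_ge0 // => n z zs.
rewrite (eq_bigr (fun i : 'I_n => k * (a i * z ^+ i))); last by move=> i _; rewrite mulrA.
by rewrite -mulr_sumr -mulrBr cmodM -mulrA ler_wpM2l ?cmod_ge0 ?H1.
Qed.

Definition conv a b n : C := \sum_(k < n.+1) a k * b (n - k)%N.

(** The product is holomorphic and so has some Taylor series. Its coefficients are found from
    products of truncations, whose n-th coefficient is exact once both truncations exceed n; no
    rearrangement of double series occurs. *)
Lemma taylorM f g a b : taylor f a -> taylor g b -> taylor (fun z => f z * g z) (conv a b).
Proof.
move=> fa gb; have hf := taylor_hol fa; have hg := taylor_hol gb.
have [c fc] := hol_taylor (holM hf hg).
suff -> : conv a b = c by [].
apply/funext => n.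
have h0 : 0 < 1 / 2 :> R by rewrite divr_gt0.
have h1 : 1 / 2 < 1 :> R by rewrite ltr_pdivrMr // mul1r ltr1n.
rewrite -(taylor_tcoef n fc h0 h1); apply/esym.
apply: (@tcoef_lim _ (fun N => ppoly a N * ppoly b N)) => //; first exact: holM.
move=> e e0.
have [Mf Mf0 HMf] := hol_bounded hf (ltW h0) h1; have [Mg Mg0 HMg] := hol_bounded hg (ltW h0) h1.
pose L := 1 + Mf + Mg; have L0 : 0 < L by rewrite /L -addrA ltr_pwDl // addr_ge0.
pose e' := Num.min 1 (e / L).
have e'0 : 0 < e' by rewrite lt_min ltr01 divr_gt0.
have [m1 H1] := taylor_unif fa (ltW h0) h1 e'0; have [m2 H2] := taylor_unif gb (ltW h0) h1 e'0.
pose N := maxn n.+1 (maxn m1 m2); exists N.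
  rewrite coefM; apply: eq_bigr => k _; rewrite !coef_poly.
  have kN : (k < N)%N by rewrite (leq_trans (ltn_ord k)) // leq_maxl.
  have nkN : (n - k < N)%N by rewrite (@leq_trans n.+1) ?leq_maxl // ltnS leq_subr.
  by rewrite kN nkN.
move=> z zr; rewrite hornerM.
have h3 : cmod (f z - (ppoly a N).[z]) <= e' by apply: H1; rewrite ?zr // /N; lia.
have h4 : cmod (g z - (ppoly b N).[z]) <= e' by apply: H2; rewrite ?zr // /N; lia.
have -> : f z * g z - (ppoly a N).[z] * (ppoly b N).[z] =
  (f z - (ppoly a N).[z]) * g z + f z * (g z - (ppoly b N).[z]) -
  (f z - (ppoly a N).[z]) * (g z - (ppoly b N).[z]) by ring.
apply: le_trans (cmodB _ _) _; apply: le_trans (lerD (cmodD _ _) (lexx _)) _.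
rewrite !cmodM; apply: le_trans (_ : e' * L <= _); last first.
  by rewrite -ler_pdivlMr // ge_min lexx orbT.
have -> : e' * L = e' * Mg + Mf * e' + e' * 1 by rewrite /L; ring.
have e'1 : e' <= 1 by rewrite ge_min lexx.
apply: lerD; first apply: lerD.
- by apply: ler_pM; rewrite ?cmod_ge0 ?HMg.
- by apply: ler_pM; rewrite ?cmod_ge0 ?HMf.
- by apply: ler_pM; rewrite ?cmod_ge0 // (le_trans h4).
Qed.

Lemma taylor_cst (k : C) : taylor (fun=> k) (fun n => if n is 0 then k else 0).
Proof.
move=> s s0 s1; exists (cmod k), 0; split; rewrite ?cmod_ge0 // => -[|n] z zs.
  by rewrite big_ord0 subr0 expr0 mulr1.
by rewrite big_ord_recl /= expr0 mulr1 big1 ?addr0 ?subrr ?cmod0 ?expr0n ?mulr0 // => i _; rewrite mul0r.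
Qed.

Lemma taylor0 f a : taylor f a -> f 0 = a 0%N.
Proof.
move=> fa; apply: close_eq => e e0.
have z1 : cmod (0 : C) < 1 by rewrite cmod0.
have [m /(_ m.+1 (leqnSn m))] := taylor_psum fa z1 e0.
by rewrite /psum big_ord_recl /= expr0 mulr1 big1 ?addr0 // => i _; rewrite /bump expr0n mulr0.
Qed.

Lemma coef_geo_shift a : coef_geo a -> coef_geo (fun n => a n.+1).
Proof.
move=> ag s s0 s1; have [r sr r1] : exists2 r, s < r & r < 1 by exists ((1 + s) / 2); lra.
have r0 : 0 < r := le_lt_trans s0 sr.
have [K [q [K0 q0 q1 H]]] := ag r (ltW r0) r1.
exists (K / r), q; split; rewrite ?divr_ge0 ?(ltW r0) // => n.
have := H n.+1; rewrite exprSr mulrA -ler_pdivlMr // => h.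
apply: le_trans (_ : cmod (a n.+1) * r ^+ n <= _).
  by rewrite ler_wpM2l ?cmod_ge0 // lerXn2r ?nnegrE // ltW.
apply: le_trans h _; rewrite [leRHS]mulrAC ler_wpM2r ?invr_ge0 ?(ltW r0) //.
by rewrite ler_wpM2l // exprS ler_piMl ?exprn_ge0 // ltW.
Qed.

Lemma taylor_mulX f a : taylor f a ->
  taylor (fun z => z * f z) (fun n => if n is n'.+1 then a n' else 0).
Proof.
move=> fa s s0 s1; have [K [q [K0 q0 q1 H]]] := fa s s0 s1.
have [q' q01 q'1] : exists2 q', q < q' & q' < 1 by exists ((1 + q) / 2); lra.
have q'0 : 0 < q' := le_lt_trans q0 q01.
have [M M0 HM] := coef_geo_sum (taylor_coef_geo fa) s0 s1.
exists (K / q' + (K + M)), q'; split; rewrite ?addr_ge0 ?divr_ge0 ?(ltW q'0) // => -[|n] z zs.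
  rewrite big_ord0 subr0 expr0 mulr1 cmodM.
  have := H 0%N z zs; rewrite big_ord0 subr0 expr0 mulr1 => h.
  apply: le_trans (_ : K <= _); last by rewrite addrCA lerDl addr_ge0 ?divr_ge0 // ltW.
  rewrite -[K]mul1r; apply: ler_pM; rewrite ?cmod_ge0 //.
  by rewrite (le_trans zs) // ltW.
rewrite big_ord_recl /= mul0r add0r.
have -> : z * f z - \sum_(i < n) a i * z ^+ bump 0 i = z * (f z - psum a n z).
  rewrite mulrBr mulr_sumr; congr (_ - _); apply: eq_bigr => i _.
  by rewrite /bump leq0n add1n exprS; ring.
rewrite cmodM; apply: le_trans (_ : 1 * (K * q ^+ n) <= _).
  by apply: ler_pM; rewrite ?cmod_ge0 ?H // (le_trans zs) // ltW.
rewrite mul1r mulrDl; apply: le_trans (_ : K / q' * q' ^+ n.+1 <= _).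
  rewrite exprS mulrA divfK ?gt_eqF // ler_wpM2l // lerXn2r ?nnegrE // ltW //.
by rewrite lerDl mulr_ge0 ?addr_ge0 ?exprn_ge0 // ltW.
Qed.

Lemma taylor_quotient f a : taylor f a -> exists2 g, taylor g (fun n => a n.+1) &
  forall z, cmod z < 1 -> f z = f 0 + z * g z.
Proof.
move=> fa; have [g ga] := coef_geo_taylor (coef_geo_shift (taylor_coef_geo fa)).
exists g => // z z1.
apply: (taylor_fun_unique (g := fun z => f 0 + z * g z) fa _ z1).
have := taylorD (taylor_cst (f 0)) (taylor_mulX ga).
by congr taylor; apply/funext => -[|n] /=; rewrite ?addr0 ?add0r // (taylor0 fa).
Qed.

(** The mean of |f| ^ 2 on |z| = r, kept as the real part of a complex mean so that the calculus of
    [cmean] applies. *)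
Definition mean2 f r : R := complex.Re (cmean (fun z => f z * conjc (f z)) r).

Lemma mean2_poly p r : 0 < r -> mean2 (fun z => p.[z]) r = \sum_(k < size p) cmod (p`_k) ^+ 2 * r ^+ (2 * k).
Proof.
move=> r0; rewrite /mean2.
have cr z : cmod z = r -> conjc z = (r ^+ 2)%:C * z^-1.
  move=> zr; have z0 : z != 0 by rewrite -cmod_gt0 zr.
  by apply: (mulfI z0); rewrite mulcJ zr mulrCA divff // mulr1.
rewrite (@eq_cmean _ _ (fun z => \sum_(k < size p) (conjc p`_k * (r ^+ 2)%:C ^+ k) * (p.[z] * (z ^+ k)^-1))); last 2 first.
- exact: ltW.
- move=> z zr; rewrite {2}horner_coef rmorph_sum /= mulr_sumr; apply: eq_bigr => k _.
  by rewrite rmorphM /= rmorphXn /= (cr z zr) exprMn exprVn; ring.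
have hc k : circ_rcont (fun z => p.[z] * (z ^+ k)^-1) r.
  by apply: circ_rcontM; [exact/circ_poly/ltW|exact: circ_expV].
have [_ ->] := @cmean_sum _ (index_enum 'I_(size p)) (fun (k : 'I__) z =>
  (conjc p`_k * (r ^+ 2)%:C ^+ k) * (p.[z] * (z ^+ k)^-1)) r (fun i => rcontZ _ (hc i)).
rewrite Re_sum; apply: eq_bigr => k _; rewrite cmeanZ // [cmean _ _](tcoef_poly p k r0).
have -> : conjc p`_k * (r ^+ 2)%:C ^+ k * p`_k = (r ^+ (2 * k))%:C * (p`_k * conjc p`_k).
  by rewrite exprM !rmorphXn; ring.
by rewrite mulcJ -rmorphM /= mulrC.
Qed.

(** Parseval's identity as a limit of partial sums, inherited from polynomials by uniform
    approximation on the circle. *)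
Lemma taylor_mean2 f a r : taylor f a -> 0 < r -> r < 1 -> forall e : R, 0 < e ->
  exists m, forall k, (m <= k)%N -> `|mean2 f r - \sum_(i < k) cmod (a i) ^+ 2 * r ^+ (2 * i)| <= e.
Proof.
move=> fa r0 r1 e e0; have hf := taylor_hol fa.
have [M M0 HM] := hol_bounded hf (ltW r0) r1.
have L0 : 0 < 2 * M + 1 by rewrite ltr_wpDl ?mulr_ge0.
pose e' := Num.min 1 (e / (2 * M + 1)).
have e'0 : 0 < e' by rewrite lt_min ltr01 divr_gt0.
have [m Hm] := taylor_unif fa (ltW r0) r1 e'0; exists m => k mk.
have E : \sum_(i < k) cmod (a i) ^+ 2 * r ^+ (2 * i) = mean2 (fun z => (ppoly a k).[z]) r.
  rewrite mean2_poly //; have sk : (size (ppoly a k) <= k)%N by exact: size_poly.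
  rewrite -(big_mkord xpredT (fun i => cmod ((ppoly a k)`_i) ^+ 2 * r ^+ (2 * i))).
  rewrite (big_nat_widen _ _ _ _ _ sk) -(big_mkord xpredT (fun i => cmod (a i) ^+ 2 * r ^+ (2 * i))).
  rewrite [RHS]big_mkcond big_nat_cond [RHS]big_nat_cond; apply: eq_bigr => i /andP[/andP[_ ik] _].
  case: ltnP => si /=; first by rewrite coef_poly ik.
  have := @nth_default _ 0 (ppoly a k) i si; rewrite coef_poly ik => ->.
  by rewrite cmod0 expr0n mul0r.
have cf : circ_rcont f r by apply: hol_circ; rewrite ?(ltW r0).
have cp : circ_rcont (fun z => (ppoly a k).[z]) r by apply: circ_poly; exact: ltW.
rewrite E /mean2 -ReN -ReD; apply: le_trans (Re_le_cmod _) _.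
apply: cmean_approx; first exact: ltW.
- by apply: circ_rcontM => //; exact: circ_rcont_conj.
- by apply: circ_rcontM => //; exact: circ_rcont_conj.
move=> z zr; have h : cmod (f z - (ppoly a k).[z]) <= e' by apply: Hm; rewrite ?zr.
set p := (ppoly a k).[z] in h *.
have -> : f z * conjc (f z) - p * conjc p =
   (f z - p) * conjc (f z) + f z * conjc (f z - p) - (f z - p) * conjc (f z - p).
  by rewrite rmorphB /=; ring.
apply: le_trans (cmodB _ _) _; apply: le_trans (lerD (cmodD _ _) (lexx _)) _.
rewrite !cmodM !cmod_conj; apply: le_trans (_ : e' * (2 * M + 1) <= _); last first.
  by rewrite -ler_pdivlMr // ge_min lexx orbT.
have -> : e' * (2 * M + 1) = e' * M + M * e' + e' * 1 by ring.
have e'1 : e' <= 1 by rewrite ge_min lexx.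
apply: lerD; first apply: lerD.
- by apply: ler_pM; rewrite ?cmod_ge0 ?HM.
- by apply: ler_pM; rewrite ?cmod_ge0 ?HM.
- by apply: ler_pM; rewrite ?cmod_ge0 // (le_trans h).
Qed.

Lemma taylor_bessel f a r n : taylor f a -> 0 < r -> r < 1 ->
  \sum_(i < n) cmod (a i) ^+ 2 * r ^+ (2 * i) <= mean2 f r.
Proof.
move=> fa r0 r1; apply/ler_addgt0Pl => e e0.
have [m Hm] := taylor_mean2 fa r0 r1 e0.
have := Hm _ (leq_maxl m n); rewrite ler_norml => /andP[h1 h2].
apply: le_trans (_ : \sum_(i < maxn m n) cmod (a i) ^+ 2 * r ^+ (2 * i) <= _).
  rewrite -(big_mkord xpredT (fun i => cmod (a i) ^+ 2 * r ^+ (2 * i))).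
  rewrite -(big_mkord xpredT (fun i => cmod (a i) ^+ 2 * r ^+ (2 * i))).
  rewrite (big_cat_nat (n := n) (leq0n n) (leq_maxr m n)) /= lerDl sumr_ge0 // => i _.
  by rewrite mulr_ge0 ?exprn_ge0 ?cmod_ge0 // ltW.
by lra.
Qed.

Lemma taylor_mean2_le f a r (X : R) : taylor f a -> 0 < r -> r < 1 ->
  (forall n, \sum_(i < n) cmod (a i) ^+ 2 * r ^+ (2 * i) <= X) -> mean2 f r <= X.
Proof.
move=> fa r0 r1 H; apply/ler_addgt0Pl => e e0.
have [m /(_ m (leqnn _))] := taylor_mean2 fa r0 r1 e0.
by rewrite ler_norml => /andP[_ h]; have := H m; lra.
Qed.

End TaylorCalculus.

#[global] Opaque mean2 tcoef derive1.

(** * Univalent functions *)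

Section Univalent.
Variable R : realType.
Local Notation C := R[i].
Implicit Types (f g F G : C -> C) (r s t q K rho m : R) (z w : C) (a b : nat -> C).

Lemma cmean_center F r : 0 < r -> (forall z, cmod z <= r -> exists d, cdiff F z d) ->
  cmean F r = F 0.
Proof.
move=> r0 Fd; apply: close_eq => e e0.
have Fc z : cmod z <= r -> ccont F z by move=> /Fd[d]; exact: cdiff_cont.
have c0 z : cmod z = 0 -> ccont F z by move=> zE; apply: Fc; rewrite zE ltW.
have [del del0 Hdel] := cmean_continuous (lexx 0) c0 e0.
have [s [s0 sr sd]] : exists s, [/\ 0 < s, s <= r & s < del].
  exists (Num.min r (del / 2)); rewrite lt_min r0 ge_min lexx gt_min.
  by split; rewrite ?divr_gt0 //= [X in _ || X]ltr_pdivrMr // ltr_pMr // ltr1n orbT.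
rewrite -(@cmean_const _ _ s r s0 sr); last by move=> z /andP[_]; exact: Fd.
have := Hdel s (ltW s0); rewrite cmean0 subr0; apply; first by rewrite gtr0_norm.
by apply: circ_rcontP => [|z zs]; [exact: ltW|apply: Fc; rewrite zs].
Qed.

(** Otherwise 1 / (f - w) is holomorphic on the disc, at most 1 / m on the circle and larger than 1
    / m at the centre, against the mean value property. This is the open mapping property with
    explicit radii. *)
Lemma zero_exists f z0 w rho m : 0 < rho ->
  (forall z, cmod (z - z0) <= rho -> exists d, cdiff f z d) ->
  (forall z, cmod (z - z0) = rho -> m <= cmod (f z - w)) -> cmod (f z0 - w) < m ->
  exists2 z, cmod (z - z0) <= rho & f z = w.
Proof.
move=> rho0 fd fm fz0; apply: contrapT => H.
have nz z : cmod z <= rho -> f (z0 + z) - w != 0.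
  move=> zr; rewrite subr_eq0; apply/eqP => E; apply: H; exists (z0 + z) => //.
  by rewrite addrC addKr.
have m0 : 0 < m := le_lt_trans (cmod_ge0 _) fz0.
pose F z := (f (z0 + z) - w)^-1.
have Fd z : cmod z <= rho -> exists d, cdiff F z d.
  move=> zr; have [|d hd] := fd (z0 + z); first by rewrite addrC addKr.
  eexists; apply: (cdiffV (f := fun z => f (z0 + z) - w)); first exact: nz.
  apply: cdiffB (cdiff_cst _ _); apply: (cdiff_comp (f := fun z => z0 + z)) hd.
  exact: cdiffD (cdiff_cst _ _) (cdiff_id _).
have : cmod (F 0) <= m^-1.
  rewrite -(cmean_center rho0 Fd); apply: cmean_le; first exact: ltW.
    by apply: circ_rcontP => [|z zr]; [exact: ltW|have [|d /cdiff_cont] := Fd z; rewrite ?zr].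
  move=> z zr; rewrite /F cmodV lef_pV2 ?posrE ?cmod_gt0 ?nz ?zr // fm //.
  by rewrite addrC addKr.
rewrite /F addr0 cmodV lef_pV2 ?posrE //; first by rewrite leNgt fz0.
by rewrite cmod_gt0 -[z0]addr0 nz // cmod0 ltW.
Qed.

(** Local constants become a single one by bisection; monotonicity in c lets the smallest of four
    constants replace the others. *)
Lemma compact_disc (A : R -> C -> Prop) s :
  (forall c c' z, c' <= c -> A c z -> A c' z) ->
  (forall z, cmod z <= s -> exists c del : R, [/\ 0 < c, 0 < del &
     forall w, cmod w <= s -> cmod (w - z) < del -> A c w]) ->
  exists2 c : R, 0 < c & forall z, cmod z <= s -> A c z.
Proof.
move=> mono loc.
have [s0|s0] := ltP s 0.
  by exists 1 => // z zs; have := lt_le_trans s0 (cmod_ge0 z); rewrite ltNge zs.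
pose P (a b c d : R) := exists2 e : R, 0 < e & forall z, cmod z <= s -> in_rect a b c d z -> A e z.
have ss : - s <= s by rewrite ge0_cp.
suff [c c0 H] : P (- s) s (- s) s.
  exists c => // z zs; apply: H => //; split; rewrite -ler_norml.
    exact: le_trans (Re_le_cmod z) zs.
  exact: le_trans (Im_le_cmod z) zs.
apply: (@cousin_rect _ P) => // [a b c d _ _ _ _ _ _ m n [e1 e10 H1] [e2 e20 H2] [e3 e30 H3] [e4 e40 H4]|x y xs ys].
  exists (Num.min (Num.min e1 e2) (Num.min e3 e4)); first by rewrite !lt_min e10 e20 e30 e40.
  move=> z zs [/andP[z1 z2] /andP[z3 z4]].
  have [zm|/ltW zm] := leP (complex.Re z) m; have [zn|/ltW zn] := leP (complex.Im z) n.
  - apply: (mono e1); first by rewrite !ge_min lexx.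
    by apply: H1 => //; split; apply/andP.
  - apply: (mono e3); first by rewrite !ge_min lexx !orbT.
    by apply: H3 => //; split; apply/andP.
  - apply: (mono e2); first by rewrite !ge_min lexx !orbT.
    by apply: H2 => //; split; apply/andP.
  - apply: (mono e4); first by rewrite !ge_min lexx !orbT.
    by apply: H4 => //; split; apply/andP.
have near (del a b c d : R) z : 0 < del -> a <= x <= b -> c <= y <= d -> b - a < del / 2 -> d - c < del / 2 ->
    in_rect a b c d z -> cmod (z - (x +i* y)) < del.
  move=> del0 /andP[x1 x2] /andP[y1 y2] ba dc [/andP[z1 z2] /andP[z3 z4]].
  apply: le_lt_trans (cmod_le_ReIm _) _; rewrite ReD ImD ReN ImN /= [del]splitr.
  by apply: ltrD; rewrite ltr_norml; lra.
have [zs|zs] := leP (cmod (x +i* y)) s.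
  have [e [del [e0 del0 H]]] := loc _ zs.
  exists (del / 2) => [|a b c d /andP[_ a1] /andP[b1 _] /andP[_ c1] /andP[d1 _] ba dc]; first by rewrite divr_gt0.
  exists e => // z zs' zr; apply: H => //; apply: near del0 _ _ ba dc zr; first by rewrite a1.
  by rewrite c1.
(* Around a point off the closed disc a small rectangle misses the disc, and any constant will
   do. *)
pose del := cmod (x +i* y) - s; have del0 : 0 < del by rewrite subr_gt0.
exists (del / 2) => [|a b c d /andP[_ a1] /andP[b1 _] /andP[_ c1] /andP[d1 _] ba dc]; first by rewrite divr_gt0.
exists 1 => // z zs' zr.
have h : cmod (z - (x +i* y)) < del.
  by apply: near del0 _ _ ba dc zr; rewrite ?a1 ?c1.
have := cmod_subr (x +i* y) z; rewrite cmodC leNgt (lt_le_trans h) //.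
by rewrite /del lerD2l lerN2.
Qed.

Lemma disc_lower_bound f s : (forall z, cmod z <= s -> ccont f z) ->
  (forall z, cmod z <= s -> f z != 0) -> exists2 c : R, 0 < c & forall z, cmod z <= s -> c <= cmod (f z).
Proof.
move=> fc nz; apply: (@compact_disc (fun c z => c <= cmod (f z))) => [c c' z cc|z zs].
  exact: le_trans.
have fz : 0 < cmod (f z) / 2 by rewrite divr_gt0 // cmod_gt0 nz.
have [del del0 H] := fc z zs _ fz.
exists (cmod (f z) / 2), del; split => // w ws /H.
have := cmod_subr (f z) (f w); rewrite cmodC; lra.
Qed.

Lemma disc_upper_bound f s : (forall z, cmod z <= s -> ccont f z) ->
  exists2 M : R, 0 < M & forall z, cmod z <= s -> cmod (f z) <= M.
Proof.
move=> fc.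
have [c c0 H] : exists2 c : R, 0 < c & forall z, cmod z <= s -> c * cmod (f z) <= 1.
  apply: (@compact_disc (fun c z => c * cmod (f z) <= 1)) => [c c' z cc|z zs].
    by apply: le_trans; rewrite ler_wpM2r ?cmod_ge0.
  have [del del0 H] := fc z zs _ ltr01.
  have p0 : 0 < 1 + cmod (f z) by rewrite (ltr_wpDr (cmod_ge0 _)).
  exists (1 + cmod (f z))^-1, del; split; rewrite ?invr_gt0 // => w ws /H h.
  rewrite mulrC ler_pdivrMr // mul1r.
  by have := cmod_subr (f w) (f z); lra.
exists c^-1 => [|z zs]; first by rewrite invr_gt0.
by rewrite -(ler_pM2l c0) mulfV ?gt_eqF // H.
Qed.

Definition inj_disc f := forall z w, cmod z < 1 -> cmod w < 1 -> f z = f w -> z = w.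

Lemma recenter_in z0 rho z : 0 <= rho -> cmod z0 + rho <= 1 -> cmod z < 1 -> 0 < rho ->
  cmod (z0 + rho%:C * z) < 1.
Proof.
move=> rho0 h z1 rho1; apply: le_lt_trans (cmodD _ _) _; rewrite cmodM cmodR ger0_norm //.
by apply: lt_le_trans h; rewrite ltrD2l gtr_pMr.
Qed.

Lemma hol_recenter f z0 rho : hol f -> 0 < rho -> cmod z0 + rho <= 1 ->
  hol (fun z => f (z0 + rho%:C * z)) /\
  forall z, cmod z < 1 -> derive1 (fun z => f (z0 + rho%:C * z)) z = rho%:C * derive1 f (z0 + rho%:C * z).
Proof.
move=> hf rho0 h.
have D z : cmod z < 1 -> cdiff (fun z => f (z0 + rho%:C * z)) z (derive1 f (z0 + rho%:C * z) * (0 + rho%:C * 1)).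
  move=> z1; apply: (cdiff_comp (f := fun z => z0 + rho%:C * z)).
    exact: cdiffD (cdiff_cst _ _) (cdiffZ _ (cdiff_id _)).
  by apply: hol_cdiff => //; apply: recenter_in => //; exact: ltW.
split=> z z1; first by eexists; exact: D.
by rewrite (cdiff_derive1 (D z z1)) add0r mulr1 mulrC.
Qed.

Lemma inj_recenter f z0 rho : inj_disc f -> 0 < rho -> cmod z0 + rho <= 1 ->
  inj_disc (fun z => f (z0 + rho%:C * z)).
Proof.
move=> fi rho0 h z w z1 w1 /fi; rewrite !recenter_in ?(ltW rho0) // => /(_ erefl erefl).
move/addrI/mulfI; apply; rewrite -cmod_gt0 cmodR gtr0_norm //.
Qed.

Lemma hol_const f : hol f -> (forall z, cmod z < 1 -> derive1 f z = 0) ->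
  forall z, cmod z < 1 -> f z = f 0.
Proof.
move=> hf f0 z z1; have [a fa] := hol_taylor hf; have [fa' _] := taylor_deriv fa.
have a0 n : a n.+1 = 0.
  have := taylor_unique (taylor_ext f0 fa') (taylor_cst 0).
  move/(congr1 (fun u => u n)); rewrite /dcoef /=.
  have -> : match n with 0%N | _ => 0 : C end = 0 by case: n.
  move/eqP; rewrite mulf_eq0 pnatr_eq0 /= => /eqP //.
apply: (taylor_fun_unique (g := fun=> f 0) fa _ z1).
have := taylor_cst (f 0); congr taylor; apply/funext => -[|n] /=; first by rewrite (taylor0 fa).
by rewrite a0.
Qed.

Lemma half_lt1 : (1 / 2 : R) < 1. Proof. by rewrite ltr_pdivrMr // mul1r ltr1n. Qed.
Lemma half_gt0 : 0 < (1 / 2 : R). Proof. by rewrite divr_gt0. Qed.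

Lemma inj_nonconst f : inj_disc f -> hol f -> exists2 z, cmod z < 1 & derive1 f z != 0.
Proof.
move=> fi hf; apply: contrapT => H.
have h1 : cmod ((1 / 2 : R)%:C : C) < 1 by rewrite cmodR gtr0_norm ?half_gt0 // half_lt1.
have : f (1 / 2 : R)%:C = f 0.
  apply: hol_const => // z z1; apply/eqP/negPn/negP => nz; apply: H; by exists z.
move/fi; rewrite cmod0 ltr01 h1 => /(_ erefl erefl) /(congr1 (@complex.Re R)) /= /eqP.
by rewrite gt_eqF // half_gt0.
Qed.

(** Identity principle: every Taylor coefficient is a mean over that circle, hence zero. *)
Lemma deriv_zero_near f r : hol f -> 0 < r -> r < 1 ->
  (forall z, cmod z = r -> f z = 0) -> forall z, cmod z < 1 -> f z = 0.
Proof.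
move=> hf r0 r1 f0 z z1; have [a fa] := hol_taylor hf.
have a0 n : a n = 0.
  rewrite -(taylor_tcoef n fa r0 r1); apply: (@tcoef_lim _ _ (fun=> 0)) => // e e0.
  exists 0%N => [|w wr]; first by rewrite coef0.
  by rewrite horner0 f0 // subrr cmod0 ltW.
apply: (taylor_fun_unique (g := fun=> 0) fa _ z1).
by have := taylor_cst (0 : C); congr taylor; apply/funext => -[|n]; rewrite a0.
Qed.

(** Suppose f' 0 = 0. For small l <> 0 the quotient (f - f l) / (z - l) is bounded below on a fixed
    circle about 0 but only of order |l| at 0, since f - f 0 is quadratic there; so it has a zero
    inside. Injectivity places this zero at l itself, whence f' l = 0. Then f' vanishes on a small
    circle, hence everywhere, and f would be constant. *)
Lemma inj_deriv0 f : hol f -> inj_disc f -> derive1 f 0 != 0.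
Proof.
move=> hf fi; apply/negP => /eqP f00.
have [a fa] := hol_taylor hf; have [fa' fd] := taylor_deriv fa.
have q1 : (3 / 4 : R) < 1 by rewrite ltr_pdivrMr // mul1r ltr_nat.
have [K K0 HK] := taylor_quad fa fa' (divr_ge0 (ler0n _ 3) (ler0n _ 4)) q1.
have [m m0 Hm] : exists2 m : R, 0 < m & forall z, cmod z = 1 / 2 -> m <= cmod (f z - f 0).
  have [c c0 Hc] : exists2 c : R, 0 < c & forall z, cmod z <= 1 / 2 -> cmod z = 1 / 2 -> c <= cmod (f z - f 0).
    apply: (@compact_disc (fun c z => cmod z = 1 / 2 -> c <= cmod (f z - f 0))) => [c c' z cc h /h|z zs].
      exact: le_trans.
    have [->|z0] := eqVneq z 0.
      exists 1, (1 / 2); split; rewrite ?half_gt0 // => w ws; rewrite subr0 => h1 h2.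
      by move: h1; rewrite h2 ltxx.
    have z1 : cmod z < 1 by apply: le_lt_trans zs half_lt1.
    have fz : 0 < cmod (f z - f 0) / 2.
      rewrite divr_gt0 // cmod_gt0 subr_eq0; apply: contra_neq z0 => /fi; apply => //.
      by rewrite cmod0.
    have [del del0 H] := hol_cont hf z1 fz.
    exists (cmod (f z - f 0) / 2), del; split => // w ws /H h _.
    by have := cmod_tri (f z) (f 0) (f w); rewrite cmodC in h; lra.
  by exists c => // z zE; apply: Hc; rewrite ?zE.
pose d := Num.min (1 / 8) (m / (8 * (1 + K))).
have K1 : 0 < 1 + K by rewrite ltr_pwDl.
have d0 : 0 < d by rewrite lt_min !divr_gt0 // mulr_gt0.
have key l : 0 < cmod l -> cmod l <= d -> derive1 f l = 0.
  move=> l0 ld.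
  have l8 : cmod l <= 1 / 8 by apply: le_trans ld _; rewrite ge_min lexx.
  have lm : cmod l * (8 * (1 + K)) <= m.
    by rewrite -ler_pdivlMr ?mulr_gt0 // (le_trans ld) // ge_min lexx orbT.
  have fl : cmod (f l - f 0) <= K * cmod l ^+ 2.
    have := HK 0 l; rewrite cmod0 f00 mul0r !subr0; apply; first by rewrite divr_ge0.
    by apply: le_trans l8 _; lra.
  have q0 : 0 < 3 / 4 :> R by rewrite divr_gt0.
  have lq : cmod l + 3 / 4 <= 1 by lra.
  have [hF dF] := hol_recenter hf q0 lq; have iF := inj_recenter fi q0 lq.
  set F := (fun z => f (l + _)) in hF dF iF.
  have [b Fb] := hol_taylor hF; have [E Eb FE] := taylor_quotient Fb.
  have hE := taylor_hol Eb.
  (* The point that z |-> l + (3 / 4) z sends to the origin. *)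
  pose z0 : C := - ((4 / 3 : R)%:C * l).
  have mz0 : cmod z0 = 4 / 3 * cmod l by rewrite /z0 cmodN cmodM cmodR ger0_norm ?divr_ge0.
  have Fz0 : F z0 = f 0.
    rewrite /F /z0 mulrN mulrA -rmorphM /= (_ : 3 / 4 * (4 / 3) = 1 :> R) ?mul1r ?subrr //.
    by field.
  have F0 : F 0 = f l by rewrite /F mulr0 addr0.
  have z01 : cmod z0 < 1 by rewrite mz0; lra.
  have r0 : 0 < 2 / 3 :> R by rewrite divr_gt0.
  have ball z : cmod (z - z0) <= 2 / 3 -> cmod z < 1.
    by move=> h; have := cmod_subr z z0; rewrite mz0; lra.
  have circ z : cmod (z - z0) = 2 / 3 -> m / 2 <= cmod (E z - 0).
    move=> zz; have z1 : cmod z < 1 by apply: ball; rewrite zz.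
    have := FE z z1; rewrite F0 subr0 => Fz.
    have hz : m <= cmod (F z - f 0).
      apply: Hm; have -> : l + (3 / 4 : R)%:C * z = (3 / 4 : R)%:C * (z - z0).
        rewrite mulrBr /z0 mulrN opprK mulrA -rmorphM /= (_ : 3 / 4 * (4 / 3) = 1 :> R) ?mul1r 1?addrC //.
        by field.
      by rewrite cmodM zz cmodR ger0_norm ?divr_ge0 //; field.
    have h1 : m - K * cmod l ^+ 2 <= cmod (z * E z).
      have -> : z * E z = (F z - f 0) - (f l - f 0) by rewrite Fz; ring.
      by have := cmod_subr (F z - f 0) (f l - f 0); lra.
    have h2 : K * cmod l ^+ 2 <= m / 2.
      have : K * cmod l ^+ 2 <= cmod l * (8 * (1 + K)) / 8.
        rewrite (_ : cmod l * (8 * (1 + K)) / 8 = cmod l * (1 + K)); last by field.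
        rewrite expr2 mulrCA ler_wpM2l ?cmod_ge0 // -[leRHS]mulr1 mulrC.
        rewrite mulrC; apply: ler_pM; rewrite ?cmod_ge0 // ?lerDr //; lra.
      by lra.
    have : cmod (z * E z) <= cmod (E z) by rewrite cmodM ler_piMl ?cmod_ge0 // ltW.
    by lra.
  have small : cmod (E z0 - 0) < m / 2.
    rewrite subr0; have := FE z0 z01; rewrite F0 Fz0 => h.
    have h1 : cmod z0 * cmod (E z0) <= K * cmod l ^+ 2.
      by rewrite -cmodM -(addKr (f l) (z0 * E z0)) -h addrC cmodC.
    rewrite mz0 in h1.
    have h2 : cmod (E z0) <= K * cmod l.
      rewrite -(ler_pM2l l0); apply: le_trans (_ : 4 / 3 * cmod l * cmod (E z0) <= _); last by rewrite (le_trans h1) // expr2 mulrCA.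
      by rewrite -mulrA ler_peMl ?mulr_ge0 ?cmod_ge0 //; lra.
    apply: le_lt_trans h2 _; have : K * cmod l <= cmod l * (8 * (1 + K)) / 8.
      rewrite (_ : cmod l * (8 * (1 + K)) / 8 = cmod l * (1 + K)); last by field.
      by rewrite mulrC ler_wpM2l ?cmod_ge0 // lerDr.
    by lra.
  have [z zr Ez] := @zero_exists E z0 0 (2 / 3) (m / 2) r0
     (fun z zr => hE z (ball z zr)) circ small.
  have zE : z = 0.
    by apply: iF; rewrite ?cmod0 ?ball // (FE z (ball _ zr)) Ez mulr0 addr0.
  have E0 : E 0 = 0 by move: Ez; rewrite zE.
  have q34 : (3 / 4 : R)%:C != 0 :> C by rewrite -cmod_gt0 cmodR gtr0_norm.
  have := dF 0; rewrite cmod0 ltr01 => /(_ erefl); rewrite mulr0 addr0.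
  have [Fb' _] := taylor_deriv Fb.
  rewrite (taylor0 Fb') /dcoef mul1r -(taylor0 Eb) E0 => h.
  by apply: (mulfI q34); rewrite mulr0 h.
have d1 : d < 1 by rewrite gt_min; apply/orP; left; lra.
have K2 w : cmod w = d -> derive1 f w = 0 by move=> wd; apply: key; rewrite wd.
clearbody d; have [z z1 /eqP] := inj_nonconst fi hf; apply.
exact: deriv_zero_near (taylor_hol fa') d0 d1 K2 z z1.
Qed.

Lemma inj_deriv f z : hol f -> inj_disc f -> cmod z < 1 -> derive1 f z != 0.
Proof.
move=> hf fi z1; have r0 : 0 < 1 - cmod z by rewrite subr_gt0.
have h : cmod z + (1 - cmod z) <= 1 by rewrite addrC subrK.
have [hF dF] := hol_recenter hf r0 h.
have := inj_deriv0 hF (inj_recenter fi r0 h).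
rewrite dF ?cmod0 // mulr0 addr0; apply: contra_neq => ->; exact: mulr0.
Qed.

(** Compactness is used in z and, for each z, in w. Off the diagonal continuity suffices; on it the
    nonzero derivative dominates the quadratic remainder. *)
Lemma inj_bilip f s : hol f -> inj_disc f -> 0 <= s -> s < 1 ->
  exists2 c : R, 0 < c & forall z w, cmod z <= s -> cmod w <= s -> c * cmod (z - w) <= cmod (f z - f w).
Proof.
move=> hf fi s0 s1.
have [a fa] := hol_taylor hf; have [fa' fd] := taylor_deriv fa; have hf' := taylor_hol fa'.
have [K K0 HK] := taylor_quad fa fa' s0 s1.
suff [c c0 H] : exists2 c : R, 0 < c & forall z, cmod z <= s -> forall w, cmod w <= s ->
     c * cmod (z - w) <= cmod (f z - f w) by exists c => // z w zs ws; exact: H.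
have wk (c c' : R) z w : c' <= c -> c * cmod (z - w) <= cmod (f z - f w) -> c' * cmod (z - w) <= cmod (f z - f w).
  by move=> cc; apply: le_trans; rewrite ler_wpM2r ?cmod_ge0.
apply: (@compact_disc (fun c z => forall w, cmod w <= s -> c * cmod (z - w) <= cmod (f z - f w)))
  => [c c' z cc H w ws|z0 z0s].
  exact: wk cc (H w ws).
have [c c0 H] : exists2 c : R, 0 < c & forall w, cmod w <= s -> forall z, cmod z <= s ->
    cmod (z - z0) < c -> c * cmod (z - w) <= cmod (f z - f w).
  apply: (@compact_disc (fun c w => forall z, cmod z <= s ->
    cmod (z - z0) < c -> c * cmod (z - w) <= cmod (f z - f w))) => [c c' w cc H z zs zc|w0 w0s].
    by apply: (wk c) => //; apply: H => //; exact: lt_le_trans cc.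
  have z01 : cmod z0 < 1 := le_lt_trans z0s s1.
  have w01 : cmod w0 < 1 := le_lt_trans w0s s1.
  have [E|zw] := eqVneq w0 z0.
    rewrite E in w0s w01 *.
    have [D DE d0] : exists2 D, D = cmod (derive1 f z0) & 0 < D.
      by exists (cmod (derive1 f z0)) => //; rewrite cmod_gt0 inj_deriv.
    have D4 : 0 < D / 4 by rewrite divr_gt0.
    have [del del0 Hdel] := hol_cont hf' z01 D4.
    have K1 : 0 < 1 + K by rewrite ltr_pwDl.
    have [c [c0 c1 c2 c3]] : exists c, [/\ 0 < c, c <= D / 4, c <= del & c <= D / (8 * (1 + K))].
      exists (Num.min (Num.min (D / 4) del) (D / (8 * (1 + K)))).
      by rewrite !lt_min D4 del0 divr_gt0 ?mulr_gt0 // !ge_min !lexx !orbT.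
    exists c, c; split => // w ws wc z zs zc.
    have h1 : 3 / 4 * D <= cmod (derive1 f z).
      have t1 : cmod (derive1 f z - derive1 f z0) < D / 4 := Hdel z (lt_le_trans zc c2).
      have t2 : D - cmod (derive1 f z) <= cmod (derive1 f z - derive1 f z0).
        by rewrite DE [leRHS]cmodC; exact: cmod_subr.
      move: t1 t2; generalize (cmod (derive1 f z - derive1 f z0)) (cmod (derive1 f z)) => x y t1 t2.
      by clear -t1 t2; lra.
    have h2 : cmod (w - z) <= D / (4 * (1 + K)).
      apply: le_trans (cmod_tri _ _ z0) _; rewrite [cmod (z0 - z)]cmodC.
      apply: le_trans (lerD (ltW (lt_le_trans wc c3)) (ltW (lt_le_trans zc c3))) _.
      by rewrite le_eqVlt; apply/orP; left; apply/eqP; field; rewrite gt_eqF.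
    have h3 : K * cmod (w - z) <= D / 4.
      apply: le_trans (_ : (1 + K) * (D / (4 * (1 + K))) <= _).
        by apply: ler_pM; rewrite ?cmod_ge0 // lerDr.
      by rewrite le_eqVlt; apply/orP; left; apply/eqP; field; rewrite gt_eqF.
    have h4 : K * cmod (w - z) ^+ 2 <= D / 4 * cmod (w - z) by rewrite expr2 mulrA ler_wpM2r ?cmod_ge0.
    have h5 : 3 / 4 * D * cmod (w - z) <= cmod (derive1 f z * (w - z)) by rewrite cmodM ler_wpM2r ?cmod_ge0.
    have h6 := HK z w zs ws.
    have h7 : cmod (derive1 f z * (w - z)) <= cmod (f w - f z) + cmod (f w - f z - derive1 f z * (w - z)).
      by rewrite -{1}[derive1 f z * (w - z)](subKr (f w - f z)) cmodB.
    have h8 : c * cmod (w - z) <= D / 4 * cmod (w - z) by rewrite ler_wpM2r ?cmod_ge0.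
    have h9 : 0 <= D * cmod (w - z) by rewrite mulr_ge0 ?cmod_ge0 // ltW.
    rewrite (cmodC z w) (cmodC (f z) (f w)).
    move: (le_trans h6 h4) h5 h7 h8 h9.
    move: (cmod (w - z)) (cmod (f w - f z)) (cmod (f w - f z - _)) (cmod (_ * (w - z))) => x A Y P.
    by clear; lra.
  have [D DE fzw] : exists2 D, D = cmod (f z0 - f w0) & 0 < D.
    exists (cmod (f z0 - f w0)) => //; rewrite cmod_gt0 subr_eq0.
    by apply: contra_neq zw => /fi ->.
  have D4 : 0 < D / 4 by rewrite divr_gt0.
  have [d1 d10 H1] := hol_cont hf z01 D4; have [d2 d20 H2] := hol_cont hf w01 D4.
  have [c [c0 c1 c2 c3]] : exists c, [/\ 0 < c, c <= D / 4, c <= d1 & c <= d2].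
    exists (Num.min (Num.min (D / 4) d1) d2).
    by rewrite !lt_min D4 d10 d20 !ge_min !lexx !orbT.
  exists c, c; split => // w ws wc z zs zc.
  have h1 := H1 z (lt_le_trans zc c2); have h2 := H2 w (lt_le_trans wc c3).
  have h3 : D <= cmod (f z0 - f z) + cmod (f z - f w) + cmod (f w - f w0).
    rewrite DE; apply: le_trans (cmod_tri _ _ (f w)) _; rewrite lerD2r; exact: cmod_tri.
  rewrite (cmodC (f z0)) in h3.
  have h4 : cmod (z - w) <= 2.
    apply: le_trans (cmodB _ _) _; rewrite -[2]/(1 + 1) lerD // ltW //; [exact: le_lt_trans zs s1|exact: le_lt_trans ws s1].
  have h5 : c * cmod (z - w) <= D / 4 * 2 by apply: ler_pM; rewrite ?cmod_ge0 // ltW.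
  by lra.
exists c, c; split => // z zs zc w ws; exact: H.
Qed.

(** * Holomorphic logarithms and square roots *)

Lemma cexp_surj w : w != 0 -> exists l, cexp l = w.
Proof.
move=> w0; have [t [_ E]] := cis_surj w0.
by exists (ln (cmod w) +i* t); rewrite cexp_polar ?cmod_gt0 // -E.
Qed.

Lemma taylor_primitive f (k : C) : hol f -> exists u : C -> C, [/\ hol u, u 0 = k & forall z, cmod z < 1 -> derive1 u z = f z].
Proof.
move=> /hol_taylor[b fb]; pose a n := if n is n'.+1 then b n' / n'.+1%:R else k.
have ag : coef_geo a.
  move=> s s0 s1; have [K [q [K0 q0 q1 H]]] := taylor_coef_geo fb s0 s1.
  have [q' q01 q'1] : exists2 q', q < q' & q' < 1 by exists ((1 + q) / 2); lra.
  have q'0 : 0 < q' := le_lt_trans q0 q01.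
  exists (cmod k + K / q'), q'; split; rewrite ?addr_ge0 ?divr_ge0 ?cmod_ge0 ?(ltW q'0) // => -[|n].
    by rewrite !expr0 !mulr1 lerDl divr_ge0 // ltW.
  rewrite /= cmodM cmodV cmod_nat mulrDl ler_wpDl ?mulr_ge0 ?exprn_ge0 ?cmod_ge0 ?(ltW q'0) //.
  have -> : K / q' * q' ^+ n.+1 = K * q' ^+ n by rewrite exprS mulrA divfK // gt_eqF.
  apply: le_trans (_ : cmod (b n) * s ^+ n <= _).
    apply: ler_pM; rewrite ?divr_ge0 ?cmod_ge0 ?exprn_ge0 //.
      by rewrite ler_pdivrMr // ler_peMr ?cmod_ge0 // ler1n.
    by rewrite exprS ler_piMl ?exprn_ge0 // ltW.
  by apply: le_trans (H n) _; rewrite ler_wpM2l // lerXn2r ?nnegrE // ltW.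
have [u ua] := coef_geo_taylor ag; exists u; split; [exact: taylor_hol ua|exact: taylor0 ua|].
move=> z z1; have [ud _] := taylor_deriv ua.
apply: (taylor_fun_unique ud) z1; suff -> : dcoef a = b by [].
by apply/funext => n; rewrite /dcoef /a mulrC divfK // pnatr_eq0.
Qed.

Lemma hol_log f l : hol f -> (forall z, cmod z < 1 -> f z != 0) -> cexp l = f 0 ->
  exists u : C -> C, [/\ hol u, u 0 = l, forall z, cmod z < 1 -> cexp (u z) = f z &
    forall z, cmod z < 1 -> derive1 u z = derive1 f z / f z].
Proof.
move=> hf nz fl; have hd := holM (hol_deriv hf) (holV hf nz).
have [u [hu u0 ud]] := taylor_primitive l hd.
exists u; split => // z z1.
pose G z := f z * cexp (- u z).
have Gd w : cmod w < 1 -> cdiff G w 0.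
  move=> w1; have h := cdiffM (hol_cdiff hf w1) (cdiff_comp (cdiffN (hol_cdiff hu w1)) (cdiff_cexp _)).
  apply: (cdiff_near ltr01 (f := G)) => //; move: h; congr cdiff.
  by rewrite ud //; field; exact: nz.
have hG : hol G by move=> w w1; exists 0; exact: Gd.
have G0 w : cmod w < 1 -> derive1 G w = 0 by move=> w1; apply: cdiff_derive1; exact: Gd.
have := hol_const hG G0 z1; rewrite /G u0 (cexpN l) fl mulfV; last by apply: nz; rewrite cmod0.
rewrite cexpN => h; have := cexp_neq0 (u z) => h0.
by apply/esym; rewrite -[LHS]mulr1 -(mulVf h0) mulrA h mul1r.
Qed.

Lemma hol_cexp f : hol f -> hol (fun z => cexp (f z)).
Proof. by move=> hf z z1; have [d fd] := hf z z1; eexists; apply: cdiff_comp fd (cdiff_cexp _). Qed.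

Lemma hol_sqrt f k : hol f -> (forall z, cmod z < 1 -> f z != 0) -> k ^+ 2 = f 0 ->
  exists q : C -> C, [/\ hol q, q 0 = k & forall z, cmod z < 1 -> q z ^+ 2 = f z].
Proof.
move=> hf nz kf; have k0 : k != 0.
  by apply: contraTneq (nz 0 _) => [k0|]; rewrite ?cmod0 // -kf k0 expr0n eqxx.
have [l0 El] := cexp_surj k0.
(* Starting from twice a logarithm of [k], halving returns k and not - k. *)
have [|u [hu u0 eu _]] := @hol_log f (l0 + l0) hf nz; first by rewrite cexpD El -expr2.
exists (fun z => cexp ((1 / 2 : R)%:C * u z)); split.
- by apply: hol_cexp; apply: holM => //; exact: hol_cst.
- rewrite u0 -El; congr cexp; rewrite -mulr2n -[l0 *+ 2]mulr_natl mulrA.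
  have -> : (1 / 2 : R)%:C * 2 = 1 :> C.
    by apply: complex_eq; rewrite ?ReM ?ImM /=; field.
  by rewrite mul1r.
- move=> z z1; rewrite expr2 -cexpD -mulrDl -rmorphD /= -splitr mul1r; exact: eu.
Qed.

End Univalent.

(** * Koebe-type estimates *)

Section Koebe.
Variable R : realType.
Local Notation C := R[i].
Implicit Types (f g F G b : C -> C) (r s t K rho m M : R) (z w : C) (a : nat -> C).

Lemma coef_bound f a n r M : taylor f a -> 0 < r -> r < 1 -> (forall z, cmod z = r -> cmod (f z) <= M) ->
  cmod (a n) * r ^+ n <= M.
Proof.
move=> fa r0 r1 fM; have hf := taylor_hol fa.
rewrite -(taylor_tcoef n fa r0 r1) -ler_pdivlMr ?exprn_gt0 // tcoefE.
apply: cmean_le; [exact: ltW|exact: circ_tcoef|].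
move=> z zr; rewrite cmodM cmodV cmodX zr ler_wpM2r ?invr_ge0 ?exprn_ge0 ?(ltW r0) //.
exact: fM.
Qed.

(** Cauchy's estimates at radius 1 / 2 give |a_n| <= M 2 ^ n; for |z| <= 1 / 4 the series of the
    remainder over z ^ 2 is dominated by 4 M times the sum of (1 / 2) ^ k. *)
Lemma linear_approx f M : hol f -> f 0 = 0 -> (forall z, cmod z < 1 -> cmod (f z) <= M) ->
  cmod (derive1 f 0) <= 2 * M /\
  forall z, cmod z <= 1 / 4 -> cmod (f z - derive1 f 0 * z) <= 8 * M * cmod z ^+ 2.
Proof.
move=> hf f0 fM; have [a fa] := hol_taylor hf; have [fa' _] := taylor_deriv fa.
have a0 : a 0%N = 0 by rewrite -(taylor0 fa).
have a1 : derive1 f 0 = a 1%N by rewrite (taylor0 fa') /dcoef mul1r.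
have M0 : 0 <= M by apply: le_trans (fM 0 _); rewrite ?cmod_ge0 // cmod0.
have ca n : cmod (a n) <= M * 2 ^+ n.
  have : cmod (a n) * (1 / 2) ^+ n <= M.
    apply: (@coef_bound f a n (1 / 2) M fa (half_gt0 R) (half_lt1 R)) => z zr.
    by apply: fM; rewrite zr half_lt1.
  by rewrite expr_div_n expr1n mul1r ler_pdivrMr ?exprn_gt0.
split; first by rewrite a1 mulrC; have := ca 1%N; rewrite expr1.
move=> z z4; have z1 : cmod z < 1 by apply: le_lt_trans z4 _; rewrite ltr_pdivrMr // mul1r ltr1n.
have [g ga fg] := taylor_quotient fa; have [h hb gh] := taylor_quotient ga.
have -> : f z - derive1 f 0 * z = z ^+ 2 * h z.
  by rewrite fg // f0 gh // (taylor0 ga) a1; ring.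
rewrite cmodM cmodX mulrC ler_wpM2r ?exprn_ge0 ?cmod_ge0 //.
have h0 : 0 <= 1 / 4 :> R by rewrite divr_ge0.
apply/ler_addgt0Pl => e e0.
have [n /(_ n (leqnn n)) Hn] := taylor_psum hb z1 e0.
rewrite -[h z](subrK (psum (fun n => a n.+2) n z)); apply: le_trans (cmodD _ _) (lerD Hn _).
apply: le_trans (cmod_sum _ _ _) _.
apply: le_trans (_ : \sum_(k < n) 4 * M * (1 / 2) ^+ k <= _).
  apply: ler_sum => k _; rewrite cmodM cmodX.
  apply: le_trans (_ : M * 2 ^+ k.+2 * (1 / 4) ^+ k <= _).
    by apply: ler_pM; rewrite ?cmod_ge0 ?exprn_ge0 ?cmod_ge0 // lerXn2r ?nnegrE ?cmod_ge0.
  rewrite !exprS !expr_div_n !expr1n (_ : (4 : R) ^+ k = 2 ^+ k * 2 ^+ k); last first.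
    by rewrite -exprMn -natrM.
  by rewrite le_eqVlt; apply/orP; left; apply/eqP; field; rewrite expf_neq0.
rewrite -mulr_sumr; have -> : \sum_(k < n) (1 / 2 : R) ^+ k = 2 - 2 * (1 / 2) ^+ n.
  elim: n {Hn} => [|n IH]; first by rewrite big_ord0 expr0 mulr1 subrr.
  by rewrite big_ord_recr /= IH exprS; field.
apply: le_trans (_ : 4 * M * 2 <= _); last by rewrite le_eqVlt; apply/orP; left; apply/eqP; ring.
rewrite ler_wpM2l ?mulr_ge0 // gerBl mulr_ge0 // exprn_ge0 // divr_ge0 //.
Qed.

(** On |z| = r = |D| / (16 M), where D = f' 0, the linear term |D| r is twice the bound 8 M r ^ 2
    for the remainder. So |f| >= |D| ^ 2 / (32 M) there, and every value of modulus below half of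
    that is taken inside. *)
Lemma landau_cover f M w : hol f -> f 0 = 0 -> (forall z, cmod z < 1 -> cmod (f z) <= M) -> 0 < M ->
  0 < cmod (derive1 f 0) -> cmod w < cmod (derive1 f 0) ^+ 2 / (64 * M) ->
  exists2 z, cmod z < 1 & f z = w.
Proof.
move=> hf f0 fM M0 d0 wb; have [dM lin] := linear_approx hf f0 fM.
move: d0 wb dM lin; set D := derive1 f 0; move: (D) => {}D d0 wb dM lin.
pose r := cmod D / (16 * M).
have r0 : 0 < r by rewrite divr_gt0 // mulr_gt0.
have r8 : r <= 1 / 8.
  rewrite /r ler_pdivrMr ?mulr_gt0 //; apply: le_trans dM _.
  by rewrite le_eqVlt; apply/orP; left; apply/eqP; field.
have r4 : r <= 1 / 4 by lra.
have rM : r * (16 * M) = cmod D by rewrite divfK // gt_eqF // mulr_gt0.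
have H1 z : cmod (z - 0) <= r -> exists d, cdiff f z d.
  by rewrite subr0 => zr; apply: hf; apply: le_lt_trans zr _; lra.
have H2 z : cmod (z - 0) = r -> cmod D ^+ 2 / (32 * M) - cmod w <= cmod (f z - w).
  rewrite subr0 => zr; apply: le_trans (cmod_subr _ _); rewrite lerD2r.
  have := lin z; rewrite zr => /(_ r4) h.
  have := cmod_subr (D * z) (D * z - f z); rewrite subKr [cmod (D * z - f z)]cmodC cmodM zr.
  have E1 : cmod D * r = cmod D ^+ 2 / (16 * M) by rewrite /r; field; rewrite gt_eqF.
  have E2 : 8 * M * r ^+ 2 = cmod D ^+ 2 / (32 * M) by rewrite /r; field; rewrite gt_eqF.
  have E3 : cmod D ^+ 2 / (16 * M) = 2 * (cmod D ^+ 2 / (32 * M)) by field; rewrite gt_eqF.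
  rewrite E2 in h; rewrite E1 E3.
  by move: h; move: (cmod D ^+ 2 / _) (cmod (f z - _)) (cmod (f z)) => x y u; clear; lra.
have H3 : cmod (f 0 - w) < cmod D ^+ 2 / (32 * M) - cmod w.
  rewrite f0 sub0r cmodN; have E4 : cmod D ^+ 2 / (32 * M) = 2 * (cmod D ^+ 2 / (64 * M)) by field; rewrite gt_eqF.
  by rewrite E4; lra.
have [z zr fz] := zero_exists r0 H1 H2 H3; exists z => //.
by apply: le_lt_trans (_ : r < 1); [rewrite -[z]subr0|lra].
Qed.

(** If D = |b' 0| > 8 and |b| <= M, the image covers the disc of radius D ^ 2 / (64 M). No value has
    its reciprocal in the image, so |b| <= 64 M / D ^ 2: the bound has shrunk by a fixed factor q <
    1. Iteration forces b = 0, against the covering. *)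
Lemma bieberbach_eilenberg_bounded b M0 : hol b -> b 0 = 0 -> 0 < M0 ->
  (forall z, cmod z < 1 -> cmod (b z) <= M0) ->
  (forall z w, cmod z < 1 -> cmod w < 1 -> b z * b w != 1) -> cmod (derive1 b 0) <= 8.
Proof.
move=> hb b0 M00 HM0 bb; rewrite leNgt; apply/negP => d8.
have cov M w := @landau_cover b M w hb b0.
move: (cmod (derive1 b 0)) d8 cov => D d8 cov.
have D0 : 0 < D by lra.
have [q [q0 q1 qE]] : exists q, [/\ 0 < q, q < 1 & q = 64 / D ^+ 2].
  exists (64 / D ^+ 2); split=> //; first by rewrite divr_gt0 // exprn_gt0.
  rewrite ltr_pdivrMr ?exprn_gt0 // mul1r (_ : 64 = 8 ^+ 2); last by ring.
  by rewrite ltrXn2r ?nnegrE // ltW.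
have step M : 0 < M -> (forall z, cmod z < 1 -> cmod (b z) <= M) -> forall z, cmod z < 1 -> cmod (b z) <= M * q.
  move=> M_0 HM z z1; rewrite leNgt; apply/negP => Bz.
  have Mq : 0 < M * q by rewrite mulr_gt0.
  have Bz0 : b z != 0 by rewrite -cmod_gt0 (lt_trans Mq).
  have [|w w1 Bw] := cov M (b z)^-1 HM M_0 D0.
    have Bz1 : 0 < cmod (b z) by apply: lt_trans Bz.
    rewrite cmodV -[X in _ < X]invrK ltf_pV2 ?posrE ?invr_gt0 ?divr_gt0 ?mulr_gt0 ?exprn_gt0 //.
    by apply: le_lt_trans Bz; rewrite qE invf_div le_eqVlt; apply/orP; left; apply/eqP; field; rewrite gt_eqF.
  by have := bb _ _ z1 w1; rewrite Bw mulfV // eqxx.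
have all n : forall z, cmod z < 1 -> cmod (b z) <= M0 * q ^+ n.
  elim: n => [|n IH]; first by rewrite expr0 mulr1.
  by rewrite exprSr mulrA; apply: step => //; rewrite mulr_gt0 // exprn_gt0.
have B_0 z : cmod z < 1 -> b z = 0.
  move=> z1; apply: close_eq => e e0; rewrite subr0.
  have [n /(_ n (leqnn n))] := geo_eps M0 (ltW q0) q1 e0; apply: le_trans; exact: all.
have w0 : 0 < D ^+ 2 / (128 * M0) by rewrite divr_gt0 ?exprn_gt0 // mulr_gt0.
have [|z z1 Bz] := cov M0 (D ^+ 2 / (128 * M0))%:C HM0 M00 D0.
  rewrite cmodR gtr0_norm // ltr_pM2l ?exprn_gt0 // ltf_pV2 ?posrE ?mulr_gt0 //.
  by rewrite ltr_pM2r // ltr_nat.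
have : cmod (b z) = 0 by rewrite B_0 // cmod0.
by rewrite Bz cmodR gtr0_norm // => h; rewrite h ltxx in w0.
Qed.

(** Restriction to |z| < 1 / 2 makes b bounded and halves the derivative, whence 16 in place of
    8. *)
Lemma bieberbach_eilenberg b : hol b -> b 0 = 0 ->
  (forall z w, cmod z < 1 -> cmod w < 1 -> b z * b w != 1) -> cmod (derive1 b 0) <= 16.
Proof.
move=> hb b0 bb.
have h1 : cmod (0 : C) + 1 / 2 <= 1 by rewrite cmod0 add0r ltW // half_lt1.
have [hB dB] := hol_recenter hb (half_gt0 R) h1.
have zz z : cmod z < 1 -> cmod (0 + (1 / 2 : R)%:C * z) < 1.
  by move=> z1; apply: recenter_in; rewrite ?half_gt0 // ltW ?half_gt0.
have [|M M0 HM] := @disc_upper_bound R b (1 / 2).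
  by move=> z zs; apply: hol_cont => //; apply: le_lt_trans zs (half_lt1 R).
have d8 := @bieberbach_eilenberg_bounded _ M hB.
rewrite dB ?cmod0 // mulr0 addr0 cmodM cmodR gtr0_norm ?half_gt0 // in d8.
have : 1 / 2 * cmod (derive1 b 0) <= 8.
  apply: d8 => //.
  - move=> z z1; apply: HM; rewrite add0r cmodM cmodR gtr0_norm ?half_gt0 //.
    by rewrite ger_pMr ?half_gt0 // ltW.
  - by move=> z w z1 w1; apply: bb; apply: zz.
by move: (cmod _) => x; lra.
Qed.

(* With q a square root of (f - w) / (f 0 - w), q never takes opposite values, so the
   function (1 - q) / (1 + q) never takes reciprocal ones. *)
Lemma koebe f w : hol f -> inj_disc f -> (forall z, cmod z < 1 -> f z != w) ->
  cmod (derive1 f 0) <= 64 * cmod (f 0 - w).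
Proof.
move=> hf injf fw.
have z01 : cmod (0 : C) < 1 by rewrite cmod0.
have f0w : f 0 - w != 0 by rewrite subr_eq0 fw.
have hF : hol (fun z => (f 0 - w)^-1 * (f z - w)).
  by apply: holM; [exact: hol_cst|apply: holB => //; exact: hol_cst].
have [|| q [hq q0 qF]] := @hol_sqrt R _ 1 hF.
- by move=> z z1; rewrite mulf_neq0 ?invr_eq0 // subr_eq0 fw.
- by rewrite mulVf // expr1n.
have qn z z' : cmod z < 1 -> cmod z' < 1 -> q z != - q z'.
  move=> z1 z1'; apply/eqP => e.
  have : q z ^+ 2 = q z' ^+ 2 by rewrite e sqrrN.
  rewrite !qF // => /(mulfI (invr_neq0 f0w)) /(addIr _) /(injf _ _ z1 z1') zz.
  move: e; rewrite zz => /eqP; rewrite -addr_eq0 -mulr2n mulrn_eq0 /= => /eqP h.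
  have := qF z' z1'; rewrite h expr0n /= => /esym/eqP; rewrite mulf_eq0 invr_eq0 (negbTE f0w) /=.
  by rewrite subr_eq0 (negbTE (fw _ z1')).
have q1 z : cmod z < 1 -> 1 + q z != 0.
  by move=> z1; rewrite addr_eq0 -q0 qn.
have hb : hol (fun z => (1 - q z) * (1 + q z)^-1).
  by apply: holM; [apply: holB|apply: holV => //; apply: holD] => //; exact: hol_cst.
have := bieberbach_eilenberg hb; rewrite q0 subrr mul0r.
have dq := hol_cdiff hq z01.
have db : cdiff (fun z => (1 - q z) * (1 + q z)^-1) 0 (- derive1 q 0 / 2).
  have := @cdiff_div R (fun z => 1 - q z) (fun z => 1 + q z) 0 _ _ (q1 _ z01) (cdiffB (cdiff_cst 1 0) dq) (cdiffD (cdiff_cst 1 0) dq).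
  by rewrite q0 (_ : (_ / _) = - derive1 q 0 / 2) //; field.
have dF : cdiff (fun z => q z ^+ 2) 0 (2 * derive1 q 0).
  have := cdiffM dq dq; rewrite q0 mulr1 mul1r (_ : derive1 q 0 + derive1 q 0 = 2 * derive1 q 0).
    by apply: cdiff_near ltr01 _ => z _; rewrite expr2.
  by ring.
have dF2 : cdiff (fun z => q z ^+ 2) 0 ((f 0 - w)^-1 * derive1 f 0).
  have := cdiffZ (f 0 - w)^-1 (cdiffB (hol_cdiff hf z01) (cdiff_cst w 0)); rewrite subr0.
  by apply: cdiff_near ltr01 _ => z; rewrite subr0 => z1; rewrite qF.
have E := cdiff_unique dF dF2.
rewrite (cdiff_derive1 db) => /(_ erefl) H.
have {}H : cmod (- derive1 q 0 / 2) <= 16.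
  apply: H => z z' z1 z1'; apply/eqP => e.
  have : (1 - q z) * (1 - q z') = (1 + q z) * (1 + q z').
    have <- : (1 - q z) * (1 + q z)^-1 * ((1 - q z') * (1 + q z')^-1) * ((1 + q z) * (1 + q z')) = (1 - q z) * (1 - q z').
      by field; rewrite !q1.
    by rewrite e mul1r.
  move/eqP; rewrite -subr_eq0 (_ : _ - _ = (-2) * (q z + q z')); last by ring.
  by rewrite mulf_eq0 oppr_eq0 pnatr_eq0 /= addr_eq0 (negbTE (qn _ _ z1 z1')).
have -> : derive1 f 0 = (- derive1 q 0 / 2) * (- 4%:R * (f 0 - w)).
  move: E f0w; move: (derive1 q 0) (derive1 f 0) (f 0 - w) => x y u E u0.
  have -> : - x / 2 * (- 4%:R * u) = 2 * x * u by field.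
  by rewrite E mulrAC mulVf ?mul1r.
have c4 (u : C) : cmod (- 4%:R * u) = 4 * cmod u by rewrite cmodM cmodN cmod_nat.
rewrite cmodM c4 mulrA ler_wpM2r ?cmod_ge0 //.
by rewrite (_ : 64 = 16 * 4) ?ler_wpM2r //; ring.
Qed.

Lemma koebe_at f w z0 rho : hol f -> inj_disc f -> 0 < rho -> cmod z0 + rho <= 1 ->
  (forall z, cmod z < 1 -> f (z0 + rho%:C * z) != w) ->
  rho * cmod (derive1 f z0) <= 64 * cmod (f z0 - w).
Proof.
move=> hf injf r0 zr fw; have [hB dB] := hol_recenter hf r0 zr.
have := koebe hB (inj_recenter injf r0 zr) fw.
by rewrite dB ?cmod0 // mulr0 addr0 cmodM cmodR gtr0_norm.
Qed.

End Koebe.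

(** * Omitted values and reduction to bounded functions *)

Section OmittedValue.
Variable R : realType.
Local Notation C := R[i].
Implicit Types (f g F G phi : C -> C) (r s t K rho m M : R) (z w : C) (a : nat -> C).

(** The bi-Lipschitz bound keeps f away from f z0 on a circle about z0, and [zero_exists] fills a
    disc of values; [c] records that their preimages stay away from the unit circle. *)
Lemma inj_open f z0 : hol f -> inj_disc f -> cmod z0 < 1 -> exists c e : R, [/\ 0 < c, 0 < e &
  forall w, cmod (w - f z0) < e -> exists2 z, cmod z <= 1 - c & f z = w].
Proof.
move=> hf injf z01.
have [rho [r0 z0r s1]] : exists rho, [/\ 0 < rho, 0 <= cmod z0 + rho & cmod z0 + rho < 1].
  by exists ((1 - cmod z0) / 2); have := cmod_ge0 z0; split; lra.
have [c c0 cB] := inj_bilip hf injf z0r s1.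
have zs z : cmod (z - z0) <= rho -> cmod z <= cmod z0 + rho.
  by move=> zr; rewrite -[z](subrK z0) addrC; apply: le_trans (cmodD _ _) _; rewrite lerD2l.
exists (1 - (cmod z0 + rho)), (c * rho / 2); split; [lra|by rewrite divr_gt0 // mulr_gt0|].
move=> w wf.
have [|||z zr fz] := @zero_exists R f z0 w rho (c * rho / 2) r0.
- move=> z zr; exists (derive1 f z); apply: hol_cdiff => //; exact: le_lt_trans (zs _ zr) s1.
- move=> z zr; have := cB z z0 (zs z _); rewrite zr lexx lerDl (ltW r0) => /(_ isT isT) h.
  have := cmod_tri (f z) (f z0) w; move: h wf.
  by move: (cmod (f z - f z0)) (cmod (f z - w)) (cmod (w - f z0)) (c * rho) => x y u v; clear; lra.
- by rewrite cmodC.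
by exists z => //; rewrite opprB addrC subrK zs.
Qed.

(** If phi were onto, compactness of |w| <= 3 would give each such w a preimage in |z| <= 1 - c, so
    by injectivity |phi| > 3 nearer to the unit circle. Then z / phi, holomorphic with value 1 at 0,
    would have modulus at most 1 / 3 on a circle, against the mean value property. *)
Lemma omitted_value phi : hol phi -> inj_disc phi -> phi 0 = 0 -> derive1 phi 0 = 1 ->
  exists w0, forall z, cmod z < 1 -> phi z != w0.
Proof.
move=> hp injp p0 dp; apply: contrapT => nw.
have surj w : exists2 z, cmod z < 1 & phi z = w.
  apply: contrapT => h; apply: nw; exists w => z z1; apply/eqP => pz; apply: h; by exists z.
have z01 : cmod (0 : C) < 1 by rewrite cmod0.
have [||c c0 Hc] := @compact_disc R (fun c w => exists2 z, cmod z <= 1 - c & phi z = w) 3.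
- by move=> c c' w cc [z z1 pz]; exists z => //; lra.
- move=> w _; have [z0 z01' pz0] := surj w.
  have [c [e [c0 e0 H]]] := inj_open hp injp z01'.
  by exists c, e; split=> // w' _; rewrite -pz0; apply: H.
have far z : 1 - c < cmod z -> cmod z < 1 -> 3 < cmod (phi z).
  move=> zc z1; rewrite ltNge; apply/negP => /Hc [z' z'1 e].
  have z'1' : cmod z' < 1 by lra.
  by move: zc; rewrite -(injp _ _ z'1' z1 e); lra.
have [a pa] := hol_taylor hp; have [g ga pg] := taylor_quotient pa.
have [pa' _] := taylor_deriv pa.
have g0 : g 0 = 1 by rewrite (taylor0 ga) -dp (taylor0 pa') /dcoef mul1r.
have gn0 z : cmod z < 1 -> g z != 0.
  move=> z1; apply/eqP => gz; have := pg z z1; rewrite gz mulr0 addr0 => /(injp _ _ z1 z01) z0.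
  by move: gz; rewrite z0 g0 => /eqP; rewrite oner_eq0.
have hH : hol (fun z => (g z)^-1) by apply: holV => //; exact: taylor_hol ga.
have [r [rc r0 r1]] : exists r, [/\ 1 - c < r, 0 < r & r < 1].
  have [h|h] := leP c 1; first by exists (1 - c / 2); split; lra.
  by exists (1 / 2); split; lra.
have : cmod (cmean (fun z => (g z)^-1) r) <= 1 / 3.
  apply: cmean_le; [exact: ltW|by apply: hol_circ; rewrite ?(ltW r0)|].
  move=> z zr; have z1 : cmod z < 1 by rewrite zr.
  have := far z; rewrite zr => /(_ rc r1); rewrite pg // p0 add0r cmodM zr cmodV => h.
  rewrite -[1 / 3]invrK lef_pV2 ?posrE ?invr_gt0 ?divr_gt0 //; last by rewrite cmod_gt0 gn0.
  rewrite invf_div divr1 ltW // (lt_le_trans h) // ger_pMl ?(ltW r1) //.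
  by rewrite cmod_gt0 gn0.
rewrite cmean_center // => [|z zr]; last by apply: hH; exact: le_lt_trans zr r1.
by rewrite g0 invr1 cmod1; lra.
Qed.

(* With q a square root of phi - w0, put g = 1 / (q + q 0) and g2 = q g = 1 - (q 0) g; then
   derive1 phi = - 2 g2 (derive1 g) / g ^ 3. *)
Lemma bounded_reduction phi w0 : hol phi -> inj_disc phi -> (forall z, cmod z < 1 -> phi z != w0) ->
  exists g g2 B, [/\ [/\ hol g, inj_disc g, forall z, cmod z < 1 -> g z != 0 &
       forall z, cmod z < 1 -> cmod (g z) <= B],
     [/\ hol g2, inj_disc g2, forall z, cmod z < 1 -> g2 z != 0 &
       forall z, cmod z < 1 -> cmod (g2 z) <= B] &
     forall z, cmod z < 1 -> derive1 (derive1 phi) z / derive1 phi z =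
       derive1 (derive1 g) z / derive1 g z + derive1 g2 z / g2 z - 3 * (derive1 g z / g z)].
Proof.
move=> hp injp pw.
have z01 : cmod (0 : C) < 1 by rewrite cmod0.
have hF : hol (fun z => phi z - w0) by apply: holB => //; exact: hol_cst.
have Fn0 z : cmod z < 1 -> phi z - w0 != 0 by move=> z1; rewrite subr_eq0 pw.
have [k kE] : exists k, k ^+ 2 = phi 0 - w0.
  have [l lE] := cexp_surj (Fn0 _ z01); exists (cexp (l / 2)).
  by rewrite expr2 -cexpD -lE; congr cexp; field.
have [q [hq q0 qF]] := hol_sqrt hF Fn0 kE.
have k0 : k != 0 by apply/eqP => e; have := Fn0 0 z01; rewrite -kE e expr0n eqxx.
have qn0 z : cmod z < 1 -> q z != 0.
  by move=> z1; apply/eqP => e; have := Fn0 z z1; rewrite -qF // e expr0n eqxx.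
have qn z z' : cmod z < 1 -> cmod z' < 1 -> q z != - q z'.
  move=> z1 z1'; apply/eqP => e.
  have : q z ^+ 2 = q z' ^+ 2 by rewrite e sqrrN.
  rewrite !qF // => /(addIr _) /(injp _ _ z1 z1') zz.
  move: e; rewrite zz => /eqP; rewrite -addr_eq0 -mulr2n mulrn_eq0 /=.
  by rewrite (negbTE (qn0 _ z1')).
have injq : inj_disc q.
  by move=> z z' z1 z1' e; apply: injp => //; apply: (addIr (- w0)); rewrite -!qF // e.
(* The image of q contains the disc of radius e about k = q 0; as q never takes opposite values, |q
   + k| >= e, and 1 / (q + k) is bounded. *)
have [c [e [c0 e0 qo]]] := inj_open hq injq z01.
have qk z : cmod z < 1 -> e <= cmod (q z + k).
  move=> z1; rewrite leNgt; apply/negP => h.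
  have [|z' z'1 qz'] := qo (- q z); first by rewrite q0 -opprD cmodN.
  have z'1' : cmod z' < 1 by lra.
  by have := qn _ _ z'1' z1; rewrite qz' eqxx.
have qk0 z : cmod z < 1 -> q z + k != 0.
  by move=> z1; rewrite -cmod_gt0 (lt_le_trans e0) // qk.
have hqk : hol (fun z => q z + k) by apply: holD => //; exact: hol_cst.
have hg : hol (fun z => (q z + k)^-1) by apply: holV.
have gE z : cmod z < 1 -> q z / (q z + k) = 1 - k * (q z + k)^-1.
  by move=> z1; field; exact: qk0.
have gB z : cmod z < 1 -> cmod (q z + k)^-1 <= e^-1.
  by move=> z1; rewrite cmodV lef_pV2 ?posrE ?qk // cmod_gt0 qk0.
have ei : 0 < e^-1 by rewrite invr_gt0.
exists (fun z => (q z + k)^-1), (fun z => q z / (q z + k)), (e^-1 + (1 + cmod k * e^-1)); split.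
- split => // [z z' z1 z1' /invr_inj /addIr|z z1|z z1]; first exact: injq.
    by rewrite invr_eq0 qk0.
  by apply: le_trans (gB z z1) _; rewrite lerDl addr_ge0 // mulr_ge0 ?cmod_ge0 // ltW.
- split => [|z z' z1 z1'|z z1|z z1]; first exact: holM.
  + rewrite !gE // => /addrI /oppr_inj /(mulfI k0) /invr_inj /addIr; exact: injq.
  + by rewrite mulf_neq0 ?invr_eq0 ?qk0 ?qn0.
  + rewrite gE //; apply: le_trans (cmodB _ _) _; rewrite cmod1 cmodM.
    apply: le_trans (_ : 1 + cmod k * e^-1 <= _); last by rewrite lerDr ltW.
    by rewrite lerD2l ler_wpM2l ?cmod_ge0 // gB.
move=> z z1.
have dq := hol_cdiff hq; have dq2 := hol_cdiff (hol_deriv hq).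
have dqz := @inj_deriv R q _ hq injq.
have dP y : cmod y < 1 -> derive1 phi y = 2 * (q y * derive1 q y).
  move=> y1; apply: cdiff_derive1.
  have := cdiffD (cdiffM (dq _ y1) (dq _ y1)) (cdiff_cst w0 y).
  rewrite (_ : _ + _ + 0 = 2 * (q y * derive1 q y)); last by ring.
  apply: (@cdiff_near R _ _ y _ (1 - cmod y)); first by rewrite subr_gt0.
  move=> u uy; rewrite -expr2 qF ?subrK //.
  by rewrite -[u](subrK y); apply: le_lt_trans (cmodD _ _) _; rewrite -ltrBrDr.
have near_disc (f1 f2 : C -> C) d : (forall y, cmod y < 1 -> f1 y = f2 y) -> cdiff f2 z d -> cdiff f1 z d.
  move=> E; apply: (@cdiff_near R _ _ z _ (1 - cmod z)); first by rewrite subr_gt0.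
  move=> u uy; rewrite E //.
  by rewrite -[u](subrK z); apply: le_lt_trans (cmodD _ _) _; rewrite -ltrBrDr.
have dg y : cmod y < 1 -> derive1 (fun z => (q z + k)^-1) y = - derive1 q y / (q y + k) ^+ 2.
  move=> y1; apply: cdiff_derive1.
  have := @cdiffV R (fun z => q z + k) y _ (qk0 _ y1) (cdiffD (dq _ y1) (cdiff_cst k y)).
  by rewrite addr0.
have E1 : derive1 (derive1 phi) z = 2 * (derive1 q z * derive1 q z + q z * derive1 (derive1 q) z).
  by apply: cdiff_derive1; apply: (near_disc _ _ _ dP); apply: cdiffZ; exact: cdiffM (dq _ z1) (dq2 _ z1).
have E2 : derive1 (derive1 (fun z => (q z + k)^-1)) z =
   - derive1 (derive1 q) z / (q z + k) ^+ 2 + 2 * derive1 q z ^+ 2 / (q z + k) ^+ 3.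
  apply: cdiff_derive1; apply: (near_disc _ _ _ dg).
  have dk := cdiffD (dq _ z1) (cdiff_cst k z).
  have := @cdiff_div R (fun z => - derive1 q z) (fun z => (q z + k) * (q z + k)) z _ _ (mulf_neq0 (qk0 _ z1) (qk0 _ z1))
    (cdiffN (dq2 _ z1)) (cdiffM dk dk).
  have := qk0 z z1; move: (derive1 q z) (derive1 (derive1 q) z) (q z) => x y u uk.
  by rewrite (_ : (_ / _) = - y / (u + k) ^+ 2 + 2 * x ^+ 2 / (u + k) ^+ 3) //; field.
have E3 : derive1 (fun z => q z / (q z + k)) z = k * derive1 q z / (q z + k) ^+ 2.
  apply: cdiff_derive1.
  have := @cdiff_div R q (fun z => q z + k) z _ _ (qk0 _ z1) (dq _ z1) (cdiffD (dq _ z1) (cdiff_cst k z)).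
  by rewrite addr0 (_ : _ * _ - _ = k * derive1 q z); last by ring.
have key (A D A2 D2 A3 x y u : C) : u + k != 0 -> u != 0 -> x != 0 ->
    A = 2 * (x * x + u * y) -> D = 2 * (u * x) -> A2 = - y / (u + k) ^+ 2 + 2 * x ^+ 2 / (u + k) ^+ 3 ->
    D2 = - x / (u + k) ^+ 2 -> A3 = k * x / (u + k) ^+ 2 ->
    A / D = A2 / D2 + A3 / (u / (u + k)) - 3 * (D2 / (u + k)^-1).
  by move=> uk u0 x0 -> -> -> -> ->; field; rewrite uk u0 x0.
exact: key (qk0 z z1) (qn0 z z1) (dqz z z1) E1 (dP z z1) E2 (dg z z1) E3.
Qed.

(** * Distortion along rays *)

Lemma real_is_derive (u : R -> R) (x d : R) :
  (forall e : R, 0 < e -> exists2 del : R, 0 < del &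
     forall h, `|h| < del -> `|u (x + h) - u x - d * h| <= e * `|h|) -> is_derive x 1 u d.
Proof.
move=> ud.
have H : (fun h : R => h^-1 *: (u (h *: 1 + x) - u x)) @ 0^' --> d.
  apply/cvgrPdist_le => /= e e0; have [del del0 H] := ud _ e0.
  near=> h.
  have h0 : h != 0 by near: h; exact: nbhs_dnbhs_neq.
  have hd : `|h| < del.
    rewrite -[h]opprK normrN -[- h]add0r.
    by near: h; apply: nbhs_dnbhs; exists del.
  rewrite /GRing.scale /= mulr1 [h + x]addrC.
  have -> : d - h^-1 * (u (x + h) - u x) = - (h^-1 * (u (x + h) - u x - d * h)).
    by move: (u _ - u _) => k; field.
  by rewrite normrN normrM normfV mulrC ler_pdivrMr ?normr_gt0 // H.
apply: DeriveDef; first by apply/cvg_ex; exists d.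
by rewrite /derive; apply/cvg_lim => //; exact: Rhausdorff.
Unshelve. all: end_near. Qed.

Lemma cdiff_ray f z w d x : cdiff f (w + x%:C * z) d ->
  is_derive x 1 (fun t => complex.Re (f (w + t%:C * z))) (complex.Re (d * z)).
Proof.
move=> fd; apply: real_is_derive => e e0.
have z0 : 0 < cmod z + 1 by apply: ltr_wpDl; rewrite ?cmod_ge0.
have [del del0 H] := fd _ (divr_gt0 e0 z0).
exists (del / (cmod z + 1)); first by rewrite divr_gt0.
move=> h; rewrite ltr_pdivlMr // => hd.
have hz : cmod (h%:C * z) <= `|h| * (cmod z + 1).
  by rewrite cmodM cmodR ler_wpM2l // lerDl.
have := H (h%:C * z) (le_lt_trans hz hd).
have -> : w + x%:C * z + h%:C * z = w + (x + h)%:C * z by rewrite rmorphD /= mulrDl addrA.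
move=> h1; rewrite -(ReN (f _)) -ReD.
have -> : complex.Re (d * z) * h = complex.Re (d * (h%:C * z)) by rewrite mulrCA ReZ mulrC.
rewrite -(ReN (d * _)) -ReD; apply: le_trans (Re_le_cmod _) _; apply: le_trans h1 _.
apply: le_trans (ler_wpM2l _ hz) _; first by rewrite divr_ge0 ?ltW.
by rewrite mulrCA mulrA -mulrA divfK ?gt_eqF // mulrC.
Qed.

Lemma koebe_log f z : hol f -> inj_disc f -> (forall z, cmod z < 1 -> f z != 0) -> cmod z < 1 ->
  (1 - cmod z) * cmod (derive1 f z) <= 64 * cmod (f z).
Proof.
move=> hf injf fn0 z1; rewrite -[f z]subr0.
apply: koebe_at => //; [by rewrite subr_gt0|by rewrite addrC subrK|].
move=> y y1; apply: fn0; apply: recenter_in => //; [by rewrite subr_ge0 ltW|by rewrite addrC subrK|by rewrite subr_gt0].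
Qed.

(** Since |f' / f| <= 64 / (1 - |z|), the function ln |f (t z)| - 64 ln (1 - t |z|) does not
    decrease on [0, 1]; the exponent is the Koebe constant. The real part of a holomorphic logarithm
    stands for ln |f|. *)
Lemma distortion f z : hol f -> inj_disc f -> (forall z, cmod z < 1 -> f z != 0) -> cmod z < 1 ->
  cmod (f 0) * (1 - cmod z) ^+ 64 <= cmod (f z).
Proof.
move=> hf injf fn0 z1.
have z01 : cmod (0 : C) < 1 by rewrite cmod0.
have [l lE] := cexp_surj (fn0 _ z01).
have [u [hu u0 uE du]] := hol_log hf fn0 lE.
have tz (t : R) : 0 <= t -> t <= 1 -> cmod (t%:C * z) = t * cmod z /\ t * cmod z < 1.
  move=> t0 t1; rewrite cmodM cmodR ger0_norm //; split=> //.
  by apply: le_lt_trans z1; rewrite ler_piMl ?cmod_ge0.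
pose psi (t : R) := complex.Re (u (0 + t%:C * z)) - 64 * ln (1 - t * cmod z).
pose dpsi (t : R) := complex.Re (derive1 u (t%:C * z) * z) + 64 * (cmod z / (1 - t * cmod z)).
have D (t : R) : 0 <= t <= 1 -> is_derive t 1 psi (dpsi t).
  move=> /andP[t0 t1]; have [e1 e2] := tz t t0 t1.
  have lt0 : 0 < 1 - t * cmod z by rewrite subr_gt0.
  have h1 : cdiff u (0 + t%:C * z) (derive1 u (t%:C * z)).
    by rewrite add0r; apply: hol_cdiff; rewrite ?e1.
  have h1' := cdiff_ray h1.
  have h2 : is_derive t 1 (fun t : R => 1 - t * cmod z) (- cmod z).
    apply: real_is_derive => e e0; exists 1 => // h _.
    rewrite (_ : _ - _ - _ = 0); last by ring.
    by rewrite normr0 mulr_ge0 // ltW.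
  have h3 : is_derive t 1 (fun t : R => ln (1 - t * cmod z)) ((1 - t * cmod z)^-1 * - cmod z).
    exact: (@is_derive1_comp R (@ln R) (fun t : R => 1 - t * cmod z) t _ _ (@is_derive1_ln R _ lt0) h2).
  have h4 := is_deriveZ (64 : R) h3.
  have h5 := is_deriveB h1' h4.
  apply: (is_derive_eq (f := psi)) h5 _; rewrite /dpsi /GRing.scale /=.
  by move: (complex.Re _) (cmod z) lt0 => x m lt0; field; rewrite gt_eqF.
have [|||c c01 Ec] := @MVT_segment R psi dpsi 0 1.
- exact: ler01.
- by move=> x; rewrite in_itv /= => /andP[/ltW x0 /ltW x1]; apply: D; rewrite x0.
- apply: derivable_within_continuous => x; rewrite in_itv /= => x01.
  by have := D x x01; case.
have dc : 0 <= dpsi c.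
  move: c01; rewrite in_itv /= => /andP[c0 c1]; have [e1 e2] := tz c c0 c1.
  rewrite /dpsi du ?e1 //.
  have := @koebe_log f (c%:C * z) hf injf fn0; rewrite e1 => /(_ e2) k.
  have fz0 : 0 < cmod (f (c%:C * z)) by rewrite cmod_gt0 fn0 // e1.
  have lt0 : 0 < 1 - c * cmod z by rewrite subr_gt0.
  have := Re_le_cmod (derive1 f (c%:C * z) / f (c%:C * z) * z); rewrite ler_norml => /andP[h _].
  have k2 : cmod (derive1 f (c%:C * z) / f (c%:C * z) * z) <= 64 * (cmod z / (1 - c * cmod z)).
    rewrite (cmodM (_ / _)) (cmodM (derive1 _ _)) cmodV.
    move: fz0 lt0 k (cmod_ge0 z); move: (cmod (derive1 _ _)) (cmod (f _)) (1 - c * cmod z) (cmod z) => a b x m b0 x0 k m0.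
    rewrite [64 * _]mulrCA [a / b * m]mulrC ler_wpM2l // ler_pdivrMr //.
    by rewrite mulrAC ler_pdivlMr // mulrC.
  by move: h k2; move: (complex.Re _) (cmod _) (64 * _) => a b x; clear; lra.
have : psi 0 <= psi 1 by rewrite -subr_ge0 Ec subr0 mulr1.
rewrite /psi !(mul0r, mul1r, rmorph0, rmorph1, subr0, add0r, addr0, ln1, mulr0).
rewrite -(uE _ z01) -(uE _ z1) !cmod_cexp => h.
have lt0 : 0 < 1 - cmod z by rewrite subr_gt0.
rewrite -[1 - cmod z]lnK // -expRM_natl -expRD ler_expR.
by move: h; rewrite -[_ *+ 64]mulr_natl; lra.
Qed.
End OmittedValue.

(** * Green formula and Parseval identity on disks *)

Section DiscIntegral.
Variable R : realType.
Local Notation C := R[i].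
Local Notation mu := (@lebesgue_measure R).
Local Notation mu2 := (mu \x mu)%E.
Implicit Types (f g : C -> C) (u : R -> C) (a b s t x y : R) (z w c : C) (p q : {poly C}).

Lemma cintE a b u : cint a b u =
  (\int[mu]_(x in `[a, b]) complex.Re (u x)) +i* (\int[mu]_(x in `[a, b]) complex.Im (u x)).
Proof. exact: erefl. Qed.

Lemma cmeanE f s : cmean f s = ((2 * pi)^-1)%:C * cint 0 (2 * pi) (fun t => f (s%:C * cis t)).
Proof. exact: erefl. Qed.

Lemma cisE t : cis t = cos t +i* sin t.
Proof. exact: erefl. Qed.

Lemma cint_real a b u : rcont a b u ->
  (\int[mu]_(x in `[a, b]) (complex.Re (u x))%:E)%E = (complex.Re (cint a b u))%:E.
Proof.
move=> /rcont_integrable[h _]; rewrite cintE /= /Rintegral fineK //.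
exact: integrable_fin_num.
Qed.

Section Substitution.
Variables (h dh : R -> R) (a b : R) (u : R -> C).
Hypotheses (ab : a <= b) (dE : forall x : R, is_derive x 1 h (dh x)) (cdh : continuous dh).

Let derE : h^`()%classic = dh.
Proof. by apply/funext => x; rewrite derive1E; have [_] := dE x. Qed.

Let ch x : {for x, continuous h}.
Proof. by apply: differentiable_continuous; apply/derivable1_diffP; have [] := dE x. Qed.

Let LR : derivable_oo_LRcontinuous h a b.
Proof.
split=> [x _||]; first by have [] := dE x.
  by apply: cvg_at_right_filter; exact: ch.
by apply: cvg_at_left_filter; exact: ch.
Qed.

Lemma cint_subst_increasing : {in `[a, b] &, {homo h : x y / x < y}} -> rcont (h a) (h b) u ->
  cint (h a) (h b) u = cint a b (fun t => u (h t) * (dh t)%:C).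
Proof.
move=> inc hu; have [c1 c2] := rcont_ReIm hu; rewrite !cintE.
have S (G : R -> R) : {within `[h a, h b], continuous G} ->
    \int[mu]_(x in `[h a, h b]) G x = \int[mu]_(x in `[a, b]) (G (h x) * dh x).
  move=> cG; rewrite /Rintegral (integration_by_substitution_increasing ab inc) ?derE //.
  - by apply/cvg_ex; exists (dh a); apply: cvg_at_right_filter; exact: cdh.
  - by apply/cvg_ex; exists (dh b); apply: cvg_at_left_filter; exact: cdh.
rewrite !S //; congr (_ +i* _); apply: eq_Rintegral => x _.
  by rewrite ReM /= mulr0 subr0.
by rewrite ImM /= mulr0 add0r.
Qed.

Lemma cint_subst_decreasing : {in `[a, b] &, {homo h : x y /~ x < y}} -> rcont (h b) (h a) u ->
  cint (h b) (h a) u = cint a b (fun t => u (h t) * (- dh t)%:C).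
Proof.
move=> dec hu; have [c1 c2] := rcont_ReIm hu; rewrite !cintE.
have S (G : R -> R) : {within `[h b, h a], continuous G} ->
    \int[mu]_(x in `[h b, h a]) G x = \int[mu]_(x in `[a, b]) (G (h x) * - dh x).
  move=> cG; rewrite /Rintegral (integration_by_substitution_decreasing ab dec) ?derE //.
  - by apply/cvg_ex; exists (dh a); apply: cvg_at_right_filter; exact: cdh.
  - by apply/cvg_ex; exists (dh b); apply: cvg_at_left_filter; exact: cdh.
rewrite !S //; congr (_ +i* _); apply: eq_Rintegral => x _.
  by rewrite ReM /= mulr0 subr0.
by rewrite ImM /= mulr0 add0r.
Qed.

End Substitution.

Lemma is_derive_affine (k l x : R) : is_derive x 1 (fun t : R => k * t + l) k.
Proof.
apply: real_is_derive => e e0; exists 1 => // h _.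
rewrite (_ : _ - _ - _ = 0); last by ring.
by rewrite normr0 mulr_ge0 // ltW.
Qed.

Lemma cint_shift a b l u : a <= b -> rcont (a + l) (b + l) u ->
  cint (a + l) (b + l) u = cint a b (fun t => u (t + l)).
Proof.
move=> ab hu; have := @cint_subst_increasing (fun t => 1 * t + l) (cst 1) a b u ab (is_derive_affine 1 l).
rewrite !mul1r => -> //; last by move=> x y _ _; rewrite !mul1r ltrD2r.
  by apply: eq_cint => t _; rewrite mulr1 mul1r.
by move=> x; exact: cst_continuous.
Qed.

Lemma cint_reflect a b l u : a <= b -> rcont (l - b) (l - a) u ->
  cint (l - b) (l - a) u = cint a b (fun t => u (l - t)).
Proof.
move=> ab hu.
have dE x : is_derive x 1 (fun t : R => l - t) (-1).
  apply: real_is_derive => e e0; exists 1 => // h _.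
  rewrite (_ : _ - _ - _ = 0); last by ring.
  by rewrite normr0 mulr_ge0 // ltW.
have cc : continuous (cst (-1 : R) : R -> R) by move=> x; exact: cst_continuous.
have dec : {in `[a, b] &, {homo (fun t : R => l - t) : x y /~ x < y}} by move=> x y _ _ xy; rewrite ltrD2l ltrN2.
have -> := @cint_subst_decreasing (fun t => l - t) (cst (-1)) a b u ab dE cc dec hu.
by apply: eq_cint => t _; rewrite opprK mulr1.
Qed.

Definition pt (v : R * R) : C := v.1 +i* v.2.
Definition disc c s : set (R * R) := [set v | cmod (pt v - c) < s].

(** Measurability by components, over any measurable domain so that it also serves on a product of
    two planes. *)
Definition mC d (T : measurableType d) (F : T -> C) :=
  measurable_fun setT (fun v => complex.Re (F v)) /\ measurable_fun setT (fun v => complex.Im (F v)).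

Lemma mC_cst d (T : measurableType d) (k : C) : mC (fun _ : T => k).
Proof. by split; exact: measurable_cst. Qed.

Lemma mC_pt : mC pt.
Proof. by split; [exact: measurable_fst|exact: measurable_snd]. Qed.

Lemma mCD d (T : measurableType d) (F G : T -> C) : mC F -> mC G -> mC (fun v => F v + G v).
Proof.
move=> [F1 F2] [G1 G2]; split.
  by under eq_fun do rewrite ReD; exact: measurable_funD.
by under eq_fun do rewrite ImD; exact: measurable_funD.
Qed.

Lemma mCM d (T : measurableType d) (F G : T -> C) : mC F -> mC G -> mC (fun v => F v * G v).
Proof.
move=> [F1 F2] [G1 G2]; split.
  under eq_fun do rewrite ReM; apply: measurable_funB; exact: measurable_funM.
under eq_fun do rewrite ImM; apply: measurable_funD; exact: measurable_funM.
Qed.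

Lemma mC_conj d (T : measurableType d) (F : T -> C) : mC F -> mC (fun v => conjc (F v)).
Proof.
move=> [F1 F2]; split.
  by rewrite (_ : (fun v => _) = (fun v => complex.Re (F v))) //; apply/funext => v; case: (F v).
rewrite (_ : (fun v => _) = (fun v => 0 - complex.Im (F v))).
  by apply: measurable_funB => //; exact: measurable_cst.
by apply/funext => v; case: (F v) => x y; rewrite sub0r.
Qed.

Lemma mC_poly d (T : measurableType d) (F : T -> C) p : mC F -> mC (fun v => p.[F v]).
Proof.
move=> hF; elim/poly_ind: p => [|p k IH].
  by under eq_fun do rewrite horner0; exact: mC_cst.
under eq_fun do rewrite hornerMXaddC.
by apply: mCD; [exact: mCM|exact: mC_cst].
Qed.

Lemma mC_sqr d (T : measurableType d) (F : T -> C) : mC F -> measurable_fun setT (fun v => cmod (F v) ^+ 2).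
Proof.
move=> [F1 F2]; under eq_fun do rewrite cmodE.
by apply: measurable_funD; exact: measurable_funX.
Qed.

Lemma mC_comp d d' (T : measurableType d) (T' : measurableType d') (F : T -> C) (h : T' -> T) :
  mC F -> measurable_fun setT h -> mC (fun v => F (h v)).
Proof. by move=> [F1 F2] mh; split; [exact: (measurableT_comp F1 mh)|exact: (measurableT_comp F2 mh)]. Qed.

Lemma mC_lt d (T : measurableType d) (F : T -> C) s : 0 <= s -> mC F -> measurable_fun setT (fun v => cmod (F v) < s).
Proof.
move=> s0 mF; rewrite (_ : (fun v => _) = (fun v => cmod (F v) ^+ 2 < s ^+ 2)).
  by apply: measurable_fun_ltr; [exact: mC_sqr|exact: measurable_cst].
by apply/funext => v; rewrite ltr_pXn2r ?nnegrE ?cmod_ge0.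
Qed.

Lemma mC_ge d (T : measurableType d) (F : T -> C) s : 0 <= s -> mC F -> measurable_fun setT (fun v => s <= cmod (F v)).
Proof.
move=> s0 mF; rewrite (_ : (fun v => _) = (fun v => s ^+ 2 <= cmod (F v) ^+ 2)).
  by apply: measurable_fun_ler; [exact: measurable_cst|exact: mC_sqr].
by apply/funext => v; rewrite ler_pXn2r ?nnegrE ?cmod_ge0.
Qed.

Lemma measurable_lim d (T : measurableType d) (h : nat -> T -> R) (k : T -> R) :
  (forall n, measurable_fun setT (h n)) ->
  (forall v (e : R), 0 < e -> exists m, forall n, (m <= n)%N -> `|k v - h n v| <= e) ->
  measurable_fun setT k.
Proof.
move=> mh hk; apply: (measurable_fun_cvg mh) => v _.
apply/cvgrPdist_le => e e0; have [m hm] := hk v e e0.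
by exists m => // n /= mn; exact: hm.
Qed.

Lemma mC_lim d (T : measurableType d) (h : nat -> T -> C) (k : T -> C) : (forall n, mC (h n)) ->
  (forall v (e : R), 0 < e -> exists m, forall n, (m <= n)%N -> cmod (k v - h n v) <= e) -> mC k.
Proof.
move=> mh hk; split.
  apply: (measurable_lim (fun n => (mh n).1)) => v e /(hk v) [m hm]; exists m => n /hm.
  by rewrite -ReN -ReD; apply: le_trans; exact: Re_le_cmod.
apply: (measurable_lim (fun n => (mh n).2)) => v e /(hk v) [m hm]; exists m => n /hm.
by rewrite -ImN -ImD; apply: le_trans; exact: Im_le_cmod.
Qed.

Lemma measurable_if d (T : measurableType d) (b : T -> bool) (h : T -> R) :
  measurable_fun setT b -> measurable_fun setT h -> measurable_fun setT (fun v => if b v then h v else 0).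
Proof. by move=> mb mh; apply: measurable_fun_ifT => //; exact: measurable_cst. Qed.

Lemma mC_if d (T : measurableType d) (b : T -> bool) (F : T -> C) :
  measurable_fun setT b -> mC F -> mC (fun v => if b v then F v else 0).
Proof.
move=> mb [F1 F2]; split.
  rewrite (_ : (fun v => _) = (fun v => if b v then complex.Re (F v) else 0)); first exact: measurable_if.
  by apply/funext => v; case: (b v).
rewrite (_ : (fun v => _) = (fun v => if b v then complex.Im (F v) else 0)); first exact: measurable_if.
by apply/funext => v; case: (b v).
Qed.

Lemma disc_sqr c s : 0 < s -> disc c s = [set v | cmod (pt v - c) ^+ 2 < s ^+ 2].
Proof.
move=> s0; apply/seteqP; split => p /=; rewrite /disc /= ltr_pXn2r ?nnegrE ?cmod_ge0 ?ltW //.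
Qed.

Lemma measurable_disc c s : measurable (disc c s).
Proof.
have [s0|s0] := leP s 0.
  rewrite (_ : disc c s = set0) //; apply/seteqP; split => p //=; rewrite /disc /=.
  by move/lt_le_trans => /(_ _ s0); rewrite ltNge cmod_ge0.
rewrite disc_sqr //.
have h : measurable_fun setT (fun v : R * R => cmod (pt v - c) ^+ 2).
  by apply: mC_sqr; apply: mCD; [exact: mC_pt|exact: mC_cst].
have := h measurableT _ (measurable_itv `]-oo, (s ^+ 2)[).
by rewrite setTI; congr (measurable _); apply/seteqP; split => p /=; rewrite in_itv.
Qed.

(* Fubini: both iterated integrals agree, so exchanging the coordinates preserves integrals. *)
Lemma integral_swap (F : R * R -> R) : mu2.-integrable setT (EFin \o F) ->
  mu2.-integrable setT (EFin \o (fun v => F (v.2, v.1))) ->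
  (\int[mu2]_v (F v)%:E = \int[mu2]_v (F (v.2, v.1))%:E)%E.
Proof.
move=> iF iG; have := integral12_prod_meas1 iF; have := integral21_prod_meas1 iG.
by rewrite /fubini_F /fubini_G /= => <- <-.
Qed.

Lemma rcont_circle (f : C -> C) (v : R -> C) a b : (forall z, ccont f z) -> rcont a b v -> rcont a b (fun t => f (v t)).
Proof.
move=> hf hv x xab e e0; have [d d0 hd] := hf (v x) e e0; have [d' d'0 hd'] := hv x xab d d0.
by exists d' => // y yab yx; apply: hd; exact: hd'.
Qed.

Lemma rcont_real a b (h k : R -> R) : {in `[a, b], continuous h} -> {in `[a, b], continuous k} ->
  rcont a b (fun t => h t +i* k t).
Proof.
move=> ch ck x xab e e0; have xi : x \in `[a, b] by rewrite in_itv.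
have e2 : 0 < e / 2 by rewrite divr_gt0.
have /cvgrPdist_lt /(_ _ e2) [d1 /= d10 h1] := ch x xi.
have /cvgrPdist_lt /(_ _ e2) [d2 /= d20 h2] := ck x xi.
exists (Num.min d1 d2); first by rewrite lt_min d10.
move=> y yab; rewrite lt_min !(distrC y) => /andP[y1 y2].
apply: le_lt_trans (cmod_le_ReIm _) _; rewrite [e]splitr /=.
by apply: ltrD; rewrite distrC; [exact: h1|exact: h2].
Qed.

Lemma rcont_line f y a b : (forall z, ccont f z) -> rcont a b (fun x => f (x +i* y)).
Proof.
move=> hf; apply: (rcont_circle hf); apply: rcont_real => x _; first exact: cvg_id.
exact: cst_continuous.
Qed.

Lemma ccont_Re f z : ccont f z -> ccont (fun z => (complex.Re (f z))%:C) z.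
Proof.
move=> h e e0; have [d d0 hd] := h e e0; exists d => // w wz.
apply: le_lt_trans (hd w wz); rewrite -rmorphB /= cmodR -ReN -ReD; exact: Re_le_cmod.
Qed.

Lemma patch_if (T : Type) (D : set T) (P : pred T) (h : T -> R) : (forall i, D i <-> P i) ->
  (fun i => (if P i then h i else 0)%:E) = (fun i => (h i)%:E) \_ D.
Proof.
move=> DP; apply/funext => x; rewrite patchE.
have -> : (x \in D) = P x by apply/idP/idP => [/set_mem /DP|/DP /mem_set].
by case: (P x).
Qed.

Lemma integral_if_itv u a b : rcont a b u ->
  (\int[mu]_x (if a < x < b then complex.Re (u x) else 0)%:E)%E = (complex.Re (cint a b u))%:E.
Proof.
move=> hu; rewrite -cint_real //.
transitivity (\int[mu]_(x in `]a, b[) (complex.Re (u x))%:E)%E.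
  by rewrite [RHS]integral_mkcond (patch_if (D := `]a, b[%classic)) // => x /=; rewrite in_itv.
apply/esym/(integral_itv_bndoo true false).
have [h _] := rcont_integrable hu; apply: measurable_funS (measurable_int _ h) => //.
by move=> x /=; rewrite !in_itv /= => /andP[/ltW -> /ltW ->].
Qed.

Lemma mu2_disc_lty c s : (mu2 (disc c s) < +oo)%E.
Proof.
have sub : disc c s `<=` `[complex.Re c - s, complex.Re c + s] `*` `[complex.Im c - s, complex.Im c + s].
  move=> [x y]; rewrite /disc /pt /= => h; split; rewrite /= in_itv /=.
    have := le_lt_trans (Re_le_cmod _) h; rewrite ReD ReN /= ltr_norml => /andP[h1 h2].
    by apply/andP; split; lra.
  have := le_lt_trans (Im_le_cmod _) h; rewrite ImD ImN /= ltr_norml => /andP[h1 h2].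
  by apply/andP; split; lra.
apply: (@le_lt_trans _ _ (mu2 (`[complex.Re c - s, complex.Re c + s] `*` `[complex.Im c - s, complex.Im c + s]))).
  by apply: le_measure; rewrite ?inE //; [exact: measurable_disc|exact: measurableX].
rewrite [ltLHS]product_measure1E //= !lebesgue_measure_itv /=.
by case: ifP => _; case: ifP => _; rewrite ?mule0 ?mul0e // -!EFinB -EFinM ltry.
Qed.

Lemma integrable_disc c s f : (forall z, ccont f z) ->
  measurable_fun setT (fun v => complex.Re (f (pt v))) ->
  mu2.-integrable setT (EFin \o (fun v => if cmod (pt v - c) < s then complex.Re (f (pt v)) else 0)).
Proof.
move=> cf mf.
rewrite /comp (patch_if (D := disc c s)) //.
apply: (integrable_mkcond (mu := mu2) (fun i => (complex.Re (f (pt i)))%:E) (measurable_disc c s)).1.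
apply: measurable_bounded_integrable; [exact: measurable_disc|exact: mu2_disc_lty| |].
  exact: measurable_funS mf.
have [M M0 HM] := @disc_upper_bound R f (cmod c + `|s|) (fun z _ => cf z).
exists M; split; first exact: num_real.
move=> x Mx v; rewrite /disc /= => h; apply: le_trans (Re_le_cmod _) _.
apply: le_trans (HM _ _) (ltW Mx); rewrite -[pt v](subrK c) addrC.
apply: le_trans (cmodD _ _) _; rewrite lerD2l; apply: le_trans (ltW h) (ler_norm s).
Qed.

(** Fubini with x inside: on each horizontal chord the fundamental theorem of calculus leaves the
    difference of f at the two ends, and y = Im c + s sin t moves these ends along the circle. *)
Lemma green_x f g c s : 0 < s -> (forall z, ccont f z) -> (forall z, ccont g z) ->
  measurable_fun setT (fun v => complex.Re (g (pt v))) ->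
  (forall x y, is_derive x 1 (fun x => complex.Re (f (x +i* y))) (complex.Re (g (x +i* y)))) ->
  (\int[mu2]_v (if cmod (pt v - c) < s then complex.Re (g (pt v)) else 0)%:E)%E =
  (complex.Re (cint (- (pi / 2)) (pi / 2) (fun t =>
    (f (c + s%:C * cis t) - f (c + s%:C * cis (pi - t))) * (s * cos t)%:C)))%:E.
Proof.
move=> s0 cf cg mg dfg.
have iF := @integrable_disc c s g cg mg.
have [a [b cE]] : exists a b, c = a +i* b by exists (complex.Re c), (complex.Im c); case: (c).
pose rho (y : R) := Num.sqrt (s ^+ 2 - (y - b) ^+ 2).
have condE x y : (cmod (pt (x, y) - c) < s) = (a - rho y < x < a + rho y).
  rewrite -ltr_distl -(ltr_pXn2r (n := 2)) ?nnegrE ?cmod_ge0 ?ltW // cmodE cE /pt /=.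
  rewrite -ltrBrDr; apply/idP/idP => h.
    rewrite -(ltr_pXn2r (n := 2)) ?nnegrE ?normr_ge0 ?sqrtr_ge0 // real_normK ?num_real //.
    by rewrite sqr_sqrtr //; apply: le_trans (ltW h); exact: sqr_ge0.
  have r0 : 0 < rho y by apply: le_lt_trans h.
  move: (r0); rewrite sqrtr_gt0 => r1.
  by rewrite -(ltr_pXn2r (n := 2)) ?nnegrE ?normr_ge0 ?ltW // real_normK ?num_real // sqr_sqrtr ?ltW // in h.
rewrite -[LHS](integral21_prod_meas1 iF) /fubini_G /=.
pose G y : C := f ((a + rho y) +i* y) - f ((a - rho y) +i* y).
have inner y : (\int[mu]_x (if cmod (pt (x, y) - c) < s then complex.Re (g (pt (x, y))) else 0)%:E = (complex.Re (G y))%:E)%E.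
  have r0 : 0 <= rho y by exact: sqrtr_ge0.
  have cu : rcont (a - rho y) (a + rho y) (fun x => (complex.Re (g (x +i* y)))%:C).
    by apply: (@rcont_line (fun z => (complex.Re (g z))%:C)) => z; exact: ccont_Re.
  rewrite -[X in _ = (complex.Re X)%:E]/(G y).
  have -> : complex.Re (G y) = complex.Re (cint (a - rho y) (a + rho y) (fun x => (complex.Re (g (x +i* y)))%:C)).
    have i0 x : is_derive x 1 (fun t => complex.Im ((complex.Re (f (t +i* y)))%:C : C)) (complex.Im ((complex.Re (g (x +i* y)))%:C : C)).
      exact: is_derive_cst.
    have rr : a - rho y <= a + rho y by rewrite lerD2l; apply: (le_trans _ r0); rewrite oppr_le0.
    have -> := @cint_FTC R _ _ (fun x => (complex.Re (f (x +i* y)))%:C) _ rr cu (dfg^~ y) i0.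
    by rewrite /G !ReD !ReN.
  rewrite -(integral_if_itv cu); apply: eq_integral => x _; by rewrite condE.
have crho : continuous rho.
  move=> y; apply: continuous_comp; last exact: sqrt_continuous.
  by apply: continuousB; [exact: cst_continuous|apply: (@continuousM _ _ (fun y => y - b) (fun y => y - b)); apply: continuousB => //; exact: cst_continuous].
have cG : rcont (b - s) (b + s) G.
  have c1 : rcont (b - s) (b + s) (fun y => f ((a + rho y) +i* y)).
    apply: (rcont_circle cf); apply: rcont_real => y _; last exact: cvg_id.
    by apply: continuousD; [exact: cst_continuous|exact: crho].
  have c2 : rcont (b - s) (b + s) (fun y => f ((a - rho y) +i* y)).
    apply: (rcont_circle cf); apply: rcont_real => y _; last exact: cvg_id.
    by apply: continuousB; [exact: cst_continuous|exact: crho].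
  apply: rcont_ext (rcontD c1 (rcontZ (-1) c2)) => y _; by rewrite mulN1r.
transitivity (\int[mu]_y (if b - s < y < b + s then complex.Re (G y) else 0)%:E)%E.
  apply: eq_integral => y _; rewrite inner; case: ifPn => // h; congr EFin.
  (* [Num.sqrt] is 0 on nonpositive numbers, so outside the strip the two ends of the chord
     coincide. *)
  have -> : G y = 0; last by [].
  rewrite /G (_ : rho y = 0) ?addr0 ?subr0 ?subrr //; apply/eqP; rewrite sqrtr_eq0 subr_le0.
  move: h; rewrite -ltr_distl -leNgt => h.
  by rewrite -(real_normK (num_real (y - b))) ler_pXn2r ?nnegrE ?(ltW s0).
rewrite (integral_if_itv cG); congr (complex.Re _)%:E.
have p20 : 0 <= pi / 2 :> R by rewrite divr_ge0 ?pi_ge0.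
have p2 : - (pi / 2) <= pi / 2 :> R by apply: (@le_trans _ _ 0); rewrite ?oppr_le0.
have dh x : is_derive x 1 (fun t : R => b + s * sin t) (s * cos x).
  have h1 := is_deriveD (is_derive_cst b x 1) (is_deriveZ s (is_derive_sin x)).
  by apply: (is_derive_eq (f := fun t : R => b + s * sin t)) h1 _; rewrite add0r.
have ch : continuous (fun t : R => s * cos t).
  by move=> t; apply: continuousM; [exact: cst_continuous|exact: continuous_cos].
have inc : {in `[- (pi / 2), pi / 2] &, {homo (fun t : R => b + s * sin t) : x y / x < y}}.
  by move=> x y xi yi xy; rewrite ltrD2l ltr_pM2l // ltr_sin.
have e1 : b + s * sin (- (pi / 2)) = b - s by rewrite sinN sin_pihalf mulrN1.
have e2 : b + s * sin (pi / 2) = b + s by rewrite sin_pihalf mulr1.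
have := @cint_subst_increasing _ _ _ _ G p2 dh ch inc; rewrite e1 e2 => -> //.
apply: eq_cint => t /andP[t1 t2]; congr (_ * _).
have rE : rho (b + s * sin t) = s * cos t.
  rewrite /rho [b + _]addrC addrK exprMn -{1}[s ^+ 2]mulr1 -mulrBr -cos2sin2 -exprMn sqrtr_sqr ger0_norm //.
  by rewrite mulr_ge0 ?(ltW s0) // cos_ge0_pihalf // t1.
rewrite /G rE cE; congr (f _ - f _); apply: complex_eq; rewrite !(ReD, ImD, ReZ, ImZ) !cisE /= //.
  by rewrite [pi - t]addrC cosDpi cosN mulrN.
by rewrite [pi - t]addrC sinDpi sinN opprK.
Qed.

(** The exchange of coordinates reduces this to [green_x]; it turns the angle t into pi / 2 - t. *)
Lemma green_y f g c s : 0 < s -> (forall z, ccont f z) -> (forall z, ccont g z) ->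
  measurable_fun setT (fun v => complex.Re (g (pt v))) ->
  (forall x y, is_derive y 1 (fun y => complex.Re (f (x +i* y))) (complex.Re (g (x +i* y)))) ->
  (\int[mu2]_v (if cmod (pt v - c) < s then complex.Re (g (pt v)) else 0)%:E)%E =
  (complex.Re (cint (- (pi / 2)) (pi / 2) (fun t =>
    (f (c + s%:C * cis (pi / 2 - t)) - f (c + s%:C * cis (t - pi / 2))) * (s * cos t)%:C)))%:E.
Proof.
move=> s0 cf cg mg dfg.
pose sw z : C := complex.Im z +i* complex.Re z.
have swK z : sw (sw z) = z by case: z.
have swD z w : sw (z + w) = sw z + sw w by apply: complex_eq; rewrite !(ReD, ImD) /= ?(ReD, ImD).
have swN z : sw (- z) = - sw z by case: z.
have csw z : cmod (sw z) = cmod z.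
  by apply/eqP; rewrite -(eqrXn2 (n := 2)) ?cmod_ge0 // !cmodE addrC.
have cc h : (forall z, ccont h z) -> forall z, ccont (fun z => h (sw z)) z.
  move=> ch z e e0; have [d d0 hd] := ch (sw z) e e0; exists d => // w wz.
  by apply: hd; rewrite -swN -swD csw.
have mg' : measurable_fun setT (fun v => complex.Re (g (sw (pt v)))).
  rewrite (_ : (fun v => _) = (fun v => complex.Re (g (pt v))) \o (fun v : R * R => (v.2, v.1))) //.
  apply: measurableT_comp => //.
  by apply: measurable_fun_pair; [exact: measurable_snd|exact: measurable_fst].
have G := @green_x _ _ (sw c) s s0 (cc _ cf) (cc _ cg) mg' (fun x y => dfg y x).
rewrite (integral_swap (@integrable_disc c s g cg mg)).
  transitivity (\int[mu2]_v (if cmod (pt v - sw c) < s then complex.Re (g (sw (pt v))) else 0)%:E)%E.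
    by apply: eq_integral => v _; rewrite -csw swD swN.
  rewrite G; congr (complex.Re _)%:E; apply: eq_cint => t _.
  rewrite !swD swK; congr ((f (c + _) - f (c + _)) * _); apply: complex_eq;
    rewrite /sw !(ReZ, ImZ) !cisE /=.
  - by rewrite -[pi / 2 - t]opprB cosN cosBpihalf.
  - by rewrite -[pi / 2 - t]opprB sinN sinBpihalf opprK.
  - by rewrite cosBpihalf addrC sinDpi sinN opprK.
  - by rewrite sinBpihalf addrC cosDpi cosN.
have := @integrable_disc (sw c) s _ (cc _ cg) mg'.
by congr (mu2.-integrable _ _); apply/funext => v /=; rewrite -(csw (_ - c)) swD swN.
Qed.

Lemma rcont_reflect a b l u : rcont (l - b) (l - a) u -> rcont a b (fun t => u (l - t)).
Proof.
move=> hu x /andP[xa xb] e e0.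
have [|d d0 hd] := hu (l - x) _ e e0; first by rewrite !lerD2l !lerN2 xa xb.
exists d => // y /andP[ya yb] yx; apply: hd; first by rewrite !lerD2l !lerN2 ya yb.
by rewrite opprB addrC addrA subrK distrC.
Qed.

Lemma rcont_shift a b l u : rcont (a + l) (b + l) u -> rcont a b (fun t => u (t + l)).
Proof.
move=> hu x /andP[xa xb] e e0.
have [|d d0 hd] := hu (x + l) _ e e0; first by rewrite !lerD2r xa xb.
exists d => // y /andP[ya yb] yx; apply: hd; first by rewrite !lerD2r ya yb.
by rewrite opprD addrACA subrr addr0.
Qed.

Lemma cint_periodic a u : (forall x y, rcont x y u) -> (forall t, u (t + 2 * pi) = u t) ->
  - (2 * pi) <= a -> a <= 0 -> cint a (a + 2 * pi) u = cint 0 (2 * pi) u.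
Proof.
move=> cu pu a1 a0.
have e1 : 0 <= a + 2 * pi by rewrite -lerBlDr sub0r.
have e2 : a + 2 * pi <= 2 * pi by rewrite -lerBrDr subrr.
rewrite (cint_split a0 e1 (cu _ _)) (cint_split e1 e2 (cu _ _)) addrC; congr (_ + _).
rewrite -{2}[2 * pi]add0r cint_shift //; by apply: eq_cint => t _; rewrite pu.
Qed.

Lemma cmean_poly_conj p q r N : 0 < r -> (size q <= N)%N ->
  cmean (fun z => p.[z] * conjc q.[z]) r = \sum_(k < N) p`_k * conjc q`_k * (r ^+ (2 * k))%:C.
Proof.
move=> r0 qN.
have cr z : cmod z = r -> conjc z = (r ^+ 2)%:C * z^-1.
  move=> zr; have z0 : z != 0 by rewrite -cmod_gt0 zr.
  by apply: (mulfI z0); rewrite mulcJ zr mulrCA divff // mulr1.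
rewrite (@eq_cmean _ _ (fun z => \sum_(k < N) (conjc q`_k * (r ^+ 2)%:C ^+ k) * (p.[z] * (z ^+ k)^-1))); last 2 first.
- exact: ltW.
- move=> z zr; rewrite (horner_coef_wide _ qN) rmorph_sum /= mulr_sumr; apply: eq_bigr => k _.
  by rewrite rmorphM /= rmorphXn /= (cr z zr) exprMn exprVn; ring.
have hc k : circ_rcont (fun z => p.[z] * (z ^+ k)^-1) r.
  by apply: circ_rcontM; [exact/circ_poly/ltW|exact: circ_expV].
have [_ ->] := @cmean_sum _ _ (index_enum 'I_N) (fun (k : 'I__) z =>
  (conjc q`_k * (r ^+ 2)%:C ^+ k) * (p.[z] * (z ^+ k)^-1)) r (fun i => rcontZ _ (hc i)).
apply: eq_bigr => k _; rewrite cmeanZ // [cmean _ _](tcoef_poly p k r0).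
by rewrite exprM !rmorphXn; ring.
Qed.

(** Re (a conj b) equals Re a Re b + Re (- i a) Re (- i b), so the real product rule applies to real
    parts only. *)
Lemma ray_derive f g w z x df dg : cdiff f (w + x%:C * z) df -> cdiff g (w + x%:C * z) dg ->
  is_derive x 1 (fun t => complex.Re (f (w + t%:C * z) * conjc (g (w + t%:C * z))))
    (complex.Re (df * z * conjc (g (w + x%:C * z)) + f (w + x%:C * z) * conjc (dg * z))).
Proof.
move=> hf hg.
have ReJ (a b : C) : complex.Re (a * conjc b) = complex.Re a * complex.Re b + complex.Re (- 'i * a) * complex.Re (- 'i * b).
  by case: a => a1 a2; case: b => b1 b2 /=; ring.
have f1 := cdiff_ray hf; have g1 := cdiff_ray hg.
have f2 := cdiff_ray (cdiffZ (- 'i) hf); have g2 := cdiff_ray (cdiffZ (- 'i) hg).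
have D := is_deriveD (is_deriveM f1 g1) (is_deriveM f2 g2).
rewrite (_ : (fun t => _) = (fun t => complex.Re (f (w + t%:C * z)) * complex.Re (g (w + t%:C * z)) +
  complex.Re (- 'i * f (w + t%:C * z)) * complex.Re (- 'i * g (w + t%:C * z)))); last first.
  by apply/funext => t; rewrite ReJ.
apply: (is_derive_eq D); rewrite /GRing.scale /= ReD !ReJ -!mulrA; ring.
Qed.

Lemma poly_cont p c z : ccont (fun z => p.[z - c]) z.
Proof.
suff H q (y : C) : exists d, cdiff (fun z => q.[z]) y d.
  have [d hd] := H p (z - c); have hc : cdiff (fun z => z - c) z (1 - 0) by apply: cdiffB; [exact: cdiff_id|exact: cdiff_cst].
  exact: cdiff_cont (cdiff_comp hc hd).
elim/poly_ind: q => [|q k [d IH]].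
  by exists 0; apply: cdiff_near ltr01 _ (cdiff_cst 0 y) => w _; rewrite horner0.
exists (d * y + q.[y] * 1 + 0).
apply: cdiff_near ltr01 _ (cdiffD (cdiffM IH (cdiff_id y)) (cdiff_cst k y)) => w _.
by rewrite hornerMXaddC.
Qed.

Lemma poly_cdiff p z : cdiff (fun z => p.[z]) z p^`().[z].
Proof.
elim/poly_ind: p => [|p k IH].
  by rewrite deriv0 horner0; apply: cdiff_near ltr01 _ (cdiff_cst 0 z) => w _; rewrite horner0.
rewrite (_ : _.[z] = p^`().[z] * z + p.[z] * 1 + 0).
  apply: cdiff_near ltr01 _ (cdiffD (cdiffM IH (cdiff_id z)) (cdiff_cst k z)) => w _.
  by rewrite hornerMXaddC.
by rewrite derivD derivM derivX derivC !hornerE.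
Qed.

Lemma ccont_conj f z : ccont f z -> ccont (fun z => conjc (f z)) z.
Proof.
move=> h e e0; have [d d0 hd] := h e e0; exists d => // w wz.
by rewrite -rmorphB cmod_conj; exact: hd.
Qed.

Lemma ccontD f g z : ccont f z -> ccont g z -> ccont (fun z => f z + g z) z.
Proof.
move=> hf hg e e0; have e2 : 0 < e / 2 by rewrite divr_gt0.
have [d1 d10 h1] := hf _ e2; have [d2 d20 h2] := hg _ e2.
exists (Num.min d1 d2); first by rewrite lt_min d10.
move=> w; rewrite lt_min => /andP[w1 w2]; rewrite opprD addrACA [e]splitr.
by apply: le_lt_trans (cmodD _ _) (ltrD _ _); [exact: h1|exact: h2].
Qed.

Lemma rcont_scale s (h : R -> R) x y : continuous h -> rcont x y (fun t => (s * h t)%:C : C).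
Proof.
move=> ch; apply: (rcont_real (k := cst 0)) => t _; last exact: cst_continuous.
by apply: continuousM; [exact: cst_continuous|exact: ch].
Qed.

(** Reflection, shift and periodicity join each pair of half circles to a full turn; s cos t and i s
    sin t then add up to z. *)
Lemma circle_boundary (f : C -> C) s : (forall z, ccont f z) ->
  cint (- (pi / 2)) (pi / 2) (fun t => (f (s%:C * cis t) - f (s%:C * cis (pi - t))) * (s * cos t)%:C) +
  cint (- (pi / 2)) (pi / 2) (fun t => ('i * f (s%:C * cis (pi / 2 - t)) - 'i * f (s%:C * cis (t - pi / 2))) * (s * cos t)%:C) =
  (2 * pi)%:C * cmean (fun z => z * f z) s.
Proof.
move=> cf.
have p0 : 0 <= pi :> R by exact: pi_ge0.
have p2 : - (pi / 2) <= pi / 2 :> R by lra.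
have h3 : pi / 2 <= - (pi / 2) + 2 * pi :> R by lra.
have h4 : - pi <= 0 :> R by lra.
have h5 : 0 <= - pi + 2 * pi :> R by lra.
have h6 : - (2 * pi) <= - (pi / 2) :> R by lra.
have h7 : - (pi / 2) <= 0 :> R by lra.
have h8 : - (2 * pi) <= - pi :> R by lra.
have k1 : pi - pi / 2 = pi / 2 :> R by lra.
have k2 : pi - - (pi / 2) = - (pi / 2) + 2 * pi :> R by lra.
have k3 : pi / 2 - pi / 2 = 0 :> R by lra.
have k4 : pi / 2 - - (pi / 2) = - pi + 2 * pi :> R by lra.
have k5 : - (pi / 2) + - (pi / 2) = - pi :> R by lra.
have k6 : pi / 2 + - (pi / 2) = 0 :> R by lra.
pose e (t : R) := s%:C * cis t.
pose A (t : R) : C := f (e t) * (s * cos t)%:C; pose B (t : R) : C := 'i * f (e t) * (s * sin t)%:C.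
have rf x y : rcont x y (fun t => f (e t)) by apply: rcont_circle => //; exact: cis_rcont.
have rA x y : rcont x y A by apply: rcontM => //; apply: rcont_scale; exact: continuous_cos.
have rB x y : rcont x y B.
  by apply: rcontM; [exact: rcontZ|apply: rcont_scale; exact: continuous_sin].
have eper t : e (t + 2 * pi) = e t by rewrite /e cisD cis2pi mulr1.
have per t : (cos (t + 2 * pi) = cos t :> R) * (sin (t + 2 * pi) = sin t :> R).
  have := cisD t (2 * pi); rewrite cis2pi mulr1 !cisE; by case.
have c1E : cint (- (pi / 2)) (pi / 2) (fun t => (f (e t) - f (e (pi - t))) * (s * cos t)%:C) = cint 0 (2 * pi) A.
  rewrite -(@cint_periodic (- (pi / 2)) A rA _ h6 h7); last by move=> t; rewrite /A eper per.
  have s1 := @cint_reflect (- (pi / 2)) (pi / 2) pi A p2 (rA _ _); rewrite k1 k2 in s1.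
  rewrite (cint_split p2 h3 (rA _ _)) s1 -cintD; [|exact: rA|exact: rcont_reflect].
  apply: eq_cint => t _; rewrite /A mulrBl; congr (_ + _).
  have -> : cos (pi - t) = - cos t :> R by rewrite addrC cosDpi cosN.
  by rewrite mulrN rmorphN mulrN.
have c2E : cint (- (pi / 2)) (pi / 2) (fun t => ('i * f (e (pi / 2 - t)) - 'i * f (e (t - pi / 2))) * (s * cos t)%:C) = cint 0 (2 * pi) B.
  rewrite -(@cint_periodic (- pi) B rB _ h8 h4); last by move=> t; rewrite /B eper per.
  have s1 := @cint_reflect (- (pi / 2)) (pi / 2) (pi / 2) B p2 (rB _ _); rewrite k3 k4 in s1.
  have s2 := @cint_shift (- (pi / 2)) (pi / 2) (- (pi / 2)) B p2 (rB _ _); rewrite k5 k6 in s2.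
  rewrite (cint_split h4 h5 (rB _ _)) [RHS]addrC s1 s2 -cintD; [|exact: rcont_reflect|exact: rcont_shift].
  apply: eq_cint => t _; rewrite /B mulrBl; congr (_ + _).
    by rewrite -[pi / 2 - t]opprB sinN sinBpihalf opprK.
  by rewrite sinBpihalf mulrN rmorphN mulrN.
rewrite c1E c2E -cintD // cmeanE mulrA -rmorphM divff ?rmorph1 ?mul1r ?gt_eqF ?pi2_gt0 //.
apply: eq_cint => t _; rewrite /A /B -/(e t).
have eE : e t = (s * cos t)%:C + 'i * (s * sin t)%:C.
  by rewrite /e cisE; apply: complex_eq; rewrite !(ReD, ImD, ReM, ImM) /=; ring.
by move: (f (e t)) => k; rewrite eE; ring.
Qed.

(* Green's formula for 2 |p|^2 = d/dx Re (p conj q) - d/dy Im (p conj q), where q' = p. *)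
Lemma disc_parseval p c s : 0 < s ->
  (\int[mu2]_v (if cmod (pt v - c) < s then cmod p.[pt v - c] ^+ 2 else 0)%:E)%E =
  (pi * \sum_(k < size p) cmod p`_k ^+ 2 * s ^+ (2 * k.+1) / k.+1%:R)%:E.
Proof.
move=> s0.
pose q : {poly C} := \poly_(k < (size p).+1) (if k is k'.+1 then p`_k' / k'.+1%:R else 0).
have qk k : q`_k.+1 = p`_k / k.+1%:R.
  rewrite coef_poly ltnS; case: ltnP => // h; by rewrite nth_default ?mul0r.
have dq : q^`() = p.
  by apply/polyP => k; rewrite coef_deriv qk -[LHS]mulr_natr divfK // pnatr_eq0.
pose H z := p.[z - c] * conjc q.[z - c].
pose g1 z := p^`().[z - c] * conjc q.[z - c] + p.[z - c] * conjc p.[z - c].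
pose g2 z := - 1 * (p^`().[z - c] * conjc q.[z - c]) + p.[z - c] * conjc p.[z - c].
have cH z : ccont H z by apply: ccontM; [exact: poly_cont|apply: ccont_conj; exact: poly_cont].
have cdp z : ccont (fun z => p^`().[z - c] * conjc q.[z - c]) z by apply: ccontM; [exact: poly_cont|apply: ccont_conj; exact: poly_cont].
have cpp z : ccont (fun z => p.[z - c] * conjc p.[z - c]) z by apply: ccontM; [exact: poly_cont|apply: ccont_conj; exact: poly_cont].
have cst_c (k z : C) : ccont (fun=> k) z by exact: cdiff_cont (cdiff_cst k z).
have cg1 z : ccont g1 z by apply: ccontD; [exact: cdp|exact: cpp].
have cg2 z : ccont g2 z by apply: ccontD; [apply: ccontM; [exact: cst_c|exact: cdp]|exact: cpp].
have mp r : mC (fun v => r.[pt v - c]) by apply: mC_poly; apply: mCD; [exact: mC_pt|exact: mC_cst].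
have mg1 : mC (fun v => g1 (pt v)) by apply: mCD; apply: mCM => //; exact: mC_conj.
have mg2 : mC (fun v => g2 (pt v)) by apply: mCD; apply: mCM; [exact: mC_cst|apply: mCM|exact: mp|]; try exact: mC_conj; exact: mp.
have cs (r : {poly C}) (y : C) : cdiff (fun z => r.[z - c]) y r^`().[y - c].
  have hc : cdiff (fun z => z - c) y (1 - 0) by apply: cdiffB; [exact: cdiff_id|exact: cdiff_cst].
  by have := cdiff_comp hc (poly_cdiff r (y - c)); rewrite subr0 mulr1.
have dx x y : is_derive x 1 (fun x => complex.Re (H (x +i* y))) (complex.Re (g1 (x +i* y))).
  have E t : t +i* y = (0 +i* y) + t%:C * 1 by apply: complex_eq; rewrite !(ReD, ImD, ReZ, ImZ) /=; ring.
  rewrite (_ : (fun x => _) = (fun t => complex.Re (p.[(0 +i* y) + t%:C * 1 - c] * conjc q.[(0 +i* y) + t%:C * 1 - c]))); last first.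
    by apply/funext => t; rewrite /H -E.
  apply: (is_derive_eq (ray_derive (cs p _) (cs q _))).
  by rewrite -E dq !mulr1.
have dy x y : is_derive y 1 (fun y => complex.Re ('i * H (x +i* y))) (complex.Re (g2 (x +i* y))).
  have E t : x +i* t = (x +i* 0) + t%:C * 'i by apply: complex_eq; rewrite !(ReD, ImD, ReZ, ImZ) /=; ring.
  rewrite (_ : (fun y => _) = (fun t => complex.Re (('i * p.[(x +i* 0) + t%:C * 'i - c]) * conjc q.[(x +i* 0) + t%:C * 'i - c]))); last first.
    by apply/funext => t; rewrite /H -E mulrA.
  apply: (is_derive_eq (ray_derive (cdiffZ 'i (cs p _)) (cs q _))).
  rewrite -E dq /g2; congr complex.Re.
  move: (p^`().[_]) (conjc q.[_]) (p.[_]) => a b d.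
  case: a b d => [a1 a2] [b1 b2] [d1 d2]; apply: complex_eq; rewrite /=; ring.
have G1 := @green_x H g1 c s s0 cH cg1 mg1.1 dx.
have G2 := @green_y (fun z => 'i * H z) g2 c s s0 (fun z => ccontM (cst_c 'i z) (cH z)) cg2 mg2.1 dy.
have i1 := @integrable_disc c s g1 cg1 mg1.1; have i2 := @integrable_disc c s g2 cg2 mg2.1.
have S : (\int[mu2]_v (2 * (if cmod (pt v - c) < s then cmod p.[pt v - c] ^+ 2 else 0))%:E =
   \int[mu2]_v (if cmod (pt v - c) < s then complex.Re (g1 (pt v)) else 0)%:E +
   \int[mu2]_v (if cmod (pt v - c) < s then complex.Re (g2 (pt v)) else 0)%:E)%E.
  rewrite -integralD //; apply: eq_integral => v _; rewrite -EFinD; case: ifP => _; last by rewrite mulr0 addr0.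
  rewrite /g1 /g2 mulN1r !ReD ReN mulcJ /=; congr EFin; ring.
have cH0 z : ccont (fun z => p.[z] * conjc q.[z]) z.
  apply: ccontM; [|apply: ccont_conj]; exact: cdiff_cont (poly_cdiff _ z).
have HE (z : C) : H (c + z) = p.[z] * conjc q.[z] by rewrite /H addrC addKr.
have E2 := @circle_boundary _ s cH0.
have E3 := @cmean_poly_conj ('X * p) q s _ s0 (size_poly _ _).
have E1 : ((2 * pi * \sum_(k < size p) cmod p`_k ^+ 2 * s ^+ (2 * k.+1) / k.+1%:R)%:E =
   \int[mu2]_v (2 * (if cmod (pt v - c) < s then cmod p.[pt v - c] ^+ 2 else 0))%:E)%E.
  rewrite S G1 G2 -EFinD -ReD; congr EFin.
  have -> : cint (- (pi / 2)) (pi / 2) (fun t => (H (c + s%:C * cis t) - H (c + s%:C * cis (pi - t))) * (s * cos t)%:C) =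
    cint (- (pi / 2)) (pi / 2) (fun t => (p.[s%:C * cis t] * conjc q.[s%:C * cis t] -
      p.[s%:C * cis (pi - t)] * conjc q.[s%:C * cis (pi - t)]) * (s * cos t)%:C).
    by apply: eq_cint => t _; rewrite !HE.
  have -> : cint (- (pi / 2)) (pi / 2) (fun t => ('i * H (c + s%:C * cis (pi / 2 - t)) - 'i * H (c + s%:C * cis (t - pi / 2))) * (s * cos t)%:C) =
    cint (- (pi / 2)) (pi / 2) (fun t => ('i * (p.[s%:C * cis (pi / 2 - t)] * conjc q.[s%:C * cis (pi / 2 - t)]) -
      'i * (p.[s%:C * cis (t - pi / 2)] * conjc q.[s%:C * cis (t - pi / 2)])) * (s * cos t)%:C).
    by apply: eq_cint => t _; rewrite !HE.
  rewrite E2 ReZ; congr (_ * _).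
  rewrite (@eq_cmean _ _ (fun z => ('X * p).[z] * conjc q.[z])); [|exact: ltW|by move=> z _; rewrite hornerM hornerX mulrA].
  rewrite E3 big_ord_recl coefXM mul0r mul0r add0r Re_sum; apply: eq_bigr => k _.
  rewrite lift0 coefXM qk /= rmorphM /= mulrA mulcJ.
  rewrite (_ : conjc (k.+1%:R)^-1 = ((k.+1%:R)^-1 : R)%:C); last first.
    by rewrite -[LHS]/(conjc (k.+1%:R)^-1) rmorphV ?unitfE ?pnatr_eq0 // rmorph_nat fmorphV rmorph_nat.
  by rewrite -!rmorphM /= mulrAC.
have iP : mu2.-integrable setT (EFin \o (fun v => if cmod (pt v - c) < s then complex.Re (p.[pt v - c] * conjc p.[pt v - c]) else 0)).
  by apply: (@integrable_disc c s (fun z => p.[z - c] * conjc p.[z - c])) => //; exact: (mCM (mp p) (mC_conj (mp p))).1.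
have ER : (fun v : R * R => (if cmod (pt v - c) < s then cmod p.[pt v - c] ^+ 2 else 0)%:E) =
   EFin \o (fun v => if cmod (pt v - c) < s then complex.Re (p.[pt v - c] * conjc p.[pt v - c]) else 0).
  by apply/funext => v /=; rewrite mulcJ.
have : (2%:E * \int[mu2]_v (if cmod (pt v - c) < s then cmod p.[pt v - c] ^+ 2 else 0)%:E =
   2%:E * (pi * \sum_(k < size p) cmod p`_k ^+ 2 * s ^+ (2 * k.+1) / k.+1%:R)%:E)%E.
  rewrite -EFinM mulrA E1 ER -integralZl //; apply: eq_integral => v _.
  by rewrite /= mulcJ.
have fin : (\int[mu2]_v (if cmod (pt v - c) < s then cmod p.[pt v - c] ^+ 2 else 0)%:E)%E \is a fin_num.
  by rewrite ER; exact: integrable_fin_num.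
by rewrite -(fineK fin) -!EFinM => -[] /mulfI -> //; rewrite pnatr_eq0.
Qed.

Lemma disc_const c s (k : R) : 0 < s ->
  (\int[mu2]_v (if cmod (pt v - c) < s then k ^+ 2 else 0)%:E)%E = (pi * k ^+ 2 * s ^+ 2)%:E.
Proof.
move=> s0; have [->|k0] := eqVneq k 0.
  by rewrite expr0n mulr0 mul0r; apply: integral0_eq => v _; rewrite if_same.
have kc0 : (k%:C : C) != 0 by rewrite -cmod_gt0 cmodR normr_gt0.
have := disc_parseval (k%:C)%:P c s0; rewrite size_polyC kc0 big_ord1 coefC /= cmodR real_normK ?num_real // muln1 divr1 mulrA => <-.
by apply: eq_integral => v _; rewrite hornerC cmodR real_normK ?num_real.
Qed.

End DiscIntegral.

(** * The area inequality *)

Section Area.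
Variable R : realType.
Local Notation C := R[i].
Local Notation mu := (@lebesgue_measure R).
Local Notation mu2 := (mu \x mu)%E.
Implicit Types (f g : C -> C) (s t x y : R) (z w c : C) (p q : {poly C}).

Lemma mC_sub c : mC (fun v : R * R => pt v - c).
Proof. by apply: mCD; [exact: mC_pt|exact: mC_cst]. Qed.

(** The density |w - c| ^ (-2) on an annulus, half-open so that consecutive annuli tile exactly. *)
Definition ring_inv c (a b : R) (v : R * R) : R :=
  if (a <= cmod (pt v - c)) && (cmod (pt v - c) < b) then (cmod (pt v - c) ^+ 2)^-1 else 0.

Lemma ring_inv_ge0 c a b v : 0 <= ring_inv c a b v.
Proof. by rewrite /ring_inv; case: ifP => // _; rewrite invr_ge0 sqr_ge0. Qed.

Lemma measurable_ring c (a b : R) : 0 <= a -> 0 <= b ->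
  measurable_fun setT (fun v => (a <= cmod (pt v - c)) && (cmod (pt v - c) < b)).
Proof. by move=> a0 b0; apply: measurable_and; [apply: mC_ge|apply: mC_lt] => //; exact: mC_sub. Qed.

Lemma measurable_ring_inv c (a b : R) : 0 <= a -> 0 <= b -> measurable_fun setT (ring_inv c a b).
Proof.
move=> a0 b0; apply: measurable_if; first exact: measurable_ring.
rewrite (_ : (fun v => _) = (fun v => (cmod (pt v - c) ^+ 2) `^ (-1))).
  exact: (measurableT_comp (@measurable_powR R (-1)) (mC_sqr (mC_sub c))).
by apply/funext => v; rewrite powR_inv1 // sqr_ge0.
Qed.

Lemma layer_integral c r (q : R) : 0 < r -> 1 < q ->
  (\int[mu2]_v (ring_inv c r (r * q) v)%:E <= (pi * (q ^+ 2 - 1))%:E)%E.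
Proof.
move=> r0 q1; have q0 : 0 < q by apply: lt_trans q1.
have rq0 : 0 < r * q by rewrite mulr_gt0.
pose L (v : R * R) : R := if (r <= cmod (pt v - c)) && (cmod (pt v - c) < r * q) then (r ^+ 2)^-1 else 0.
have mL : measurable_fun setT L.
  by apply: measurable_if; [apply: measurable_ring; rewrite ltW|exact: measurable_cst].
have L0 v : 0 <= L v by rewrite /L; case: ifP => // _; rewrite invr_ge0 sqr_ge0.
apply: (@le_trans _ _ (\int[mu2]_v (L v)%:E)%E).
  apply: ge0_le_integral => //; [by move=> v _; rewrite lee_fin ring_inv_ge0| |exact/measurable_EFinP|].
    by apply/measurable_EFinP; apply: measurable_ring_inv; rewrite ltW.
  move=> v _; rewrite lee_fin /ring_inv /L; case: ifP => // /andP[h1 _].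
  have h3 := lt_le_trans r0 h1.
  by rewrite lef_pV2 ?posrE ?exprn_gt0 // ler_pXn2r ?nnegrE ?cmod_ge0 ?(ltW r0).
have := disc_const c (r^-1) rq0; have := disc_const c (r^-1) r0.
have -> : (\int[mu2]_v (if (cmod (pt v - c) < r * q)%R then (r^-1 ^+ 2)%R else 0%R)%:E =
   \int[mu2]_v (L v)%:E + \int[mu2]_v (if (cmod (pt v - c) < r)%R then (r^-1 ^+ 2)%R else 0%R)%:E)%E.
  rewrite -ge0_integralD //.
  - apply: eq_integral => v _; rewrite -EFinD /L exprVn; congr EFin.
    have [h|h] := leP r (cmod (pt v - c)); first by rewrite addr0.
    by rewrite (lt_trans h) ?add0r // ltr_pMr.
  - by move=> v _; rewrite lee_fin.
  - exact/measurable_EFinP.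
  - by move=> v _; rewrite lee_fin; case: ifP => // _; exact: sqr_ge0.
  - by apply/measurable_EFinP; apply: measurable_if; [apply: mC_lt; [exact: ltW|exact: mC_sub]|exact: measurable_cst].
move=> ->; case: (\int[mu2]_v (L v)%:E)%E => [x| |] //.
rewrite -EFinD => -[xE]; rewrite lee_fin.
have -> : x = pi * r^-1 ^+ 2 * (r * q) ^+ 2 - pi * r^-1 ^+ 2 * r ^+ 2 by rewrite -xE addrK.
by rewrite le_eqVlt; apply/orP; left; apply/eqP; field; rewrite gt_eqF.
Qed.

Lemma layers_integral c r (n : nat) (q : R) : 0 < r -> 1 < q ->
  (\int[mu2]_v (ring_inv c r (r * q ^+ n) v)%:E <= (n%:R * (pi * (q ^+ 2 - 1)))%:E)%E.
Proof.
move=> r0 q1; have q0 : 0 < q by apply: lt_trans q1.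
have rq m : 0 < r * q ^+ m by rewrite mulr_gt0 // exprn_gt0.
elim: n => [|n IH].
  rewrite mul0r integral0_eq // => v _; rewrite /ring_inv; case: ifP => // /andP[h1 h2].
  by move: h2; rewrite expr0 mulr1 ltNge h1.
have -> : (\int[mu2]_v (ring_inv c r (r * q ^+ n.+1) v)%:E = \int[mu2]_v (ring_inv c r (r * q ^+ n) v)%:E
   + \int[mu2]_v (ring_inv c (r * q ^+ n) (r * q ^+ n * q) v)%:E)%E.
  rewrite -ge0_integralD //; try by move=> v _; rewrite lee_fin ring_inv_ge0.
  - apply: eq_integral => v _; rewrite -EFinD /ring_inv exprSr mulrA; congr EFin.
    have [h|h] := leP (r * q ^+ n) (cmod (pt v - c)).
      have -> : r <= cmod (pt v - c) by apply: le_trans h; rewrite ler_pMr // exprn_ege1 // ltW.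
      by rewrite /= add0r.
    have -> : cmod (pt v - c) < r * q ^+ n * q by rewrite (lt_trans h) // ltr_pMr.
    by rewrite /= addr0 andbT.
  - by apply/measurable_EFinP; apply: measurable_ring_inv; rewrite ltW.
  - by apply/measurable_EFinP; apply: measurable_ring_inv; rewrite ltW // mulr_gt0.
rewrite -addn1 natrD mulrDl mul1r EFinD; apply: leeD => //; exact: layer_integral.
Qed.

(** Cut into n annuli of ratio exp (L / n), L = ln (b / a), and bound the density by its largest
    value on each: n pi (exp (2 L / n) - 1) tends to 2 pi L. Areas of discs thus replace polar
    coordinates. *)
Lemma ring_integral c (a b : R) : 0 < a -> a < b ->
  (\int[mu2]_v (ring_inv c a b v)%:E <= (2 * pi * ln (b / a))%:E)%E.
Proof.
move=> a0 ab; have b0 : 0 < b by apply: lt_trans ab.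
have ba1 : 1 < b / a by rewrite ltr_pdivlMr // mul1r.
have L0 : 0 < ln (b / a) by rewrite ln_gt0.
have ba : b = a * expR (ln (b / a)) by rewrite lnK ?posrE ?divr_gt0 // mulrC divfK ?gt_eqF.
move: (ln (b / a)) L0 ba => L L0 ba.
have H (n : nat) : 2 * L < n%:R -> (\int[mu2]_v (ring_inv c a b v)%:E <= (2 * pi * L / (1 - 2 * L / n%:R))%:E)%E.
  move=> nL; have n0 : 0 < n%:R :> R by apply: lt_trans nL; rewrite mulr_gt0.
  have q1 : 1 < expR (L / n%:R) by rewrite expR_gt1 divr_gt0.
  have := layers_integral c n a0 q1; rewrite -!expRM_natr divfK ?gt_eqF // -ba => h.
  apply: le_trans h _; rewrite lee_fin.
  have u1 : 2 * L / n%:R < 1 by rewrite ltr_pdivrMr // mul1r.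
  have -> : L / n%:R * 2 = 2 * L / n%:R by rewrite mulrC mulrA.
  have -> : 2 * pi * L = n%:R * pi * (2 * L / n%:R) by field; rewrite gt_eqF.
  move: (2 * L / n%:R) u1 => u u1; rewrite [n%:R * (pi * _)]mulrA -[_ * u / _]mulrA ler_wpM2l ?mulr_ge0 ?pi_ge0 ?(ltW n0) //.
  have u1' : 0 < 1 - u by rewrite subr_gt0.
  rewrite lerBlDr -[X in _ + X](divff (lt0r_neq0 u1')) -mulrDl addrC subrK div1r.
  (* Here exp u <= 1 / (1 - u), from exp (- u) >= 1 - u. *)
  rewrite -[expR u]opprK -{1}[u]opprK expRN opprK lef_pV2 ?posrE ?expR_gt0 //.
  exact: expR_ge1Dx.
case E : (\int[mu2]_v (ring_inv c a b v)%:E)%E => [x| |]; last 1 first.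
- by rewrite leNye.
- rewrite lee_fin -subr_le0; apply: (@le0_eps _ _ (2 * pi * L)) => e e0.
  have [n hn] : exists n : nat, 2 * L * (1 + e) / e < n%:R.
    by exists (Num.Def.archi_bound (2 * L * (1 + e) / e)); apply: archi_boundP; rewrite divr_ge0 ?mulr_ge0 ?(ltW e0) ?(ltW L0) ?addr_ge0 ?(ltW e0).
  have nL : 2 * L < n%:R.
    apply: le_lt_trans hn; rewrite -mulrA ler_peMr ?mulr_ge0 ?(ltW L0) //.
    by rewrite ler_pdivlMr // mul1r lerDr.
  have n0 : 0 < n%:R :> R by apply: lt_trans nL; rewrite mulr_gt0.
  have := H n nL; rewrite E lee_fin => h.
  have u1 : 2 * L / n%:R <= e / (1 + e).
    have e1 : 0 < 1 + e by rewrite addr_gt0.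
    by rewrite ler_pdivrMr // mulrAC ler_pdivlMr // [e * _]mulrC -ler_pdivrMr // ltW.
  rewrite lerBlDr; apply: le_trans h _.
  have e1 : 0 < 1 + e by rewrite addr_gt0.
  have u2 : (1 + e)^-1 <= 1 - 2 * L / n%:R.
    have <- : 1 - e / (1 + e) = (1 + e)^-1 by field; rewrite gt_eqF.
    by rewrite lerD2l lerN2.
  have p1 : 0 <= 2 * pi * L by rewrite !mulr_ge0 ?pi_ge0 // ltW.
  apply: le_trans (_ : 2 * pi * L * (1 + e) <= _); last by rewrite mulrDr mulr1 addrC.
  rewrite ler_wpM2l // -[1 + e]invrK lef_pV2 ?posrE ?invr_gt0 //.
  by apply: lt_le_trans u2; rewrite invr_gt0.
have [n hn] : exists n : nat, 2 * L < n%:R by exists (Num.Def.archi_bound (2 * L)); apply: archi_boundP; rewrite mulr_ge0 // ltW.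
by have := H n hn; rewrite E.
Qed.

(** Adding the quadratic estimates based at z and at w bounds |f' w - f' z| |w - z| by 2 K |w - z| ^
    2. *)
Lemma deriv_lipschitz f s : hol f -> 0 <= s -> s < 1 -> exists2 K : R, 0 < K & forall z w, cmod z <= s -> cmod w <= s ->
  cmod (f w - f z - derive1 f z * (w - z)) <= K * cmod (w - z) ^+ 2 /\
  cmod (derive1 f w - derive1 f z) <= K * cmod (w - z).
Proof.
move=> hf s0 s1; have [a fa] := hol_taylor hf; have [fa' _] := taylor_deriv fa.
have [K K0 HK] := taylor_quad fa fa' s0 s1.
exists (2 * K + 1) => [|z w zs ws]; first by rewrite ltr_wpDl // mulr_ge0.
have x0 := cmod_ge0 (w - z).
split.
  by apply: le_trans (HK z w zs ws) _; rewrite ler_wpM2r ?exprn_ge0 //; lra.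
have [->|wz] := eqVneq w z; first by rewrite !subrr cmod0 mulr0.
have x1 : 0 < cmod (w - z) by rewrite cmod_gt0 subr_eq0.
have h1 := HK z w zs ws; have h2 := HK w z ws zs; rewrite (cmodC z w) in h2.
rewrite -(ler_pM2r x1) -cmodM.
have -> : (derive1 f w - derive1 f z) * (w - z) = (f w - f z - derive1 f z * (w - z)) + (f z - f w - derive1 f w * (z - w)).
  by move: (derive1 f w) (derive1 f z) (f w) (f z) => a1 a2 a3 a4; ring.
apply: le_trans (cmodD _ _) _; move: h1 h2; move: (cmod (_ - _ - _)) (cmod (_ - _ - _)) (cmod (w - z)) x1 => a1 a2 x x1 h1 h2.
rewrite -mulrA -expr2; have := exprn_gt0 2 x1; move: (x ^+ 2) h1 h2 => y; clear -K0; nra.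
Qed.

(** For w near f z1, injectivity confines all z with |w - f z| < del to a neighbourhood of z1 where
    f is almost affine. They lie in a disc of radius nearly del / |f' z1|, on which |f' / (f - w0)|
    is at most nearly |f' z1| / |w - w0|. What matters is that [del] is uniform in z1 and w. *)
Lemma area_local f s w0 (B d t : R) : hol f -> inj_disc f -> 0 <= s -> s < 1 -> 0 < d -> 0 < t -> t <= 1 ->
  (forall z, cmod z <= s -> d <= cmod (f z - w0) <= B) ->
  exists2 del : R, 0 < del & forall w z1, cmod z1 <= s -> cmod (w - f z1) < del ->
    d / (1 + t) <= cmod (w - w0) < (1 + t) * B /\
    forall z, cmod z <= s -> cmod (w - f z) < del ->
      cmod (z - (z1 + (w - f z1) / derive1 f z1)) < (1 + t) * del / cmod (derive1 f z1) /\
      cmod (derive1 f z / (f z - w0)) <= (1 + t) ^+ 2 * cmod (derive1 f z1) / cmod (w - w0).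
Proof.
move=> hf injf s0 s1 d0 t0 t1 fB.
have [K K0 HK] := deriv_lipschitz hf s0 s1.
have [c c0 Hc] := inj_bilip hf injf s0 s1.
have [|| c2 c20 Hc2] := @disc_lower_bound R (derive1 f) s.
- by move=> z zs; apply: hol_cont (hol_deriv hf) (le_lt_trans zs s1).
- by move=> z zs; apply: inj_deriv => //; exact: le_lt_trans zs s1.
(* In proportion to t, the three conditions control the linearization error, the variation of f' and
   the variation of |f - w0|. *)
have [del [del0 D1 D2 D3]] : exists del, [/\ 0 < del, 4 * K * del <= t * c ^+ 2, 2 * K * del <= t * c * c2 & 2 * del <= t * d].
  exists (Num.min (t * c ^+ 2 / (4 * K)) (Num.min (t * c * c2 / (2 * K)) (t * d / 2))); split.
  - by rewrite !lt_min !divr_gt0 ?mulr_gt0 ?exprn_gt0.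
  - by rewrite mulrC -ler_pdivlMr ?mulr_gt0 // ge_min lexx.
  - by rewrite mulrC -ler_pdivlMr ?mulr_gt0 // !ge_min lexx orbT.
  - by rewrite mulrC -ler_pdivlMr ?mulr_gt0 // !ge_min lexx !orbT.
exists del => // w z1 z1s wz1.
have e1 : 0 < 1 + t by rewrite addr_gt0.
have [dz1 zB1] := andP (fB z1 z1s).
have B0 : d <= B by apply: le_trans zB1.
have tr1 := cmod_tri (f z1) w0 w; have tr2 := cmod_tri w w0 (f z1).
rewrite (cmodC (f z1) w) in tr1.
have low : d / (1 + t) <= cmod (w - w0).
  rewrite ler_pdivrMr //; move: tr1 dz1 wz1 D3; move: (cmod (f z1 - w0)) (cmod (w - f z1)) (cmod (w - w0)) (cmod_ge0 (w - w0)) => x y u u0 *.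
  by nra.
split.
  rewrite low /=; move: tr2 zB1 wz1 D3; move: (cmod (f z1 - w0)) (cmod (w - f z1)) (cmod (w - w0)) => x y u *.
  by nra.
have w00 : 0 < cmod (w - w0) by apply: lt_le_trans low; rewrite divr_gt0.
move=> z zs wz.
have [dz zB] := andP (fB z zs).
have zz1 : c * cmod (z - z1) <= 2 * del.
  apply: le_trans (Hc z z1 zs z1s) _; have := cmod_tri (f z) (f z1) w; rewrite (cmodC (f z) w).
  by move: wz wz1; move: (cmod _) (cmod _) (cmod _) => x y u; clear; lra.
have [q1 q2] := HK z1 z z1s zs.
have g1 := Hc2 z1 z1s; have g1' : 0 < cmod (derive1 f z1) by apply: lt_le_trans g1.
have gn : derive1 f z1 != 0 by rewrite -cmod_gt0.
have x0 := cmod_ge0 (z - z1).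
split.
  rewrite ltr_pdivlMr // -cmodM.
  have -> : (z - (z1 + (w - f z1) / derive1 f z1)) * derive1 f z1 = (f z - w) - (f z - f z1 - derive1 f z1 * (z - z1)).
    by move: (derive1 f z1) gn (f z) (f z1) => a an b b1; field.
  apply: le_lt_trans (cmodB _ _) _; rewrite (cmodC (f z) w).
  move: q1 wz; move: (cmod (w - f z)) (cmod (_ - _ - _)) (cmod (z - z1)) zz1 x0 => x y u h u0 q1 wz.
  have k1 : (c * u) ^+ 2 <= (2 * del) ^+ 2 by rewrite ler_pXn2r ?nnegrE ?mulr_ge0 // ltW.
  have k2 : c ^+ 2 * (K * u ^+ 2) <= c ^+ 2 * (t * del).
    apply: (@le_trans _ _ (K * (2 * del) ^+ 2)); first by rewrite mulrCA -exprMn ler_pM2l.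
    have -> : K * (2 * del) ^+ 2 = 4 * K * del * del by ring.
    by rewrite [c ^+ 2 * _]mulrCA mulrA ler_pM2r // mulrC (le_trans D1) // mulrC.
  rewrite ler_pM2l ?exprn_gt0 // in k2; rewrite mulrDl mul1r.
  by move: q1 wz k2; move: (K * u ^+ 2) (t * del) => a b; clear; lra.
have k1 : cmod (derive1 f z) <= (1 + t) * cmod (derive1 f z1).
  have := cmodD (derive1 f z - derive1 f z1) (derive1 f z1); rewrite subrK => h; apply: le_trans h _.
  rewrite mulrDl mul1r addrC lerD2l; apply: le_trans q2 _.
  apply: (@le_trans _ _ (t * c2)); last by rewrite ler_pM2l.
  rewrite -(ler_pM2l c0) mulrCA; apply: (@le_trans _ _ (K * (2 * del))); first by rewrite ler_pM2l.
  rewrite (_ : K * (2 * del) = 2 * K * del); last by rewrite mulrCA mulrA.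
  by rewrite (_ : c * (t * c2) = t * c * c2) // mulrCA mulrA.
have k2 : cmod (w - w0) <= (1 + t) * cmod (f z - w0).
  have := cmod_tri w w0 (f z); move: wz dz D3; move: (cmod (w - w0)) (cmod (w - f z)) (cmod (f z - w0)) => x y u; clear -t0 d0.
  by nra.
have fz0 : 0 < cmod (f z - w0) by apply: lt_le_trans dz.
rewrite cmodM cmodV ler_pdivrMr // mulrAC ler_pdivlMr //.
have -> : (1 + t) ^+ 2 * cmod (derive1 f z1) * cmod (f z - w0) = (1 + t) * cmod (derive1 f z1) * ((1 + t) * cmod (f z - w0)).
  by move: (cmod _) (cmod _) => x y; ring.
by apply: ler_pM; rewrite ?cmod_ge0.
Qed.

(* An alias of the plane measure: for the product itself, inference picks the instance reserved
   for products of subprobabilities. *)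
Definition plane_measure : set (measurableTypeR R * measurableTypeR R)%type -> \bar R := mu2.
HB.instance Definition _ := Measure.copy plane_measure mu2.

Lemma plane_measure_sigma_finite : sigma_finite setT plane_measure.
Proof.
exists (fun n => disc 0 n%:R).
  apply/seteqP; split => // v _.
  exists (Num.Def.archi_bound (cmod (pt v))) => //; rewrite /disc /= subr0.
  by apply: archi_boundP; exact: cmod_ge0.
by move=> n; split; [exact: measurable_disc|exact: mu2_disc_lty].
Qed.

HB.instance Definition _ := Measure_isSigmaFinite.Build _ _ _ plane_measure plane_measure_sigma_finite.

(** The slice at fixed w is empty or lies in the disc of [area_local]. The area of that disc times
    the squared bound for |g| is free of f' z1 and leaves |w - w0| ^ (-2); two powers of 1 + t come
    from the radius, four from the bound. *)
Lemma area_slice f g s w0 (B d t del : R) (phi : R * R -> C) (psi : R * R -> R) (w : R * R) : 0 < t -> 0 < d -> 0 < del ->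
  (forall w z1, cmod z1 <= s -> cmod (w - f z1) < del ->
    d / (1 + t) <= cmod (w - w0) < (1 + t) * B /\
    forall z, cmod z <= s -> cmod (w - f z) < del ->
      cmod (z - (z1 + (w - f z1) / derive1 f z1)) < (1 + t) * del / cmod (derive1 f z1) /\
      cmod (g z) <= (1 + t) ^+ 2 * cmod (derive1 f z1) / cmod (w - w0)) ->
  (forall z, cmod z < s -> 0 < cmod (derive1 f z)) ->
  (forall v, cmod (pt v) < s -> phi v = f (pt v)) -> (forall v, cmod (pt v) < s -> psi v = cmod (g (pt v)) ^+ 2) ->
  (forall v, 0 <= psi v) ->
  measurable_fun setT (fun v => (if (cmod (pt v) < s) && (cmod (pt w - phi v) < del) then psi v else 0)%:E) ->
  (\int[mu2]_z (if (cmod (pt z) < s) && (cmod (pt w - phi z) < del) then psi z else 0)%:E <=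
    (pi * del ^+ 2 * (1 + t) ^+ 6)%:E * (ring_inv w0 (d / (1 + t)) ((1 + t) * B) w)%:E)%E.
Proof.
move=> t0 d0 del0 Hloc g0 phiE psiE psi0 mF.
have e1 : 0 < 1 + t by rewrite addr_gt0.
have [[z1 z1s zw]|no] := pselect (exists2 z : R * R, cmod (pt z) < s & cmod (pt w - phi z) < del); last first.
  rewrite integral0_eq.
    by rewrite -EFinM lee_fin mulr_ge0 ?ring_inv_ge0 // !mulr_ge0 ?pi_ge0 ?sqr_ge0 ?exprn_ge0 // ltW.
  move=> z _; case: ifP => [/andP[h1 h2]|_]; last exact: erefl.
  exfalso; apply: no; exact: (ex_intro2 _ _ z h1 h2).
rewrite phiE // in zw.
have [/andP[w1 w2] loc] := Hloc (pt w) (pt z1) (ltW z1s) zw.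
have {}g0 := g0 _ z1s.
have w00 : 0 < cmod (pt w - w0) by apply: lt_le_trans w1; rewrite divr_gt0.
rewrite /ring_inv w1 w2 /= -EFinM.
move: (_ + _ / _) loc => c1 loc.
have [r1 [r10 r1E]] : exists r1, 0 < r1 /\ r1 = (1 + t) * del / cmod (derive1 f (pt z1)).
  by eexists; split; last reflexivity; rewrite divr_gt0 // mulr_gt0.
have [k1 [k10 k1E]] : exists k1, 0 <= k1 /\ k1 = (1 + t) ^+ 2 * cmod (derive1 f (pt z1)) / cmod (pt w - w0).
  by eexists; split; last reflexivity; rewrite divr_ge0 ?cmod_ge0 // mulr_ge0 ?exprn_ge0 ?cmod_ge0 // ltW.
rewrite -r1E -k1E in loc.
have <- : pi * k1 ^+ 2 * r1 ^+ 2 = pi * del ^+ 2 * (1 + t) ^+ 6 * (cmod (pt w - w0) ^+ 2)^-1.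
  rewrite r1E k1E; move: (cmod _) (cmod _) g0 w00 => x y x0 y0.
  by field; rewrite !gt_eqF.
rewrite -(disc_const c1 k1 r10); apply: ge0_le_integral.
- exact: measurableT.
- by move=> z _; rewrite lee_fin; case: ifP.
- exact: mF.
- by apply/measurable_EFinP; apply: measurable_if; [apply: mC_lt; [exact: ltW|exact: mC_sub]|exact: measurable_cst].
move=> z _; rewrite lee_fin; case: ifP => [/andP[h1 h2]|_]; last by case: ifP => // _; exact: sqr_ge0.
rewrite phiE // in h2; have [l1 l2] := loc (pt z) (ltW h1) h2.
by rewrite l1 psiE // lerXn2r ?nnegrE ?cmod_ge0.
Qed.

(* Tonelli for the indicator of |w - f z| < del: integrating first in w gives the area
   pi del ^ 2; integrating first in z gives almost pi del ^ 2 / |f' z| ^ 2 by injectivity. *)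
Lemma area_core f s w0 (B d t : R) : hol f -> inj_disc f -> 0 < s -> s < 1 -> 0 < d -> 0 < t -> t <= 1 ->
  (forall z, cmod z <= s -> d <= cmod (f z - w0) <= B) ->
  mC (fun v => if cmod (pt v) < s then f (pt v) else 0) ->
  mC (fun v => if cmod (pt v) < s then derive1 f (pt v) / (f (pt v) - w0) else 0) ->
  (\int[mu2]_v (if cmod (pt v) < s then cmod (derive1 f (pt v) / (f (pt v) - w0)) ^+ 2 else 0)%:E <=
   ((1 + t) ^+ 6 * (2 * pi * ln ((1 + t) ^+ 2 * (B / d))))%:E)%E.
Proof.
move=> hf injf s0 s1 d0 t0 t1 fB mf mV.
have [del del0 Hloc] := area_local hf injf (ltW s0) s1 d0 t0 t1 fB.
have e1 : 0 < 1 + t by rewrite addr_gt0.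
have dB : d <= B by have /andP[h1 h2] := fB 0 (eq_ind_r (fun x => x <= s) (ltW s0) (cmod0 R)); apply: le_trans h2.
have B0 : 0 < B by apply: lt_le_trans dB.
have a0 : 0 < d / (1 + t) by rewrite divr_gt0.
have b0 : 0 < (1 + t) * B by rewrite mulr_gt0.
have ab : d / (1 + t) < (1 + t) * B.
  rewrite ltr_pdivrMr // mulrAC -expr2; apply: le_lt_trans dB _.
  by rewrite ltr_pMl // expr_gt1 ?ltW // ltrDl.
have RI := ring_integral w0 a0 ab.
have pd : 0 < pi * del ^+ 2 by rewrite mulr_gt0 ?pi_gt0 ?exprn_gt0.
have lnE : ln ((1 + t) * B / (d / (1 + t))) = ln ((1 + t) ^+ 2 * (B / d)).
  by congr ln; field; rewrite !gt_eqF.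
have E2 : ((pi * del ^+ 2)%:E * ((1 + t) ^+ 6 * (2 * pi * ln ((1 + t) ^+ 2 * (B / d))))%:E =
    (pi * del ^+ 2 * (1 + t) ^+ 6)%:E * (2 * pi * ln ((1 + t) * B / (d / (1 + t))))%:E)%E.
  by rewrite lnE -!EFinM; congr EFin; move: (ln _) => l; ring.
have k0 : 0 <= pi * del ^+ 2 by rewrite mulr_ge0 ?pi_ge0 ?sqr_ge0.
have k0' : 0 <= pi * del ^+ 2 * (1 + t) ^+ 6 by rewrite !mulr_ge0 ?pi_ge0 ?sqr_ge0 ?exprn_ge0 // ltW.
have t6 : 0 <= (1 + t) ^+ 6 by rewrite exprn_ge0 // ltW.
have kE (a b : R) : 0 < a -> 0 < b -> pi * ((1 + t) ^+ 2 * a / b) ^+ 2 * ((1 + t) * del / a) ^+ 2 =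
    pi * del ^+ 2 * (1 + t) ^+ 6 * (b ^+ 2)^-1.
  by move=> ha hb; field; rewrite !gt_eqF.
have g0 z : cmod z < s -> 0 < cmod (derive1 f z).
  by move=> zs; rewrite cmod_gt0; apply: inj_deriv => //; exact: lt_trans zs s1.
pose V z := derive1 f z / (f z - w0).
pose phi (v : R * R) : C := if cmod (pt v) < s then f (pt v) else 0.
pose psi (v : R * R) : R := if cmod (pt v) < s then cmod (V (pt v)) ^+ 2 else 0.
have psi0 v : 0 <= psi v by rewrite /psi; case: ifP => // _; exact: sqr_ge0.
have mpsi : measurable_fun setT psi.
  have := mC_sqr mV; congr (measurable_fun _ _); apply/funext => v; rewrite /psi.
  by case: ifP => // _; rewrite cmod0 expr0n.
have phiE v : cmod (pt v) < s -> phi v = f (pt v) by rewrite /phi => ->.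
have psiE v : cmod (pt v) < s -> psi v = cmod (V (pt v)) ^+ 2 by rewrite /psi => ->.
pose F (u : (R * R) * (R * R)) : R := if (cmod (pt u.1) < s) && (cmod (pt u.2 - phi u.1) < del) then psi u.1 else 0.
have F0 u : 0 <= F u by rewrite /F; case: ifP.
have mF : measurable_fun setT (EFin \o F).
  apply/measurable_EFinP; apply: measurable_if; last exact: (measurableT_comp mpsi measurable_fst).
  apply: measurable_and.
    by apply: mC_lt; [exact: ltW|exact: (mC_comp (mC_pt R) measurable_fst)].
  apply: mC_lt; first exact: ltW.
  have := mCD (mC_comp (mC_pt R) measurable_snd) (mCM (mC_cst _ (-1)) (mC_comp mf measurable_fst)).
  by congr mC; apply/funext => u; rewrite mulN1r.
have T := @fubini_tonelli _ _ _ _ R plane_measure plane_measure (EFin \o F) mF F0.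
have L : (\int[mu2]_z \int[mu2]_w (F (z, w))%:E = (pi * del ^+ 2)%:E * \int[mu2]_v (psi v)%:E)%E.
  have p0 v : setT v -> (0 <= (psi v)%:E)%E by move=> _; rewrite lee_fin.
  have mp : measurable_fun setT (fun v => (psi v)%:E) by exact/measurable_EFinP.
  rewrite -(@ge0_integralZl_EFin _ _ R mu2 setT measurableT (fun v => (psi v)%:E) p0 mp _ k0).
  apply: eq_integral => v _; rewrite /F /psi /phi /=.
  case: (ltP (cmod (pt v)) s) => h /=; last first.
    by rewrite mule0; apply: integral0_eq.
  by rewrite (disc_const (f (pt v)) (cmod (V (pt v))) del0) -EFinM mulrAC.
have U : (\int[mu2]_w \int[mu2]_z (F (z, w))%:E <=
   (pi * del ^+ 2 * (1 + t) ^+ 6)%:E * \int[mu2]_v (ring_inv w0 (d / (1 + t)) ((1 + t) * B) v)%:E)%E.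
  have mr : measurable_fun setT (EFin \o ring_inv w0 (d / (1 + t)) ((1 + t) * B)).
    by apply/measurable_EFinP; apply: measurable_ring_inv; rewrite ltW.
  have p0 v : setT v -> (0 <= (ring_inv w0 (d / (1 + t)) ((1 + t) * B) v)%:E)%E by move=> _; rewrite lee_fin ring_inv_ge0.
  rewrite -(@ge0_integralZl_EFin _ _ R mu2 setT measurableT (fun v => (ring_inv w0 (d / (1 + t)) ((1 + t) * B) v)%:E) p0 mr _ k0').
    apply: ge0_le_integral.
    + exact: measurableT.
    + by move=> w _; apply: integral_ge0 => z _; rewrite lee_fin.
    + exact: (@measurable_fun_fubini_tonelli_G _ _ _ _ R plane_measure (EFin \o F) mF F0).
    + exact: measurable_funeM.
    move=> w _; apply: (area_slice t0 d0 del0 Hloc g0 phiE psiE psi0).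
    exact: (measurableT_comp mF (measurable_fun_pair (@measurable_id _ _ setT) (measurable_cst w))).
rewrite L in T; rewrite -T in U.
have : ((pi * del ^+ 2)%:E * \int[mu2]_v (psi v)%:E <=
  (pi * del ^+ 2)%:E * ((1 + t) ^+ 6 * (2 * pi * ln ((1 + t) ^+ 2 * (B / d))))%:E)%E.
  rewrite E2; apply: le_trans U _.
  apply: lee_pmul; [by rewrite lee_fin| |exact: lexx|exact: RI].
  by apply: integral_ge0 => v _; rewrite lee_fin ring_inv_ge0.
by rewrite lee_pmul2l.
Qed.

Lemma disc_parseval0 p s : 0 < s ->
  (\int[mu2]_v (if cmod (pt v) < s then cmod p.[pt v] ^+ 2 else 0)%:E)%E =
  (pi * \sum_(k < size p) cmod p`_k ^+ 2 * s ^+ (2 * k.+1) / k.+1%:R)%:E.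
Proof. by move=> s0; rewrite -(disc_parseval p 0 s0); apply: eq_integral => v _; rewrite subr0. Qed.

Lemma mC_unif_disc (g : C -> C) (P : nat -> {poly C}) s : 0 <= s ->
  (forall e : R, 0 < e -> exists m, forall k, (m <= k)%N -> forall z, cmod z <= s -> cmod (g z - (P k).[z]) <= e) ->
  mC (fun v : R * R => if cmod (pt v) < s then g (pt v) else 0).
Proof.
move=> s0 gP; apply: (@mC_lim _ _ _ (fun k v => if cmod (pt v) < s then (P k).[pt v] else 0)).
  by move=> k; apply: mC_if; [apply: mC_lt => //; exact: mC_pt|apply: mC_poly; exact: mC_pt].
move=> v e e0; have [m hm] := gP e e0; exists m => k mk.
by case: ifP => [/ltW h|_]; [exact: hm|rewrite subrr cmod0 ltW].
Qed.

Lemma area_limit_arith (x l L t e u : R) : 0 <= l -> l <= t -> 0 < t -> t <= 1 -> t <= e -> 0 <= L -> 0 <= u ->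
  x <= (1 + t) ^+ 6 * (u * (2 * l + L)) -> x - u * L <= u * (128 + 63 * L) * e.
Proof.
move=> l0 lt t0 t1 te L0 u0 h; rewrite lerBlDr; apply: le_trans h _.
(* On [0, 1] a convex function lies below its chord, and 63 = 2 ^ 6 - 1. *)
have p6 : (1 + t) ^+ 6 <= 1 + 63 * t.
  have -> : (1 + t) ^+ 6 = 1 + t * (6 + t * (15 + t * (20 + t * (15 + t * (6 + t))))) by ring.
  rewrite lerD2l [63 * t]mulrC ler_pM2l //.
  have h1 : t * (6 + t) <= 7 by nra.
  have h2 : t * (15 + t * (6 + t)) <= 22 by nra.
  have h3 : t * (20 + t * (15 + t * (6 + t))) <= 42 by nra.
  by nra.
apply: (@le_trans _ _ ((1 + 63 * t) * (u * (2 * t + L)))).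
  apply: ler_pM => //; [by rewrite exprn_ge0 // addr_ge0 // ltW|by rewrite mulr_ge0 // addr_ge0 // mulr_ge0|].
  by rewrite ler_wpM2l // lerD2r ler_pM2l.
have -> : (1 + 63 * t) * (u * (2 * t + L)) = u * (t * (2 + 126 * t + 63 * L)) + u * L by ring.
rewrite lerD2r -mulrA ler_wpM2l //; nra.
Qed.

Lemma ln_sqrM (x y : R) : 0 < x -> 0 < y -> ln (x ^+ 2 * y) = 2 * ln x + ln y.
Proof. by move=> x0 y0; rewrite expr2 !lnM ?posrE ?mulr_gt0 //; ring. Qed.

Lemma ler_sum_ord (g : nat -> R) m n : (forall i, 0 <= g i) -> (m <= n)%N -> \sum_(i < m) g i <= \sum_(i < n) g i.
Proof.
move=> g0 mn; rewrite -!(big_mkord xpredT) (big_cat_nat (leq0n m) mn) //= lerDl; exact: sumr_ge0.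
Qed.

Lemma sum_ord_support (g : nat -> R) m n : (forall i, (m <= i)%N -> g i = 0) -> (m <= n)%N ->
  \sum_(i < n) g i = \sum_(i < m) g i.
Proof.
move=> g0 mn; rewrite -!(big_mkord xpredT) (big_cat_nat (leq0n m) mn) //= [X in _ + X]big1_seq ?addr0 // => i /andP[_].
by rewrite mem_index_iota => /andP[/g0].
Qed.

(** Letting t tend to 0 in [area_core] bounds the integral of |f' / (f - w0)| ^ 2 over |z| < s;
    Parseval for polynomial approximations, cut at J, does the rest. Approximation is asked on |z|
    <= s only, because f - w0 may vanish further out. *)
Lemma area_inequality f s w0 (B d : R) (c : nat -> C) J : hol f -> inj_disc f -> 0 < s -> s < 1 -> 0 < d ->
  (forall z, cmod z <= s -> d <= cmod (f z - w0) <= B) ->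
  (forall e : R, 0 < e -> exists m, forall k, (m <= k)%N -> forall z, cmod z <= s ->
     cmod (derive1 f z / (f z - w0) - (ppoly c k).[z]) <= e) ->
  \sum_(j < J) cmod (c j) ^+ 2 * s ^+ (2 * j.+1) / j.+1%:R <= 2 * ln (B / d).
Proof.
move=> hf injf s0 s1 d0 fB hc.
have mV := mC_unif_disc (ltW s0) hc.
have mf : mC (fun v : R * R => if cmod (pt v) < s then f (pt v) else 0).
  have [a fa] := hol_taylor hf; apply: (@mC_unif_disc f (ppoly a)); first exact: ltW.
  by move=> e e0; have [m hm] := taylor_unif fa (ltW s0) s1 e0; exists m => k mk z; exact: hm.
have AC t (t0 : 0 < t) (t1 : t <= 1) := area_core hf injf s0 s1 d0 t0 t1 fB mf mV.
have dB : d <= B by have /andP[h1 h2] := fB 0 (eq_ind_r (fun x => x <= s) (ltW s0) (cmod0 R)); apply: le_trans h2.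
have B0 : 0 < B by apply: lt_le_trans dB.
have L0 : 0 <= ln (B / d) by rewrite ln_ge0 // ler_pdivlMr // mul1r.
pose V z := derive1 f z / (f z - w0).
have mX : measurable_fun setT (fun v : R * R => if cmod (pt v) < s then cmod (V (pt v)) ^+ 2 else 0).
  have := mC_sqr mV; congr (measurable_fun _ _); apply/funext => v.
  by case: ifP => // _; rewrite cmod0 expr0n.
have {}AC t : 0 < t -> t <= 1 -> (\int[mu2]_v (if cmod (pt v) < s then cmod (V (pt v)) ^+ 2 else 0)%:E <=
   ((1 + t) ^+ 6 * (2 * pi * ln ((1 + t) ^+ 2 * (B / d))))%:E)%E := @AC t.
have {}hc (e : R) : 0 < e -> exists m, forall k, (m <= k)%N -> forall z, cmod z <= s ->
   cmod (V z - (ppoly c k).[z]) <= e := hc e.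
clear mV mf; clearbody V.
have X0 v : 0 <= if cmod (pt v) < s then cmod (V (pt v)) ^+ 2 else 0 by case: ifP => // _; exact: sqr_ge0.
have [x xE] : exists x : R, (\int[mu2]_v (if cmod (pt v) < s then cmod (V (pt v)) ^+ 2 else 0)%:E)%E = x%:E.
  have := AC 1 ltr01 (lexx 1).
  have : (0 <= \int[mu2]_v (if cmod (pt v) < s then cmod (V (pt v)) ^+ 2 else 0)%:E)%E.
    by apply: integral_ge0 => v _; rewrite lee_fin.
  by case: (\int[mu2]_v _)%E => // x _ _; exists x.
have x2 : x <= 2 * pi * ln (B / d).
  rewrite -subr_le0; apply: (@le0_eps _ _ (2 * pi * (128 + 63 * ln (B / d)))) => e e0.
  have [t [t0 t1 te]] : exists t : R, [/\ 0 < t, t <= 1 & t <= e].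
    by exists (Num.min e 1); rewrite lt_min e0 ltr01 !ge_min !lexx orbT.
  have := AC t t0 t1; rewrite xE lee_fin (ln_sqrM (addr_gt0 ltr01 t0) (divr_gt0 B0 d0)) => h.
  apply: area_limit_arith h => //.
  - by rewrite ln_ge0 // lerDl ltW.
  - by apply: le_ln1Dx; apply: lt_trans t0; rewrite ltrN10.
  - by rewrite mulr_ge0 ?pi_ge0.
have x0 : 0 <= x by rewrite -lee_fin -xE; apply: integral_ge0 => v _; rewrite lee_fin.
clear AC.
rewrite -(ler_pM2l (pi_gt0 R)) mulrA [pi * 2]mulrC; apply: le_trans x2.
rewrite -subr_le0; apply: (@le0_eps _ _ (x + 2 * (pi * s ^+ 2))) => e e0.
have [t [t0 t1 te]] : exists t : R, [/\ 0 < t, t <= 1 & t <= e].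
  by exists (Num.min e 1); rewrite lt_min e0 ltr01 !ge_min !lexx orbT.
have [m hm] := hc t t0; pose k := maxn m J; have pk := hm k (leq_maxl _ _).
have := disc_parseval0 (ppoly c k) s0.
set S := \sum_(k < size _) _ => PE.
have SJ : \sum_(j < J) cmod (c j) ^+ 2 * s ^+ (2 * j.+1) / j.+1%:R <= S.
  have Jk : (J <= k)%N by rewrite leq_maxr.
  have g0 i : 0 <= cmod (ppoly c k)`_i ^+ 2 * s ^+ (2 * i.+1) / i.+1%:R.
    by rewrite divr_ge0 // mulr_ge0 ?exprn_ge0 ?cmod_ge0 // ltW.
  have gz i : (size (ppoly c k) <= i)%N -> cmod (ppoly c k)`_i ^+ 2 * s ^+ (2 * i.+1) / i.+1%:R = 0.
    by move=> h; rewrite nth_default // cmod0 expr0n !mul0r.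
  rewrite /S -(sum_ord_support gz (leq_maxl _ J)).
  apply: le_trans (ler_sum_ord g0 (leq_maxr (size (ppoly c k)) J)).
  by apply: ler_sum => i _; rewrite coef_poly (leq_trans (ltn_ord i) Jk).
(* If |p - V| <= t <= 1 then |p| ^ 2 <= (1 + t) |V| ^ 2 + 2 t; the square root fits 2 t to the shape
   of [disc_const]. *)
have t20 : 0 <= 2 * t by rewrite mulr_ge0 // ltW.
have dc := disc_const 0 (Num.sqrt (2 * t)) s0; rewrite sqr_sqrtr // in dc.
have : (\int[mu2]_v (if cmod (pt v) < s then cmod (ppoly c k).[pt v] ^+ 2 else 0)%:E <=
   (1 + t)%:E * \int[mu2]_v (if cmod (pt v) < s then cmod (V (pt v)) ^+ 2 else 0)%:E +
   \int[mu2]_v (if cmod (pt v - 0)%R < s then 2 * t else 0)%:E)%E.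
  have mt : measurable_fun setT (fun v : R * R => (if cmod (pt v - 0) < s then 2 * t else 0)%:E).
    by apply/measurable_EFinP; apply: measurable_if; [apply: mC_lt; [exact: ltW|exact: mC_sub]|exact: measurable_cst].
  have tt0 : 0 <= 1 + t by rewrite addr_ge0 // ltW.
  have mX1 : measurable_fun setT (fun v : R * R => (if cmod (pt v) < s then cmod (V (pt v)) ^+ 2 else 0)%:E) by exact/measurable_EFinP.
  rewrite -(@ge0_integralZl_EFin _ _ R mu2 setT measurableT _ _ mX1 _ tt0); last by move=> v _; rewrite lee_fin.
  rewrite -ge0_integralD.
  - apply: ge0_le_integral; [exact: measurableT|..].
    + by move=> v _; rewrite lee_fin; case: ifP => // _; exact: sqr_ge0.
    + apply/measurable_EFinP; apply: measurable_if; first by apply: mC_lt; [exact: ltW|exact: mC_pt].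
      by apply: mC_sqr; apply: mC_poly; exact: mC_pt.
    + by apply: emeasurable_funD => //; exact: measurable_funeM.
    move=> v _; rewrite subr0 -EFinM -EFinD lee_fin; case: ifP => [vs|_]; last by rewrite mulr0 addr0.
    have := pk (pt v) (ltW vs); rewrite cmodC => h.
    have := cmod_tri (ppoly c k).[pt v] 0 (V (pt v)); rewrite !subr0.
    move: h (cmod_ge0 (ppoly c k).[pt v]) (cmod_ge0 (V (pt v))).
    move: (cmod ((ppoly c k).[pt v] - V (pt v))) (cmod (ppoly c k).[pt v]) (cmod (V (pt v))) => a b u h b0 u0 bu.
    apply: (@le_trans _ _ ((t + u) ^+ 2)); first by rewrite lerXn2r ?nnegrE ?addr_ge0 ?(ltW t0) // (le_trans bu) // lerD2r.
    rewrite sqrrD; clear -t0 t1 u0; have := sqr_ge0 (u - 1); rewrite sqrrB1 => h; nra.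
  - exact: measurableT.
  - by move=> v _; rewrite -EFinM lee_fin mulr_ge0.
  - exact: measurable_funeM.
  - by move=> v _; rewrite lee_fin; case: ifP.
  - exact: mt.
rewrite PE xE dc -EFinM -EFinD lee_fin => h.
have : pi * (\sum_(j < J) cmod (c j) ^+ 2 * s ^+ (2 * j.+1) / j.+1%:R) <= pi * S by rewrite ler_pM2l ?pi_gt0.
have : 0 <= pi * s ^+ 2 by rewrite mulr_ge0 ?pi_ge0 ?sqr_ge0.
move: h; rewrite (_ : pi * (2 * t) * s ^+ 2 = pi * s ^+ 2 * (2 * t)); last by ring.
move: (pi * S) (pi * _) (pi * s ^+ 2) => a b u h u0 h2.
clear -x0 te h u0 h2; nra.
Qed.
End Area.

(** * The logarithm of the difference quotient *)

Definition fps (A : Type) := nat -> A.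

Section FPS.
Variable A : comNzRingType.
Implicit Types u v w : fps A.

HB.instance Definition _ := gen_eqMixin (fps A).
HB.instance Definition _ := gen_choiceMixin (fps A).

Definition fps_add u v : fps A := fun n => u n + v n.
Definition fps_opp u : fps A := fun n => - u n.
Definition fps_zero : fps A := fun=> 0.
Definition fps_one : fps A := fun n => (n == 0)%:R.
Definition fps_mul u v : fps A := fun n => \sum_(k < n.+1) u k * v (n - k)%N.

Fact fps_addA : associative fps_add.
Proof. by move=> u v w; apply/funext => n; rewrite /fps_add addrA. Qed.
Fact fps_addC : commutative fps_add.
Proof. by move=> u v; apply/funext => n; rewrite /fps_add addrC. Qed.
Fact fps_add0 : left_id fps_zero fps_add.
Proof. by move=> u; apply/funext => n; rewrite /fps_add add0r. Qed.
Fact fps_addN : left_inverse fps_zero fps_opp fps_add.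
Proof. by move=> u; apply/funext => n; rewrite /fps_add addNr. Qed.

HB.instance Definition _ := GRing.isZmodule.Build (fps A) fps_addA fps_addC fps_add0 fps_addN.

(** Coefficients up to m of a product are those of a product of truncations, so the ring laws are
    inherited from polynomials. *)
Fact fps_mulE u v n m : (n <= m)%N ->
  fps_mul u v n = ((\poly_(i < m.+1) u i) * (\poly_(i < m.+1) v i))`_n.
Proof.
move=> nm; rewrite coefM; apply: eq_bigr => i _.
have im : (i < m.+1)%N by apply: leq_trans (ltn_ord i) _.
by rewrite !coef_poly im ltnS (leq_trans (leq_subr _ _) nm).
Qed.

Fact fps_mul_coef u v w n : (forall i, (i <= n)%N -> u i = v i) -> fps_mul u w n = fps_mul v w n.
Proof. by move=> E; apply: eq_bigr => i _; rewrite E // -ltnS. Qed.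

Fact fps_mulC : commutative fps_mul.
Proof. by move=> u v; apply/funext => n; rewrite !(fps_mulE _ _ (leqnn n)) mulrC. Qed.

Fact fps_mulA : associative fps_mul.
Proof.
move=> u v w; apply/funext => n; rewrite fps_mulC.
pose P (t : fps A) := \poly_(i < n.+1) t i.
have H t t' t'' : fps_mul (fps_mul t t') t'' n = (P t * P t' * P t'')`_n.
  rewrite coefM; apply: eq_bigr => i _; have im : (i <= n)%N by rewrite -ltnS.
  by rewrite (fps_mulE _ _ im) coef_poly ltnS leq_subr.
by rewrite !H mulrC mulrA.
Qed.

Fact fps_mul1 : left_id fps_one fps_mul.
Proof.
move=> u; apply/funext => n; rewrite /fps_mul big_ord_recl /fps_one /= mul1r subn0 big1 ?addr0 // => i _.
by rewrite mul0r.
Qed.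

Fact fps_mulD : left_distributive fps_mul fps_add.
Proof.
move=> u v w; apply/funext => n; rewrite /fps_mul /fps_add -big_split /=.
by apply: eq_bigr => i _; rewrite mulrDl.
Qed.

Fact fps_one_neq0 : fps_one != fps_zero.
Proof. by apply/eqP => /(congr1 (fun u => u 0%N)) /eqP; rewrite oner_eq0. Qed.

HB.instance Definition _ := GRing.Zmodule_isComNzRing.Build (fps A)
  fps_mulA fps_mulC fps_mul1 fps_mulD fps_one_neq0.

Lemma fpsD u v n : (u + v) n = u n + v n. Proof. by []. Qed.
Lemma fpsN u n : (- u) n = - u n. Proof. by []. Qed.
Lemma fpsM u v n : (u * v) n = \sum_(k < n.+1) u k * v (n - k)%N. Proof. by []. Qed.
Lemma fps0 n : (0 : fps A) n = 0. Proof. by []. Qed.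
Lemma fpsMn u n k : (u *+ k) n = u n *+ k.
Proof. by elim: k => [|k IH]; rewrite ?mulr0n // !mulrS fpsD IH. Qed.

(** The operator t d/dt, a derivation that unlike d/dt does not shift indices. *)
Definition fps_euler u : fps A := fun n => n%:R * u n.

Lemma fps_eulerD u v : fps_euler (u + v) = fps_euler u + fps_euler v.
Proof. by apply/funext => n; rewrite /fps_euler !fpsD mulrDr. Qed.

Lemma fps_eulerN u : fps_euler (- u) = - fps_euler u.
Proof. by apply/funext => n; rewrite /fps_euler !fpsN mulrN. Qed.

Lemma fps_eulerM u v : fps_euler (u * v) = fps_euler u * v + u * fps_euler v.
Proof.
apply/funext => n; rewrite fpsD !fpsM /fps_euler fpsM mulr_sumr -big_split; apply: eq_bigr => i _ /=.
have -> : n%:R = i%:R + (n - i)%:R :> A by rewrite -natrD subnKC // -ltnS.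
by ring.
Qed.

Hypothesis char0 : forall n (x : A), n.+1%:R * x = 0 -> x = 0.

(** Uniqueness for t u' = v u: as v has no constant term, coefficient n of v u involves only lower
    coefficients of u, and all vanish by induction. *)
Lemma fps_euler_eq0 u v : u 0%N = 0 -> v 0%N = 0 -> fps_euler u = v * u -> u = 0.
Proof.
move=> u0 v0 E; apply/funext => n; rewrite fps0; elim/ltn_ind: n => -[_ //|n IH].
have := congr1 (fun w => w n.+1) E; rewrite fpsM /fps_euler => /= h; apply: (char0 (n := n)).
rewrite h big1 // => -[[|i] hi] _ /=; first by rewrite v0 mul0r.
by rewrite IH ?mulr0 // subSS ltnS leq_subr.
Qed.

End FPS.

Lemma fps_cancel (F : idomainType) (u v w : fps F) : u 0%N != 0 -> v * u = w * u -> v = w.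
Proof.
move=> u0 E; apply/funext => n; elim/ltn_ind: n => n IH.
have := congr1 (fun t => t n) E; rewrite !fpsM !big_ord_recr /= !subnn.
rewrite (eq_bigr (fun i : 'I_n => w i * u (n - i)%N)); last by move=> i _; rewrite IH.
by move/addrI/(mulIf u0).
Qed.

(** * The formal logarithm, its moments and its symmetry *)

Section FormalLog.
Variable R : realType.
Local Notation C := R[i].
Implicit Types (a : nat -> C) (D K : fps {poly C}).

Lemma poly_char0 n (x : {poly C}) : n.+1%:R * x = 0 -> x = 0.
Proof. by move/eqP; rewrite mulf_eq0 -polyC1 -polyCMn polyC_eq0 pnatr_eq0 /= => /eqP. Qed.

(** The relation t D' = (t K') D reads m D_m = sum_i i K_i D_(m - i) and is solved for K_m. Each
    coefficient uses all earlier ones, so the recursion builds their table; [c] stands for the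
    constant coefficient of [D]. *)
Fixpoint log_tab D (c : C) n : seq {poly C} :=
  if n is m.+1 then let l := log_tab D c m in
    rcons l ((m%:R * c)^-1 *: (m%:R * D m - \sum_(i < m) i%:R * l`_i * D (m - i)%N))
  else [::].

Lemma size_log_tab D c n : size (log_tab D c n) = n.
Proof. by elim: n => //= n IH; rewrite size_rcons IH. Qed.

Definition fps_log D c : fps {poly C} := fun m => (log_tab D c m.+1)`_m.

Lemma nth_log_tab D c n i : (i < n)%N -> (log_tab D c n)`_i = fps_log D c i.
Proof.
elim: n => // n IH; rewrite ltnS leq_eqVlt => /predU1P[->//|h].
by rewrite /= nth_rcons size_log_tab h IH.
Qed.

Lemma fps_logE D c m : fps_log D c m =
  (m%:R * c)^-1 *: (m%:R * D m - \sum_(i < m) i%:R * fps_log D c i * D (m - i)%N).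
Proof.
rewrite {1}/fps_log /= nth_rcons size_log_tab ltnn eqxx; congr (_ *: (_ - _)).
by apply: eq_bigr => i _; rewrite nth_log_tab.
Qed.

Lemma fps_log0 D c : fps_log D c 0%N = 0.
Proof. by rewrite fps_logE big_ord0 subr0 !mul0r scaler0. Qed.

Lemma fps_log_euler D c : D 0%N = c%:P -> c != 0 -> fps_euler D = fps_euler (fps_log D c) * D.
Proof.
move=> D0 c0; apply/funext => -[|m]; rewrite fpsM /fps_euler.
  by rewrite big_ord1 !mul0r.
rewrite big_ord_recr /= subnn D0 [fps_log D c m.+1]fps_logE.
have -> : m.+1%:R * ((m.+1%:R * c)^-1 *: (m.+1%:R * D m.+1 - \sum_(i < m.+1) i%:R * fps_log D c i * D (m.+1 - i)%N)) * c%:P =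
  m.+1%:R * D m.+1 - \sum_(i < m.+1) i%:R * fps_log D c i * D (m.+1 - i)%N.
  rewrite -!mul_polyC -[X in X * (_ * _) * _](rmorph_nat polyC) mulrAC mulrA -!rmorphM /=.
  by rewrite mulfV ?mul1r // mulf_neq0 // pnatr_eq0.
by rewrite addrC subrK.
Qed.

Definition fps_deriv D : fps {poly C} := fun m => (D m)^`().

Lemma fps_derivM D K : fps_deriv (D * K) = fps_deriv D * K + D * fps_deriv K.
Proof.
apply/funext => m; rewrite fpsD !fpsM /fps_deriv fpsM -big_split raddf_sum; apply: eq_bigr => i _ /=.
by rewrite derivM.
Qed.

Lemma fps_deriv_euler D : fps_deriv (fps_euler D) = fps_euler (fps_deriv D).
Proof. by apply/funext => m; rewrite /fps_deriv /fps_euler !mulr_natl derivMn. Qed.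

(** [fps_log] is defined by differentiation in t; here the variable x of the coefficient polynomials
    is differentiated. The difference of the two sides satisfies t u' = v u with u and v free of
    constant terms, hence is zero. *)
Lemma fps_log_deriv D c : D 0%N = c%:P -> c != 0 -> fps_deriv D = fps_deriv (fps_log D c) * D.
Proof.
move=> D0 c0; have E := fps_log_euler D0 c0; move: (fps_log0 D c) E; move: (fps_log D c) => K K0 E.
apply/eqP; rewrite -subr_eq0; apply/eqP; apply: (fps_euler_eq0 poly_char0 (v := fps_euler K)).
- by rewrite fpsD fpsN fpsM big_ord1 /fps_deriv K0 D0 derivC deriv0 mul0r subrr.
- by rewrite /fps_euler mul0r.
rewrite fps_eulerD fps_eulerN fps_eulerM -!fps_deriv_euler E fps_derivM; ring.
Qed.

Definition fps_at1 D : fps C := fun m => (D m).[1].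

Lemma fps_at1D D K : fps_at1 (D + K) = fps_at1 D + fps_at1 K.
Proof. by apply/funext => m; rewrite /fps_at1 !fpsD hornerD. Qed.

Lemma fps_at1M D K : fps_at1 (D * K) = fps_at1 D * fps_at1 K.
Proof.
apply/funext => m; rewrite /fps_at1 !fpsM horner_sum; apply: eq_bigr => i _.
by rewrite hornerM.
Qed.

Lemma fps_at1_euler D : fps_at1 (fps_euler D) = fps_euler (fps_at1 D).
Proof. by apply/funext => m; rewrite /fps_at1 /fps_euler hornerM -polyC1 -polyCMn hornerC. Qed.

(* Coefficients in t of the difference quotient (g (x t) - g t) / (x t - t). *)
Definition diff_quot a : fps {poly C} := fun m => (a m.+1)%:P * \sum_(i < m.+1) 'X^i.

Lemma diff_quot0 a : diff_quot a 0%N = (a 1%N)%:P.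
Proof. by rewrite /diff_quot big_ord1 expr0 mulr1. Qed.

(** The logarithm of (g (x t) - g t) / (a_1 (x t - t)). With x = z / lam and t = lam, the
    coefficient of x ^ j in term m is k_(m,j) for m > 0; division by a_1 removes the constant. *)
Definition dq_log a := fps_log (diff_quot a) (a 1%N).

Lemma sum_nat_mul2 n : (\sum_(i < n.+1) i%:R : C) * 2 = n.+1%:R * n%:R.
Proof.
elim: n => [|n IH]; first by rewrite big_ord1 mul0r mulr0.
by rewrite big_ord_recr /= mulrDl IH -!natr1; ring.
Qed.

Lemma sum_nat_mul3 n : (\sum_(i < n.+1) i%:R * (i%:R - 1) : C) * 3 = n.+1%:R * (n%:R * (n%:R - 1)).
Proof.
elim: n => [|n IH]; first by rewrite big_ord1 !mul0r mulr0.
by rewrite big_ord_recr /= mulrDl IH -!natr1; ring.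
Qed.

Lemma at1_diff_quot a m : fps_at1 (diff_quot a) m = m.+1%:R * a m.+1.
Proof.
rewrite /fps_at1 /diff_quot hornerM hornerC horner_sum (eq_bigr (fun=> 1)) => [|i _].
  by rewrite sumr_const card_ord mulrC.
by rewrite hornerXn expr1n.
Qed.

(** At x = 1 the difference quotient is g'. Taylor expansion of g at t gives its x-derivatives
    there: t g'' / 2 for the first and t ^ 2 g''' / 3 for the second, treated next. *)
Lemma at1_diff_quot1 a : fps_at1 (fps_deriv (diff_quot a)) *+ 2 = fps_euler (fps_at1 (diff_quot a)).
Proof.
apply/funext => m; rewrite fpsMn /fps_euler at1_diff_quot /fps_at1 /fps_deriv /diff_quot.
rewrite derivM derivC mul0r add0r hornerM hornerC raddf_sum horner_sum.
rewrite (eq_bigr (fun i : 'I_m.+1 => i%:R)) => [|i _]; last first.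
  by rewrite /= derivXn hornerMn hornerXn expr1n.
by rewrite -[LHS]mulr_natr -mulrA sum_nat_mul2; ring.
Qed.

Lemma at1_diff_quot2 a : fps_at1 (fps_deriv (fps_deriv (diff_quot a))) *+ 3 =
  fps_euler (fps_euler (fps_at1 (diff_quot a))) - fps_euler (fps_at1 (diff_quot a)).
Proof.
apply/funext => m; rewrite fpsMn fpsD fpsN /fps_euler at1_diff_quot /fps_at1 /fps_deriv /diff_quot.
rewrite derivM derivC mul0r add0r derivM derivC mul0r add0r hornerM hornerC !raddf_sum horner_sum.
rewrite (eq_bigr (fun i : 'I_m.+1 => i%:R * (i%:R - 1))) => [|i _]; last first.
  rewrite /= derivXn derivMn derivXn !hornerMn hornerXn expr1n; case: (nat_of_ord i) => [|k]; first by rewrite mulr0n mul0r.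
  by rewrite -[LHS]mulr_natl /=; congr (_ * _); rewrite -natr1 addrK.
by rewrite -[LHS]mulr_natr -mulrA sum_nat_mul3; ring.
Qed.

Lemma diff_quotE a m : diff_quot a m = \poly_(i < m.+1) a m.+1.
Proof.
by rewrite poly_def /diff_quot mul_polyC scaler_sumr.
Qed.

Lemma size_natM n (p : {poly C}) : (size (n%:R * p)%R <= size p)%N.
Proof. by rewrite mulr_natl -scaler_nat size_scale_leq. Qed.

Lemma horner_natM n (p : {poly C}) x : (n%:R * p).[x] = n%:R * p.[x].
Proof. by rewrite !mulr_natl hornerMn. Qed.

Lemma size_deriv_le (p : {poly C}) n : (size p <= n)%N -> (size p^`() <= n)%N.
Proof.
move=> sp; apply/leq_sizeP => i ni; rewrite coef_deriv nth_default ?mul0rn //.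
exact: leq_trans sp (leqW ni).
Qed.

Lemma size_fps_log D c m : (forall m, (size (D m) <= m.+1)%N) -> (size (fps_log D c m) <= m.+1)%N.
Proof.
move=> hD; elim/ltn_ind: m => m IH; rewrite fps_logE; apply: leq_trans (size_scale_leq _ _) _.
apply: leq_trans (size_polyD _ _) _; rewrite geq_max size_polyN; apply/andP; split.
  exact: leq_trans (size_natM _ _) _.
apply: leq_trans (size_sum _ _ _) _; apply/bigmax_leqP => i _.
rewrite -mulrA; apply: leq_trans (size_natM _ _) _.
apply: leq_trans (size_polyMleq _ _) _; have := IH _ (ltn_ord i); have := hD (m - i)%N.
by have := ltn_ord i; lia.
Qed.

Lemma size_dq_log a m : (size (dq_log a m) <= m.+1)%N.
Proof. by apply: size_fps_log => k; rewrite diff_quotE size_poly. Qed.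

(** The symmetry j <-> m - j of the coefficients, in functional form so that it passes through the
    sums and products in the recurrence of [fps_log]. *)
Definition palindrome m (p : {poly C}) := forall y : C, y != 0 -> y ^+ m * p.[y^-1] = p.[y].

Lemma palindrome_log D c m : (forall m, palindrome m (D m)) -> palindrome m (fps_log D c m).
Proof.
move=> hD y y0; elim/ltn_ind: m => m IH; rewrite fps_logE !hornerZ mulrCA; congr (_ * _).
rewrite !(hornerD, hornerN) mulrDr mulrN !horner_natM mulrCA hD //; congr (_ - _).
rewrite !horner_sum mulr_sumr; apply: eq_bigr => i _.
rewrite -!mulrA !horner_natM !hornerM -(hD _ y y0) -(IH _ (ltn_ord i)).
have -> : y ^+ m = y ^+ i * y ^+ (m - i) by rewrite -exprD subnKC // ltnW.
by ring.
Qed.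

Lemma palindrome_dq a m : palindrome m (diff_quot a m).
Proof.
move=> y y0; rewrite /diff_quot !hornerM !hornerC mulrCA !horner_sum; congr (_ * _).
rewrite mulr_sumr (reindex_inj rev_ord_inj) /=; apply: eq_bigr => i _.
rewrite !hornerXn subSS exprVn; apply: (mulIf (expf_neq0 (m - i) y0)).
by rewrite mulfVK ?expf_neq0 // -exprD subnKC // -ltnS.
Qed.

Lemma poly_circle_eq (p q : {poly C}) : (forall y, y != 0 -> p.[y] = q.[y]) -> p = q.
Proof.
move=> E; apply/polyP => n; rewrite -(tcoef_poly p n ltr01) -(tcoef_poly q n ltr01) !tcoefE.
apply: eq_cmean => // z z1; rewrite E // -cmod_gt0 z1 //.
Qed.

Lemma palindrome_coef m p j : palindrome m p -> (size p <= m.+1)%N -> (j <= m)%N -> p`_j = p`_(m - j).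
Proof.
move=> pp sp jm; have E : p = \poly_(i < m.+1) p`_(m - i).
  apply: poly_circle_eq => y y0; rewrite -(pp y y0) horner_poly (horner_coef_wide _ sp) mulr_sumr.
  rewrite (reindex_inj rev_ord_inj) /=; apply: eq_bigr => i _.
  rewrite subSS mulrCA; congr (_ * _); rewrite exprVn.
  apply: (mulIf (expf_neq0 (m - i) y0)).
  by rewrite mulfVK ?expf_neq0 // -exprD subnKC // -ltnS.
by rewrite {1}E coef_poly ltnS jm.
Qed.

Lemma sum_ord_shift (F : nat -> C) n : F 0%N = 0 -> F n = 0 -> \sum_(i < n) F i.+1 = \sum_(i < n) F i.
Proof.
move=> F0 Fn; have := big_ord_recl n (fun i : 'I_n.+1 => F i) : \sum_(i < n.+1) F i = _.
by rewrite big_ord_recr /= F0 Fn addr0 add0r => ->.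
Qed.

Lemma deriv_at1 (p : {poly C}) n : (size p <= n)%N -> p^`().[1] = \sum_(j < n) j%:R * p`_j.
Proof.
move=> sp; rewrite (horner_coef_wide (n := n)); last exact: size_deriv_le.
rewrite -(@sum_ord_shift (fun j => j%:R * p`_j)); [|exact: mul0r|by rewrite nth_default ?mulr0].
by apply: eq_bigr => i _; rewrite coef_deriv expr1n mulr1 mulr_natl.
Qed.

Lemma deriv2_at1 (p : {poly C}) n : (size p <= n)%N -> p^`()^`().[1] = \sum_(j < n) (j%:R * (j%:R - 1)) * p`_j.
Proof.
move=> sp; rewrite (@deriv_at1 _ n); last exact: size_deriv_le.
rewrite -(@sum_ord_shift (fun j => (j%:R * (j%:R - 1)) * p`_j)); [|by rewrite !mul0r|by rewrite nth_default ?mulr0].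
by apply: eq_bigr => i _; rewrite coef_deriv -[in RHS]natr1 addrK natr1 -mulr_natl; ring.
Qed.

(** Let G be the difference quotient, K its logarithm, h = K at x = 1 and theta = t d/dt. On the
    diagonal K_x = G_x / G and K_xx = G_xx / G - K_x ^ 2, that is K_x = theta h / 2 and 3 K_xx =
    theta ^ 2 h - theta h + (theta h) ^ 2 - 3 K_x ^ 2. The square of theta h thus enters K_xx with 1
    / 3 - 1 / 4 = 1 / 12. *)
Lemma dq_log_moments a : a 1%N != 0 ->
  let K := dq_log a in let h := fps_at1 K in
  fps_euler (fps_at1 (diff_quot a)) = fps_euler h * fps_at1 (diff_quot a) /\
  forall m, \sum_(j < m.+1) (j%:R * (m%:R - j%:R)) * (K m)`_j =
    (m%:R ^+ 2 - m%:R) * h m / 6 - (fps_euler h * fps_euler h) m / 12.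
Proof.
move=> a1 K h; have D0 := diff_quot0 a.
have E := fps_log_euler D0 a1; have E1 := fps_log_deriv D0 a1.
rewrite -/(dq_log a) -/K in E E1.
have E2 := congr1 fps_deriv E1; rewrite fps_derivM in E2.
move: (at1_diff_quot1 a) (at1_diff_quot2 a) (at1_diff_quot a 0).
have e0 := congr1 fps_at1 E; have e1 := congr1 fps_at1 E1; have e2 := congr1 fps_at1 E2.
rewrite fps_at1M !fps_at1_euler -/h in e0; rewrite fps_at1M in e1; rewrite fps_at1D !fps_at1M in e2.
move: e0 e1 e2; move: (fps_at1 (diff_quot a)) (fps_at1 (fps_deriv (diff_quot a))) (fps_at1 (fps_deriv (fps_deriv (diff_quot a)))).
move=> G G1 G2 e0 e1 e2 g1 g2; rewrite mul1r => G0.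
have {}G0 : G 0%N != 0 by rewrite G0.
split=> //.
pose k1 := fps_at1 (fps_deriv K); pose k2 := fps_at1 (fps_deriv (fps_deriv K)).
have K1 : k1 *+ 2 = fps_euler h.
  by apply: (fps_cancel G0); rewrite -e0 -g1 e1 -mulrnAl.
have K2 : k2 *+ 3 + k1 ^+ 2 *+ 3 = fps_euler (fps_euler h) + fps_euler h ^+ 2 - fps_euler h.
  apply: (fps_cancel G0); rewrite !mulrDl mulNr -[fps_euler h * G]e0.
  have -> : fps_euler (fps_euler h) * G + fps_euler h ^+ 2 * G = fps_euler (fps_euler G).
    by rewrite e0 fps_eulerM e0; ring.
  by rewrite -g2 e2 e1 -/k1 -/k2; ring.
have L1 m : \sum_(j < m.+1) j%:R * (K m)`_j = m%:R * h m / 2.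
  rewrite -deriv_at1 ?size_dq_log //; apply: (mulIf (x := 2)); first by rewrite pnatr_eq0.
  have := congr1 (fun u => u m) K1; rewrite fpsMn /fps_euler /k1 /fps_at1 /fps_deriv => E5.
  by rewrite divfK ?pnatr_eq0 // -E5 mulr_natr.
have K11 : k1 ^+ 2 *+ 4 = fps_euler h * fps_euler h by rewrite -K1; ring.
move=> m; have L2 : \sum_(j < m.+1) (j%:R * (j%:R - 1)) * (K m)`_j = k2 m.
  by rewrite -deriv2_at1 ?size_dq_log.
have := congr1 (fun u => u m) K11; have := congr1 (fun u => u m) K2.
rewrite !(fpsD, fpsMn, fpsN) -L2; have -> : (fps_euler h ^+ 2) m = (fps_euler h * fps_euler h) m by rewrite expr2.
have -> : fps_euler (fps_euler h) m = m%:R ^+ 2 * h m by rewrite /fps_euler mulrA expr2.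
have -> : fps_euler h m = m%:R * h m by [].
have -> : \sum_(j < m.+1) (j%:R * (m%:R - j%:R)) * (K m)`_j =
   (m%:R - 1) * (\sum_(j < m.+1) j%:R * (K m)`_j) - \sum_(j < m.+1) (j%:R * (j%:R - 1)) * (K m)`_j.
  by rewrite mulr_sumr -sumrB; apply: eq_bigr => i _; ring.
rewrite L1; move: (\sum_(j < _) _) ((k1 ^+ 2) m) ((fps_euler h * fps_euler h) m) (h m) (m%:R : C) => x y z u v E3 E4.
have -> : z = y *+ 4 by [].
have -> : x = (v ^+ 2 * u + y *+ 4 - v * u - y *+ 3) / 3.
  by rewrite E4 -E3 addrK -[x *+ 3]mulr_natr mulfK // pnatr_eq0.
by field.
Qed.

Definition fps_of a : fps C := a.

(* Coefficients of the expansion in l of l ^ (n + 1) c_n, where c_n is the n-th coefficient of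
   derive1 g / (g - g l). *)
Definition quot_coef a n : nat -> C := fun i => (dq_log a i)^`()`_n - (i == 0%N)%:R.

Lemma conv_fps (b c : nat -> C) n : conv b c n = (fps_of b * fps_of c) n.
Proof. by []. Qed.

(** This expresses (g z - g lam) times g' z / (g z - g lam) = g' z at the power z ^ n, and is the
    recursion that [kernel_coefs] solves. Formally, (x - 1) G = sum_m a_(m + 1) (x ^ (m + 1) - 1) t
    ^ m is differentiated in x. *)
Lemma quot_coef_rec a n m : a 1%N != 0 ->
  \sum_(i < m.+1) a (m - i).+1 * quot_coef a n i =
  (\sum_(l < m.+1) if (l < n)%N then a l.+1 * quot_coef a (n - l.+1) (m - l) else 0)
    - (m == n)%:R * (m.+1%:R * a m.+1).
Proof.
move=> a1; set K := dq_log a.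
have E1 := fps_log_deriv (diff_quot0 a) a1; rewrite -/(dq_log a) -/K in E1.
have Xm i : ('X - 1) * diff_quot a i = (a i.+1)%:P * ('X^(i.+1) - 1).
  by rewrite /diff_quot mulrCA -subrX1.
have F : ('X - 1) * (diff_quot a m)^`() + diff_quot a m = (a m.+1)%:P * (m.+1%:R * 'X^m).
  have d1 : ('X - 1 : {poly C})^`() = 1 by rewrite derivB derivX -polyC1 derivC subr0.
  have d2 : ('X^(m.+1) - 1 : {poly C})^`() = m.+1%:R * 'X^m.
    by rewrite derivB derivXn -polyC1 derivC subr0 mulr_natl.
  have := congr1 (@deriv _) (Xm m).
  by rewrite (derivM ('X - 1) (diff_quot a m)) (derivM (a m.+1)%:P ('X^(m.+1) - 1)) derivC mul0r add0r d1 d2 mul1r addrC.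
have F2 : ('X - 1) * (diff_quot a m)^`() = \sum_(i < m.+1) (a (m - i).+1)%:P * ('X^((m - i).+1) - 1) * (K i)^`().
  have -> : (diff_quot a m)^`() = \sum_(i < m.+1) (K i)^`() * diff_quot a (m - i)%N.
    by have := congr1 (fun u => u m) E1; rewrite fpsM.
  by rewrite mulr_sumr; apply: eq_bigr => i _; rewrite mulrCA Xm mulrC.
have := congr1 (fun p : {poly C} => p`_n) F; rewrite F2 coefD coef_sum diff_quotE coef_poly ltnS.
rewrite coefCM mulr_natl coefMn coefXn.
rewrite (eq_bigr (fun i : 'I_m.+1 => a (m - i).+1 * ((if (n < (m - i).+1)%N then 0 else (K i)^`()`_(n - (m - i).+1)) - (K i)^`()`_n))); last first.
  by move=> i _; rewrite -mulrA coefCM mulrBl mul1r coefB coefXnM.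
move=> H.
have -> : \sum_(i < m.+1) a (m - i).+1 * quot_coef a n i =
    \sum_(i < m.+1) a (m - i).+1 * (K i)^`()`_n - a m.+1.
  rewrite /quot_coef -/K; under eq_bigr do rewrite mulrBr.
  rewrite sumrB; congr (_ - _); rewrite big_ord_recl /= subn0 mulr1 big1 ?addr0 // => i _.
  by rewrite mulr0.
have -> : \sum_(l < m.+1) (if (l < n)%N then a l.+1 * quot_coef a (n - l.+1) (m - l) else 0) =
    \sum_(i < m.+1) a (m - i).+1 * (if (n < (m - i).+1)%N then 0 else (K i)^`()`_(n - (m - i).+1)) - (m < n)%:R * a m.+1.
  rewrite (reindex_inj rev_ord_inj) /= -[X in _ - X](_ : \sum_(i < m.+1) (if (m - i < n)%N then a (m - i).+1 * ((i : nat) == 0%N)%:R else 0) = _); last first.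
    rewrite big_ord_recl /= subn0 mulr1 big1 ?addr0 => [|i _]; last by rewrite mulr0 if_same.
    by case: ltnP; rewrite ?mul1r ?mul0r.
  rewrite -sumrB; apply: eq_bigr => i _; rewrite subSS ltnS.
  have im : (i <= m)%N by rewrite -ltnS.
  by rewrite [(n <= m - i)%N]leqNgt; case: (m - i < n)%N => /=; rewrite ?mulr0 ?subrr // /quot_coef subKn // mulrBr.
have -> : (m == n)%:R * (m.+1%:R * a m.+1) = a m.+1 * ((n == m)%:R *+ m.+1).
  by rewrite eq_sym -mulr_natr; ring.
rewrite -H (eq_bigr _ (fun (i : 'I_m.+1) _ => mulrBr _ _ _)) sumrB.
move: (\sum_(i < m.+1) _) (\sum_(i < m.+1) _) (a m.+1) => x y z.
by case: ltnP; rewrite ?mul1r ?mul0r => _; ring.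
Qed.

(** The squared distance from x to its projection on the span of 1 and w is nonnegative; these two
    are orthogonal as w sums to 0. *)
Lemma bessel_two (n : nat) (w x : nat -> R) : \sum_(j < n) w j = 0 ->
  (\sum_(j < n) x j) ^+ 2 / n%:R + (\sum_(j < n) w j * x j) ^+ 2 / \sum_(j < n) w j ^+ 2 <= \sum_(j < n) x j ^+ 2.
Proof.
move=> w0; pose al := (\sum_(j < n) x j) / n%:R; pose be := (\sum_(j < n) w j * x j) / \sum_(j < n) w j ^+ 2.
have E : \sum_(j < n) (x j - al - be * w j) ^+ 2 = \sum_(j < n) x j ^+ 2 - 2 * al * (\sum_(j < n) x j)
   - 2 * be * (\sum_(j < n) w j * x j) + n%:R * al ^+ 2 + be ^+ 2 * (\sum_(j < n) w j ^+ 2) + 2 * al * be * (\sum_(j < n) w j).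
  have -> : n%:R * al ^+ 2 = \sum_(j < n) al ^+ 2 by rewrite sumr_const card_ord mulr_natl.
  rewrite !mulr_sumr -!sumrB -!big_split /=; apply: eq_bigr => j _; ring.
have P : 0 <= \sum_(j < n) (x j - al - be * w j) ^+ 2 by apply: sumr_ge0 => j _; exact: sqr_ge0.
(* Division by zero gives 0, so the degenerate cases n = 0 and w = 0 are included. *)
have inv0 (u t : R) : t * (u / t) ^+ 2 = u ^+ 2 / t.
  by have [->|t0] := eqVneq t 0; [rewrite invr0 !mulr0 mul0r|field].
move: P; rewrite E w0 /al /be.
move: (\sum_(j < n) x j) (\sum_(j < n) w j * x j) (\sum_(j < n) w j ^+ 2) (\sum_(j < n) x j ^+ 2) (n%:R : R) => X Y W Z N.
rewrite (inv0 X N) [(Y / W) ^+ 2 * W]mulrC (inv0 Y W) mulr0 addr0.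
rewrite (_ : 2 * (X / N) * X = 2 * (X ^+ 2 / N)); last by ring.
rewrite (_ : 2 * (Y / W) * Y = 2 * (Y ^+ 2 / W)); last by ring.
by move: (X ^+ 2 / N) (Y ^+ 2 / W) => u t; lra.
Qed.

Lemma bessel_two_complex (n : nat) (w : nat -> R) (k : nat -> C) : \sum_(j < n) w j = 0 ->
  cmod (\sum_(j < n) k j) ^+ 2 / n%:R + cmod (\sum_(j < n) (w j)%:C * k j) ^+ 2 / \sum_(j < n) w j ^+ 2 <=
  \sum_(j < n) cmod (k j) ^+ 2.
Proof.
move=> w0; have h1 := bessel_two (fun j => complex.Re (k j)) w0; have h2 := bessel_two (fun j => complex.Im (k j)) w0.
rewrite !cmodE !Re_sum !Im_sum.
rewrite (eq_bigr _ (fun (j : 'I_n) _ => ReZ (w j) (k j))) (eq_bigr _ (fun (j : 'I_n) _ => ImZ (w j) (k j))).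
rewrite (eq_bigr _ (fun (j : 'I_n) _ => cmodE (k j))) big_split /=.
by apply: le_trans (lerD h1 h2); rewrite !mulrDl addrACA.
Qed.

Lemma power_sums (m : nat) :
  [/\ \sum_(j < m.+1) (j%:R : R) = m%:R * (m%:R + 1) / 2,
      \sum_(j < m.+1) (j%:R : R) ^+ 2 = m%:R * (m%:R + 1) * (2 * m%:R + 1) / 6,
      \sum_(j < m.+1) (j%:R : R) ^+ 3 = (m%:R * (m%:R + 1) / 2) ^+ 2 &
      \sum_(j < m.+1) (j%:R : R) ^+ 4 = m%:R * (m%:R + 1) * (2 * m%:R + 1) * (3 * m%:R ^+ 2 + 3 * m%:R - 1) / 30].
Proof.
elim: m => [|m [h1 h2 h3 h4]]; first by split; rewrite big_ord1 ?expr0n /= !mul0r ?expr0n ?mul0r.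
by split; rewrite big_ord_recr /= ?h1 ?h2 ?h3 ?h4 -!natr1; field.
Qed.

(** The weight j (m - j) minus its average over 0 <= j <= m. *)
Definition quad_weight m (j : nat) : R := j%:R * (m%:R - j%:R) - (m%:R - 1) * m%:R / 6.

Lemma sum_ord_cst m (c : R) : \sum_(j < m.+1) c = (m%:R + 1) * c.
Proof. by rewrite sumr_const card_ord -[LHS]mulr_natl -natr1. Qed.

Lemma sum_quad_weight m : \sum_(j < m.+1) quad_weight m j = 0.
Proof.
have [h1 h2 _ _] := power_sums m.
rewrite (eq_bigr (fun j : 'I_m.+1 => m%:R * j%:R - j%:R ^+ 2 - (m%:R - 1) * m%:R / 6)); last by move=> j _; rewrite /quad_weight; ring.
by rewrite !sumrB -mulr_sumr h1 h2 sum_ord_cst; field.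
Qed.

Lemma sum_quad_weight2 m : \sum_(j < m.+1) quad_weight m j ^+ 2 =
  m%:R * (m%:R - 1) * (m%:R + 1) * (m%:R + 2) * (m%:R + 3) / 180.
Proof.
have [h1 h2 h3 h4] := power_sums m.
rewrite (eq_bigr (fun j : 'I_m.+1 => (m%:R ^+ 2 * j%:R ^+ 2 + j%:R ^+ 4 + ((m%:R - 1) * m%:R / 3) * j%:R ^+ 2 + ((m%:R - 1) * m%:R / 6) ^+ 2)
   - (2 * m%:R) * j%:R ^+ 3 - ((m%:R - 1) * m%:R / 3 * m%:R) * j%:R)); last by move=> j _; rewrite /quad_weight; field.
by rewrite !sumrB !big_split /= -!mulr_sumr h1 h2 h3 h4 sum_ord_cst; field.
Qed.

(* By symmetry the weight j may be replaced by m / 2; then Bessel's inequality for the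
   orthogonal vectors 1 and quad_weight m. *)
Lemma dq_log_lower a m (K := dq_log a) (h := fps_at1 K) : a 1%N != 0 ->
  m%:R / 2 * (cmod (h m) ^+ 2 / m.+1%:R + (cmod ((fps_euler h * fps_euler h) m) / 12) ^+ 2 /
     (m%:R * (m%:R - 1) * (m%:R + 1) * (m%:R + 2) * (m%:R + 3) / 180)) <=
  \sum_(j < m.+1) j%:R * cmod ((K m)`_j) ^+ 2.
Proof.
move=> a1; have [_ M] := dq_log_moments a1.
have := @bessel_two_complex m.+1 (quad_weight m) (fun j => (K m)`_j) (sum_quad_weight m).
rewrite sum_quad_weight2.
have hE : \sum_(j < m.+1) (K m)`_j = h m.
  rewrite /h /fps_at1 (horner_coef_wide _ (size_dq_log a m)); apply: eq_bigr => j _.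
  by rewrite expr1n mulr1.
(* Centring the weight cancels the term in h m exactly, so only the square of t h' remains. *)
have -> : \sum_(j < m.+1) (quad_weight m j)%:C * (K m)`_j = - ((fps_euler h * fps_euler h) m / 12).
  have := M m; rewrite -/K -/h => Mm.
  rewrite (eq_bigr (fun j : 'I_m.+1 => (j%:R * (m%:R - j%:R)) * (K m)`_j - ((m%:R - 1) * m%:R / 6) * (K m)`_j)); last first.
    move=> j _; rewrite -mulrBl; congr (_ * _).
    by rewrite /quad_weight rmorphB !rmorphM rmorphB rmorphB fmorphV !rmorph_nat.
  by rewrite sumrB -mulr_sumr hE Mm; field.
rewrite hE cmodN cmodM cmodV (cmod_nat R 12) => B.
have hp : palindrome m (K m) := palindrome_log (a 1%N) m (fun k => @palindrome_dq a k).
have P (j : 'I_m.+1) : cmod ((K m)`_(m - j)) = cmod ((K m)`_j).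
  have jm : (j <= m)%N by rewrite -ltnS.
  by rewrite -(palindrome_coef hp (size_dq_log a m) jm).
have -> : \sum_(j < m.+1) j%:R * cmod ((K m)`_j) ^+ 2 = m%:R / 2 * \sum_(j < m.+1) cmod ((K m)`_j) ^+ 2.
  have E : \sum_(j < m.+1) j%:R * cmod ((K m)`_j) ^+ 2 = \sum_(j < m.+1) (m%:R - j%:R) * cmod ((K m)`_j) ^+ 2.
    rewrite (reindex_inj rev_ord_inj) /=; apply: eq_bigr => j _.
    by rewrite subSS P natrB // -ltnS.
  have : \sum_(j < m.+1) j%:R * cmod ((K m)`_j) ^+ 2 + \sum_(j < m.+1) j%:R * cmod ((K m)`_j) ^+ 2 =
     m%:R * \sum_(j < m.+1) cmod ((K m)`_j) ^+ 2.
    by rewrite {2}E -big_split mulr_sumr; apply: eq_bigr => j _ /=; rewrite -mulrDl addrC subrK.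
  by move: (\sum_(j < m.+1) _) (\sum_(j < m.+1) _) => x y; lra.
by rewrite ler_wpM2l ?divr_ge0.
Qed.
End FormalLog.

(** * Averaging the area inequality *)

Section Averaging.
Variable R : realType.
Local Notation C := R[i].
Local Notation Re := complex.Re.
Implicit Types (f g F : C -> C) (r s t x M rho : R) (z w lam : C) (a b : nat -> C).

Lemma taylor_mulXn f a l : taylor f a ->
  taylor (fun z => z ^+ l * f z) (fun n => if (n < l)%N then 0 else a (n - l)%N).
Proof.
move=> ta; elim: l => [|l IH].
  apply: (@taylor_ext _ f) => [z _|]; first by rewrite expr0 mul1r.
  by have -> : (fun n => if (n < 0)%N then 0 else a (n - 0)%N) = a
    by apply/funext => n; rewrite subn0.
have := taylor_mulX IH.
have -> : (fun n => if n is n'.+1 then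
     if (n' < l)%N then 0 else a (n' - l)%N else 0) =
   (fun n => if (n < l.+1)%N then 0 else a (n - l.+1)%N).
  by apply/funext => -[|n].
by apply: taylor_ext => z _; rewrite exprS mulrA.
Qed.

Lemma taylor_sum (I : Type) (l : seq I) (F : I -> C -> C) (c : I -> nat -> C) :
  (forall i, taylor (F i) (c i)) ->
  taylor (fun z => \sum_(i <- l) F i z) (fun n => \sum_(i <- l) c i n).
Proof.
move=> h; elim: l => [|i l IH].
  apply: (@taylor_ext _ (fun=> 0)) => [z _|]; first by rewrite big_nil.
  have -> : (fun n => \sum_(i <- [::]) c i n) = (fun n => if n is 0 then 0 else 0).
    by apply/funext => -[|n]; rewrite big_nil.
  exact: taylor_cst.
have -> : (fun n => \sum_(j <- i :: l) c j n) =
  (fun n => c i n + \sum_(j <- l) c j n).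
  by apply/funext => n; rewrite big_cons.
by apply: taylor_ext (taylorD (h i) IH) => z _; rewrite big_cons.
Qed.

Lemma taylor_scale f a rho : 0 <= rho -> rho <= 1 -> taylor f a ->
  taylor (fun z => f (rho%:C * z)) (fun n => a n * rho%:C ^+ n).
Proof.
move=> rho0 rho1 ta s s0 s1; have [K [q [K0 q0 q1 h]]] := ta s s0 s1.
exists K, q; split=> // n z zs.
have -> : \sum_(k < n) a k * rho%:C ^+ k * z ^+ k =
    \sum_(k < n) a k * (rho%:C * z) ^+ k.
  by apply: eq_bigr => k _; rewrite exprMn mulrA.
apply: h; rewrite cmodM cmodR ger0_norm //.
by apply: le_trans zs; rewrite ler_piMl ?cmod_ge0.
Qed.

Lemma conv_cancel (u v w : nat -> C) : u 0%N != 0 ->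
  (forall n, conv u v n = conv u w n) -> v = w.
Proof.
move=> u0 h; apply: (@fps_cancel _ (fps_of u) (fps_of v) (fps_of w)) => //.
apply/funext => n; rewrite ![_ * fps_of u]mulrC.
by have := h n; rewrite !conv_fps.
Qed.

Lemma taylor_at0 g a : hol g -> taylor g a -> a 1%N = derive1 g 0.
Proof.
move=> hg ta; have [td _] := taylor_deriv ta.
by rewrite (taylor0 td) /dcoef mul1r.
Qed.

(** * The kernel g' / (g - g lam) and its coefficient functions *)

Section Kernel.
Variables (g : C -> C) (a : nat -> C).
Hypotheses (hg : hol g) (ig : inj_disc g) (ta : taylor g a).

Let a1 : a 1%N != 0.
Proof. by rewrite (taylor_at0 hg ta) inj_deriv0. Qed.

(** [F n] is lam ^ (n + 1) times the n-th coefficient in z of g' / (g - g lam); the power of lam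
    removes the singularity at lam = 0. Strong induction on n: [q] has no zeros by injectivity, and
    [quot_coef_rec] says that the right-hand side divided by [q] has the expected series. *)
Lemma kernel_coefs : exists (q : C -> C) (F : nat -> C -> C),
  [/\ forall z, cmod z < 1 -> g z = g 0 + z * q z,
      forall n, taylor (F n) (quot_coef a n)
    & forall n z, cmod z < 1 -> q z * F n z =
      \sum_(l < n) a l.+1 * z ^+ l * F (n - l.+1)%N z - n.+1%:R * a n.+1 * z ^+ n].
Proof.
have [q tq gq] := taylor_quotient ta.
have hq := taylor_hol tq.
have q0 z : cmod z < 1 -> q z != 0.
  move=> z1; have [->|zn] := eqVneq z 0.
    by rewrite (taylor0 tq).
  apply/negP => /eqP e; move: (gq z z1); rewrite e mulr0 addr0 => /ig.
  by rewrite cmod0 => /(_ z1 ltr01) ze; rewrite ze eqxx in zn.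
have hQ := holV hq q0.
have tH (F : nat -> C -> C) n : (forall k, (k < n)%N -> taylor (F k) (quot_coef a k)) ->
  taylor (fun z => \sum_(l < n) a l.+1 * z ^+ l * F (n - l.+1)%N z
      - n.+1%:R * a n.+1 * z ^+ n)
    (conv (fun n => a n.+1) (quot_coef a n)).
  move=> hF.
  have t1 (l : 'I_n) : taylor (fun z => a l.+1 * (z ^+ l * F (n - l.+1)%N z))
     (fun m => a l.+1 * (if (m < l)%N then 0 else quot_coef a (n - l.+1) (m - l))).
    by apply: taylorZ; apply: taylor_mulXn; apply: hF; have := ltn_ord l; lia.
  have t2 := taylor_sum (index_enum 'I_n) t1.
  have t3 := taylorZ (- (n.+1%:R * a n.+1)) (taylor_mulXn n (taylor_cst (1 : C))).
  have := taylorD t2 t3.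
  set c1 := (X in taylor _ X).
  have -> : c1 = conv (fun n => a n.+1) (quot_coef a n).
    apply/funext => m; rewrite /c1 {c1}.
    have -> : conv (fun n => a n.+1) (quot_coef a n) m =
      \sum_(i < m.+1) a (m - i).+1 * quot_coef a n i.
      rewrite /conv (reindex_inj rev_ord_inj) /=; apply: eq_bigr => i _.
      by rewrite subSS subKn // -ltnS.
    rewrite quot_coef_rec //; congr (_ + _).
      (* Both sums effectively run over l < min n (m + 1); beyond that the terms vanish. *)
      pose G l := if (l < n)%N && (l < m.+1)%N then
        a l.+1 * quot_coef a (n - l.+1) (m - l) else 0.
      rewrite (eq_bigr (fun l : 'I_n => G l)); last first.
        by move=> l _; rewrite /G ltn_ord /= ltnS; case: (ltnP m l) => _; rewrite ?mulr0.
      rewrite [RHS](eq_bigr (fun l : 'I_m.+1 => G l)); last first.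
        by move=> l _; rewrite /G (ltn_ord l) andbT.
      have G0 k : (minn n m.+1 <= k)%N -> G k = 0.
        by rewrite /G geq_min => /orP[] h; rewrite ifF //; lia.
      have gen N : (minn n m.+1 <= N)%N -> \sum_(l < N) G l = \sum_(l < minn n m.+1) G l.
        move=> hN; rewrite -!(big_mkord xpredT G) (big_cat_nat (leq0n (minn n m.+1)) hN) /=.
        by rewrite [X in _ + X]big_nat [X in _ + X]big1 ?addr0 // => k /andP[k1 _]; apply: G0.
      by rewrite gen ?geq_minl // gen ?geq_minr.
    rewrite mulNr; congr (- _); have [-> |mn] := eqVneq m n.
      by rewrite ltnn subnn mulr1 mul1r.
    rewrite mul0r; case: ltnP => h; first by rewrite mulr0.
    by have -> : (m - n = (m - n).-1.+1)%N; [lia|rewrite mulr0].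
  by apply: taylor_ext => z _; congr (_ + _); [apply: eq_bigr => l _; rewrite mulrA|rewrite mulr1 mulNr].
have step n : (forall k, (k < n)%N -> exists F, taylor F (quot_coef a k)) ->
  exists F, taylor F (quot_coef a n).
  move=> IH.
  have /choice [F hF] : forall k, exists F, (k < n)%N -> taylor F (quot_coef a k).
    by move=> k; case: (ltnP k n) => [/IH [F h]|_]; [exists F|exists (fun=> 0)].
  have th := tH F n hF.
  have [b tb] := hol_taylor (holM (taylor_hol th) hQ).
  exists (fun z => (\sum_(l < n) a l.+1 * z ^+ l * F (n - l.+1)%N z
      - n.+1%:R * a n.+1 * z ^+ n) * (q z)^-1).
  suff -> : quot_coef a n = b by [].
  apply: (@conv_cancel (fun n => a n.+1)) => // m; apply/esym.
  have := taylorM tq tb; move/(@taylor_ext _ _ _ _) => tx.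
  rewrite (taylor_unique th (tx _ _)) // => z z1.
  by rewrite mulrCA divff ?mulr1 ?q0.
have /choice [F hF] : forall n, exists F, taylor F (quot_coef a n).
  by move=> n; elim/ltn_ind: n => n; apply: step.
exists q, F; split=> // n z z1.
exact: (taylor_fun_unique (taylorM tq (hF n)) (tH F n (fun k _ => hF k)) z1).
Qed.

(** Rescaling z by rho = |lam| makes g (rho z) - g lam free of zeros in the unit disc, so the
    quotient has a Taylor series there. Its coefficients are identified by multiplying with the
    denominator, which yields the recursion of the [F n]. *)
Lemma kernel_unif (q : C -> C) (F : nat -> C -> C) lam s :
  (forall z, cmod z < 1 -> g z = g 0 + z * q z) ->
  (forall n z, cmod z < 1 -> q z * F n z =
      \sum_(l < n) a l.+1 * z ^+ l * F (n - l.+1)%N z - n.+1%:R * a n.+1 * z ^+ n) ->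
  0 <= s -> s < cmod lam -> cmod lam < 1 ->
  forall e : R, 0 < e -> exists m, forall k, (m <= k)%N -> forall z, cmod z <= s ->
    cmod (derive1 g z / (g z - g lam) -
          (ppoly (fun n => F n lam / lam ^+ n.+1) k).[z]) <= e.
Proof.
move=> gq qF s0 sl l1.
have [rho rhoE] : exists rho, rho = cmod lam by exists (cmod lam).
have rho0 : 0 < rho by rewrite rhoE; lra.
have rhoC : rho%:C != 0 :> C by rewrite -cmod_gt0 cmodR gtr0_norm.
have lam0 : lam != 0 by rewrite -cmod_gt0 -rhoE.
have rho1 : rho <= 1 by rewrite rhoE ltW.
have in1 z : cmod z < 1 -> cmod (rho%:C * z) < rho.
  by move=> z1; rewrite cmodM cmodR gtr0_norm // -[ltRHS]mulr1 ltr_pM2l.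
have in2 z : cmod z < 1 -> cmod (rho%:C * z) < 1 by move=> /in1; lra.
have tG := taylor_scale (ltW rho0) rho1 ta.
have [td _] := taylor_deriv ta.
have tD := taylor_scale (ltW rho0) rho1 td.
have tS := taylorD tG (taylor_cst (- g lam)).
have S0 z : cmod z < 1 -> g (rho%:C * z) + - g lam != 0.
  move=> z1; rewrite subr_eq0; apply/negP => /eqP /ig e.
  by have := in1 z z1; rewrite e ?in2 // -rhoE ltxx.
have hV := holM (taylor_hol tD) (holV (taylor_hol tS) S0).
have [b tb] := hol_taylor hV.
have cE n : F n lam / lam ^+ n.+1 * rho%:C ^+ n = b n.
  suff <- : (fun n => F n lam / lam ^+ n.+1 * rho%:C ^+ n) = b by [].
  apply: (@conv_cancel (fun n => a n * rho%:C ^+ n + (if n is 0 then - g lam else 0))).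
    have := S0 0; rewrite mulr0 (taylor0 ta) expr0 mulr1; apply.
    by rewrite cmod0.
  move=> {}n.
  have -> : conv (fun n => a n * rho%:C ^+ n + (if n is 0 then - g lam else 0)) b n =
     dcoef a n * rho%:C ^+ n.
    have tX : taylor (fun z => derive1 g (rho%:C * z))
        (conv (fun n => a n * rho%:C ^+ n + (if n is 0 then - g lam else 0)) b).
      apply: taylor_ext (taylorM tS tb) => z z1.
      by rewrite mulrC -mulrA mulVf ?mulr1 ?S0.
    by rewrite (taylor_unique tX tD).
  rewrite /conv big_ord_recl /= subn0 expr0 mulr1.
  rewrite (eq_bigr (fun l : 'I_n => rho%:C ^+ n * (a l.+1 *
    (F (n - l.+1)%N lam / lam ^+ (n - l.+1).+1)))); last first.
    move=> l _; rewrite /bump /= add1n addr0.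
    have -> : rho%:C ^+ n = rho%:C ^+ l.+1 * rho%:C ^+ (n - l.+1) :> C.
      by rewrite -exprD subnKC.
    by ring.
  rewrite -mulr_sumr -(taylor0 ta).
  have -> : g 0 + - g lam = - (lam * q lam).
    by rewrite (gq lam) //; ring.
  have -> : - (lam * q lam) * (F n lam / lam ^+ n.+1 * rho%:C ^+ n) =
     rho%:C ^+ n * (- (q lam * F n lam) / lam ^+ n).
    by rewrite exprS; field; rewrite lam0 expf_neq0.
  rewrite qF // -mulrDr /dcoef [RHS]mulrC; congr (_ * _).
  have ln0 : lam ^+ n != 0 by rewrite expf_neq0.
  rewrite opprB mulrDl mulfK // -[RHS]addr0 -addrA; congr (_ + _).
  rewrite mulNr mulr_suml; apply/eqP; rewrite addrC subr_eq0; apply/eqP.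
  apply: eq_bigr => l _.
  have -> : lam ^+ n = lam ^+ l * lam ^+ (n - l.+1).+1.
    by rewrite -exprD subnSK // subnKC // ltnW.
  by field; rewrite !expf_neq0.
move=> e e0.
have sr0 : 0 <= s / rho by rewrite divr_ge0 // ltW.
have sr1 : s / rho < 1 by rewrite ltr_pdivrMr // mul1r rhoE.
have [m hm] := taylor_unif tb sr0 sr1 e0.
exists m => k mk z zs.
have := hm k (z / rho%:C) mk.
rewrite cmodM cmodV cmodR gtr0_norm // ler_pM2r ?invr_gt0 // => /(_ zs).
have zE : rho%:C * (z / rho%:C) = z by rewrite mulrC divfK.
have -> : (ppoly b k).[z / rho%:C] = (ppoly (fun n => F n lam / lam ^+ n.+1) k).[z].
  rewrite !horner_ppoly; apply: eq_bigr => n _.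
  rewrite -cE expr_div_n -mulrA; congr (_ * _).
  by rewrite mulrC divfK // expf_neq0.
by rewrite zE.
Qed.

End Kernel.

(** * Averaging over the circle of poles *)

Lemma cmean_Re_le F r M : circ_rcont F r ->
  (forall z, cmod z = r -> Re (F z) <= M) -> 0 <= r -> Re (cmean F r) <= M.
Proof.
move=> cF h r0; have p0 := @pi2_gt0 R.
rewrite cmeanE ReZ mulrC ler_pdivrMr // [M * _]mulrC.
have c2 : rcont 0 (2 * pi) (fun=> M%:C : C) by apply: rcont_cst.
have <- : Re (cint 0 (2 * pi) (fun=> M%:C : C)) = 2 * pi * M.
  by rewrite cint_cst ?subr0 ?ReZ //; exact: ltW.
rewrite -lee_fin -!cint_real //; apply: le_integral => //.
- by have [] := rcont_integrable cF.
- by have [] := rcont_integrable c2.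
move=> t _; rewrite lee_fin; apply: h; exact: cmod_rcis.
Qed.

(** The holomorphic logarithm u of 1 - z has coefficients - 1 / n, found by comparing coefficients
    in (1 - z) u' = - 1; at a real point its real part is ln (1 - x). *)
Lemma log_series x (e : R) : 0 < x -> x < 1 -> 0 < e ->
  exists m, forall J, (m <= J)%N ->
    - ln (1 - x) <= \sum_(j < J) x ^+ j.+1 / j.+1%:R + e.
Proof.
move=> x0 x1 e0.
pose f := fun z : C => 1 - z.
have hf : hol f by apply: holB; [apply: hol_cst|apply: hol_id].
have f0 z : cmod z < 1 -> f z != 0.
  by rewrite /f subr_eq0; apply: contraTneq => <-; rewrite cmod1 ltxx.
have df z : derive1 f z = -1.
  by apply: cdiff_derive1; have := cdiffB (cdiff_cst 1 z) (cdiff_id z); rewrite sub0r.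
have [u [hu u0 uf ud]] : exists u : C -> C, [/\ hol u, u 0 = 0,
   forall z, cmod z < 1 -> cexp (u z) = f z &
   forall z, cmod z < 1 -> derive1 u z = derive1 f z / f z].
  by apply: hol_log => //; rewrite cexp0 /f subr0.
have [b tb] := hol_taylor hu.
have [td _] := taylor_deriv tb.
pose c := (fun n : nat => if n is 0 then 1 else if n is 1 then -1 else 0 : C).
have tf : taylor f c.
  have := taylorD (taylor_cst (1 : C)) (taylorZ (-1) (taylor_mulX (taylor_cst (1 : C)))).
  have -> : (fun n : nat => (if n is 0 then 1 else 0 : C) +
      -1 * (if n is n'.+1 then (if n' is 0 then 1 else 0) else 0)) = c.
    by apply/funext => -[|[|n]]; rewrite /c ?mulr0 ?addr0 ?add0r ?mulr1.
  by apply: taylor_ext => z _; rewrite /f mulr1 mulN1r.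
have bE : dcoef b = (fun=> -1).
  apply: (@conv_cancel c); first exact: oner_neq0.
  have tE : taylor (fun=> -1 : C) (conv c (dcoef b)).
    apply: taylor_ext (taylorM tf td) => z z1.
    by rewrite ud // df mulrC divfK ?f0.
  rewrite (taylor_unique tE (taylor_cst (-1))) => -[|n].
    by rewrite /conv big_ord1 mul1r.
  rewrite /conv !big_ord_recl /= big1 ?addr0; last by move=> i _; rewrite mul0r.
  by ring.
have xE : cmod (x%:C : C) = x by rewrite cmodR gtr0_norm.
have [m hm] : exists m, forall k, (m <= k)%N -> cmod (u x%:C - psum b k x%:C) <= e.
  by apply: (taylor_psum tb _ e0); rewrite xE.
exists m => J mJ.
have := hm J.+1 (leq_trans mJ (leqnSn J)).
have uR : Re (u x%:C) = ln (1 - x).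
  have := congr1 (@cmod R) (uf x%:C _); rewrite cmod_cexp xE => /(_ x1) E.
  rewrite -[LHS]expRK E /f; congr ln.
  by rewrite -[1]/(1%:C) -rmorphB cmodR gtr0_norm // subr_gt0.
have pR : Re (psum b J.+1 x%:C) = - \sum_(j < J) x ^+ j.+1 / j.+1%:R.
  rewrite /psum big_ord_recl -(taylor0 tb) u0 mul0r add0r Re_sum -sumrN.
  apply: eq_bigr => j _; rewrite lift0.
  have -> : b j.+1 = (- (j.+1%:R : R)^-1)%:C.
    have := congr1 (fun h => h (j : nat)) bE; rewrite /dcoef => E.
    have j0 : j.+1%:R != 0 :> C by rewrite pnatr_eq0.
    apply: (mulfI j0); rewrite E.
    by rewrite -(rmorph_nat (real_complex R)) -rmorphM mulrN divff ?pnatr_eq0 // rmorphN rmorph1.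
  by rewrite -rmorphXn -rmorphM /= mulrC mulrN.
move: (Re_le_cmod (u x%:C - psum b J.+1 x%:C)); rewrite ReD ReN uR pR opprK.
rewrite addrC; move: (cmod _) (\sum_(j < J) _) (ln _) => y S l.
by move=> h1 h2; move: (le_trans h1 h2); rewrite ler_norml; lra.
Qed.

(** ln |g'| is the real part of a holomorphic function, so its mean is its value at the centre. *)
Lemma deriv_log_mean g r : hol g -> (forall z, cmod z < 1 -> derive1 g z != 0) ->
  0 < r -> r < 1 ->
  exists u : C -> C, [/\ circ_rcont u r, Re (cmean u r) = ln (cmod (derive1 g 0))
     & forall z, cmod z < 1 -> Re (u z) = ln (cmod (derive1 g z))].
Proof.
move=> hg d0 r0 r1; have z1 : cmod (0 : C) < 1 by rewrite cmod0 ltr01.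
have [l lE] := cexp_surj (d0 0 z1).
have [u [hu u0 uE _]] := hol_log (hol_deriv hg) d0 lE.
have uR z : cmod z < 1 -> Re (u z) = ln (cmod (derive1 g z)).
  by move=> z2; rewrite -(uE z z2) cmod_cexp expRK.
exists u; split=> //; first by apply: hol_circ; rewrite // ltW.
rewrite cmean_center // ?uR // => z zr; apply: hu; exact: le_lt_trans r1.
Qed.

Lemma weighted_mean2 (F : nat -> C -> C) (k : nat -> R) J (u : C -> C) r M :
  0 <= r -> (forall j, circ_rcont (F j) r) -> circ_rcont u r ->
  (forall z, cmod z = r -> \sum_(j < J) k j * cmod (F j z) ^+ 2 + 2 * Re (u z) <= M) ->
  \sum_(j < J) k j * mean2 (F j) r + 2 * Re (cmean u r) <= M.
Proof.
move=> r0 cF cu h.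
have c1 (j : 'I_J) : circ_rcont (fun z => F j z * conjc (F j z)) r.
  by apply: circ_rcontM => //; apply: circ_rcont_conj.
have c2 (j : 'I_J) : circ_rcont (fun z => (k j)%:C * (F j z * conjc (F j z))) r.
  by apply: rcontZ; apply: c1.
have [c3 c3E] := cmean_sum (index_enum 'I_J) c2.
have c4 : circ_rcont (fun z => 2%:C * u z) r by exact: rcontZ.
have -> : \sum_(j < J) k j * mean2 (F j) r + 2 * Re (cmean u r) =
  Re (cmean (fun z => \sum_(j < J) (k j)%:C * (F j z * conjc (F j z)) + 2%:C * u z) r).
  rewrite cmeanD // ReD c3E cmeanZ // (ReZ 2) Re_sum; congr (_ + _).
  by apply: eq_bigr => j _; rewrite cmeanZ // ReZ.
apply: cmean_Re_le => // [|z zr]; first exact: rcontD.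
apply: le_trans (h z zr); rewrite ReD ReZ Re_sum lerD2r ler_sum // => j _.
by rewrite ReZ mulcJ.
Qed.

Lemma ln_ratio M x y : 0 < M -> 0 < x -> 0 < y ->
  ln (2 * M / (x * y / 64)) = ln (256 * M) - ln (2 * x) - ln y.
Proof.
move=> M0 x0 y0; apply/eqP; rewrite eq_sym subr_eq eq_sym eq_sym subr_eq -!lnM ?posrE.
- by apply/eqP; congr ln; field; rewrite !gt_eqF.
- by rewrite !mulr_gt0 // invr_gt0 !mulr_gt0.
- by rewrite mulr_gt0.
- by rewrite !mulr_gt0 // invr_gt0 !mulr_gt0.
exact: y0.
Qed.

(** For each lam with |lam| = rho = (1 + s) / 2 the area inequality is used with w0 = g lam, B = 2 M
    and d = (rho - s) |g' lam| / 64, then averaged. The 256 is 2 * 64 * 2, the last factor because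
    rho - s = (1 - s) / 2. *)
Lemma kernel_mean g a (q : C -> C) (F : nat -> C -> C) s M J :
  hol g -> inj_disc g -> taylor g a ->
  (forall z, cmod z < 1 -> g z = g 0 + z * q z) ->
  (forall n, taylor (F n) (quot_coef a n)) ->
  (forall n z, cmod z < 1 -> q z * F n z =
      \sum_(l < n) a l.+1 * z ^+ l * F (n - l.+1)%N z - n.+1%:R * a n.+1 * z ^+ n) ->
  0 < M -> (forall z, cmod z < 1 -> cmod (g z) <= M) -> 0 < s -> s < 1 ->
  \sum_(j < J) ((2 * s / (1 + s)) ^+ 2) ^+ j.+1 / j.+1%:R * mean2 (F j) ((1 + s) / 2)
    <= 2 * (ln (256 * M) - ln (1 - s)) - 2 * ln (cmod (derive1 g 0)).
Proof.
move=> hg ig ta gq tF qF M0 gM s0 s1.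
have [rho rhoE] : exists rho, rho = (1 + s) / 2 by exists ((1 + s) / 2).
have sr : s < rho by rewrite rhoE; lra.
have r1 : rho < 1 by rewrite rhoE; lra.
have r0 : 0 < rho by lra.
have xE : 2 * s / (1 + s) = s / rho.
  by rewrite rhoE; field; rewrite !gt_eqF //; lra.
rewrite -rhoE xE {xE}.
have [u [cu u0 uR]] := deriv_log_mean hg (fun z h => inj_deriv hg ig h) r0 r1.
have rs : 0 < rho - s by lra.
have rE : 1 - s = 2 * (rho - s) by rewrite rhoE; lra.
have cF j : circ_rcont (F j) rho.
  by apply: hol_circ; [exact: taylor_hol (tF j)|rewrite ltW].
rewrite -u0 lerBrDr.
apply: (weighted_mean2 (k := fun j => ((s / rho) ^+ 2) ^+ j.+1 / j.+1%:R)) => //.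
  exact: ltW.
move=> lam lr.
have l1 : cmod lam < 1 by rewrite lr.
rewrite uR // -lerBrDr.
have D0 : 0 < cmod (derive1 g lam) by rewrite cmod_gt0 inj_deriv.
have d0 : 0 < (rho - s) * cmod (derive1 g lam) / 64 by rewrite divr_gt0 ?mulr_gt0.
have := @area_inequality R g s (g lam) (2 * M) ((rho - s) * cmod (derive1 g lam) / 64)
  (fun n => F n lam / lam ^+ n.+1) J hg ig s0 s1 d0.
have HB z : cmod z <= s ->
   (rho - s) * cmod (derive1 g lam) / 64 <= cmod (g z - g lam) <= 2 * M.
  move=> zs; have z1 : cmod z < 1 by exact: le_lt_trans s1.
  apply/andP; split; last first.
    apply: (le_trans (cmodB _ _)); move: (gM z z1) (gM lam l1).
    by move: (cmod _) (cmod _) => x y; lra.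
  (* The disc of radius rho - s about lam stays in the unit disc, as 2 rho - s = 1, and misses |z|
     <= s; by injectivity g omits g z on it. *)
  have : (rho - s) * cmod (derive1 g lam) <= 64 * cmod (g lam - g z).
    apply: koebe_at => // [|w w1]; first by rewrite lr rhoE; lra.
    have w2 : cmod (lam + (rho - s)%:C * w) < 1.
      by apply: recenter_in; rewrite ?lr //; [exact: ltW|rewrite rhoE; lra].
    apply/negP => /eqP /ig e.
    have : cmod lam - cmod ((rho - s)%:C * w) <= cmod z.
      have := cmod_subr lam (- ((rho - s)%:C * w)); rewrite opprK cmodN e //.
    rewrite lr cmodM cmodR gtr0_norm //; have : (rho - s) * cmod w < rho - s.
      by rewrite -[ltRHS]mulr1 ltr_pM2l.
    by move: zs; move: (cmod z) ((_ - _) * _) => x y; lra.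
  by rewrite cmodC; move: (cmod _) (_ * _) => x y; lra.
move=> /(_ HB); move=> /(_ _); move=> H.
have H1 : forall e : R, 0 < e -> exists m, forall k, (m <= k)%N -> forall z, cmod z <= s ->
    cmod (derive1 g z / (g z - g lam) -
          (ppoly (fun n => F n lam / lam ^+ n.+1) k).[z]) <= e.
  by apply: (kernel_unif ig ta gq qF (ltW s0)); rewrite lr.
move: (H H1); clear H H1 HB.
have -> : ln (2 * M / ((rho - s) * cmod (derive1 g lam) / 64)) =
    ln (256 * M) - ln (1 - s) - ln (cmod (derive1 g lam)).
  by rewrite rE; exact: ln_ratio.
rewrite mulrBr; apply: le_trans; rewrite le_eqVlt; apply/orP; left; apply/eqP.
apply: eq_bigr => j _; rewrite cmodM cmodV cmodX lr.
rewrite !expr_div_n -!exprM.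
rewrite [(j.+1 * 2)%N]mulnC; ring.
Qed.

(** The leading 1 is the square of the constant term - 1, the trace of the pole 1 / (z - lam). The
    term of index 0 in [dq_log a] is 0, so nothing else contributes there. *)
Lemma quot_coef_mean2 a F j r L : taylor F (quot_coef a j) -> 0 < r -> r < 1 ->
  1 + \sum_(i < L) j.+1%:R ^+ 2 * cmod ((dq_log a i)`_j.+1) ^+ 2 * r ^+ (2 * i)
    <= mean2 F r.
Proof.
move=> tF r0 r1; apply: le_trans (taylor_bessel L.+1 tF r0 r1).
rewrite (eq_bigr (fun i : 'I_L.+1 => (if (i : nat) == 0%N then 1 else 0) +
   j.+1%:R ^+ 2 * cmod ((dq_log a i)`_j.+1) ^+ 2 * r ^+ (2 * i))).
  rewrite big_split /=; apply: lerD.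
    by rewrite big_ord_recl /= lerDl sumr_ge0.
  rewrite [leRHS]big_ord_recr /=.
  by rewrite lerDl !mulr_ge0 ?exprn_ge0 // ?cmod_ge0 // ltW.
move=> [[|i] /= _] _.
  rewrite /quot_coef /dq_log fps_log0 coef_deriv !coef0 mul0rn sub0r cmodN cmod1.
  by rewrite cmod0 expr1n expr0n mulr0 mul0r addr0 expr0 mulr1.
by rewrite /quot_coef /= subr0 coef_deriv -[_ *+ j.+1]mulr_natl cmodM cmod_nat exprMn add0r.
Qed.

(** Only j <= i occur on the left, and for these (s / rho) ^ (2 j) rho ^ (2 i) >= s ^ (2 i) because
    s < rho; the factor j remains from j ^ 2 / j. *)
Lemma weight_sum (c : nat -> nat -> R) s rho L J : 0 < s -> s < rho ->
  (forall i j, 0 <= c i j) -> (L <= J)%N ->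
  \sum_(i < L) s ^+ (2 * i) * \sum_(j < i.+1) j%:R * c i j <=
  \sum_(j < J) ((s / rho) ^+ 2) ^+ j.+1 / j.+1%:R *
     \sum_(i < L) j.+1%:R ^+ 2 * c i j.+1 * rho ^+ (2 * i).
Proof.
move=> s0 sr c0 LJ; have r0 : 0 < rho by lra.
have x0 : 0 <= (s / rho) ^+ 2 by rewrite exprn_ge0 // divr_ge0 // ltW.
pose G i j := ((s / rho) ^+ 2) ^+ j.+1 * j.+1%:R * c i j.+1 * rho ^+ (2 * i).
have -> : \sum_(j < J) ((s / rho) ^+ 2) ^+ j.+1 / j.+1%:R *
     \sum_(i < L) j.+1%:R ^+ 2 * c i j.+1 * rho ^+ (2 * i) =
   \sum_(i < L) \sum_(j < J) G i j.
  rewrite exchange_big /=; apply: eq_bigr => j _; rewrite mulr_sumr.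
  apply: eq_bigr => i _; rewrite /G.
  have jn : j.+1%:R != 0 :> R by rewrite pnatr_eq0.
  move: jn; move: (j.+1%:R) (_ ^+ j.+1) (c _ _) (rho ^+ _) => n x d p n0.
  by field.
apply: ler_sum => i _.
have G0 j : 0 <= G i j.
  exact: mulr_ge0 (mulr_ge0 (mulr_ge0 (exprn_ge0 _ x0) (ler0n _ _)) (c0 _ _)) (exprn_ge0 _ (ltW r0)).
apply: le_trans (ler_sum_ord (m := i) G0 _); last by have := ltn_ord i; lia.
rewrite big_ord_recl mul0r add0r mulr_sumr; apply: ler_sum => j _.
rewrite lift0 /G.
have -> : (((s / rho) ^+ 2) ^+ j.+1 * j.+1%:R * c i j.+1 * rho ^+ (2 * i) =
   (((s / rho) ^+ 2) ^+ j.+1 * rho ^+ (2 * i)) * (j.+1%:R * c i j.+1)) by ring.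
apply: ler_wpM2r; first by rewrite mulr_ge0.
have := ltn_ord j; move: (nat_of_ord j) => j'; move: (nat_of_ord i) => n; move: j'.+1 => m mn.
have nE k : k ^+ (2 * n) = k ^+ (2 * m) * k ^+ (2 * (n - m)) :> R.
  by rewrite -exprD -mulnDr subnKC.
rewrite -exprM expr_div_n !nE.
have -> : s ^+ (2 * m) / rho ^+ (2 * m) * (rho ^+ (2 * m) * rho ^+ (2 * (n - m)))
   = s ^+ (2 * m) * rho ^+ (2 * (n - m)).
  by rewrite mulrA divfK // expf_neq0 // gt_eqF.
rewrite ler_wpM2l ?exprn_ge0 ?lerXn2r // ?nnegrE ?(ltW s0) ?(ltW r0) //; exact: ltW.
Qed.

(** With x = (2 s / (1 + s)) ^ 2, the difference 1 - x is (1 - s) (1 + 3 s) / (1 + s) ^ 2, and (1 +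
    3 s) / (1 + s) ^ 2 <= 9 / 8 amounts to (1 - 3 s) ^ 2 >= 0. *)
Lemma ln_radius_ratio s : 0 < s -> s < 1 ->
  - ln (1 - s) - ln (9 / 8) <= - ln (1 - (2 * s / (1 + s)) ^+ 2).
Proof.
move=> s0 s1; have p1 : 0 < 1 + s by rewrite addr_gt0.
have s1' : 0 < 1 - s by rewrite subr_gt0.
have e0' : 0 < 9 / 8 :> R by rewrite divr_gt0.
have p3 : 0 < (1 + 3 * s) / (1 + s) ^+ 2.
  by rewrite divr_gt0 ?exprn_gt0 // addr_gt0 // mulr_gt0.
have -> : 1 - (2 * s / (1 + s)) ^+ 2 = (1 - s) * ((1 + 3 * s) / (1 + s) ^+ 2).
  by field; rewrite gt_eqF.
have p4 := mulr_gt0 s1' p3; have p5 := mulr_gt0 s1' e0'.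
rewrite -opprD lerN2 -lnM ?posrE // ler_ln ?posrE //.
rewrite ler_pM2l // ler_pdivrMr ?exprn_gt0 //.
by have := sqr_ge0 (1 - 3 * s); rewrite !expr2; lra.
Qed.

(** Of the 2 log (1 / (1 - s)) in [kernel_mean], the constant terms of the coefficient functions use
    up the sum of x ^ j / j with x = (2 s / (1 + s)) ^ 2, a full logarithm up to a constant. What
    remains bounds the weighted k_(m,j). *)
Lemma log_coef_sum g a M : hol g -> inj_disc g -> taylor g a -> 0 < M ->
  (forall z, cmod z < 1 -> cmod (g z) <= M) ->
  exists K : R, forall s L, 0 < s -> s < 1 ->
  \sum_(i < L) s ^+ (2 * i) * \sum_(j < i.+1) j%:R * cmod ((dq_log a i)`_j) ^+ 2
    <= - ln (1 - s) + K.
Proof.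
move=> hg ig ta M0 gM.
have [q [F [gq tF qF]]] := kernel_coefs hg ig ta.
exists (2 * ln (256 * M) - 2 * ln (cmod (derive1 g 0)) + ln (9 / 8)) => s L s0 s1.
apply/ler_addgt0Pl => e e0.
have x0 : 0 < (2 * s / (1 + s)) ^+ 2.
  by rewrite exprn_gt0 // divr_gt0 //; lra.
have sq : 2 * s / (1 + s) < 1 by rewrite ltr_pdivrMr; lra.
have x1 : (2 * s / (1 + s)) ^+ 2 < 1.
  by rewrite expr_lt1 // ltW // divr_gt0 //; lra.
have [m hm] := log_series x0 x1 e0.
have [J [mJ LJ]] : exists J, (m <= J)%N /\ (L <= J)%N.
  by exists (maxn m L); rewrite leq_maxl leq_maxr.
have r0 : 0 < (1 + s) / 2 by lra.
have r1 : (1 + s) / 2 < 1 by lra.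
have sr : s < (1 + s) / 2 by lra.
have xE : s / ((1 + s) / 2) = 2 * s / (1 + s).
  by field; rewrite !gt_eqF //; lra.
have H1 := kernel_mean J hg ig ta gq tF qF M0 gM s0 s1.
have H2 := @weight_sum (fun i j => cmod ((dq_log a i)`_j) ^+ 2) s ((1 + s) / 2) L J
  s0 sr (fun i j => exprn_ge0 2 (cmod_ge0 _)) LJ.
have H3 : \sum_(j < J) ((2 * s / (1 + s)) ^+ 2) ^+ j.+1 / j.+1%:R * (1 +
   \sum_(i < L) j.+1%:R ^+ 2 * cmod ((dq_log a i)`_j.+1) ^+ 2 * ((1 + s) / 2) ^+ (2 * i))
   <= \sum_(j < J) ((2 * s / (1 + s)) ^+ 2) ^+ j.+1 / j.+1%:R * mean2 (F j) ((1 + s) / 2).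
  apply: ler_sum => j _; apply: ler_wpM2l.
    by rewrite divr_ge0 // exprn_ge0 // ltW.
  exact: quot_coef_mean2 (tF j) r0 r1.
have H4 := hm J mJ.
have H5 := ln_radius_ratio s0 s1.
move: H1 H2 H3 H4 H5; rewrite xE.
have dist (x : nat -> R) (y : nat -> R) :
  \sum_(j < J) x j * (1 + y j) = \sum_(j < J) x j + \sum_(j < J) x j * y j.
  by rewrite -big_split; apply: eq_bigr => j _; rewrite mulrDr mulr1.
rewrite (dist (fun j => ((2 * s / (1 + s)) ^+ 2) ^+ j.+1 / j.+1%:R)
  (fun j => \sum_(i < L) j.+1%:R ^+ 2 * cmod ((dq_log a i)`_j.+1) ^+ 2 * ((1 + s) / 2) ^+ (2 * i))).
move: (\sum_(j < J) _ * mean2 _ _) (\sum_(i < L) _) => A1 A2.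
move: (\sum_(j < J) _ * _) (\sum_(j < J) _ ) (ln (1 - _ ^+ 2)) => A3 A4 l1.
by clear -A1 A2 A3 A4 l1; move: (ln (256 * M)) (ln (1 - s)) (ln (9 / 8)) (ln (cmod _)) => l2 l3 l4 l5; lra.
Qed.

End Averaging.

(** * The fourth power of the pre-Schwarzian *)

Section Tangent.
Variable R : realType.
Local Notation C := R[i].
Local Notation Re := complex.Re.
Implicit Types (f g F : C -> C) (r s t x y c : R) (z w : C) (p q : {poly R}).

Lemma deriv_ge0_le (psi dpsi : R -> R) x y : x <= y ->
  (forall t, x <= t <= y -> is_derive t 1 psi (dpsi t)) ->
  (forall t, x <= t <= y -> 0 <= dpsi t) -> psi x <= psi y.
Proof.
move=> xy D d0.
have [|||c0 c01 Ec] := @MVT_segment R psi dpsi x y.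
- exact: xy.
- by move=> t; rewrite in_itv /= => /andP[/ltW x0 /ltW x1]; apply: D; rewrite x0.
- apply: derivable_within_continuous => t; rewrite in_itv /= => x01.
  by have := D t x01; case.
rewrite -subr_ge0 Ec mulr_ge0 ?subr_ge0 // d0 //.
Qed.

Lemma is_derive_ln_sub t x : x < t ->
  is_derive x 1 (fun u : R => - ln (t - u)) (t - x)^-1.
Proof.
move=> xt; have lt0 : 0 < t - x by rewrite subr_gt0.
have h2 : is_derive x 1 (fun u : R => t - u) (- 1).
  apply: real_is_derive => e e0; exists 1 => // h _.
  rewrite (_ : _ - _ - _ = 0); last by ring.
  by rewrite normr0 mulr_ge0 // ltW.
have h3 := @is_derive1_comp R (@ln R) (fun u : R => t - u) x _ _ (@is_derive1_ln R _ lt0) h2.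
have h4 := is_deriveN h3.
apply: (is_derive_eq (f := fun u : R => - ln (t - u))) h4 _.
by rewrite mulrN1 opprK.
Qed.

(** The primitive of (t - x) ^ 3 / 6 times x ^ m vanishing at 0, by repeated integration by parts.
    Written in powers of t - x, all terms but the last vanish at x = t, leaving a division by four
    consecutive integers. *)
Definition kernel3 t m : {poly R} :=
  (6 * m.+1%:R)^-1 *: ((t%:P - 'X) ^+ 3 * 'X^(m.+1)) +
  (2 * (m.+1%:R * m.+2%:R))^-1 *: ((t%:P - 'X) ^+ 2 * 'X^(m.+2)) +
  (m.+1%:R * m.+2%:R * m.+3%:R)^-1 *: ((t%:P - 'X) ^+ 1 * 'X^(m.+3)) +
  (m.+1%:R * m.+2%:R * m.+3%:R * m.+4%:R)^-1 *: ((t%:P - 'X) ^+ 0 * 'X^(m.+4)).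

Lemma deriv_kernel_term t a n (k x : R) :
  (k *: ((t%:P - 'X) ^+ a * 'X^(n.+1)))^`().[x] =
  k * ((t - x) ^+ a * (n.+1%:R * x ^+ n) - a%:R * (t - x) ^+ a.-1 * x ^+ n.+1).
Proof.
rewrite derivZ derivM deriv_exp derivXn derivB derivC derivX !(hornerZ, hornerD, hornerM, hornerMn, hornerN, horner_exp, hornerXn, hornerX, hornerC).
rewrite -[_ *+ a]mulr_natl -[_ *+ n.+1]mulr_natl /=.
move: ((t - x) ^+ a) ((t - x) ^+ a.-1) (a%:R) (n.+1%:R) (x ^+ n) (x ^+ n.+1) => y1 y2 y3 y4 y5 y6.
by ring.
Qed.

Lemma deriv_kernel3 t m x : (kernel3 t m)^`().[x] = (t - x) ^+ 3 / 6 * x ^+ m.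
Proof.
have n1 k : k.+1%:R != 0 :> R by rewrite pnatr_eq0.
rewrite !derivD !hornerD !deriv_kernel_term !exprS !expr0 /= !mulr0n !mulr1n.
move: (n1 m) (n1 m.+1) (n1 m.+2) (n1 m.+3).
move: (m.+1%:R) (m.+2%:R) (m.+3%:R) (m.+4%:R) (x ^+ m) => n2 n3 n4 n5 B h2 h3 h4 h5.
by field; rewrite h2 h3 h4 h5.
Qed.

Lemma horner_kernel_term t a n (k x : R) :
  (k *: ((t%:P - 'X) ^+ a * 'X^n)).[x] = k * ((t - x) ^+ a * x ^+ n).
Proof. by rewrite hornerZ hornerM horner_exp hornerXn hornerD hornerN hornerC hornerX. Qed.

Definition kernel1 t m : {poly R} :=
  (m.+1%:R)^-1 *: ((t%:P - 'X) ^+ 1 * 'X^(m.+1)) +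
  (m.+1%:R * m.+2%:R)^-1 *: ((t%:P - 'X) ^+ 0 * 'X^(m.+2)).

Lemma deriv_kernel1 t m x : (kernel1 t m)^`().[x] = (t - x) * x ^+ m.
Proof.
have n1 k : k.+1%:R != 0 :> R by rewrite pnatr_eq0.
rewrite !derivD !hornerD !deriv_kernel_term !exprS !expr0 /= !mulr0n !mulr1n.
move: (n1 m) (n1 m.+1); move: (m.+1%:R) (m.+2%:R) (x ^+ m) => n2 n3 B h2 h3.
by field; rewrite h2 h3.
Qed.

Lemma kernel1_0 t m : (kernel1 t m).[0] = 0.
Proof. by rewrite hornerD !horner_kernel_term !expr0n !mulr0 addr0. Qed.

Lemma kernel1_end t m : (kernel1 t m).[t] = t ^+ m.+2 / (m.+1%:R * m.+2%:R).
Proof.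
by rewrite hornerD !horner_kernel_term subrr expr0 expr1 mul0r mulr0 add0r mul1r mulrC.
Qed.

Lemma kernel3_0 t m : (kernel3 t m).[0] = 0.
Proof. by rewrite !hornerD !horner_kernel_term !expr0n !mulr0 !addr0. Qed.

Lemma kernel3_end t m :
  (kernel3 t m).[t] = t ^+ m.+4 / (m.+1%:R * m.+2%:R * m.+3%:R * m.+4%:R).
Proof.
by rewrite !hornerD !horner_kernel_term subrr !expr0n !mul0r !mulr0 !add0r mul1r mulrC.
Qed.

Lemma kernel3_le t m x : 0 <= x -> x <= t -> (kernel3 t m).[x] <= (kernel3 t m).[t].
Proof.
move=> x0 xt; apply: (@deriv_ge0_le (horner (kernel3 t m)) (horner (kernel3 t m)^`())) => //.
move=> y /andP[xy yt]; rewrite deriv_kernel3 mulr_ge0 ?divr_ge0 ?exprn_ge0 ?subr_ge0 //.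
exact: le_trans xy.
Qed.

(** The hypothesis at y = c / d ^ 2, where d = t - u, multiplied by d ^ 3 / 6; d <= 1 takes care of
    the term in e and x - u <= d of the term in A. *)
Lemma tangent_arith t x u c (e A B : R) : u <= x -> x < t -> t <= 1 -> 0 <= c ->
  0 <= e -> 0 <= u -> 0 <= B -> 0 <= A ->
  (forall y, 0 <= y -> 2 * y * A - y ^+ 2 <= B + e) ->
  0 <= (t - u) ^+ 3 / 6 * B + e - c / 3 * (x - u) * A + c ^+ 2 / 6 * (t - u)^-1.
Proof.
move=> ux xt t1 c0 e0 u0 B0 A0 h.
have [d dE] : exists d, d = t - u by exists (t - u).
have d0 : 0 < d by lra.
have d1 : d <= 1 by lra.
rewrite -dE; have xd : x - u <= d by lra.
have := h (c / d ^+ 2) (divr_ge0 c0 (exprn_ge0 _ (ltW d0))).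
rewrite -(@ler_pM2l _ (d ^+ 3 / 6)) ?divr_gt0 ?exprn_gt0 //.
have -> : d ^+ 3 / 6 * (2 * (c / d ^+ 2) * A - (c / d ^+ 2) ^+ 2) =
   c / 3 * d * A - c ^+ 2 / 6 * d^-1 by field; rewrite gt_eqF.
have k1 : c / 3 * (x - u) * A <= c / 3 * d * A.
  by rewrite ler_wpM2r // ler_wpM2l // divr_ge0.
have k2 : d ^+ 3 / 6 * e <= e.
  have d3 : d ^+ 3 <= 1 by rewrite exprn_ile1 // ltW.
  by rewrite ler_piMl //; lra.
rewrite mulrDr; move: k1 k2; move: (_ * A) (_ * A) (_ * B) (_ * e) (_ * d^-1) => a1 a2 a3 a4 a5.
by clear; lra.
Qed.

(* The inequality 2 y A - y ^ 2 <= B + e at y = c / (t - u) ^ 2, integrated in u over [0, x]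
   against (t - u) ^ 3 / 6. *)
Lemma kernel_tangent (a b : nat -> R) L t x c (e : R) :
  0 < x -> x < t -> t <= 1 -> 0 <= c -> 0 <= e ->
  (forall m, 0 <= a m) -> (forall m, 0 <= b m) ->
  (forall u y, 0 <= u -> u <= x -> 0 <= y ->
     2 * y * (\sum_(m < L) a m * u ^+ m) - y ^+ 2 <= \sum_(m < L) b m * u ^+ m + e) ->
  c / 3 * \sum_(m < L) a m * x ^+ m.+2 / (m.+1%:R * m.+2%:R) <=
  \sum_(m < L) b m * t ^+ m.+4 / (m.+1%:R * m.+2%:R * m.+3%:R * m.+4%:R)
   + e + c ^+ 2 / 6 * (ln t - ln (t - x)).
Proof.
move=> x0 xt t1 c0 e0 a0 b0 h.
pose P : {poly R} := \sum_(m < L) b m *: kernel3 t m + e *: 'X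
   - (c / 3) *: \sum_(m < L) a m *: kernel1 x m.
(* Monotonicity of an explicit primitive replaces the integration in u. The cost c ^ 2 / (6 (t - u))
   contributes a logarithm, finite at u = x because x < t. *)
pose psi (u : R) := P.[u] + c ^+ 2 / 6 * (- ln (t - u)).
pose dpsi (u : R) := P^`().[u] + c ^+ 2 / 6 * (t - u)^-1.
have PE u : P^`().[u] = (t - u) ^+ 3 / 6 * (\sum_(m < L) b m * u ^+ m) + e
    - c / 3 * (x - u) * (\sum_(m < L) a m * u ^+ m).
  rewrite /P derivB derivD !derivZ derivX !(big_morph _ (@derivD R) (@deriv0 R)) !(hornerD, hornerN).
  rewrite !hornerZ hornerC mulr1 !horner_sum.
  rewrite -[_ * _ * \sum_(_ < _) _]mulrA !mulr_sumr; congr (_ + _ - _); apply: eq_bigr => m _.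
    by rewrite derivZ hornerZ deriv_kernel3; ring.
  by rewrite derivZ hornerZ deriv_kernel1; ring.
have D u : 0 <= u <= x -> is_derive u 1 psi (dpsi u).
  move=> /andP[u0 ux]; have ut : u < t by exact: le_lt_trans xt.
  have h1 := is_deriveZ (c ^+ 2 / 6) (is_derive_ln_sub ut).
  exact: (is_deriveD (is_derive_poly P u) h1).
have := @deriv_ge0_le psi dpsi 0 x (ltW x0) D.
have H u : 0 <= u <= x -> 0 <= dpsi u.
  move=> /andP[u0 ux]; rewrite /dpsi PE.
  have A0 : 0 <= \sum_(m < L) b m * u ^+ m.
    by apply: sumr_ge0 => m _; rewrite mulr_ge0 // exprn_ge0.
  have B0 : 0 <= \sum_(m < L) a m * u ^+ m.
    by apply: sumr_ge0 => m _; rewrite mulr_ge0 // exprn_ge0.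
  exact: (tangent_arith ux xt t1 c0 e0 u0 A0 B0 (fun y => h u y u0 ux)).
move=> /(_ H); rewrite /psi /P !(hornerD, hornerN, hornerZ, hornerX) !horner_sum.
rewrite (eq_bigr (fun=> 0)) => [|m _]; last by rewrite hornerZ kernel3_0 mulr0.
rewrite [\sum_(m < L) (_ *: kernel1 _ _).[0]](eq_bigr (fun=> 0)) => [|m _]; last first.
  by rewrite hornerZ kernel1_0 mulr0.
rewrite big1_eq !mulr0 subr0 !addr0 add0r.
have -> : \sum_(m < L) (a m *: kernel1 x m).[x] =
    \sum_(m < L) a m * x ^+ m.+2 / (m.+1%:R * m.+2%:R).
  by apply: eq_bigr => m _; rewrite hornerZ kernel1_end mulrA.
have : \sum_(m < L) (b m *: kernel3 t m).[x] <=
  \sum_(m < L) b m * t ^+ m.+4 / (m.+1%:R * m.+2%:R * m.+3%:R * m.+4%:R).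
  apply: ler_sum => m _; rewrite hornerZ -mulrA -kernel3_end ler_wpM2l //.
  by apply: kernel3_le; exact: ltW.
have : e * x <= e by rewrite ler_piMr // ltW //; exact: lt_le_trans t1.
rewrite subr0; clear; move: (\sum_(m < L) _) (\sum_(m < L) _) (\sum_(m < L) _) (e * x) => A1 A2 A3 A4.
by move: (ln t) (ln (t - x)) => l1 l2; lra.
Qed.

Lemma cmean_square_lower F r y : circ_rcont F r -> 0 <= r ->
  2 * y * mean2 F r - y ^+ 2 <= mean2 (fun z => F z * F z) r.
Proof.
move=> cF r0.
have c1 := circ_rcontM cF (circ_rcont_conj cF).
have cFF := circ_rcontM cF cF.
have c2 := circ_rcontM cFF (circ_rcont_conj cFF).
have c3 : circ_rcont (fun z => (2 * y)%:C * (F z * conjc (F z))) r by apply: rcontZ.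
have c4 : circ_rcont (fun z => (-1) * ((F z * F z) * conjc (F z * F z))) r.
  by apply: rcontZ.
rewrite lerBlDr addrC -lerBlDr.
have -> : 2 * y * mean2 F r - mean2 (fun z => F z * F z) r =
  Re (cmean (fun z => (2 * y)%:C * (F z * conjc (F z)) +
     (-1) * ((F z * F z) * conjc (F z * F z))) r).
  by rewrite cmeanD // !cmeanZ // ReD (ReZ (2 * y)) mulN1r ReN.
apply: cmean_Re_le => //; first exact: rcontD.
move=> z _; rewrite ReD ReZ mulN1r ReN !mulcJ /= cmodM.
by have := sqr_ge0 (cmod (F z) ^+ 2 - y); rewrite !expr2; lra.
Qed.

(** The tail of the series at radius x is dominated termwise by the tail at r, so one truncation
    serves all x <= r; [kernel_tangent] asks for this uniformity in u. *)
Lemma mean2_tail f a r : taylor f a -> 0 < r -> r < 1 -> forall e : R, 0 < e ->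
  exists m, forall L, (m <= L)%N -> forall x, 0 < x -> x <= r ->
    mean2 f x <= \sum_(i < L) cmod (a i) ^+ 2 * x ^+ (2 * i) + e.
Proof.
move=> ta r0 r1 e e0; have [m hm] := taylor_mean2 ta r0 r1 e0.
exists m => L mL x x0 xr.
have x1 : x < 1 by exact: le_lt_trans r1.
apply: (taylor_mean2_le ta x0 x1) => n.
pose G i := cmod (a i) ^+ 2 * x ^+ (2 * i).
pose H i := cmod (a i) ^+ 2 * r ^+ (2 * i).
have G0 i : 0 <= G i by rewrite mulr_ge0 ?exprn_ge0 ?cmod_ge0 // ltW.
have GH i : G i <= H i.
  by rewrite ler_wpM2l ?exprn_ge0 ?cmod_ge0 // lerXn2r ?nnegrE // ltW.
have [nL|Ln] := leqP n L.
  by apply: ler_wpDr (ltW e0) _; exact: (@ler_sum_ord _ G).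
have := hm L mL; have := taylor_bessel n ta r0 r1.
rewrite -!(big_mkord xpredT G) -!(big_mkord xpredT H).
rewrite !(big_cat_nat (leq0n L) (ltnW Ln)) /= => h1 h2.
have : \sum_(L <= i < n) G i <= \sum_(L <= i < n) H i by apply: ler_sum.
move: h1 h2; rewrite ler_norml; move: (mean2 f r) => M.
move: (\sum_(0 <= i < L) H i) (\sum_(0 <= i < L) G i) (\sum_(L <= i < n) H i) (\sum_(L <= i < n) G i).
by move=> A1 A2 A3 A4; clear; lra.
Qed.

(** At x = 1 the series [dq_log a] is log g' up to a constant, and t d/dt of it is z g'' / g'. *)
Lemma taylor_prelog g a : hol g -> inj_disc g -> taylor g a ->
  taylor (fun z => z * (derive1 (derive1 g) z / derive1 g z))
    (fps_euler (fps_at1 (dq_log a))).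
Proof.
move=> hg ig ta; have g0 z := inj_deriv hg ig (z := z).
have a1 : a 1%N != 0 by rewrite (taylor_at0 hg ta) inj_deriv0.
have [td _] := taylor_deriv ta; have [tdd _] := taylor_deriv td.
have [n tn] := hol_taylor (holM (hol_deriv (hol_deriv hg)) (holV (hol_deriv hg) g0)).
have tz := taylor_mulX tn.
set H := (X in taylor _ X) in tz.
suff -> : fps_euler (fps_at1 (dq_log a)) = H by [].
have tp := taylorM td tz.
have te : taylor (fun z => z * derive1 (derive1 g) z) (conv (dcoef a) H).
  apply: taylor_ext tp => z z1.
  move: (derive1 g z) (derive1 (derive1 g) z) (g0 z z1) => x y x0.
  by clear -x0; field.
apply: (@conv_cancel _ (dcoef a)) => [|m]; first by rewrite /dcoef mul1r.
have [e _] := dq_log_moments a1.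
have atE : fps_at1 (diff_quot a) = fps_of (dcoef a).
  by apply/funext => k; rewrite at1_diff_quot.
rewrite atE in e; rewrite (taylor_unique te (taylor_mulX tdd)) conv_fps mulrC.
have := congr1 (fun u : fps C => u m) e => /= <-.
by case: m => [|m]; rewrite /fps_euler /fps_of /dcoef ?mul0r.
Qed.

(** Here 180 / (2 * 144) = 5 / 8. The denominators n (n + 1) and (n - 1) (n + 1) (n + 2) (n + 3) are
    enlarged to products of consecutive integers, as in [kernel1_end] and [kernel3_end]; n >= 2
    keeps n - 1 positive. *)
Lemma weights_le n (A B : R) : 2 <= n -> 0 <= A -> 0 <= B ->
  A / (2 * ((n + 1) * (n + 2))) + 5 / 8 * (B / ((n + 1) * (n + 2) * (n + 3) * (n + 4))) <=
  n / 2 * (A / n ^+ 2 / (n + 1) +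
     B / 144 / (n * (n - 1) * (n + 1) * (n + 2) * (n + 3) / 180)).
Proof.
move=> n2 A0 B0.
have n0 : 0 < n by lra.
have [m1 p1 p2 p3 p4] : [/\ 0 < n - 1, 0 < n + 1, 0 < n + 2, 0 < n + 3 & 0 < n + 4].
  by split; lra.
rewrite [leRHS]mulrDr; apply: lerD.
  have -> : n / 2 * (A / n ^+ 2 / (n + 1)) = A / (2 * ((n + 1) * n)).
    by field; rewrite !gt_eqF.
  rewrite ler_wpM2l // lef_pV2 ?posrE ?mulr_gt0 //.
  by rewrite ler_pM2l // ler_pM2l //; lra.
have -> : n / 2 * (B / 144 / (n * (n - 1) * (n + 1) * (n + 2) * (n + 3) / 180)) =
   5 / 8 * (B / ((n + 1) * (n + 2) * (n + 3) * (n - 1))).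
  by field; rewrite !gt_eqF.
rewrite ler_wpM2l // ler_wpM2l // lef_pV2 ?posrE ?mulr_gt0 //.
by rewrite ler_pM2l ?mulr_gt0 //; lra.
Qed.

Lemma weight1_le (A : R) : 0 <= A -> A / (2 * ((1 + 1) * (1 + 2))) <= 1 / 2 * (A / 1 ^+ 2 / (1 + 1)).
Proof.
move=> A0; have -> : A / (2 * ((1 + 1) * (1 + 2))) = A / 12 by field.
have -> : 1 / 2 * (A / 1 ^+ 2 / (1 + 1)) = A / 4 by rewrite expr1n; field.
lra.
Qed.

Lemma log_coef_terms a m t x (H := fps_euler (fps_at1 (dq_log a))) :
  a 1%N != 0 -> 0 <= x -> x <= t -> t <= 1 ->
  1 / 2 * (cmod (H m) ^+ 2 * x ^+ m.+2 / (m.+1%:R * m.+2%:R)) +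
  5 / 8 * (cmod (conv H H m) ^+ 2 * t ^+ m.+4 / (m.+1%:R * m.+2%:R * m.+3%:R * m.+4%:R))
  <= t ^+ m * \sum_(j < m.+1) j%:R * cmod ((dq_log a m)`_j) ^+ 2.
Proof.
move=> a1 x0 xt t1; have t0 := le_trans x0 xt.
have H0 : H 0%N = 0 by rewrite /H /fps_euler mul0r.
have hE : cmod (H m) ^+ 2 = m%:R ^+ 2 * cmod (fps_at1 (dq_log a) m) ^+ 2.
  by rewrite /H /fps_euler cmodM cmod_nat exprMn.
have := dq_log_lower m a1; rewrite -/H -conv_fps => low.
have A0 := exprn_ge0 2 (cmod_ge0 (H m)); have B0 := exprn_ge0 2 (cmod_ge0 (conv H H m)).
have R0 : 0 <= \sum_(j < m.+1) j%:R * cmod ((dq_log a m)`_j) ^+ 2.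
  by apply: sumr_ge0 => j _; rewrite mulr_ge0 ?exprn_ge0 ?cmod_ge0.
have tx : x ^+ m.+2 <= t ^+ m.
  apply: (@le_trans _ _ (t ^+ m.+2)); first by rewrite lerXn2r.
  by rewrite !exprS mulrA ler_piMl ?exprn_ge0 // mulr_ile1.
have t4 : t ^+ m.+4 <= t ^+ m.
  by rewrite -addn4 exprD ler_piMr ?exprn_ge0 // exprn_ile1.
apply: (@le_trans _ _ (t ^+ m * (cmod (H m) ^+ 2 / (2 * (m.+1%:R * m.+2%:R)) +
   5 / 8 * (cmod (conv H H m) ^+ 2 / (m.+1%:R * m.+2%:R * m.+3%:R * m.+4%:R))))).
  rewrite [leRHS]mulrDr; apply: lerD.
    have -> : 1 / 2 * (cmod (H m) ^+ 2 * x ^+ m.+2 / (m.+1%:R * m.+2%:R)) =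
      x ^+ m.+2 * (cmod (H m) ^+ 2 / (2 * (m.+1%:R * m.+2%:R))).
      clear; move: (cmod _ ^+ 2) (x ^+ _) (m.+1%:R * _) => y1 y2 y3.
      by rewrite invfM; ring.
    by rewrite ler_wpM2r // divr_ge0 // !mulr_ge0.
  have -> : 5 / 8 * (cmod (conv H H m) ^+ 2 * t ^+ m.+4 / (m.+1%:R * m.+2%:R * m.+3%:R * m.+4%:R)) =
   t ^+ m.+4 * (5 / 8 * (cmod (conv H H m) ^+ 2 / (m.+1%:R * m.+2%:R * m.+3%:R * m.+4%:R))).
    by clear; move: (cmod _ ^+ 2) (t ^+ _) ((_ * _)^-1) => y1 y2 y3; ring.
  by rewrite ler_wpM2r // mulr_ge0 // divr_ge0 // !mulr_ge0.
rewrite ler_wpM2l ?exprn_ge0 //; apply: le_trans low.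
(* For m <= 1 the coefficient of H * H vanishes together with H 0, and so does the squared length of
   the centred weight; these cases are settled apart from [weights_le]. *)
case: m hE A0 B0 R0 tx t4 => [|[|m]] hE A0 B0 R0 tx t4.
- by rewrite /conv big_ord1 H0 !mul0r cmod0 expr0n /= !mul0r mulr0 addr0.
- rewrite /conv !big_ord_recl big_ord0 /= /bump /= subn0 subnn H0 !(mul0r, mulr0, addr0) cmod0.
  rewrite expr0n /= !(mul0r, mulr0, addr0).
  apply: le_trans (weight1_le A0) _.
  by rewrite hE !expr1n !divr1 !mul1r expr0n !mul0r addr0.
have n2 : 2 <= m.+2%:R :> R by rewrite ler_nat.
have := weights_le n2 A0 B0; rewrite hE.
have nE k : m.+2%:R + k%:R = (m.+2 + k)%:R :> R by rewrite natrD.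
have -> : m.+3%:R = m.+2%:R + 1 :> R by rewrite natr1.
have -> : m.+4%:R = m.+2%:R + 2 :> R by rewrite nE addn2.
have -> : m.+4.+1%:R = m.+2%:R + 3 :> R by rewrite nE addn3.
have -> : m.+4.+2%:R = m.+2%:R + 4 :> R by rewrite nE addn4.
rewrite [X in X / m.+2%:R ^+ 2]mulrC mulfK ?expf_neq0 ?pnatr_eq0 //.
by rewrite [(cmod _ / 12) ^+ 2]expr_div_n (_ : 12 ^+ 2 = 144 :> R) //; ring.
Qed.

(** Eliminating B between the tangent inequality and the coefficient bound leaves (1 / 2 + 5 X / 24)
    Y <= (1 + 5 X ^ 2 / 48) l + O(1); the equation for X says that the quotient of the two factors
    is X. *)
Lemma prelog_arith (X Y B l K l2 ls lt ltx l1t : R) : 0 <= X -> 5 * X ^+ 2 + 24 * X = 48 ->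
  X / 3 * Y <= B + 1 + X ^+ 2 / 6 * (lt - ltx) -> lt <= 0 ->
  - ltx = l + l2 -> - l1t = l + l2 -> ls <= - l1t + l2 ->
  1 / 2 * Y + 5 / 8 * B <= ls + K ->
  Y <= X * l + (2 * l2 + K + 5 / 8 * (1 + X ^+ 2 / 6 * l2)) / (1 / 2 + 5 * X / 24).
Proof.
move=> X0 XE h1 lt0 e1 e2 hs h2.
have D0 : 0 < 1 / 2 + 5 * X / 24 by lra.
have x2 : 0 <= X ^+ 2 / 6 by rewrite divr_ge0 ?exprn_ge0.
have h3 : X ^+ 2 / 6 * (lt - ltx) <= X ^+ 2 / 6 * (l + l2).
  by rewrite ler_wpM2l //; lra.
rewrite -lerBlDl ler_pdivlMr // mulrC mulrBr.
have -> : (1 / 2 + 5 * X / 24) * (X * l) = (1 + 5 * X ^+ 2 / 48) * l.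
  have -> : (1 / 2 + 5 * X / 24) * (X * l) = (5 * X ^+ 2 + (5 * X ^+ 2 + 24 * X)) / 48 * l by field.
  by rewrite XE; field.
have -> : (1 / 2 + 5 * X / 24) * Y = 1 / 2 * Y + 5 / 8 * (X / 3 * Y) by field.
have -> : (1 + 5 * X ^+ 2 / 48) * l = l + 5 / 8 * (X ^+ 2 / 6 * l) by field.
move: h1 h3; rewrite !mulrDr; move: (X / 3 * Y) (X ^+ 2 / 6 * _) (X ^+ 2 / 6 * _) (X ^+ 2 / 6 * _) => y1 y2 y3 y4.
lra.
Qed.

Lemma ln_half x : x < 1 -> - ln ((1 - x) / 2) = - ln (1 - x) + ln 2.
Proof. by move=> x1; rewrite lnM ?posrE ?subr_gt0 // lnV ?posrE // opprB addrC. Qed.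

Lemma ln_sub_sqrt t : 0 < t -> t < 1 -> - ln (1 - Num.sqrt t) <= - ln (1 - t) + ln 2.
Proof.
move=> t0 t1; have s0 := sqrtr_ge0 t.
have s1 : Num.sqrt t < 1 by rewrite -sqrtr1 ltr_sqrt.
have p1 : 0 < 1 - Num.sqrt t by rewrite subr_gt0.
have p2 : 0 < 1 + Num.sqrt t by rewrite ltr_pwDl.
have -> : 1 - t = (1 - Num.sqrt t) * (1 + Num.sqrt t).
  by rewrite -[in LHS](sqr_sqrtr (ltW t0)); ring.
rewrite lnM ?posrE // opprD -addrA lerDl addrC subr_ge0.
by rewrite ler_ln ?posrE // lerD2l ltW.
Qed.

Lemma prelog_bound g a M (X : R) : hol g -> inj_disc g -> taylor g a -> 0 < M ->
  (forall z, cmod z < 1 -> cmod (g z) <= M) -> 0 <= X -> 5 * X ^+ 2 + 24 * X = 48 ->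
  exists K : R, forall x L, 0 < x -> x < 1 ->
  \sum_(m < L) cmod (fps_euler (fps_at1 (dq_log a)) m) ^+ 2 * x ^+ m.+2 / (m.+1%:R * m.+2%:R)
    <= X * (- ln (1 - x)) + K.
Proof.
move=> hg ig ta M0 gM X0 XE.
have a1 : a 1%N != 0 by rewrite (taylor_at0 hg ta) inj_deriv0.
have [K hK] := log_coef_sum hg ig ta M0 gM.
have tF := taylor_prelog hg ig ta.
have terms := fun m t x => @log_coef_terms a m t x a1.
have H0 : fps_euler (fps_at1 (dq_log a)) 0%N = 0 by rewrite /fps_euler mul0r.
move: tF terms H0; set H := fps_euler _; clearbody H => tF terms H0.
exists ((2 * ln 2 + K + 5 / 8 * (1 + X ^+ 2 / 6 * ln 2)) / (1 / 2 + 5 * X / 24)) => x L x0 x1.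
have r0 : 0 < Num.sqrt x by rewrite sqrtr_gt0.
have r1 : Num.sqrt x < 1 by rewrite -sqrtr1 ltr_sqrt.
(* A truncation error of 1 is good enough, as constants are absorbed. *)
have [m0 hm0] := mean2_tail (taylorM tF tF) r0 r1 ltr01.
have [J [mJ LJ]] : exists J, (m0 <= J)%N /\ (L <= J)%N.
  by exists (maxn m0 L); rewrite leq_maxl leq_maxr.
have pos m : 0 <= cmod (H m) ^+ 2 * x ^+ m.+2 / (m.+1%:R * m.+2%:R).
  apply: divr_ge0 => //; apply: mulr_ge0; first exact: exprn_ge0 (cmod_ge0 _).
  exact: exprn_ge0 (ltW x0).
apply: le_trans (ler_sum_ord pos LJ) _.
(* At the midpoint t - x and 1 - t both equal (1 - x) / 2, so every logarithm that occurs is log (1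
   / (1 - x)) + O(1). *)
have [t tE] : exists t, t = (1 + x) / 2 by exists ((1 + x) / 2).
have xt : x < t by lra.
have t1 : t < 1 by lra.
have t0 : 0 < t by lra.
have tang := @kernel_tangent (fun m => cmod (H m) ^+ 2) (fun m => cmod (conv H H m) ^+ 2)
  J t x X 1 x0 xt (ltW t1) X0 ler01 (fun m => exprn_ge0 2 (cmod_ge0 _))
  (fun m => exprn_ge0 2 (cmod_ge0 _)).
have hyp (u y : R) : 0 <= u -> u <= x -> 0 <= y ->
  2 * y * (\sum_(m < J) cmod (H m) ^+ 2 * u ^+ m) - y ^+ 2 <=
  \sum_(m < J) cmod (conv H H m) ^+ 2 * u ^+ m + 1.
  (* Parseval is applied at the positive radius sqrt u; at u = 0 the left sum is 0 because H 0 =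
     0. *)
  move=> u0 ux y0; have [->|un] := eqVneq u 0.
    rewrite big1 ?mulr0 ?sub0r; last first.
      by move=> [[|m] mJ'] _ /=; rewrite ?H0 ?cmod0 ?expr0n ?mul0r ?mulr0.
    apply: (@le_trans _ _ 0); first by rewrite oppr_le0 sqr_ge0.
    by rewrite addr_ge0 // sumr_ge0 // => m _; rewrite mulr_ge0 ?exprn_ge0 ?cmod_ge0.
  have up : 0 < u by rewrite lt_neqAle eq_sym un.
  have su0 : 0 < Num.sqrt u by rewrite sqrtr_gt0.
  have sux : Num.sqrt u <= Num.sqrt x by rewrite ler_sqrt // ltW.
  have su1 : Num.sqrt u < 1 by exact: le_lt_trans r1.
  have uE n : Num.sqrt u ^+ (2 * n) = u ^+ n by rewrite exprM sqr_sqrtr.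
  have B := taylor_bessel J tF su0 su1.
  have T := hm0 J mJ _ su0 sux.
  have Q := @cmean_square_lower _ _ y (hol_circ (taylor_hol tF) (r := Num.sqrt u) _) (ltW su0).
  rewrite ltW // su1 in Q; move: (Q isT) => {}Q.
  under eq_bigr do rewrite -uE.
  under [X in _ <= X + 1]eq_bigr do rewrite -uE.
  move: B T Q; move: (mean2 _ _) (mean2 _ _) (\sum_(_ < J) _) (\sum_(_ < J) _) => y1 y2 y3 y4 B T Q.
  have : 2 * y * y4 <= 2 * y * y2 by rewrite ler_wpM2l ?mulr_ge0.
  by move: (2 * y * y4) (2 * y * y2) Q T => y5 y6; clear; lra.
have {}tang := tang hyp.
have s0 : 0 < Num.sqrt t by rewrite sqrtr_gt0.
have s1 : Num.sqrt t < 1 by rewrite -sqrtr1 ltr_sqrt.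
have := hK _ J s0 s1.
under eq_bigr do rewrite exprM sqr_sqrtr ?(ltW t0) //.
move=> star.
have star2 : 1 / 2 * (\sum_(m < J) cmod (H m) ^+ 2 * x ^+ m.+2 / (m.+1%:R * m.+2%:R)) +
  5 / 8 * (\sum_(m < J) cmod (conv H H m) ^+ 2 * t ^+ m.+4 / (m.+1%:R * m.+2%:R * m.+3%:R * m.+4%:R))
  <= - ln (1 - Num.sqrt t) + K.
  apply: le_trans star; rewrite !mulr_sumr -big_split /=.
  by apply: ler_sum => m _; apply: terms => //; exact: ltW.
apply: (prelog_arith (l1t := ln (1 - t)) X0 XE tang _ _ _ _ star2).
- by apply: ln_le0; exact: ltW.
- by rewrite -(ln_half x1); congr (- ln _); rewrite tE; field.
- by rewrite -(ln_half x1); congr (- ln _); rewrite tE; field.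
exact: ln_sub_sqrt.
Qed.

End Tangent.

(** * Logarithmic growth *)

Section Growth.
Variable R : realType.
Local Notation C := R[i].
Implicit Types (f g F : C -> C) (x t k e : R) (z w : C) (a b c : nat -> C).

(** Partial sums of the disk integral in [sigma1_sq] for a function with coefficients [c], at x = r
    ^ 2. *)
Definition wsum c x L : R := \sum_(i < L) cmod (c i) ^+ 2 * x ^+ i / (i.+1%:R * i.+2%:R).

(** Growth k log + o(log), uniform in the truncation [L]; the loss e makes the class stable under
    adding terms of growth 0. *)
Definition log_growth c k := forall e, 0 < e -> exists x0 K : R, [/\ 0 <= x0, x0 < 1 &
  forall x L, x0 < x -> x < 1 -> wsum c x L <= (k + e) * (- ln (1 - x)) + K].

Lemma weight_gt0 (i : nat) : 0 < i.+1%:R * i.+2%:R :> R.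
Proof. by rewrite mulr_gt0. Qed.

(** Weights comparable for large i give comparable sums up to a constant, since the first i0 terms
    are bounded whatever the weights below 1. *)
Lemma weighted_compare (c : nat -> C) (w v : nat -> R) (q B : R) (i0 L : nat) :
  (forall i, w i <= 1) -> (forall i, 0 <= q * v i) ->
  (forall i, (i0 <= i)%N -> w i <= q * v i) ->
  \sum_(i < L) cmod (c i) ^+ 2 * v i <= B -> 0 <= q ->
  \sum_(i < L) cmod (c i) ^+ 2 * w i <= q * B + \sum_(i < i0) cmod (c i) ^+ 2.
Proof.
move=> w1 v0 wv hB q0.
pose G i : R := if (i < i0)%N then cmod (c i) ^+ 2 else 0.
have c0 i : 0 <= cmod (c i) ^+ 2 by rewrite exprn_ge0 ?cmod_ge0.
have G0 i : 0 <= G i by rewrite /G; case: ifP.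
have GE : \sum_(i < L) G i <= \sum_(i < i0) cmod (c i) ^+ 2.
  have -> : \sum_(i < i0) cmod (c i) ^+ 2 = \sum_(i < i0) G i.
    by apply: eq_bigr => i _; rewrite /G ltn_ord.
  rewrite -(@sum_ord_support _ G i0 (L + i0)) ?leq_addl //.
    by apply: ler_sum_ord => //; exact: leq_addr.
  by move=> i h; rewrite /G ltnNge h.
apply: le_trans (lerD (ler_wpM2l q0 hB) GE).
rewrite mulr_sumr -big_split /=; apply: ler_sum => i _; rewrite /G.
have [h|h] := ltnP i i0.
  apply: ler_wpDl; first by rewrite mulrCA mulr_ge0.
  by rewrite ler_piMr.
by rewrite addr0 mulrCA ler_wpM2l // wv.
Qed.

Lemma wsumE c x L : wsum c x L = \sum_(i < L) cmod (c i) ^+ 2 * (x ^+ i / (i.+1%:R * i.+2%:R)).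
Proof. by apply: eq_bigr => i _; rewrite mulrA. Qed.

Lemma wsum_weight_le1 x i : 0 < x -> x < 1 -> x ^+ i / (i.+1%:R * i.+2%:R) <= 1 :> R.
Proof.
move=> x0 x1; rewrite ler_pdivrMr ?weight_gt0 // mul1r.
apply: (@le_trans _ _ 1); first by rewrite exprn_ile1 // ltW.
by rewrite -natrM ler1n.
Qed.

Lemma log_ge0 x : 0 < x -> x < 1 -> 0 <= - ln (1 - x).
Proof. by move=> x0 x1; rewrite oppr_ge0 ln_le0 //; lra. Qed.

Lemma nat_ge (y : R) : exists i0 : nat, forall i, (i0 <= i)%N -> y <= i%:R.
Proof.
exists (Num.trunc `|y|).+1 => i h; apply: le_trans (ler_norm y) _.
apply: le_trans (ltW (truncnS_gt _)) _.
by rewrite ler_nat.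
Qed.

(** Removing the factor z from z N changes the weight by x ^ 3 (i + 1) / (i + 3), which tends to 1;
    for x near 1 and large i the loss is at most a factor 1 + q. *)
Lemma shift_growth (H : nat -> C) k K : 0 <= k ->
  (forall x L, 0 < x -> x < 1 ->
    \sum_(m < L) cmod (H m) ^+ 2 * x ^+ m.+2 / (m.+1%:R * m.+2%:R) <= k * (- ln (1 - x)) + K) ->
  log_growth (fun i => H i.+1) k.
Proof.
move=> k0 hH e e0.
have [q [q0 q1 qk]] : exists q : R, [/\ 0 < q, q <= 1 & q * k <= e].
  exists (e / (k + 1 + e)); split; first by rewrite divr_gt0 //; lra.
    by rewrite ler_pdivrMr; lra.
  rewrite mulrAC ler_pdivrMr; last lra.
  by rewrite ler_pM2l //; lra.
have [i0 hi0] := nat_ge (6 / q).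
have q12 : 0 < 1 - q / 12 by lra.
exists (1 - q / 12), ((1 + q) * K + \sum_(i < i0) cmod (H i.+1) ^+ 2); split; [lra|lra|].
move=> x L xq x1; have x0 : 0 < x by lra.
have x3 : 1 <= x ^+ 3 * (1 + q / 3).
  have h3 : 1 - q / 4 <= x ^+ 3.
    have : (1 - q / 12) ^+ 3 <= x ^+ 3 by rewrite lerXn2r ?nnegrE ?ltW.
    apply: le_trans; rewrite !exprS expr0.
    have qq : 0 <= q * q by rewrite mulr_ge0 // ltW.
    have qqq : q * q * q <= q * q by rewrite ler_piMr.
    lra.
  apply: le_trans (ler_wpM2r _ h3); last lra.
  have : q * q <= q by rewrite ler_piMl // ltW.
  lra.
have S : \sum_(i < L) cmod (H i.+1) ^+ 2 * (x ^+ i.+3 / (i.+2%:R * i.+3%:R)) <= k * (- ln (1 - x)) + K.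
  apply: le_trans (hH x L.+1 x0 x1); rewrite big_ord_recl.
  apply: ler_wpDl; last by apply: ler_sum => i _; rewrite lift0 mulrA.
  by rewrite divr_ge0 ?mulr_ge0 ?exprn_ge0 ?cmod_ge0 // ltW.
rewrite wsumE.
have v0 i : 0 <= (1 + q) * (x ^+ i.+3 / (i.+2%:R * i.+3%:R)).
  by rewrite mulr_ge0 ?divr_ge0 ?exprn_ge0 ?mulr_ge0 //; lra.
apply: le_trans (@weighted_compare (fun i => H i.+1) _ _ (1 + q) _ i0 L
   (fun i => wsum_weight_le1 i x0 x1) v0 _ S _) _; last 1 first.
- rewrite mulrDr -addrA lerD2r mulrA ler_wpM2r ?log_ge0 //; lra.
- move=> i ii; have i6 := hi0 i ii; rewrite ler_pdivrMr // in i6.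
  have -> : x ^+ i / (i.+1%:R * i.+2%:R) = x ^+ i / (i.+1%:R * i.+2%:R * i.+3%:R) * i.+3%:R.
    by rewrite -[RHS]mulrA; congr (_ * _); rewrite [in RHS]invfM mulfVK ?pnatr_eq0.
  have -> : (1 + q) * (x ^+ i.+3 / (i.+2%:R * i.+3%:R)) =
     x ^+ i / (i.+1%:R * i.+2%:R * i.+3%:R) * ((1 + q) * x ^+ 3 * i.+1%:R).
    have -> : x ^+ i.+3 = x ^+ i * x ^+ 3 by rewrite -exprD addn3.
    have : i.+1%:R != 0 :> R by rewrite pnatr_eq0.
    have : i.+2%:R * i.+3%:R != 0 :> R by rewrite mulf_neq0 ?pnatr_eq0.
    rewrite -[i.+1%:R * _ * _]mulrA; move: (i.+1%:R) (i.+2%:R * _) (x ^+ i) (x ^+ 3) => n d y1 y2.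
    by clear => n0 d0; field; rewrite n0 d0.
  apply: ler_wpM2l; first by rewrite divr_ge0 ?mulr_ge0 ?exprn_ge0 // ltW.
  have -> : i.+3%:R = i%:R + 3 :> R by rewrite -natrD addn3.
  have -> : i.+1%:R = i%:R + 1 :> R by rewrite natr1.
  have := ler0n R i; move: (i%:R) i6 => n i6 n0.
  have h1 : n + 3 <= (1 + q / 3) * (n + 1) by lra.
  have h2 : 0 <= (1 + q / 3) * (n + 1) by rewrite mulr_ge0 //; lra.
  have h3 := ler_wpM2l h2 x3.
  have h4 : (1 + q / 3) * (1 + q / 3) <= 1 + q.
    have : q * q <= q by rewrite ler_piMl // ltW.
    lra.
  have y0 : 0 <= x ^+ 3 * (n + 1) by rewrite mulr_ge0 ?exprn_ge0 ?(ltW x0) //; lra.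
  have h5 := ler_wpM2r y0 h4; move: h1 h3 h5; move: (x ^+ 3) => y; lra.
by lra.
Qed.

(** The area inequality at w0 = 0 with the distortion bound controls the sum of |c_i| ^ 2 x ^ (i +
    1) / (i + 1) by 128 log, 128 = 2 * 64. The weights of [wsum] carry a further factor 1 / (i + 2),
    so beyond a finite index an arbitrarily small share of this suffices. *)
Lemma logderiv_growth f c B : hol f -> inj_disc f -> (forall z, cmod z < 1 -> f z != 0) ->
  (forall z, cmod z < 1 -> cmod (f z) <= B) ->
  taylor (fun z => derive1 f z / f z) c -> log_growth c 0.
Proof.
move=> hf jf f0 fB tc e e0.
have [q [q0 qe]] : exists q : R, 0 < q /\ q * 128 <= e by exists (e / 128); split; lra.
have F0 : 0 < cmod (f 0) by rewrite cmod_gt0 f0 // cmod0.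
have B0 : 0 < B by apply: lt_le_trans F0 _; apply: fB; rewrite cmod0.
have [i0 hi0] := nat_ge (2 / q).
pose K := 2 * (ln B - ln (cmod (f 0))) + 128 * ln 2.
exists (1 / 2), (q * K + \sum_(i < i0) cmod (c i) ^+ 2); split; [lra|lra|].
move=> x L xh x1; have x0 : 0 < x by lra.
have s0 : 0 < Num.sqrt x by rewrite sqrtr_gt0.
have s1 : Num.sqrt x < 1 by rewrite -sqrtr1 ltr_sqrt.
have p1 : 0 < 1 - Num.sqrt x by rewrite subr_gt0.
have p2 : 0 < 1 + Num.sqrt x by rewrite addr_gt0.
have d0 : 0 < cmod (f 0) * (1 - Num.sqrt x) ^+ 64 by rewrite mulr_gt0 ?exprn_gt0.
have lb z : cmod z <= Num.sqrt x ->
  cmod (f 0) * (1 - Num.sqrt x) ^+ 64 <= cmod (f z - 0) <= B.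
  move=> zs; have z1 : cmod z < 1 by exact: le_lt_trans s1.
  rewrite subr0 fB // andbT; apply: le_trans (distortion hf jf f0 z1).
  rewrite ler_pM2l // lerXn2r ?nnegrE ?subr_ge0 ?(ltW z1) ?(ltW s1) //.
  by rewrite lerD2l lerN2.
have := @area_inequality R f _ 0 B _ c L hf jf s0 s1 d0 lb.
have un : forall e : R, 0 < e -> exists m, forall k : nat, (m <= k)%N -> forall z, cmod z <= Num.sqrt x ->
    cmod (derive1 f z / (f z - 0) - (ppoly c k).[z]) <= e.
  move=> e' e'0; have [m hm] := taylor_unif tc (ltW s0) s1 e'0.
  by exists m => n mn z zs; rewrite subr0; apply: hm.
move=> /(_ un) {un lb}.
have -> : 2 * ln (B / (cmod (f 0) * (1 - Num.sqrt x) ^+ 64)) =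
   2 * (ln B - ln (cmod (f 0))) + 128 * (- ln (1 - Num.sqrt x)).
  rewrite lnM ?posrE ?invr_gt0 // lnV ?posrE // lnM ?posrE ?exprn_gt0 // lnXn //.
  by rewrite -[_ *+ 64]mulr_natl; ring.
have hl := ln_sub_sqrt x0 x1.
move=> S.
have S2 : \sum_(i < L) cmod (c i) ^+ 2 * (x ^+ i.+1 / i.+1%:R) <= 128 * (- ln (1 - x)) + K.
  apply: (@le_trans _ _ (2 * (ln B - ln (cmod (f 0))) + 128 * - ln (1 - Num.sqrt x))).
    apply: le_trans S; apply: ler_sum => i _.
    by rewrite exprM sqr_sqrtr ?(ltW x0) // mulrA.
  rewrite /K; move: hl; clear; move: (ln _) (ln _) (ln _) (ln _) (ln _) => y1 y2 y3 y4 y5; lra.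
rewrite wsumE add0r.
have v0 i : 0 <= q * (x ^+ i.+1 / i.+1%:R).
  by rewrite mulr_ge0 ?divr_ge0 ?exprn_ge0 // ltW.
apply: le_trans (@weighted_compare c _ _ q _ i0 L
   (fun i => wsum_weight_le1 i x0 x1) v0 _ S2 (ltW q0)) _; last first.
  by rewrite mulrDr -addrA lerD2r mulrA ler_wpM2r ?log_ge0.
move=> i ii; have i6 := hi0 i ii; rewrite ler_pdivrMr // in i6.
rewrite mulrA ler_pdivrMr ?weight_gt0 // mulrA divfK ?pnatr_eq0 //.
rewrite exprS -[leLHS]mulr1 mulrA [_ * x ^+ i]mulrC -mulrA ler_wpM2l ?exprn_ge0 ?(ltW x0) //.
have -> : i.+2%:R = i%:R + 2 :> R by rewrite -natrD addn2.
have h : 1 / 2 * (i%:R * q) <= x * (i%:R * q).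
  by rewrite ler_wpM2r ?mulr_ge0 ?(ltW q0) // ltW.
have h2 : 0 <= q * x * 2 by rewrite !mulr_ge0 // ltW.
by move: h h2 i6; move: (i%:R) => n; lra.
Qed.

(** In |a + b| ^ 2 <= (1 + q) |a| ^ 2 + (1 + 1 / q) |b| ^ 2 the large factor falls on the term of
    growth 0, which absorbs it. *)
Lemma growth_add a b k : 0 <= k -> log_growth a k -> log_growth b 0 ->
  log_growth (fun i => a i + b i) k.
Proof.
move=> k0 ha hb e e0.
have [q [q0 q1 qk]] : exists q : R, [/\ 0 < q, q <= 1 & q * (k + 2) <= e / 2].
  exists (e / (2 * (k + 2) + e)); split; first by rewrite divr_gt0 //; lra.
    by rewrite ler_pdivrMr; lra.
  by rewrite mulrAC ler_pdivrMr; [rewrite -!mulrA ler_pM2l //; lra|lra].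
have Q0 : 0 < 1 + q^-1 by rewrite addr_gt0 ?invr_gt0.
have [x1 [K1 [x10 x11 h1]]] := ha q q0.
have E0 : 0 < e / 2 / (1 + q^-1) by rewrite !divr_gt0.
have [x2 [K2 [x20 x21 h2]]] := hb _ E0.
exists (Num.max x1 x2), ((1 + q) * K1 + (1 + q^-1) * K2).
split; [by rewrite le_max x10|by rewrite gt_max x11|].
move=> x L; rewrite gt_max => /andP[l1 l2] xx.
have x0 : 0 < x by exact: le_lt_trans l1.
have W : wsum (fun i => a i + b i) x L <= (1 + q) * wsum a x L + (1 + q^-1) * wsum b x L.
  rewrite !wsumE !mulr_sumr -big_split; apply: ler_sum => i _ /=.
  have : 0 <= x ^+ i / (i.+1%:R * i.+2%:R) by rewrite divr_ge0 ?exprn_ge0 ?mulr_ge0 ?(ltW x0).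
  move: (x ^+ i / _) => y y0; rewrite [(1 + q) * _]mulrA [(1 + q^-1) * _]mulrA -mulrDl ler_wpM2r //.
  have : cmod (a i + b i) ^+ 2 <= (cmod (a i) + cmod (b i)) ^+ 2.
    by rewrite lerXn2r ?nnegrE ?addr_ge0 ?cmod_ge0 ?cmodD.
  move=> /le_trans; apply; move: (cmod (a i)) (cmod (b i)) => y1 y2.
  rewrite -subr_ge0.
  have -> : (1 + q) * y1 ^+ 2 + (1 + q^-1) * y2 ^+ 2 - (y1 + y2) ^+ 2 =
     (q * y1 - y2) ^+ 2 / q by field; rewrite gt_eqF.
  by rewrite divr_ge0 ?sqr_ge0 // ltW.
apply: (le_trans W).
have H1 := ler_wpM2l (addr_ge0 ler01 (ltW q0)) (h1 x L l1 xx).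
have H2 := ler_wpM2l (ltW Q0) (h2 x L l2 xx).
have l0 := log_ge0 x0 xx; move: H1 H2.
rewrite add0r !mulrDr; move: (- ln (1 - x)) l0 => l l0.
have -> : (1 + q^-1) * (e / 2 / (1 + q^-1) * l) = e / 2 * l.
  by rewrite mulrA [_ * (e / 2 / _)]mulrC divfK ?gt_eqF.
have : (1 + q) * ((k + q) * l) <= (k + e / 2) * l.
  rewrite mulrA ler_wpM2r //.
  have : q * q <= q by rewrite ler_piMl // ltW.
  lra.
have -> : (k + e) * l = (k + e / 2) * l + e / 2 * l by field.
move: ((k + e / 2) * l) (e / 2 * l) ((1 + q) * ((k + q) * l)) => y1 y2 y3.
move: ((1 + q) * K1) ((1 + q^-1) * K2) ((1 + q) * _) ((1 + q^-1) * _) => y4 y5 y6 y7.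
by clear; lra.
Qed.

Lemma growth_scale b (k : C) : log_growth b 0 -> log_growth (fun i => k * b i) 0.
Proof.
move=> hb e e0; have k0 : 0 < cmod k ^+ 2 + 1 by rewrite ltr_wpDl ?exprn_ge0 ?cmod_ge0.
have [x1 [K1 [x10 x11 h1]]] := hb (e / (cmod k ^+ 2 + 1)) (divr_gt0 e0 k0).
exists x1, (cmod k ^+ 2 * K1); split=> // x L l1 xx.
have x0 : 0 < x by exact: le_lt_trans l1.
have -> : wsum (fun i => k * b i) x L = cmod k ^+ 2 * wsum b x L.
  by rewrite !wsumE mulr_sumr; apply: eq_bigr => i _; rewrite cmodM exprMn -mulrA.
apply: le_trans (ler_wpM2l (exprn_ge0 2 (cmod_ge0 k)) (h1 x L l1 xx)) _.
rewrite mulrDr lerD2r !add0r mulrA ler_wpM2r ?log_ge0 //.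
rewrite mulrCA ler_piMr ?(ltW e0) // ler_pdivrMr // mul1r; lra.
Qed.

Lemma taylor_combine f1 f2 f3 f a b c :
  taylor f1 a -> taylor f2 b -> taylor f3 c ->
  (forall z, cmod z < 1 -> f z = f1 z + f2 z - 3 * f3 z) ->
  taylor f (fun i => a i + b i + -3 * c i).
Proof.
move=> t1 t2 t3 fE; apply: taylor_ext (taylorD (taylorD t1 t2) (taylorZ (-3) t3)) => z zz.
by rewrite fE // mulNr.
Qed.

(** The bounded function g of [bounded_reduction] carries the growth X; the corrections g2' / g2 and
    3 g' / g have growth 0. *)
Lemma prelog_growth phi n (X : R) : hol phi -> inj_disc phi -> phi 0 = 0 -> derive1 phi 0 = 1 ->
  0 <= X -> 5 * X ^+ 2 + 24 * X = 48 ->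
  taylor (fun z => derive1 (derive1 phi) z / derive1 phi z) n -> log_growth n X.
Proof.
move=> hp ip p0 p1 X0 XE tn.
have [w0 om] := omitted_value hp ip p0 p1.
have [g [g2 [B [[hg ig gn gB] [hg2 ig2 g2n g2B] NE]]]] := bounded_reduction hp ip om.
have z1 : cmod (0 : C) < 1 by rewrite cmod0.
have B0 : 0 < B by apply: lt_le_trans (gB _ z1); rewrite cmod_gt0 gn.
have [a ta] := hol_taylor hg.
have [K hK] := prelog_bound hg ig ta B0 gB X0 XE.
have sg := shift_growth X0 hK.
have [c1 t1] := hol_taylor (holM (hol_deriv hg) (holV hg gn)).
have [c2 t2] := hol_taylor (holM (hol_deriv hg2) (holV hg2 g2n)).
have gr1 := logderiv_growth hg ig gn gB t1.
have gr2 := logderiv_growth hg2 ig2 g2n g2B t2.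
have [m tm] := hol_taylor (holM (hol_deriv (hol_deriv hg))
   (holV (hol_deriv hg) (fun z => inj_deriv hg ig (z := z)))).
have Hm : (fun i => fps_euler (fps_at1 (dq_log a)) i.+1) = m.
  by rewrite (taylor_unique (taylor_prelog hg ig ta) (taylor_mulX tm)).
rewrite Hm in sg.
have := growth_add X0 (growth_add X0 sg gr2) (growth_scale (-3) gr1).
have te : taylor (fun z => derive1 (derive1 phi) z / derive1 phi z)
   (fun i => m i + c2 i + -3 * c1 i).
  exact: (taylor_combine tm t2 t1 NE).
by rewrite (taylor_unique tn te).
Qed.

End Growth.

(** * The two limits *)

Section Integrals.
Variable R : realType.
Local Notation C := R[i].
Local Notation mu := (@lebesgue_measure R).
Local Notation mu2 := (mu \x mu)%E.
Local Notation Re := complex.Re.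
Implicit Types (f g h : C -> C) (r x e : R) (z w : C) (a b c : nat -> C) (p q : {poly C}).

Lemma circle_mean_mean2 h r : hol h -> 0 < r -> r < 1 ->
  circle_mean (fun zeta => cmod (h (r%:C * zeta)) ^+ 2) = (mean2 h r)%:E.
Proof.
move=> hh r0 r1; have rr : 0 <= r < 1 by rewrite ltW.
have cH := circ_rcontM (hol_circ hh rr) (circ_rcont_conj (hol_circ hh rr)).
have -> : mean2 h r = Re (cmean (fun z => h z * conjc (h z)) r) by [].
rewrite /circle_mean cmeanE ReZ EFinM -cint_real //.
congr (_ * _)%E; apply: eq_integral => t _.
by rewrite -cisE mulcJ.
Qed.

Lemma disk_integralE (g : C -> R) : disk_integral g =
  ((pi^-1)%:E * \int[mu2]_v (if cmod (pt v) < 1 then g (pt v) else 0)%:E)%E.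
Proof.
rewrite /disk_integral integral_mkcond.
by rewrite -(@patch_if _ _ _ (fun v => cmod (pt v) < 1)).
Qed.

Lemma mC_disc_poly p : mC (fun v : R * R => if cmod (pt v) < 1 then p.[pt v] else 0).
Proof.
apply: mC_if; first by apply: mC_lt => //; exact: mC_pt.
by apply: mC_poly; exact: mC_pt.
Qed.

Lemma disc_parseval1 p N : (size p <= N)%N ->
  (\int[mu2]_v (if cmod (pt v) < 1 then cmod p.[pt v] ^+ 2 else 0)%:E)%E =
  (pi * \sum_(k < N) cmod p`_k ^+ 2 / k.+1%:R)%:E.
Proof.
move=> sN; rewrite disc_parseval0 //; congr (pi * _)%:E.
apply: etrans (esym (@sum_ord_support _ (fun k => cmod p`_k ^+ 2 / k.+1%:R) _ _ _ sN)).
  by apply: eq_bigr => k _; rewrite expr1n mulr1.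
by move=> k h; rewrite nth_default // cmod0 expr0n mul0r.
Qed.

(** |p| ^ 2 (1 - |z| ^ 2) is |p| ^ 2 - |z p| ^ 2, so the weight becomes 1 / (k + 1) - 1 / (k +
    2). *)
Lemma disc_weight_poly p N : (size p <= N)%N ->
  (\int[mu2]_v (if cmod (pt v) < 1 then cmod p.[pt v] ^+ 2 * (1 - cmod (pt v) ^+ 2) else 0)%:E)%E =
  (pi * \sum_(k < N) cmod p`_k ^+ 2 / (k.+1%:R * k.+2%:R))%:E.
Proof.
move=> sN.
have sN2 : (size ('X * p)%R <= N.+1)%N.
  by apply: (leq_trans (size_polyMleq _ _)); rewrite size_polyX.
have P1 := disc_parseval1 sN; have P2 := disc_parseval1 sN2.
have mp q : measurable_fun setT (fun v => (if cmod (pt v) < 1 then cmod q.[pt v] ^+ 2 else 0)%:E).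
  apply/measurable_EFinP.
  rewrite (_ : (fun v => _) = (fun v => cmod (if cmod (pt v) < 1 then q.[pt v] else 0) ^+ 2)).
    by apply: mC_sqr; exact: mC_disc_poly.
  by apply/funext => v; case: ifP => // _; rewrite cmod0 expr0n.
have mw : measurable_fun setT (fun v => (if cmod (pt v) < 1 then
    cmod p.[pt v] ^+ 2 * (1 - cmod (pt v) ^+ 2) else 0)%:E).
  apply/measurable_EFinP.
  rewrite (_ : (fun v => _) = (fun v => cmod (if cmod (pt v) < 1 then p.[pt v] else 0) ^+ 2 * (1 - cmod (pt v) ^+ 2))).
    apply: measurable_funM; first by apply: mC_sqr; exact: mC_disc_poly.
    by apply: measurable_funB => //; apply: mC_sqr; exact: mC_pt.
  by apply/funext => v; case: ifP => // _; rewrite cmod0 expr0n mul0r.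
have S : (\int[mu2]_v (if cmod (pt v) < 1 then cmod p.[pt v] ^+ 2 else 0)%:E)%E =
  (\int[mu2]_v (if cmod (pt v) < 1 then cmod p.[pt v] ^+ 2 * (1 - cmod (pt v) ^+ 2) else 0)%:E +
  \int[mu2]_v (if cmod (pt v) < 1 then cmod ('X * p).[pt v] ^+ 2 else 0)%:E)%E.
  rewrite -ge0_integralD //; [|move=> v _|move=> v _|exact: mp].
  - apply: eq_integral => v _; rewrite -EFinD; congr EFin.
    case: ifP => _; last by rewrite addr0.
    by rewrite hornerM hornerX cmodM exprMn; ring.
  - rewrite lee_fin; case: ifP => // h.
    by rewrite mulr_ge0 ?exprn_ge0 ?cmod_ge0 // subr_ge0 exprn_ile1 ?cmod_ge0 ?ltW.
  - by rewrite lee_fin; case: ifP => // _; rewrite exprn_ge0 ?cmod_ge0.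
move: S; rewrite P1 P2; case: (integral _ _ _) => [y||] //= [] E.
congr EFin; move: E; rewrite big_ord_recl coefXM /= cmod0 expr0n mul0r add0r => E.
have -> : y = pi * (\sum_(k < N) cmod p`_k ^+ 2 / k.+1%:R) -
    pi * \sum_(i < N) cmod ('X * p)`_(lift ord0 i) ^+ 2 / (lift ord0 i).+1%:R.
  by rewrite E addrK.
rewrite -mulrBr -sumrB; congr (_ * _); apply: eq_bigr => k _.
rewrite lift0 coefXM /=.
have : k.+1%:R != 0 :> R by rewrite pnatr_eq0.
have : k.+2%:R != 0 :> R by rewrite pnatr_eq0.
have -> : k.+2%:R = k.+1%:R + 1 :> R by rewrite natr1.
by move: (k.+1%:R) => n n1 n0; field; rewrite n0 n1.
Qed.

Lemma sqr_close (u v M e : R) : 0 <= u -> 0 <= v -> u <= M -> `|u - v| <= e -> e <= 1 ->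
  `|u ^+ 2 - v ^+ 2| <= e * (2 * M + 1).
Proof.
move=> u0 v0 uM uv e1; have e0 : 0 <= e by apply: le_trans uv.
rewrite subr_sqr normrM; apply: ler_pM => //.
rewrite ger0_norm ?addr_ge0 //; move: uv; rewrite ler_norml => /andP[h1 h2]; lra.
Qed.

(** Polynomials approximate f (r z) uniformly on the closed unit disc; this gives both the
    finiteness of the integral and its value as the limit of [wsum]. *)
Lemma disk_value f a r : taylor f a -> 0 < r -> r < 1 ->
  exists D : R, disk_integral (fun z => cmod (f (r%:C * z)) ^+ 2 * (1 - cmod z ^+ 2)) = D%:E /\
   forall e, 0 < e -> exists m, forall k, (m <= k)%N -> `|D - wsum a (r ^+ 2) k| <= e.
Proof.
move=> ta r0 r1; have hf := taylor_hol ta.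
have [M M0 hM] : exists2 M : R, 0 < M & forall z, cmod z <= r -> cmod (f z) <= M.
  by apply: disc_upper_bound => z zr; apply: hol_cont => //; exact: le_lt_trans r1.
have rz z : cmod z <= 1 -> cmod (r%:C * z) <= r.
  by move=> z1; rewrite cmodM cmodR gtr0_norm // ler_piMr // ltW.
pose P k : {poly C} := ppoly (fun i => a i * r%:C ^+ i) k.
have PE k z : (P k).[z] = (ppoly a k).[r%:C * z].
  by rewrite /P !horner_ppoly; apply: eq_bigr => i _; rewrite exprMn mulrA.
have un (e : R) : 0 < e -> exists m, forall k : nat, (m <= k)%N -> forall z, cmod z <= 1 ->
    cmod (f (r%:C * z) - (P k).[z]) <= e.
  move=> e0; have [m hm] := taylor_unif ta (ltW r0) r1 e0.
  by exists m => k mk z z1; rewrite PE; apply: hm => //; exact: rz.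
have mF := @mC_unif_disc R (fun z => f (r%:C * z)) P 1 ler01 un.
pose U (v : R * R) : R := if cmod (pt v) < 1 then
   cmod (f (r%:C * pt v)) ^+ 2 * (1 - cmod (pt v) ^+ 2) else 0.
pose V k (v : R * R) : R := if cmod (pt v) < 1 then
   cmod (P k).[pt v] ^+ 2 * (1 - cmod (pt v) ^+ 2) else 0.
(* The constant error is a square to fit [disc_const]; a square root of the tolerance is inserted at
   the end. *)
pose W (e : R) (v : R * R) : R := if cmod (pt v) < 1 then e ^+ 2 else 0.
have mw F : mC (fun v : R * R => if cmod (pt v) < 1 then F v else 0) ->
   measurable_fun setT (fun v => (if cmod (pt v) < 1 then
    cmod (F v) ^+ 2 * (1 - cmod (pt v) ^+ 2) else 0)%:E).
  move=> mF'; apply/measurable_EFinP.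
  rewrite (_ : (fun v => _) = (fun v => cmod (if cmod (pt v) < 1 then F v else 0) ^+ 2 * (1 - cmod (pt v) ^+ 2))).
    apply: measurable_funM; first exact: mC_sqr.
    by apply: measurable_funB => //; apply: mC_sqr; exact: mC_pt.
  by apply/funext => v; case: ifP => // _; rewrite cmod0 expr0n mul0r.
have mU : measurable_fun setT (EFin \o U) by exact: mw mF.
have mV k : measurable_fun setT (EFin \o V k) by apply: mw; exact: mC_disc_poly.
have mW e : measurable_fun setT (EFin \o W e).
  apply/measurable_EFinP; apply: measurable_if => //.
  by apply: mC_lt => //; exact: mC_pt.
have d0 (y : R) v : 0 <= y -> cmod (pt v) < 1 -> 0 <= y ^+ 2 * (1 - cmod (pt v) ^+ 2).
  move=> y0 v1; rewrite mulr_ge0 ?exprn_ge0 // subr_ge0 exprn_ile1 ?cmod_ge0 //; exact: ltW.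
have U0 v : 0 <= U v by rewrite /U; case: ifP => // h; apply: d0 => //; exact: cmod_ge0.
have V0 k v : 0 <= V k v by rewrite /V; case: ifP => // h; apply: d0 => //; exact: cmod_ge0.
have W0 e v : 0 <= W e v by rewrite /W; case: ifP => // h; exact: sqr_ge0.
have close (e : R) : 0 < e -> exists m, forall k, (m <= k)%N -> forall v,
    U v <= V k v + W e v /\ V k v <= U v + W e v.
  move=> e0; pose d := Num.min 1 (e ^+ 2 / (2 * M + 1)).
  have M1 : 0 < 2 * M + 1 by lra.
  have dp : 0 < d by rewrite lt_min ltr01 divr_gt0 ?exprn_gt0.
  have d1 : d <= 1 by rewrite ge_min lexx.
  have de : d * (2 * M + 1) <= e ^+ 2 by rewrite -ler_pdivlMr // ge_min lexx orbT.
  have [m hm] := un d dp; exists m => k mk v; rewrite /U /V /W.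
  case: ifP => [v1|_]; last by rewrite addr0.
  have c1 : `|cmod (f (r%:C * pt v)) - cmod (P k).[pt v]| <= d.
    have h1 := hm k mk (pt v) (ltW v1).
    have h2 := cmod_subr (f (r%:C * pt v)) (P k).[pt v].
    have h3 := cmod_subr (P k).[pt v] (f (r%:C * pt v)); rewrite cmodC in h3.
    by rewrite ler_norml; move: h1 h2 h3; move: (cmod _) (cmod _) (cmod _) => y1 y2 y3; clear; lra.
  have := sqr_close (cmod_ge0 _) (cmod_ge0 _) (hM _ (rz _ (ltW v1))) c1 d1.
  have w0 : 0 <= 1 - cmod (pt v) ^+ 2 by rewrite subr_ge0 exprn_ile1 ?cmod_ge0 // ltW.
  have w1 : 1 - cmod (pt v) ^+ 2 <= 1 by rewrite gerBl exprn_ge0 ?cmod_ge0.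
  move=> /le_trans /(_ de); rewrite ler_norml => /andP[].
  move: (cmod _ ^+ 2) (cmod _ ^+ 2) (1 - _) w0 w1 => y1 y2 y3 w0 w1 h1 h2.
  have e2 : 0 <= e ^+ 2 by exact: sqr_ge0.
  have k1 : (y1 - y2) * y3 <= e ^+ 2 * y3 by rewrite ler_wpM2r //; lra.
  have k2 : (y2 - y1) * y3 <= e ^+ 2 * y3 by rewrite ler_wpM2r //; lra.
  have k3 : e ^+ 2 * y3 <= e ^+ 2 by rewrite ler_piMr.
  by move: k1 k2 k3; rewrite !mulrBl; move: (y1 * y3) (y2 * y3) (_ * y3) => z1 z2 z3; clear; split; lra.
have IW e : (\int[mu2]_v (W e v)%:E = (pi * e ^+ 2)%:E)%E.
  have := @disc_const R 0 1 e ltr01; rewrite expr1n mulr1 => <-.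
  by apply: eq_integral => v _; rewrite /W subr0.
have IV k : (\int[mu2]_v (V k v)%:E = (pi * wsum a (r ^+ 2) k)%:E)%E.
  rewrite (@disc_weight_poly (P k) k); last exact: size_poly.
  congr (pi * _)%:E; apply: eq_bigr => i _; rewrite coef_poly ltn_ord.
  by rewrite cmodM cmodX cmodR gtr0_norm // exprMn -!exprM mulnC.
have I1 e k (G H : R * R -> R) : measurable_fun setT (EFin \o G) -> measurable_fun setT (EFin \o H) ->
  (forall v, 0 <= G v) -> (forall v, 0 <= H v) -> (forall v, G v <= H v + W e v) ->
  (\int[mu2]_v (G v)%:E <= \int[mu2]_v (H v)%:E + (pi * e ^+ 2)%:E)%E.
  move=> mG mH G0 H0 GH; rewrite -IW -ge0_integralD //;
    [|by move=> v _; rewrite lee_fin|by move=> v _; rewrite lee_fin|exact: mW].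
  apply: ge0_le_integral => //.
  - by move=> v _; rewrite lee_fin.
  - by apply: emeasurable_funD => //; exact: mW.
  - by move=> v _; rewrite -EFinD lee_fin.
have near (e : R) : 0 < e -> exists m, forall k, (m <= k)%N ->
   (\int[mu2]_v (U v)%:E <= (pi * wsum a (r ^+ 2) k + pi * e ^+ 2)%:E)%E /\
   ((pi * wsum a (r ^+ 2) k)%:E <= \int[mu2]_v (U v)%:E + (pi * e ^+ 2)%:E)%E.
  move=> e0; have [m hm] := close e e0; exists m => k mk.
  rewrite EFinD -IV; split; apply: I1 => // v; by have [] := hm k mk v.
have UI : (\int[mu2]_v (U v)%:E)%E \is a fin_num.
  have [m hm] := near 1 ltr01; have [h _] := hm m (leqnn m).
  rewrite ge0_fin_numE; first exact: le_lt_trans h (ltry _).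
  by apply: integral_ge0 => v _; rewrite lee_fin.
exists (pi^-1 * fine (\int[mu2]_v (U v)%:E)%E); split.
  by rewrite disk_integralE EFinM fineK.
move=> e e0; have se : 0 < Num.sqrt e by rewrite sqrtr_gt0.
have [m hm] := near _ se; exists m => k mk; have [] := hm k mk.
rewrite -{1 2}(fineK UI) -EFinD !lee_fin sqr_sqrtr ?(ltW e0) //.
have p0 := pi_gt0 R; move: (fine _) (wsum _ _ _) => y1 y2 h1 h2.
rewrite ler_norml; apply/andP; split.
  by rewrite -(ler_pM2l p0) mulrBr mulVKf ?gt_eqF // mulrN; move: h1 h2; clear; lra.
by rewrite -(ler_pM2l p0) mulrBr mulVKf ?gt_eqF //; move: h1 h2; clear; lra.
Qed.

End Integrals.

(** * Comparison of the two limits superior *)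

Section Limits.
Variable R : realType.
Local Notation C := R[i].
Implicit Types (F G : R -> \bar R) (f h phi : C -> C) (r x e X : R) (z w : C) (a b c : nat -> C).

(** An arbitrarily small additive error near 1 disappears in the limit superior; the equality of the
    two limits and the final bound both take this form. *)
Lemma limf_esup_le F G : (forall e, 0 < e -> \forall r \near (1 : R)^'-, (F r <= G r + e%:E)%E) ->
  (limf_esup F 1^'- <= limf_esup G 1^'-)%E.
Proof.
move=> h; rewrite /limf_esup; apply: le_ereal_inf_tmp => _ [V FV <-]; apply/lee_addgt0Pr => e e0.
have hU := h e e0.
apply: (@le_trans _ _ (ereal_sup (F @` (V `&` [set r | (F r <= G r + e%:E)%E])))).
  by apply: ereal_inf_lbound; exists (V `&` [set r | (F r <= G r + e%:E)%E]) => //; exact: filterI.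
apply: ge_ereal_sup => _ [r [Vr Ur] <-]; apply: le_trans Ur _.
by rewrite leeD2r // ereal_sup_ubound //; exists r.
Qed.

Lemma limf_esup_cst X : (limf_esup (fun=> X%:E) (1 : R)^'- <= X%:E)%E.
Proof.
apply: (@le_trans _ _ (ereal_sup ((fun=> X%:E) @` [set: R]))).
  by apply: ereal_inf_lbound; exists setT => //; exact: filterT.
by apply: ge_ereal_sup => _ [r _ <-].
Qed.

Lemma near_left (P : R -> Prop) x0 : x0 < 1 -> (forall r, x0 < r -> r < 1 -> P r) ->
  \forall r \near (1 : R)^'-, P r.
Proof.
move=> x1 h.
near=> r; apply: h; near: r; [exact: nbhs_left_gt|exact: nbhs_left_lt].
Unshelve. all: by end_near.
Qed.

Lemma near_log (T : R) : \forall r \near (1 : R)^'-, T <= - ln (1 - r ^+ 2).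
Proof.
have e0 := expR_gt0 (- T).
apply: (@near_left _ (Num.max 0 (1 - expR (- T) / 2))); first by rewrite gt_max ltr01 /=; lra.
move=> r; rewrite gt_max => /andP[r0 rT] r1.
have x1 : 0 < 1 - r ^+ 2 by rewrite subr_gt0 expr_lt1 // ltW.
rewrite -[T]opprK lerN2 -ler_expR lnK ?posrE //.
have : (1 - r) * (1 + r) <= expR (- T) / 2 * 2.
  by apply: ler_pM; lra.
by rewrite expr2; lra.
Qed.

Lemma near_log_ratio (K e : R) : 0 < e ->
  \forall r \near (1 : R)^'-, K / (- ln (1 - r ^+ 2)) <= e.
Proof.
move=> e0; apply: filterS (near_log (`|K| / e + 1)) => r h.
have K0 : 0 <= `|K| / e by rewrite divr_ge0 // ltW.
have l0 : 0 < - ln (1 - r ^+ 2) by lra.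
rewrite ler_pdivrMr //; apply: le_trans (ler_norm K) _.
rewrite -ler_pdivrMl // mulrC; lra.
Qed.

Lemma near_radius (x0 : R) : 0 <= x0 -> x0 < 1 ->
  \forall r \near (1 : R)^'-, [/\ 0 < r, r < 1, x0 < r ^+ 2 & 0 < - ln (1 - r ^+ 2)].
Proof.
move=> x00 x01; apply: (@near_left _ (Num.max (1/2) ((1 + x0) / 2))).
  by rewrite gt_max; apply/andP; split; lra.
move=> r; rewrite gt_max => /andP[h1 h2] r1.
have r0 : 0 < r by lra.
have r2 : r ^+ 2 < 1 by rewrite expr_lt1 // ltW.
have x2 : x0 < r ^+ 2.
  have : 0 <= (1 - r) ^+ 2 by exact: sqr_ge0.
  by rewrite !expr2; lra.
split=> //; rewrite oppr_gt0 ln_lt0 // subr_gt0 r2 /=.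
by have : 0 < r ^+ 2 by [rewrite exprn_gt0]; lra.
Qed.

(** The coefficients of h are n_i / (i + 1), so the two weights have the quotient x (i + 2) / (i +
    1) with x = r ^ 2: always at least x, and at most 1 + q once i >= 1 / q. *)
Lemma circle_disk_compare h b n r (D q : R) (i0 : nat) :
  taylor h b -> b 0%N = 0 -> dcoef b = n -> 0 < r -> r < 1 -> 0 < q ->
  (forall e, 0 < e -> exists m, forall k, (m <= k)%N -> `|D - wsum n (r ^+ 2) k| <= e) ->
  (forall i, (i0 <= i)%N -> q^-1 <= i%:R) ->
  mean2 h r <= (1 + q) * D + \sum_(i < i0) cmod (n i) ^+ 2 /\ r ^+ 2 * D <= mean2 h r.
Proof.
move=> tb b0 bn r0 r1 q0 hD hq.
have x0 : 0 < r ^+ 2 by rewrite exprn_gt0.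
have x1 : r ^+ 2 < 1 by rewrite expr_lt1 // ltW.
have [x xE] : exists2 x, forall i, r ^+ (2 * i) = x ^+ i & r ^+ 2 = x.
  by exists (r ^+ 2) => // i; rewrite exprM.
move=> x2; rewrite x2 in x0 x1 hD *.
have nE i : cmod (b i.+1) ^+ 2 = cmod (n i) ^+ 2 / i.+1%:R ^+ 2.
  rewrite -bn /dcoef cmodM cmod_nat exprMn [X in X / _]mulrC mulfK //.
have shift k : \sum_(i < k.+1) cmod (b i) ^+ 2 * r ^+ (2 * i) =
   \sum_(i < k) cmod (n i) ^+ 2 * (x ^+ i.+1 / i.+1%:R ^+ 2).
  rewrite big_ord_recl b0 cmod0 expr0n mul0r add0r; apply: eq_bigr => i _.
  by rewrite lift0 nE xE mulrAC mulrA.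
have w0 i : 0 <= cmod (n i) ^+ 2 * x ^+ i / (i.+1%:R * i.+2%:R).
  by rewrite divr_ge0 ?mulr_ge0 ?exprn_ge0 ?cmod_ge0 ?(ltW x0).
have mono k l : (k <= l)%N -> wsum n x k <= wsum n x l.
  exact: (ler_sum_ord w0).
have DW k : wsum n x k <= D.
  apply/ler_addgt0Pl => e e0; have [m hm] := hD e e0.
  apply: le_trans (mono _ _ (leq_addr m k)) _.
  by have := hm (k + m)%N (leq_addl _ _); rewrite ler_norml => /andP[]; lra.
split.
  apply: (taylor_mean2_le tb r0 r1) => k.
  have := @ler_sum_ord _ (fun i => cmod (b i) ^+ 2 * r ^+ (2 * i)) k k.+1.
  move=> H; apply: (le_trans (H _ (leqnSn k))) => {H}.
    by move=> i; rewrite mulr_ge0 ?exprn_ge0 ?cmod_ge0 // ltW.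
  rewrite shift.
  apply: (@weighted_compare _ n (fun i => x ^+ i.+1 / i.+1%:R ^+ 2) (fun i => x ^+ i / (i.+1%:R * i.+2%:R))).
  - move=> i; rewrite ler_pdivrMr ?exprn_gt0 // mul1r.
    apply: (@le_trans _ _ 1); first by rewrite exprn_ile1 // ltW.
    by rewrite -natrX ler1n expn_gt0.
  - by move=> i; rewrite mulr_ge0 ?divr_ge0 ?exprn_ge0 ?mulr_ge0 ?(ltW x0) //; lra.
  - move=> i ii; have := hq i ii; rewrite -[_^-1]mul1r ler_pdivrMr // => iq.
    rewrite ler_pdivrMr ?exprn_gt0 // mulrA.
    have -> : (1 + q) * x ^+ i / (i.+1%:R * i.+2%:R) * i.+1%:R ^+ 2 =
       x ^+ i * ((1 + q) * i.+1%:R / i.+2%:R).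
      have : i.+1%:R != 0 :> R by rewrite pnatr_eq0.
      have : i.+2%:R != 0 :> R by rewrite pnatr_eq0.
      move: (i.+1%:R) (i.+2%:R) (_ ^+ i) => y1 y2 y3 n2 n1.
      by field; rewrite n1 n2.
    rewrite exprS mulrC ler_wpM2l ?exprn_ge0 ?(ltW x0) //.
    apply: (le_trans (ltW x1)); rewrite ler_pdivlMr // mul1r.
    have -> : i.+2%:R = i%:R + 2 :> R by rewrite -natrD addn2.
    have -> : i.+1%:R = i%:R + 1 :> R by rewrite natr1.
    by move: iq; move: (i%:R) => y; lra.
  - by rewrite -wsumE.
  by lra.
apply/ler_addgt0Pl => e e0; have [m hm] := hD e e0.
have : x * wsum n x m <= mean2 h r.
  apply: le_trans (taylor_bessel m.+1 tb r0 r1); rewrite shift wsumE mulr_sumr.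
  apply: ler_sum => i _; rewrite mulrCA ler_wpM2l ?exprn_ge0 ?cmod_ge0 //.
  rewrite mulrA -exprS ler_wpM2l ?exprn_ge0 ?(ltW x0) // lef_pV2 ?posrE ?exprn_gt0 ?mulr_gt0 //.
  by rewrite expr2 ler_pM2l // ler_nat.
have := hm m (leqnn m); rewrite ler_norml => /andP[_ h2].
have : x * (D - wsum n x m) <= e.
  have [s|s] := leP 0 (D - wsum n x m).
    by apply: le_trans h2; rewrite ler_piMl // ltW.
  by apply: (@le_trans _ _ 0); [rewrite pmulr_rle0 // ltW|exact: ltW].
by rewrite mulrBr; move: (x * D) (x * _) (mean2 h r) => y1 y2 y3; lra.
Qed.

Section Ratios.
Variables (Cm Dm : R -> R) (n : nat -> C) (X : R).
Let l r := - ln (1 - r ^+ 2).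
Hypotheses (X0 : 0 <= X) (nX : log_growth n X).
Hypothesis DmE : forall r, 0 < r -> r < 1 ->
  forall e, 0 < e -> exists m, forall k, (m <= k)%N -> `|Dm r - wsum n (r ^+ 2) k| <= e.
Hypothesis Cm_le : forall q, 0 < q -> exists K, forall r, 0 < r -> r < 1 ->
  Cm r <= (1 + q) * Dm r + K.
Hypothesis Dm_le : forall r, 0 < r -> r < 1 -> r ^+ 2 * Dm r <= Cm r.

Lemma disk_ratio_le e : 0 < e -> \forall r \near (1 : R)^'-, Dm r / l r <= X + e.
Proof.
move=> e0; have e2 : 0 < e / 2 by lra.
have [x0 [K [x00 x01 hK]]] := nX e2.
apply: filterS2 (near_radius x00 x01) (near_log_ratio K e2) => r [r0 r1 xr lr] h.
have DK : Dm r <= (X + e / 2) * l r + K.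
  apply/ler_addgt0Pl => d d0; have [m hm] := DmE r0 r1 d0.
  have x1 : r ^+ 2 < 1 by rewrite expr_lt1 // ltW.
  have := hm m (leqnn m); rewrite ler_norml => /andP[_].
  have := hK (r ^+ 2) m xr x1; rewrite -/(l r).
  by move: (wsum _ _ _) (_ * l r) => y1 y2; lra.
have : Dm r / l r <= X + e / 2 + K / l r.
  by rewrite ler_pdivrMr // mulrDl divfK // gt_eqF.
by move: h; rewrite -/(l r); move: (K / l r) (Dm r / l r) => y1 y2; lra.
Qed.

(** The comparison of [Cm] and [Dm] has a multiplicative error; it becomes additive because the disk
    ratio is already bounded by X + 1. *)
Lemma circle_ratio_le e : 0 < e -> \forall r \near (1 : R)^'-, Cm r / l r <= Dm r / l r + e.
Proof.
move=> e0; have e2 : 0 < e / 2 by lra.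
have X1 : 0 < X + 1 by rewrite ltr_wpDl.
have [K hK] := Cm_le (divr_gt0 e2 X1).
apply: filterS3 (near_radius (lexx 0) ltr01) (near_log_ratio K e2) (disk_ratio_le ltr01).
move=> r [r0 r1 xr lr] h1 h2.
have h3 := hK r r0 r1.
have : Cm r / l r <= Dm r / l r + e / 2 / (X + 1) * (Dm r / l r) + K / l r.
  by rewrite ler_pdivrMr // !mulrDl -!mulrA mulVf ?gt_eqF // !mulr1; move: h3; rewrite mulrDl mul1r -!mulrA.
have : e / 2 / (X + 1) * (Dm r / l r) <= e / 2 / (X + 1) * (X + 1).
  by rewrite ler_pM2l ?divr_gt0.
rewrite divfK ?gt_eqF //; move: h1; rewrite -/(l r).
by move: (e / 2 / (X + 1) * (Dm r / l r)) (K / l r) (Dm r / l r) (Cm r / l r) => y1 y2 y3 y4; lra.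
Qed.

(** The factor r ^ 2 costs at most (1 - r ^ 2) (X + 1), which is below e for r near 1. *)
Lemma disk_circle_ratio_le e : 0 < e -> \forall r \near (1 : R)^'-, Dm r / l r <= Cm r / l r + e.
Proof.
move=> e0; have X1 : 0 < X + 1 by rewrite ltr_wpDl.
have m0 : 0 <= Num.max 0 (1 - e / (X + 1)) by rewrite le_max lexx.
have m1 : Num.max 0 (1 - e / (X + 1)) < 1.
  by rewrite gt_max ltr01 /= gtrBl divr_gt0.
apply: filterS2 (near_radius m0 m1) (disk_ratio_le ltr01) => r [r0 r1].
rewrite gt_max => /andP[x0 xe] lr h.
have h1 := Dm_le r0 r1.
have x1 : r ^+ 2 < 1 by rewrite expr_lt1 // ltW.
have h2 : r ^+ 2 * (Dm r / l r) <= Cm r / l r by rewrite mulrA ler_pM2r ?invr_gt0.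
have h3 : (1 - r ^+ 2) * (Dm r / l r) <= (1 - r ^+ 2) * (X + 1).
  by rewrite ler_wpM2l // subr_ge0 ltW.
have h4 : (1 - r ^+ 2) * (X + 1) <= e by rewrite -ler_pdivlMr //; lra.
by move: h2 h3 h4; rewrite mulrBl mul1r; move: (r ^+ 2 * (Dm r / l r)) (Dm r / l r) (Cm r / l r) ((1 - r ^+ 2) * (X + 1)) => y1 y2 y3 y4; lra.
Qed.

End Ratios.

Lemma holomorphic_hol f : holomorphic_disk f -> hol f.
Proof. by move=> h z z1; exists (derive1 f z); apply: derivable_cdiff; exact: h. Qed.

Lemma hol_holomorphic f : hol f -> holomorphic_disk f.
Proof. by move=> h z z1; have [d /cdiff_derivable[]] := h z z1. Qed.

(** [xget] returns a branch as soon as one exists; differentiating exp (log_deriv phi) = phi' then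
    determines its derivative on the disc. *)
Lemma log_derivP phi : hol phi -> inj_disc phi -> derive1 phi 0 = 1 ->
  [/\ hol (log_deriv phi), log_deriv phi 0 = 0 &
   forall z, cmod z < 1 -> derive1 (log_deriv phi) z = pre_schwarzian phi z].
Proof.
move=> hp ip p1; have d0 z := inj_deriv hp ip (z := z).
have [u [hu u0 uE _]] : exists u : C -> C, [/\ hol u, u 0 = 0,
   forall z, cmod z < 1 -> cexp (u z) = derive1 phi z &
   forall z, cmod z < 1 -> derive1 u z = derive1 (derive1 phi) z / derive1 phi z].
  by apply: hol_log; [exact: hol_deriv|exact: d0|rewrite cexp0 p1].
have [hh h0 hE] : is_log_deriv phi (log_deriv phi).
  by apply: xgetPex; exists u; split=> //; exact: hol_holomorphic.
have {}hh := holomorphic_hol hh.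
have divE (x y w : C) : x != 0 -> x * y = w -> y = w / x by move=> xn <-; rewrite mulrC mulKf.
split=> // z z1; have c1 := hol_cdiff hh z1.
have c2 := cdiff_comp c1 (cdiff_cexp (log_deriv phi z)).
have rz : 0 < 1 - cmod z by rewrite subr_gt0.
have near w : cmod (w - z) < 1 - cmod z -> cexp (log_deriv phi w) = derive1 phi w.
  move=> wz; apply: hE; rewrite /unit_disk /=.
  have := cmod_subr w z; move: wz; move: (cmod _) (cmod _) (cmod _) => y1 y2 y3; lra.
have c3 := cdiff_near rz near c2.
have := cdiff_unique c3 (hol_cdiff (hol_deriv hp) z1).
rewrite (hE z z1) => e; exact: (divE _ _ _ (d0 z z1) e).
Qed.

Lemma sigma_bound phi X : hol phi -> inj_disc phi -> phi 0 = 0 -> derive1 phi 0 = 1 ->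
  0 <= X -> 5 * X ^+ 2 + 24 * X = 48 ->
  sigma_sq (log_deriv phi) = sigma1_sq (pre_schwarzian phi) /\
  (sigma1_sq (pre_schwarzian phi) <= X%:E)%E.
Proof.
move=> hp ip p0 p1 X0 XE.
have [hh h0 dh] := log_derivP hp ip p1.
have hN : hol (pre_schwarzian phi).
  by apply: holM; [do 2 apply: hol_deriv|apply: holV; [exact: hol_deriv|by move=> z; exact: inj_deriv]].
have [n tn] := hol_taylor hN.
have nX := prelog_growth hp ip p0 p1 X0 XE tn.
have [b tb] := hol_taylor hh; have [td _] := taylor_deriv tb.
have bn : dcoef b = n by apply: (taylor_unique (taylor_ext _ td) tn).
have b0 : b 0%N = 0 by rewrite -(taylor0 tb).
have /choice[D DE] : forall r, exists D : R, 0 < r -> r < 1 ->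
  disk_integral (fun z => cmod (pre_schwarzian phi (r%:C * z)) ^+ 2 * (1 - cmod z ^+ 2)) = D%:E /\
   forall e, 0 < e -> exists m, forall k, (m <= k)%N -> `|D - wsum n (r ^+ 2) k| <= e.
  move=> r; have [r0|r0] := ltP 0 r; last by exists 0.
  have [r1|r1] := ltP r 1; last by exists 0.
  by have [D hD] := disk_value tn r0 r1; exists D.
have DE2 r (r0 : 0 < r) (r1 : r < 1) := (DE r r0 r1).2.
have cmp (r q : R) i0 := @circle_disk_compare (log_deriv phi) b n r (D r) q i0 tb b0 bn.
have Cle q : 0 < q -> exists K, forall r, 0 < r -> r < 1 ->
    mean2 (log_deriv phi) r <= (1 + q) * D r + K.
  move=> q0; have [i0 hi] := nat_ge q^-1.
  exists (\sum_(i < i0) cmod (n i) ^+ 2) => r r0 r1.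
  by have [] := cmp r q i0 r0 r1 q0 (DE2 r r0 r1) hi.
have Dle r : 0 < r -> r < 1 -> r ^+ 2 * D r <= mean2 (log_deriv phi) r.
  move=> r0 r1; have [i0 hi] := nat_ge (1 : R)^-1.
  by have [] := cmp r 1 i0 r0 r1 ltr01 (DE2 r r0 r1) hi.
have lE r : 0 < r -> r < 1 -> ln ((1 - r ^+ 2)^-1) = - ln (1 - r ^+ 2).
  by move=> r0 r1; rewrite lnV // posrE subr_gt0 expr_lt1 // ltW.
have sE r (r0 : 0 < r) (r1 : r < 1) : (((ln ((1 - r ^+ 2)^-1))^-1)%:E *
    circle_mean (fun zeta => cmod (log_deriv phi (r%:C * zeta)) ^+ 2)%R =
    (mean2 (log_deriv phi) r / - ln (1 - r ^+ 2))%:E)%E.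
  by rewrite circle_mean_mean2 // lE // -EFinM mulrC.
have s1E r (r0 : 0 < r) (r1 : r < 1) : (((ln ((1 - r ^+ 2)^-1))^-1)%:E *
    disk_integral (fun z => cmod (pre_schwarzian phi (r%:C * z)) ^+ 2 * (1 - cmod z ^+ 2))%R =
    (D r / - ln (1 - r ^+ 2))%:E)%E.
  by rewrite (DE r r0 r1).1 lE // -EFinM mulrC.
split; last first.
  apply: le_trans (limf_esup_cst X); apply: limf_esup_le => e e0.
  apply: filterS2 (near_radius (lexx 0) ltr01) (disk_ratio_le nX DE2 e0) => r [r0 r1 _ _] h.
  by rewrite s1E // -EFinD lee_fin.
apply/eqP; rewrite eq_le; apply/andP; split; apply: limf_esup_le => e e0.
  apply: filterS2 (near_radius (lexx 0) ltr01) (circle_ratio_le X0 nX DE2 Cle e0) => r [r0 r1 _ _] h.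
  by rewrite sE // s1E // -EFinD lee_fin.
apply: filterS2 (near_radius (lexx 0) ltr01) (disk_circle_ratio_le X0 nX DE2 Dle e0) => r [r0 r1 _ _] h.
by rewrite sE // s1E // -EFinD lee_fin.
Qed.

End Limits.

Theorem theorem6p11 (R : realType) (phi : R[i] -> R[i]) (Sphi : classS phi) :
  sigma_sq (log_deriv phi) = sigma1_sq (pre_schwarzian phi) /\
  (sigma1_sq (pre_schwarzian phi) <=
     (2 / 5 * (Num.sqrt 96 - 6) : R)%:E)%E.
Proof.
have [hp ip p0 p1] := Sphi.
have s2 : (Num.sqrt 96 : R) ^+ 2 = 96 by rewrite sqr_sqrtr.
have s6 : 6 <= Num.sqrt 96 :> R.
  by rewrite -(ler_pXn2r (ltn0Sn 1)) ?nnegrE ?sqrtr_ge0 // s2; lra.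
apply: sigma_bound => //; first exact: holomorphic_hol.
- by move=> z w z1 w1; apply: ip; exact: mem_set.
- lra.
(* The constant is the positive root of 5 X ^ 2 + 24 X = 48, which is (5 X + 12) ^ 2 = 384 = 4 *
   96. *)
have -> : 5 * (2 / 5 * (Num.sqrt 96 - 6)) ^+ 2 + 24 * (2 / 5 * (Num.sqrt 96 - 6)) =
   4 / 5 * ((Num.sqrt 96) ^+ 2 - 36) :> R by field.
by rewrite s2; field.
Qed.
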